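(* Fix $n\ge1$. For all $\lambda>0$, $\tilde C_0>0$, $\delta>\tfrac12$ there is a constant $A=A(\tilde C_0,\lambda,\delta)$, and for every $C_1\ge\tilde C_0$ there is $T=T(\tilde C_0,C_1,\lambda,\delta)$ with $0<T\le1$, such that the following holds for every $0\le\varepsilon\le1$ and every $0<T'\le T$. Let $I=[0,T']$ and let $a,b,c,d$ be real $n\times n$ matrix valued functions on $\mathbb R\times I$ satisfying the linear coefficient hypotheses (with constants $\lambda,\tilde C_0,C_1,\delta$) stated in the context. If $\vec u:\mathbb R\times I\to\mathbb R^n$ is a classical solution (for which $\vec u\in C^0_IH^5\cap C^1_IH^1$ suffices) of $$\partial_t\vec u+a(x,t)\partial_x^3\vec u+b(x,t)\partial_x^2\vec u+c(x,t)\partial_x\vec u+d(x,t)\vec u=-\varepsilon\partial_x^4\vec u+\vec f(x,t),\qquad \vec u(x,0)=\vec u_0(x),$$ then $$\|\vec u\|_{L^\infty_IL^2_x}\le A\big(\|\vec u_0\|_{L^2}+\|\vec f\|_{L^1_IL^2_x}\big)$$ and $$\big\|\langle x\rangle^{-\delta}\langle\partial_x\rangle\vec u\big\|_{L^2_IL^2_x}\le A\big(\|\vec u_0\|_{L^2}+\|\langle x\rangle^{\delta}\langle\partial_x\rangle^{-1}\vec f\|_{L^2_IL^2_x}\big).$$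
   Context: Notation: $\langle x\rangle=(1+|x|^2)^{1/2}$, and $\langle\partial_x\rangle^{r}$ is the Fourier multiplier $\widehat{\langle\partial_x\rangle^{r}u}(\xi)=(1+|\xi|^2)^{r/2}\hat u(\xi)$. $\mathcal B^k$ is the space of $C^k$ functions of $x\in\mathbb R$ bounded together with their derivatives up to order $k$, with the natural norm. $m^\dagger_{ij}=\tfrac12(m_{ij}-m_{ji})$ denotes the antisymmetric part of a matrix $m$. $C^1_IZ$ denotes $C^1$ functions of $t\in I$ with values in $Z$. Linear coefficient hypotheses with constants $\lambda>0$, $C_1\ge\tilde C_0>0$, $\delta>\frac12$ on $\mathbb R\times I$: (i) $a_{ij}(x,t)=a_{ji}(x,t)$, and $\sum_{i,j}a_{ij}(x,0)\xi_i\xi_j\ge\lambda|\xi|^2$ for all $x\in\mathbb R$, $\xi\in\mathbb R^n$. (ii) $a\in C^1_I\mathcal B^3$, $b\in C^1_I\mathcal B^2$, $c\in C^1_I\mathcal B^1$, $d\in C^1_IL^\infty$, with $\|a(\cdot,0)\|_{\mathcal B^3}+\|b(\cdot,0)\|_{\mathcal B^2}+\|c(\cdot,0)\|_{\mathcal B^1}+\|d(\cdot,0)\|_{L^\infty}\le\tilde C_0$ and $\|a\|_{C^1_I\mathcal B^3}+\|b\|_{C^1_I\mathcal B^2}+\|c\|_{C^1_I\mathcal B^1}+\|d\|_{C^1_IL^\infty}\le C_1$. (iii) $\|\langle x\rangle^{2\delta}\partial_xa(x,0)\|_{L^\infty}+\|\langle x\rangle^{2\delta}b(x,0)\|_{L^\infty}\le\tilde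 C_0$; $\|\langle x\rangle^{2\delta}\partial_t\partial_xa(x,t)\|_{L^\infty(\mathbb R\times I)}+\|\langle x\rangle^{2\delta}\partial_tb(x,t)\|_{L^\infty(\mathbb R\times I)}\le C_1$; $\|\langle x\rangle^{\delta}\partial_xb^\dagger(x,0)\|_{L^\infty}+\|\langle x\rangle^{\delta}c^\dagger(x,0)\|_{L^\infty}\le\tilde C_0$; $\|\langle x\rangle^{\delta}\partial_t\partial_xb^\dagger(x,t)\|_{L^\infty(\mathbb R\times I)}+\|\langle x\rangle^{\delta}\partial_tc^\dagger(x,t)\|_{L^\infty(\mathbb R\times I)}\le C_1$. The dependence of constants on the fixed system size $n$ is not displayed. *)

(* Defs.v *)
From HB Require Import structures.
From mathcomp Require Import all_boot all_order all_algebra.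
From mathcomp Require Import all_classical all_reals all_analysis.
From mathcomp Require Import complex.

Set Implicit Arguments.
Unset Strict Implicit.
Unset Printing Implicit Defensive.

Import Order.TTheory GRing.Theory Num.Theory.
Import numFieldNormedType.Exports.

Local Open Scope ring_scope.
Local Open Scope complex_scope.
Local Open Scope classical_set_scope.

(* Functions of (x, t) are curried with the time variable first, [v t x], so
   that [v t] is the function of x whose X-norm appears in norms such as
   L^p_I X.  Norms take values in \bar R and may be +oo. *)

Definition jap (R : realType) (x : R) : R := Num.sqrt (1 + x ^+ 2).

Definition enorm (R : realType) (n : nat) (v : 'cV[R]_n) : R :=
  Num.sqrt (\sum_(i < n) v i 0 ^+ 2).

Definition cenorm (R : realType) (n : nat) (z : 'cV[R[i]]_n) : R :=
  Num.sqrt (\sum_(i < n) ComplexField.Normc.normc (z i 0) ^+ 2).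

Definition antisym (R : realType) (n : nat) (m : 'M[R]_n) : 'M[R]_n :=
  2^-1 *: (m - m^T).

Section SpaceVariable.
Variables (R : realType).
Notation mu := (@lebesgue_measure R).

Definition measurable_mx (p q : nat) (g : R -> 'M[R]_(p, q)) : Prop :=
  forall i j, measurable_fun setT (fun x => g x i j).

Definition L2norm (n : nat) (v : R -> 'cV[R]_n) : \bar R :=
  Lnorm mu 2%:E (fun x => (enorm (v x))%:E).

Definition wL2norm (w : R) (n : nat) (v : R -> 'cV[R]_n) : \bar R :=
  L2norm (fun x => (jap x `^ w) *: v x).

Definition L2 (n : nat) : set (R -> 'cV[R]_n) :=
  [set v | measurable_mx v /\ (L2norm v < +oo)%E].

(* [`|m|] is the norm of the normed module of matrices, that is the largest
   absolute value of an entry. *)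
Definition Linfnorm (p q : nat) (g : R -> 'M[R]_(p, q)) : \bar R :=
  Lnorm mu +oo%E (fun x => `|g x|%:E).

Definition Linf (p q : nat) : set (R -> 'M[R]_(p, q)) :=
  [set g | measurable_mx g /\ (Linfnorm g < +oo)%E].

Definition wLinfnorm (w : R) (p q : nat) (g : R -> 'M[R]_(p, q)) : \bar R :=
  Linfnorm (fun x => (jap x `^ w) *: g x).

Definition wLinfnormI (I : set R) (w : R) (p q : nat)
    (g : R -> R -> 'M[R]_(p, q)) : \bar R :=
  Lnorm (mu \x mu)%E +oo%E
    (fun z => (if z.2 \in I then (jap z.1 `^ w) * `|g z.2 z.1| else 0)%:E).

Definition Ck (k p q : nat) (g : R -> 'M[R]_(p, q)) : Prop :=
  (forall j x, (j < k)%N -> derivable (derive1n j g) x 1) /\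
  continuous (derive1n k g).

Definition Bnorm (k p q : nat) (g : R -> 'M[R]_(p, q)) : \bar R :=
  (\sum_(j < k.+1) ereal_sup [set `|derive1n j g x|%:E | x in setT])%E.

Definition Bk (k p q : nat) : set (R -> 'M[R]_(p, q)) :=
  [set g | Ck k g /\ (Bnorm k g < +oo)%E].

(* Convention: the transform of v at xi is the integral of e^(- i x xi) v(x),
   so that d/dx has symbol i xi.  It is defined on L2 as the limit in mean
   square of the integrals over [-N, N]. *)
Definition fourier_trunc (N : nat) (n : nat) (v : R -> 'cV[R]_n) (xi : R) :
    'cV[R[i]]_n :=
  \col_(i < n)
    ((\int[mu]_(x in `[- N%:R, N%:R]) (v x i 0 * cos (x * xi)))%R -i*
     (\int[mu]_(x in `[- N%:R, N%:R]) (v x i 0 * sin (x * xi)))%R).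

Definition is_fourier (n : nat) (v : R -> 'cV[R]_n) (w : R -> 'cV[R[i]]_n) :
    Prop :=
  [/\ forall i, measurable_fun setT (fun xi => complex.Re (w xi i 0)),
      forall i, measurable_fun setT (fun xi => complex.Im (w xi i 0)) &
      Lnorm mu 2%:E (fun xi => (cenorm (w xi - fourier_trunc N v xi))%:E)
        @[N --> \oo] --> 0%E].

(* [is_fourier v] determines its argument up to a null set, and for v in L2 such
   an argument exists by the Plancherel theorem. *)
Definition fourier (n : nat) (v : R -> 'cV[R]_n) : R -> 'cV[R[i]]_n :=
  xget (fun=> 0) [set w | is_fourier v w].

Definition Hnorm (s : R) (n : nat) (v : R -> 'cV[R]_n) : \bar R :=
  Lnorm mu 2%:E (fun xi => ((jap xi `^ s) * cenorm (fourier v xi))%:E).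

Definition Hs (s : R) (n : nat) : set (R -> 'cV[R]_n) :=
  [set v | L2 v /\ (Hnorm s v < +oo)%E].

Definition is_japD (r : R) (n : nat) (v w : R -> 'cV[R]_n) : Prop :=
  L2 w /\
  {ae mu, forall xi, fourier w xi = (jap xi `^ r)%:C *: fourier v xi}.

(* The multiplier with symbol <xi>^r.  It is used for v in L2 with <xi>^r times
   the transform of v in L2; the symbol being even, the result is real. *)
Definition japD (r : R) (n : nat) (v : R -> 'cV[R]_n) : R -> 'cV[R]_n :=
  xget (fun=> 0) [set w | is_japD r v w].

Definition LpI (p : \bar R) (I : set R) (g : R -> \bar R) : \bar R :=
  Lnorm mu p (fun t => if t \in I then g t else 0%E).

End SpaceVariable.

Section TimeVariable.
Variables (R : realType) (p q : nat) (I : set R).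
(* A space of functions of x, given by its elements and its norm. *)
Variables (Z : set (R -> 'M[R]_(p, q))) (nrm : (R -> 'M[R]_(p, q)) -> \bar R).

Definition C0I (v : R -> R -> 'M[R]_(p, q)) : Prop :=
  (forall t, I t -> Z (v t)) /\
  (forall t0, I t0 -> nrm (v t - v t0) @[t --> within I (nbhs t0)] --> 0%E).

(* [v] is C^1 on I with values in Z, with time derivative [v']. *)
Definition C1I (v v' : R -> R -> 'M[R]_(p, q)) : Prop :=
  [/\ C0I v, C0I v' &
      forall t0, I t0 ->
        nrm ((t - t0)^-1 *: (v t - v t0) - v' t0)
          @[t --> within I (dnbhs t0)] --> 0%E].

Definition C1Inorm (v v' : R -> R -> 'M[R]_(p, q)) : \bar R :=
  (ereal_sup [set nrm (v t) | t in I] + ereal_sup [set nrm (v' t) | t in I])%E.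

End TimeVariable.

(* [a'], [b'], [c'], [d'] are the time derivatives of the coefficients. *)
Record coeff_hyp (R : realType) (n : nat) (lambda C0 C1 delta : R) (I : set R)
    (a a' b b' c c' d d' : R -> R -> 'M[R]_n) : Prop := CoeffHyp {
  coeff_sym : forall t x, I t -> (a t x)^T = a t x ;
  coeff_ell : forall (x : R) (xi : 'cV[R]_n),
    lambda * enorm xi ^+ 2 <=
    \sum_(i < n) \sum_(j < n) a 0 x i j * xi i 0 * xi j 0 ;
  coeff_a : C1I I (@Bk R 3 n n) (@Bnorm R 3 n n) a a' ;
  coeff_b : C1I I (@Bk R 2 n n) (@Bnorm R 2 n n) b b' ;
  coeff_c : C1I I (@Bk R 1 n n) (@Bnorm R 1 n n) c c' ;
  coeff_d : C1I I (@Linf R n n) (@Linfnorm R n n) d d' ;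
  coeff_init :
    (Bnorm 3 (a 0%R) + Bnorm 2 (b 0%R) + Bnorm 1 (c 0%R) + Linfnorm (d 0%R)
      <= C0%:E)%E ;
  coeff_C1 :
    (C1Inorm I (@Bnorm R 3 n n) a a' + C1Inorm I (@Bnorm R 2 n n) b b' +
     C1Inorm I (@Bnorm R 1 n n) c c' + C1Inorm I (@Linfnorm R n n) d d'
      <= C1%:E)%E ;
  coeff_decay_ab0 :
    (wLinfnorm (2 * delta)%R (derive1 (a 0%R)) + wLinfnorm (2 * delta)%R (b 0%R)
      <= C0%:E)%E ;
  coeff_decay_ab :
    (wLinfnormI I (2 * delta)%R (fun t => derive1 (a' t)) +
     wLinfnormI I (2 * delta)%R b' <= C1%:E)%E ;
  coeff_decay_bc0 :
    (wLinfnorm delta (derive1 (fun x => antisym (b 0%R x))) +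
     wLinfnorm delta (fun x => antisym (c 0%R x)) <= C0%:E)%E ;
  coeff_decay_bc :
    (wLinfnormI I delta (fun t => derive1 (fun x => antisym (b' t x))) +
     wLinfnormI I delta (fun t x => antisym (c' t x)) <= C1%:E)%E }.

(* [u'] is the time derivative of [u].  An element of H^5 agrees almost
   everywhere with a unique C^4 function; [sol_C4] says that [u t] is that
   representative, so that the x-derivatives in the equation are classical.
   The equation is only required for almost every x because d takes values in
   L^infinity. *)
Record classical_solution (R : realType) (n : nat) (eps : R) (I : set R)
    (a b c d : R -> R -> 'M[R]_n) (f : R -> R -> 'cV[R]_n)
    (u0 : R -> 'cV[R]_n) (u u' : R -> R -> 'cV[R]_n) : Prop :=
  ClassicalSolution {
  sol_H5 : C0I I (@Hs R 5 n) (@Hnorm R 5 n) u ;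
  sol_H1 : C1I I (@Hs R 1 n) (@Hnorm R 1 n) u u' ;
  sol_C4 : forall t, I t -> Ck 4 (u t) ;
  sol_meas : forall t, I t -> measurable_mx (f t) ;
  sol_eq : forall t, I t ->
    {ae @lebesgue_measure R, forall x,
      u' t x + a t x *m derive1n 3 (u t) x + b t x *m derive1n 2 (u t) x
        + c t x *m derive1 (u t) x + d t x *m u t x
      = - (eps *: derive1n 4 (u t) x) + f t x} ;
  sol_init : forall x, u 0 x = u0 x }.

(* Main.v *)
Require Import Defs.
From HB Require Import structures.
From mathcomp Require Import all_boot all_order all_algebra.
From mathcomp Require Import all_classical all_reals all_analysis.
From mathcomp Require Import measurable_realfun ess_sup_inf complex.
From mathcomp Require Import ring lra.

Set Implicit Arguments.
Unset Strict Implicit.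
Unset Printing Implicit Defensive.

Import Order.TTheory GRing.Theory Num.Theory.
Import numFieldNormedType.Exports.

Local Open Scope ring_scope.
Local Open Scope classical_set_scope.

(* For a weight phi with 0 < Pm <= phi <= PM, differentiate the energy
   E = sum_i \int phi u_i^2.  By symmetry of a, the third order term gives
   - 3 \int phi' (a u_x, u_x) up to terms bounded by E, and the second order term
   leaves (b u_x, u_x), of size <x>^(-2 delta) |u_x|^2.  Taking
   phi = exp (M Psi / c) with Psi bounded and Psi' >= c <x>^(-2 delta), which is
   possible as 2 delta > 1, the first beats the second, and
   E' + Pm/2 \int <x>^(-2 delta) |u_x|^2 + |u|^2 <= K E + 2 sum_i \int phi u_i f_i.
   The terms pairing u with u_x involve only b and the antisymmetric parts of b_x
   and c, and are absorbed by Cauchy-Schwarz.  On a time interval of length at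
   most 1/K the factor e^(K t) is at most e.  C1 enters K only, so the constants of the
   estimates do not depend on it.

   For the second estimate, \int phi u f is the pairing of <D>(phi u) with
   <D>^(-1) f, and <x>^(-delta) <D> v is controlled by v and <x>^(-delta) v_x in L^2
   because the commutator of <x>^(-delta) with <D> is bounded on L^2.

   The Fourier transform of a real function g has even real part and odd imaginary
   part, the even part and minus the odd part of the Hartley transform, the integral
   of g(x) (cos (x xi) + sin (x xi)).  The latter is real, symmetric and squares to a
   multiple of the identity, so Plancherel's theorem is proved for it. *)

(** The constants of the estimates must not see C1, although at positive times the hypotheses
    control the coefficients through C1. The way out is comparison with time 0: every decay bound
    grows by at most C1 t, and the interval is so short that it stays below 2 C0, while the
    ellipticity constant stays above lambda / 2. The size M of the logarithmic derivative of the
    weight is then fixed by C0, lambda and n. The term with eps is not small. Integrated by parts it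
    gives eps times the weighted square of u_xx with the good sign, and this absorbs, by
    interpolation, the errors coming from the derivatives of the weight; so the bounds are uniform
    in 0 <= eps <= 1. The norms of f need be neither measurable nor finite as functions of time. The
    right hand sides are kept as integrals of nonnegative extended functions, for which monotonicity
    holds without measurability, and what is integrated on the left is continuous in time. *)

Section L2.
Context {R : realType}.
Notation mu := (@lebesgue_measure R).
Implicit Types (f g h : R -> R) (k : R).

Lemma ae_imp (P Q : R -> Prop) : (forall x, P x -> Q x) ->
  {ae mu, forall x, P x} -> {ae mu, forall x, Q x}.
Proof.
by move=> PQ [A [mA A0 AP]]; exists A; split => // x nQ; apply: AP => /PQ.
Qed.

Lemma ae_and (P Q : R -> Prop) : {ae mu, forall x, P x} ->
  {ae mu, forall x, Q x} -> {ae mu, forall x, P x /\ Q x}.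
Proof.
move=> [A [mA A0 AP]] [B [mB B0 BQ]]; exists (A `|` B); split.
- exact: measurableU.
- by apply: null_set_setU.
- move=> x; rewrite /= not_andP => -[nP|nQ]; [left|right].
    exact: AP.
  exact: BQ.
Qed.

(** * Integrable and square integrable functions on the line *)

Definition intg f := mu.-integrable setT (EFin \o f).

Lemma intg_meas f : intg f -> measurable_fun setT f.
Proof. by move=> /measurable_int/measurable_EFinP. Qed.

Lemma intg_le f g : measurable_fun setT f -> (forall x, `|f x| <= `|g x|) ->
  intg g -> intg f.
Proof.
move=> mf fg; apply: le_integrable => //; first exact/measurable_EFinP.
by move=> x _ /=; rewrite lee_fin.
Qed.

Lemma intg_eq f g : f =1 g -> intg f -> intg g.
Proof. by move=> /funext ->. Qed.

Lemma intgD f g : intg f -> intg g -> intg (f \+ g).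
Proof. by move=> fi gi; have := integrableD measurableT fi gi. Qed.

Lemma intgZ k f : intg f -> intg (fun x => k * f x).
Proof. by move=> fi; have := integrableZl measurableT k fi. Qed.

Lemma intgN f : intg f -> intg (fun x => - f x).
Proof. by move=> fi; apply: intg_eq (intgZ (-1) fi) => x; rewrite mulN1r. Qed.

Lemma intgB f g : intg f -> intg g -> intg (f \- g).
Proof. by move=> fi /intgN gi; have := intgD fi gi. Qed.

Lemma intg0 : intg (cst 0).
Proof. exact: integrable0. Qed.

Lemma intg_sum (I : Type) (s : seq I) (F : I -> R -> R) :
  (forall i, intg (F i)) -> intg (fun x => \sum_(i <- s) F i x).
Proof.
move=> Fi; elim: s => [|i s ih].
  by apply: intg_eq intg0 => x; rewrite big_nil.
by apply: intg_eq (intgD (Fi i) ih) => x /=; rewrite big_cons.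
Qed.

Lemma intg_abs f : intg f -> intg (fun x => `|f x|).
Proof.
move=> fi; have mf := intg_meas fi.
apply: intg_le fi => [|x]; last by rewrite normr_id.
exact: measurableT_comp.
Qed.

Lemma RintD f g : intg f -> intg g ->
  \int[mu]_x (f x + g x) = \int[mu]_x f x + \int[mu]_x g x.
Proof. by move=> fi gi; rewrite RintegralD. Qed.

Lemma RintB f g : intg f -> intg g ->
  \int[mu]_x (f x - g x) = \int[mu]_x f x - \int[mu]_x g x.
Proof. by move=> fi gi; rewrite RintegralB. Qed.

Lemma RintZ k f : intg f -> \int[mu]_x (k * f x) = k * \int[mu]_x f x.
Proof. by move=> fi; rewrite RintegralZl. Qed.

Lemma Rint_eq f g : f =1 g -> \int[mu]_x f x = \int[mu]_x g x.
Proof. by move=> /funext ->. Qed.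

Lemma Rint0 : \int[mu]_x (0 : R) = 0.
Proof. by rewrite Rintegral_cst// mul0r. Qed.

Lemma Rint_sum (I : Type) (s : seq I) (F : I -> R -> R) :
  (forall i, intg (F i)) ->
  \int[mu]_x (\sum_(i <- s) F i x) = \sum_(i <- s) \int[mu]_x F i x.
Proof.
move=> Fi; elim: s => [|i s ih].
  rewrite big_nil; under eq_Rintegral do rewrite big_nil.
  by rewrite Rintegral_cst// mul0r.
under eq_Rintegral do rewrite big_cons.
by rewrite RintD ?ih ?big_cons//; exact: intg_sum.
Qed.

Lemma Rint_le f g : intg f -> intg g -> (forall x, f x <= g x) ->
  \int[mu]_x f x <= \int[mu]_x g x.
Proof. by move=> fi gi fg; apply: le_Rintegral. Qed.

Lemma Rint_ge0 f : (forall x, 0 <= f x) -> 0 <= \int[mu]_x f x.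
Proof. by move=> f0; apply: Rintegral_ge0. Qed.

Lemma Rint_abs f : intg f -> `|\int[mu]_x f x| <= \int[mu]_x `|f x|.
Proof. by move=> fi; apply: le_normr_Rintegral. Qed.

Lemma intE f : intg f -> (\int[mu]_x (f x)%:E)%E = (\int[mu]_x f x)%:E.
Proof.
by move=> fi; rewrite /Rintegral fineK//; apply: integrable_fin_num fi.
Qed.

Lemma intg_ge0P f : measurable_fun setT f -> (forall x, 0 <= f x) ->
  (\int[mu]_x (f x)%:E < +oo)%E -> intg f.
Proof.
move=> mf f0 fi; apply/integrableP; split; first exact/measurable_EFinP.
by under eq_integral do rewrite /= ger0_norm//.
Qed.

Lemma Rint_ae f g : measurable_fun setT f -> measurable_fun setT g ->
  {ae mu, forall x, f x = g x} -> \int[mu]_x f x = \int[mu]_x g x.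
Proof.
move=> mf mg fg; rewrite /Rintegral; congr fine.
apply: ae_eq_integral => //; [exact/measurable_EFinP..|].
by case: fg => A [mA A0 AP]; exists A; split => // x /= xA; apply: AP => /= E; apply: xA => _; rewrite E.
Qed.

Lemma intg_ae f g : measurable_fun setT f ->
  {ae mu, forall x, f x = g x} -> intg g -> intg f.
Proof.
move=> mf fg gi; apply/integrableP; split; first exact/measurable_EFinP.
case/integrableP : (gi) => mg; apply: le_lt_trans.
rewrite le_eqVlt; apply/orP; left; apply/eqP.
apply: ae_eq_integral => //.
- by apply: measurableT_comp => //; exact/measurable_EFinP.
- by apply: measurableT_comp.
- by case: fg => A [mA A0 AP]; exists A; split => // x /= xA; apply: AP => /= E; apply: xA => _; rewrite E.
Qed.

Definition sqint f := measurable_fun setT f /\ intg (fun x => f x ^+ 2).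

Definition ip f g := \int[mu]_x (f x * g x).

Lemma sqint_meas f : sqint f -> measurable_fun setT f.
Proof. by case. Qed.

Lemma sqint_mul f g : sqint f -> sqint g -> intg (fun x => f x * g x).
Proof.
move=> [mf fi] [mg gi]; apply: (@intg_le _ (fun x => f x ^+ 2 + g x ^+ 2)).
- exact: measurable_funM.
- move=> x; rewrite [leRHS]ger0_norm ?addr_ge0 ?sqr_ge0//.
  rewrite normrM -(real_normK (num_real (f x))) -(real_normK (num_real (g x))).
  by have := sqr_ge0 (`|f x| - `|g x|); have := normr_ge0 (f x); have := normr_ge0 (g x); nra.
- exact: intgD.
Qed.

Lemma sqint_le f g : measurable_fun setT f -> (forall x, `|f x| <= `|g x|) ->
  sqint g -> sqint f.
Proof.
move=> mf fg [mg gi]; split => //; apply: intg_le gi.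
  exact: measurable_funX.
by move=> x; rewrite !normrX lerXn2r// nnegrE.
Qed.

Lemma sqintZ k f : sqint f -> sqint (fun x => k * f x).
Proof.
move=> [mf fi]; split; first exact: measurable_funM.
by apply: intg_eq (intgZ (k ^+ 2) fi) => x; rewrite exprMn.
Qed.

Lemma sqintD f g : sqint f -> sqint g -> sqint (fun x => f x + g x).
Proof.
move=> fi gi; have fgi := sqint_mul fi gi.
case: fi gi => mf fi [mg gi]; split; first exact: measurable_funD.
apply: intg_eq (intgD (intgD fi gi) (intgZ 2 fgi)) => x /=; ring.
Qed.

Lemma sqintN f : sqint f -> sqint (fun x => - f x).
Proof.
move=> [mf fi]; split; first exact: measurableT_comp.
by apply: intg_eq fi => x; rewrite sqrrN.
Qed.

Lemma sqintB f g : sqint f -> sqint g -> sqint (fun x => f x - g x).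
Proof. by move=> fi gi; apply: sqintD => //; exact: sqintN. Qed.

Lemma sqint0 : sqint (fun=> 0).
Proof.
by split => //; apply: intg_eq intg0 => x; rewrite expr0n.
Qed.

Lemma sqint_sum (I : Type) (s : seq I) (F : I -> R -> R) :
  (forall i, sqint (F i)) -> sqint (fun x => \sum_(i <- s) F i x).
Proof.
move=> Fi; elim: s => [|i s ih].
  by have -> : (fun x => \sum_(i <- [::]) F i x) = fun=> 0;
    [by apply/funext => x; rewrite big_nil|exact: sqint0].
have -> : (fun x => \sum_(j <- i :: s) F j x) =
    fun x => F i x + \sum_(j <- s) F j x.
  by apply/funext => x; rewrite big_cons.
exact: sqintD.
Qed.

Lemma sqintMb (m : R -> R) B f : measurable_fun setT m -> (forall x, `|m x| <= B) ->
  sqint f -> sqint (fun x => m x * f x).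
Proof.
move=> mm mB fi; have [mf _] := fi.
apply: (sqint_le _ _ (sqintZ B fi)); first exact: measurable_funM.
move=> x; rewrite !normrM ler_wpM2r//.
by apply: (le_trans (mB x)); exact: ler_norm.
Qed.

Lemma sqint_ae f g : measurable_fun setT f ->
  {ae mu, forall x, f x = g x} -> sqint g -> sqint f.
Proof.
move=> mf fg [mg gi]; split => //; apply: intg_ae gi.
  exact: measurable_funX.
by apply: ae_imp fg => x ->.
Qed.

Lemma sqint_abs f : sqint f -> sqint (fun x => `|f x|).
Proof.
move=> [mf fi]; split; first exact: measurableT_comp.
by apply: intg_eq fi => x; rewrite real_normK// num_real.
Qed.

Lemma ipC f g : ip f g = ip g f.
Proof. by apply: eq_Rintegral => x _; rewrite mulrC. Qed.

Lemma ipDl f g h : sqint f -> sqint g -> sqint h ->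
  ip (fun x => f x + g x) h = ip f h + ip g h.
Proof.
move=> fi gi hi; rewrite -RintD; [|exact: sqint_mul..].
by apply: eq_Rintegral => x _; rewrite mulrDl.
Qed.

Lemma ipZl k f g : sqint f -> sqint g ->
  ip (fun x => k * f x) g = k * ip f g.
Proof.
move=> fi gi; rewrite -RintZ; [|exact: sqint_mul].
by apply: eq_Rintegral => x _; rewrite mulrA.
Qed.

Lemma ipNl f g : sqint f -> sqint g -> ip (fun x => - f x) g = - ip f g.
Proof.
move=> fi gi; rewrite -mulN1r -ipZl//; congr ip.
by apply/funext => x; rewrite mulN1r.
Qed.

Lemma ipBl f g h : sqint f -> sqint g -> sqint h ->
  ip (fun x => f x - g x) h = ip f h - ip g h.
Proof. by move=> fi gi hi; rewrite ipDl ?ipNl//; exact: sqintN. Qed.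

Lemma ipDr f g h : sqint f -> sqint g -> sqint h ->
  ip h (fun x => f x + g x) = ip h f + ip h g.
Proof. by move=> *; rewrite ipC ipDl// !(ipC h). Qed.

Lemma ipBr f g h : sqint f -> sqint g -> sqint h ->
  ip h (fun x => f x - g x) = ip h f - ip h g.
Proof. by move=> *; rewrite ipC ipBl// !(ipC h). Qed.

Lemma ipZr k f g : sqint f -> sqint g ->
  ip g (fun x => k * f x) = k * ip g f.
Proof. by move=> *; rewrite ipC ipZl// (ipC g). Qed.

Definition nsq f := ip f f.

Lemma nsqE f : nsq f = \int[mu]_x (f x ^+ 2).
Proof. by apply: eq_Rintegral => x _; rewrite expr2. Qed.

Lemma nsq_ge0 f : 0 <= nsq f.
Proof. by rewrite nsqE; apply: Rint_ge0 => x; exact: sqr_ge0. Qed.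

Lemma nsqD f g : sqint f -> sqint g ->
  nsq (fun x => f x + g x) = nsq f + 2 * ip f g + nsq g.
Proof.
move=> fi gi; have fgi := sqintD fi gi.
by rewrite /nsq ipDl// !ipDr// (ipC g f); ring.
Qed.

Lemma nsqB f g : sqint f -> sqint g ->
  nsq (fun x => f x - g x) = nsq f - 2 * ip f g + nsq g.
Proof.
move=> fi gi; have fgi := sqintB fi gi.
by rewrite /nsq ipBl// !ipBr// (ipC g f); ring.
Qed.

Lemma nsqZ k f : sqint f -> nsq (fun x => k * f x) = k ^+ 2 * nsq f.
Proof.
by move=> fi; have ki := sqintZ k fi; rewrite /nsq ipZl// ipZr//; ring.
Qed.

Lemma nsqN f : nsq (fun x => - f x) = nsq f.
Proof. by rewrite !nsqE; apply: eq_Rintegral => x _; rewrite sqrrN. Qed.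

Lemma nsqBC f g : nsq (fun x => f x - g x) = nsq (fun x => g x - f x).
Proof. by rewrite -nsqN; congr nsq; apply/funext => x; rewrite opprB. Qed.

Lemma ler_nsq f g : measurable_fun setT f -> (forall x, `|f x| <= `|g x|) ->
  sqint g -> nsq f <= nsq g.
Proof.
move=> mf fg gi; have [_ fi] := sqint_le mf fg gi; case: gi => _ gi.
rewrite !nsqE; apply: Rint_le => // x.
rewrite -(real_normK (num_real (f x))) -(real_normK (num_real (g x))).
by rewrite lerXn2r// nnegrE.
Qed.

Lemma cauchy_schwarz f g : sqint f -> sqint g -> ip f g ^+ 2 <= nsq f * nsq g.
Proof.
move=> fi gi.
have P t : 0 <= t ^+ 2 * nsq f + 2 * t * ip f g + nsq g.
  have ti := sqintZ t fi.
  by have := nsq_ge0 (fun x => t * f x + g x); rewrite nsqD// nsqZ// ipZl//; nra.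
have [f0|f0] := eqVneq (nsq f) 0.
  have [->|fg0] := eqVneq (ip f g) 0; first by rewrite expr0n mulr_ge0 ?nsq_ge0.
  (* With [nsq f = 0] the polynomial is affine in [t]. At this [t] its value is -1, so its slope
     cannot be nonzero. *)
  have := P (- (nsq g + 1) / (2 * ip f g)).
  rewrite f0 mulr0 add0r [X in X + _](_ : _ = - (nsq g + 1)); last by field.
  by lra.
have fp : 0 < nsq f by rewrite lt_def f0 nsq_ge0.
(* The minimum of the quadratic polynomial. *)
have := P (- ip f g / nsq f).
rewrite (_ : _ + _ = (nsq f * nsq g - ip f g ^+ 2) / nsq f); last by field.
by rewrite pmulr_lge0 ?invr_gt0// subr_ge0.
Qed.

Definition nrm f := Num.sqrt (nsq f).

Lemma nrm_ge0 f : 0 <= nrm f.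
Proof. exact: sqrtr_ge0. Qed.

Lemma nrm_sq f : nrm f ^+ 2 = nsq f.
Proof. by rewrite sqr_sqrtr ?nsq_ge0. Qed.

Lemma cauchy_schwarz_nrm f g : sqint f -> sqint g -> `|ip f g| <= nrm f * nrm g.
Proof.
move=> fi gi; rewrite -(@ler_pXn2r _ 2)// ?nnegrE ?mulr_ge0 ?nrm_ge0//.
by rewrite exprMn !nrm_sq real_normK ?num_real// cauchy_schwarz.
Qed.

Lemma nrmD f g : sqint f -> sqint g -> nrm (fun x => f x + g x) <= nrm f + nrm g.
Proof.
move=> fi gi; rewrite -(@ler_pXn2r _ 2)// ?nnegrE ?addr_ge0 ?nrm_ge0//.
rewrite sqrrD !nrm_sq nsqD//.
have := ler_norm (ip f g); have := cauchy_schwarz_nrm fi gi; lra.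
Qed.

Lemma nrmN f : nrm (fun x => - f x) = nrm f.
Proof. by rewrite /nrm nsqN. Qed.

Lemma nrmB f g : sqint f -> sqint g -> nrm (fun x => f x - g x) <= nrm f + nrm g.
Proof. by move=> fi gi; rewrite -(nrmN g); apply: nrmD => //; exact: sqintN. Qed.

Lemma nrmBC f g : nrm (fun x => f x - g x) = nrm (fun x => g x - f x).
Proof. by rewrite /nrm nsqBC. Qed.

Lemma nrm_tri f g h : sqint f -> sqint g -> sqint h ->
  nrm (fun x => f x - h x) <= nrm (fun x => f x - g x) + nrm (fun x => g x - h x).
Proof.
move=> fi gi hi; apply: le_trans (nrmD (sqintB fi gi) (sqintB gi hi)).
by rewrite le_eqVlt; apply/orP; left; apply/eqP; congr nrm; apply/funext => x; ring.
Qed.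

Lemma nrmZ k f : sqint f -> nrm (fun x => k * f x) = `|k| * nrm f.
Proof. by move=> fi; rewrite /nrm nsqZ// sqrtrM ?sqr_ge0// sqrtr_sqr. Qed.

Lemma nsq_ae f g : measurable_fun setT f -> measurable_fun setT g ->
  {ae mu, forall x, f x = g x} -> nsq f = nsq g.
Proof.
move=> mf mg fg; rewrite !nsqE; apply: Rint_ae; [exact: measurable_funX..|].
by apply: ae_imp fg => x ->.
Qed.

Lemma nsq_eq0 f : sqint f -> nsq f = 0 -> {ae mu, forall x, f x = 0}.
Proof.
move=> [mf fi] f0.
have : (\int[mu]_x `|(f x ^+ 2)%:E| = 0)%E.
  under eq_integral do rewrite gee0_abs ?lee_fin ?sqr_ge0//.
  by rewrite intE// -nsqE f0.
have mf2 : measurable_fun setT (fun x => (f x ^+ 2)%:E).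
  by apply/measurable_EFinP; exact: measurable_funX.
move/(ae_eq_integral_abs mu measurableT mf2).
apply: ae_imp => x /(_ I) /= [] /eqP.
by rewrite sqrf_eq0 => /eqP.
Qed.

Lemma nrm_eq0 f : sqint f -> nrm f <= 0 -> {ae mu, forall x, f x = 0}.
Proof.
move=> fi f0; apply: nsq_eq0 => //; rewrite -nrm_sq.
by have -> : nrm f = 0; [apply/eqP; rewrite eq_le f0 nrm_ge0|rewrite expr0n].
Qed.

End L2.

(** * Fatou's lemma and completeness of L2 *)

Section limits.
Context {R : realType}.
Notation mu := (@lebesgue_measure R).
Implicit Types (f g h : R -> R).

(** Fatou's lemma for squares: a uniform L2 bound passes to an almost everywhere limit without
    domination, and square integrability of the limit comes with it. Both inequalities of
    Plancherel's identity survive their limits in this way. *)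
Lemma fatou_nsq (F : nat -> R -> R) f M : (forall n, sqint (F n)) ->
  measurable_fun setT f -> {ae mu, forall x, F ^~ x @ \oo --> f x} ->
  (forall n, nsq (F n) <= M) -> sqint f /\ nsq f <= M.
Proof.
move=> Fi mf Ff FM.
have mF2 n : measurable_fun setT (fun x => (F n x ^+ 2)%:E).
  by apply/measurable_EFinP; apply: measurable_funX; apply: sqint_meas.
have mf2 : measurable_fun setT (fun x => (f x ^+ 2)%:E).
  by apply/measurable_EFinP; exact: measurable_funX.
have H : (\int[mu]_x (f x ^+ 2)%:E <= M%:E)%E.
  have -> : (\int[mu]_x (f x ^+ 2)%:E =
      \int[mu]_x limn_einf (fun n => (F n x ^+ 2)%:E))%E.
    apply: ae_eq_integral => //.
      (* Measurability of the lower limit is read off that of the upper limit of the opposite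
         sequence. *)
      under eq_fun do rewrite limn_einf_lim.
      under eq_fun do rewrite -limn_einf_lim -[limn_einf _]oppeK -limn_esupN.
      apply: measurableT_comp => //.
      apply: measurable_fun_limn_esup => n.
      apply/measurable_EFinP; apply: measurableT_comp => //.
      by apply: measurable_funX; apply: sqint_meas.
    apply: ae_imp Ff => x Ffx _.
    have c : (F n x ^+ 2)%:E @[n --> \oo] --> (f x ^+ 2)%:E.
      by apply: cvg_EFin; [exact: nearW|apply: cvgM].
    by rewrite is_cvg_limn_einfE; [rewrite (cvg_lim _ c)|apply/cvg_ex; eexists; exact: c].
  apply: (le_trans (fatou mu measurableT mF2 _)).
    by move=> n x _; rewrite lee_fin sqr_ge0.
  rewrite limn_einf_lim; apply: lime_le; first exact: is_cvg_einfs.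
  apply: nearW => n; apply: (@le_trans _ _ (\int[mu]_x (F n x ^+ 2)%:E)%E).
    by apply: ereal_inf_lbound; exists n => //=.
  by rewrite intE ?lee_fin -?nsqE//; exact: (Fi n).2.
have fi : sqint f.
  split => //; apply: intg_ge0P => [|x|]; [exact: measurable_funX|exact: sqr_ge0|].
  by apply: le_lt_trans H _; rewrite ltry.
by split => //; move: H; rewrite intE ?lee_fin ?nsqE//; exact: fi.2.
Qed.

Lemma fatou_nsq_near (F : nat -> R -> R) f M : (forall n, sqint (F n)) ->
  measurable_fun setT f -> {ae mu, forall x, F ^~ x @ \oo --> f x} ->
  (\forall n \near \oo, nsq (F n) <= M) -> sqint f /\ nsq f <= M.
Proof.
move=> Fi mf Ff [N _ NM].
apply: (@fatou_nsq (fun n => F (n + N)%N)) => // [|n].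
  by apply: ae_imp Ff => x Ffx; rewrite (@cvg_shiftn N _ (F ^~ x)).
by apply: NM => /=; rewrite leq_addl.
Qed.

Lemma nsq_cvg_lim (F : nat -> R -> R) f c : (forall n, sqint (F n)) ->
  measurable_fun setT f -> {ae mu, forall x, F ^~ x @ \oo --> f x} ->
  nsq (F n) @[n --> \oo] --> c -> sqint f /\ nsq f <= c.
Proof.
move=> Fi mf Ff Fc.
have P e : 0 < e -> sqint f /\ nsq f <= c + e.
  move=> e0; apply: fatou_nsq_near Ff _ => //.
  move/cvgrPdist_le : Fc => /(_ e e0); apply: filterS => n.
  by rewrite ler_distl => /andP[]; lra.
split; first by case: (P 1 ltr01).
by apply/ler_addgt0Pr => e /P[].
Qed.

(** Riesz-Fischer: a fast subsequence converges almost everywhere, and Fatou's lemma turns its limit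
    into the L2 limit of the whole sequence. *)
Lemma complete_nsq (F : nat -> R -> R) : (forall n, sqint (F n)) ->
  (forall e : R, 0 < e -> exists N, forall m n, (N <= m)%N -> (N <= n)%N ->
     nsq (fun x => F m x - F n x) <= e) ->
  exists2 f, sqint f & nsq (fun x => F n x - f x) @[n --> \oo] --> 0.
Proof.
move=> Fi Fc.
have half1 : `|2^-1 : R| < 1 by rewrite ger0_norm ?invr_ge0// invf_lt1// ltr1n.
have /boolp.choice[N NP] : forall k, exists N, forall m n, (N <= m)%N -> (N <= n)%N ->
    nsq (fun x => F m x - F n x) <= 8^-1 ^+ k.
  by move=> k; apply: Fc; rewrite exprn_gt0.
(* Strictly increasing indices beyond [N k], so that consecutive differences have squared norm at
   most 8^-k. *)
pose n_ := fix n_ k := if k is k'.+1 then maxn (n_ k').+1 (N k) else N 0%N.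
have nN k : (N k <= n_ k)%N by case: k => //= k; rewrite leq_max leqnn orbT.
have nS k : (n_ k < n_ k.+1)%N by rewrite /= leq_max leqnn.
have nmono k l : (k <= l)%N -> (n_ k <= n_ l)%N.
  by move=> /subnKC <-; elim: (l - k)%N => [|j ih]; rewrite ?addn0// addnS (leq_trans ih)// ltnW.
have nk k : (k <= n_ k)%N by elim: k => // k ih; exact: leq_ltn_trans ih (nS k).
pose G k x := F (n_ k) x.
pose d k x := G k.+1 x - G k x.
have Gi k : sqint (G k) by exact: Fi.
have di k : sqint (d k) by exact: sqintB.
have dle k : nsq (d k) <= 8^-1 ^+ k.
  by apply: NP; [apply: leq_trans (ltnW (nS k))|].
(* Since 4^k 8^-k = 2^-k is summable, the series of 4^k d_k^2 is integrable, hence finite almost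
   everywhere. At such points |d_k| is at most a constant times 2^-k, and the subsequence
   converges. *)
have ae_sum : {ae mu, forall x, exists2 S : R, 0 <= S & forall k, 4 ^+ k * d k x ^+ 2 <= S}.
  pose t k x := (4 ^+ k * d k x ^+ 2)%:E.
  have mt k : measurable_fun setT (t k).
    apply/measurable_EFinP; apply: measurable_funM => //.
    by apply: measurable_funX; apply: sqint_meas.
  have t0 k x : (0 <= t k x)%E by rewrite lee_fin mulr_ge0 ?sqr_ge0// exprn_ge0.
  have it k : (\int[mu]_x t k x <= (2^-1 ^+ k)%:E)%E.
    have [_ dk2] := di k.
    rewrite /t (@intE _ (fun x => 4 ^+ k * d k x ^+ 2)) ?RintZ -?nsqE//; last exact: intgZ.
    rewrite lee_fin (@le_trans _ _ (4 ^+ k * 8^-1 ^+ k))// ?ler_wpM2l ?exprn_ge0//.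
    by rewrite -exprMn (_ : 4 * 8^-1 = 2^-1)//; lra.
  have fin : (\int[mu]_x (\sum_(0 <= k <oo) t k x) < +oo)%E.
    rewrite integral_nneseries//.
    apply: (@le_lt_trans _ _ (\sum_(0 <= k <oo) (2^-1 ^+ k)%:E)%E).
      by apply: lee_nneseries => // k _ _; apply: integral_ge0.
    have /cvg_ex[l cl] : cvgn (series (fun k => (2^-1 : R) ^+ k)).
      have -> : (fun k => (2^-1 : R) ^+ k) = geometric 1 2^-1.
        by apply/funext => k; rewrite /geometric /= mul1r.
      exact: is_cvg_geometric_series.
    have -> : (\sum_(0 <= k <oo) ((2^-1 : R) ^+ k)%:E)%E = l%:E.
      apply/cvg_lim => //.
      have -> : (fun n => (\sum_(0 <= k < n) ((2^-1 : R) ^+ k)%:E)%E) =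
          EFin \o series (fun k => (2^-1 : R) ^+ k).
        by apply/funext => n /=; rewrite sumEFin.
      by apply: cvg_EFin; [exact: nearW|].
    by rewrite ltry.
  have /integrable_ae : mu.-integrable setT (fun x => \sum_(0 <= k <oo) t k x)%E.
    apply/integrableP; split.
      apply: (@ge0_emeasurable_sum _ _ _ setT t xpredT) => //.
    by under eq_integral do rewrite gee0_abs ?nneseries_ge0//.
  move=> /(_ measurableT); apply: ae_imp => x /(_ I) fx.
  exists (fine (\sum_(0 <= k <oo) t k x)%E); first by rewrite fine_ge0 ?nneseries_ge0.
  move=> k; rewrite -lee_fin fineK//.
  rewrite -/(t k x) (@nneseriesD1 _ (t ^~ x) k xpredT)// leeDl// nneseries_ge0//.
have ae_cvg : {ae mu, forall x, cvgn (G ^~ x)}.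
  apply: ae_imp ae_sum => x [S S0 SP].
  have dS k : `|d k x| <= geometric (Num.sqrt S) 2^-1 k.
    rewrite /geometric /= -(@ler_pXn2r _ 2)// ?nnegrE ?mulr_ge0 ?sqrtr_ge0 ?exprn_ge0//.
    rewrite real_normK ?num_real// exprMn sqr_sqrtr// exprAC -ler_pdivrMr ?exprn_gt0 ?exprn_gt0//.
    rewrite -exprVn (_ : (2^-1 ^+ 2)^-1 = 4) 1?mulrC//; by field.
  have : cvgn (series (fun k => d k x)).
    apply: normed_cvg; apply: (series_le_cvg _ _ dS) => //.
    - by move=> n; rewrite /geometric /= mulr_ge0 ?sqrtr_ge0 ?exprn_ge0.
    - exact: is_cvg_geometric_series.
  have -> : series (fun k => d k x) = fun n => G n x - G 0%N x.
    by apply/funext => n; rewrite /series /= telescope_sumr.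
  move=> c; have := is_cvgD c (is_cvg_cst (G 0%N x)).
  have -> : (fun n => G n x - G 0%N x) + (fun=> G 0%N x) = G ^~ x.
    by apply/funext => n /=; rewrite -[LHS]/(G n x - G 0%N x + G 0%N x) subrK.
  by apply.
(* The upper limit is measurable and defined everywhere; it agrees with the limit wherever the
   subsequence converges. *)
pose f x := fine (limn_esup (fun k => (G k x)%:E)).
have mf : measurable_fun setT f.
  apply: measurableT_comp => //; apply: measurable_fun_limn_esup => k.
  by apply/measurable_EFinP; apply: sqint_meas.
have Gf : {ae mu, forall x, G ^~ x @ \oo --> f x}.
  apply: ae_imp ae_cvg => x /cvg_ex [l cl].
  have c : (G k x)%:E @[k --> \oo] --> l%:E by apply: cvg_EFin; [exact: nearW|].
  rewrite /f is_cvg_limn_esupE; last by apply/cvg_ex; eexists; exact: c.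
  by rewrite (cvg_lim _ c).
have Ff n M : (\forall k \near \oo, nsq (fun x => F n x - G k x) <= M) ->
    sqint (fun x => F n x - f x) /\ nsq (fun x => F n x - f x) <= M.
  move=> H; have mFn := sqint_meas (Fi n); apply: fatou_nsq_near H.
  - by move=> k; exact: sqintB.
  - exact: measurable_funB.
  - apply: ae_imp Gf => x Gfx; apply: cvgB => //; exact: cvg_cst.
have key e : 0 < e -> \forall n \near \oo,
    sqint (fun x => F n x - f x) /\ nsq (fun x => F n x - f x) <= e.
  move=> /Fc[M MP]; exists M => // n /= Mn; apply: Ff.
  exists M => // k /= Mk; apply: MP => //; exact: leq_trans (nk k).
have fi : sqint f.
  have [M _ /(_ M (leqnn _)) [fi _]] := key 1 ltr01.
  have -> : f = fun x => F M x - (F M x - f x) by apply/funext => x; rewrite opprB addrC subrK.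
  exact: sqintB.
exists f => //; apply/cvgrPdist_le => e /key; apply: filterS => n [_].
by rewrite sub0r normrN ger0_norm// nsq_ge0.
Qed.

End limits.

(** * Affine changes of variable and reflection *)

Definition affine (R : realType) (a b x : R) := a * x + b.

Lemma measurable_affine (R : realType) (a b : R) :
  measurable_fun setT (affine a b).
Proof. by apply: measurable_funD => //; exact: measurable_funM. Qed.

HB.instance Definition _ (R : realType) (a b : R) :=
  isMeasurableFun.Build _ _ _ _ (affine a b) (measurable_affine a b).

Section affine_change.
Context {R : realType}.
Notation mu := (@lebesgue_measure R).
Implicit Types (f g h : R -> R).

(** Uniqueness of Lebesgue measure: [a] times the image measure gives every half-open interval its
    length. *)
Lemma lebesgue_affine (a b : R) (A : set R) : 0 < a -> measurable A ->
  (a%:E * pushforward mu (affine a b : _ -> measurableTypeR R) A = mu A)%E.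
Proof.
move=> a0 mA; apply/esym.
have a0' : 0 <= a by exact: ltW.
apply: (@lebesgue_measure_unique R (mscale (NngNum a0')
  (pushforward mu (affine a b : _ -> measurableTypeR R)))) => //.
  exact: measurable_affine.
move=> maff _ [[u v]] _ <- /=.
rewrite /mscale /= /pushforward.
have -> : affine a b @^-1` `]u, v] = `](u - b) / a, (v - b) / a]%classic.
  apply/seteqP; split => x /=; rewrite /affine !in_itv /= => /andP[h1 h2]; apply/andP; split.
  - by rewrite ltr_pdivrMr//; lra.
  - by rewrite ler_pdivlMr//; lra.
  - by move: h1; rewrite ltr_pdivrMr//; lra.
  - by move: h2; rewrite ler_pdivlMr//; lra.
rewrite !lebesgue_measure_itv/= !lte_fin ltr_pM2r ?invr_gt0// ltrD2r.
case: ifPn => _; last by rewrite mule0.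
by rewrite -!EFinD -EFinM; congr EFin; field; rewrite gt_eqF.
Qed.

Lemma ge0_int_affine (a b : R) (f : R -> \bar R) : 0 < a ->
  measurable_fun setT f -> (forall x, 0 <= f x)%E ->
  (\int[mu]_x f x = a%:E * \int[mu]_x f (a * x + b)%R)%E.
Proof.
move=> a0 mf f0; have a0' : 0 <= a by exact: ltW.
have -> : (\int[mu]_x f (a * x + b)%R = \int[pushforward mu (affine a b : _ -> measurableTypeR R)]_x f x)%E.
  have := @ge0_integral_pushforward _ _ _ _ R (affine a b : measurableTypeR R -> measurableTypeR R) (measurable_affine a b) mu setT f measurableT mf.
  by rewrite preimage_setT => -> // y _; exact: f0.
rewrite -[X in _ = (X * _)%E]/((NngNum a0')%:num%:E) -ge0_integral_mscale//.
  exact: measurable_affine.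
move=> maff; apply: eq_measure_integral => //= A mA _.
by rewrite -(lebesgue_affine b a0).
Qed.

Lemma ge0_int_refl (f : R -> \bar R) :
  measurable_fun setT f -> (forall x, 0 <= f x)%E ->
  (\int[mu]_x f x = \int[mu]_x f (- x)%R)%E.
Proof.
move=> mf f0.
have -> : (\int[mu]_x f (- x)%R = \int[pushforward mu (-%R : _ -> measurableTypeR R)]_x f x)%E.
  have mN : measurable_fun setT (-%R : measurableTypeR R -> measurableTypeR R) by [].
  have := @ge0_integral_pushforward _ _ _ _ R _ mN mu setT f measurableT mf.
  by rewrite preimage_setT => -> // y _; exact: f0.
by apply: eq_measure_integral => //= A mA _; rewrite -lebesgue_measureN.
Qed.

Lemma measurable_comp_affine (a b : R) d (T : measurableType d) (f : R -> T) :
  measurable_fun setT f -> measurable_fun setT (fun x => f (a * x + b)).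
Proof.
by move=> mf; apply: (measurableT_comp mf); exact: measurable_affine.
Qed.

Lemma measurable_comp_refl d (T : measurableType d) (f : R -> T) :
  measurable_fun setT f -> measurable_fun setT (fun x : R => f (- x)).
Proof. by move=> mf; apply: (measurableT_comp mf). Qed.

Lemma intg_affine (a b : R) f : 0 < a -> intg f -> intg (fun x => f (a * x + b)).
Proof.
move=> a0 fi; have mf := intg_meas fi.
have mf' := measurable_comp_affine a b mf.
apply/integrableP; split; first exact/measurable_EFinP.
have /integrableP[_] := fi.
rewrite (ge0_int_affine b a0)//; last first.
  by apply/measurable_EFinP; exact: measurableT_comp.
case: (\int[mu]_x `|(EFin \o f) (a * x + b)%R|)%E => [r||]/=.
- by move=> _; exact: ltry.
- by rewrite gt0_muley ?lte_fin.
- by [].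
Qed.

Lemma intg_refl f : intg f -> intg (fun x => f (- x)).
Proof.
move=> fi; have mf := intg_meas fi.
have mf' := measurable_comp_refl mf.
apply/integrableP; split; first exact/measurable_EFinP.
have /integrableP[_] := fi.
rewrite (ge0_int_refl _)//.
by apply/measurable_EFinP; exact: measurableT_comp.
Qed.

(** Positive part. The changes of variable are proved for nonnegative functions and extended by
    taking differences. *)
Let pos f x := Num.max (f x) 0.

Let pos_ge0 f x : 0 <= pos f x. Proof. by rewrite le_max lexx orbT. Qed.

Let pos_intg f : intg f -> intg (pos f).
Proof.
move=> fi; have mf := intg_meas fi; apply: intg_le fi => [|x].
  exact: measurable_maxr.
by rewrite /pos /Num.max; case: ifP => // _; rewrite normr0.
Qed.

Let posE f x : f x = pos f x - pos (fun y => - f y) x.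
Proof. by rewrite /pos /Num.max; case: ltP => h1; case: ltP => h2; lra. Qed.

Lemma Rint_affine (a b : R) f : 0 < a -> intg f ->
  \int[mu]_x f x = a * \int[mu]_x f (a * x + b).
Proof.
move=> a0.
have P g : (forall x, 0 <= g x) -> intg g ->
    \int[mu]_x g x = a * \int[mu]_x g (a * x + b).
  move=> g0 gi; have gi' := intg_affine b a0 gi.
  apply: EFin_inj; rewrite EFinM -!intE//.
  rewrite (ge0_int_affine b a0)//; apply/measurable_EFinP; exact: intg_meas.
move=> fi; have pi := pos_intg fi; have ni := pos_intg (intgN fi).
have -> : \int[mu]_x f x = \int[mu]_x pos f x - \int[mu]_x pos (fun y => - f y) x.
  by rewrite -RintB//; apply: eq_Rintegral => x _; exact: posE.
rewrite (P _ _ pi)// (P _ _ ni)// -mulrBr -RintB; [|exact: intg_affine..].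
by congr (a * _); apply: eq_Rintegral => x _; rewrite -posE.
Qed.

Lemma Rint_refl f : intg f -> \int[mu]_x f x = \int[mu]_x f (- x).
Proof.
have P g : (forall x, 0 <= g x) -> intg g ->
    \int[mu]_x g x = \int[mu]_x g (- x).
  move=> g0 gi; have gi' := intg_refl gi.
  apply: EFin_inj; rewrite -!intE//.
  rewrite ge0_int_refl//; apply/measurable_EFinP; exact: intg_meas.
move=> fi; have pi := pos_intg fi; have ni := pos_intg (intgN fi).
have -> : \int[mu]_x f x = \int[mu]_x pos f x - \int[mu]_x pos (fun y => - f y) x.
  by rewrite -RintB//; apply: eq_Rintegral => x _; exact: posE.
rewrite (P _ _ pi)// (P _ _ ni)// -RintB; [|exact: intg_refl..].
by apply: eq_Rintegral => x _; rewrite -posE.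
Qed.

Lemma intg_shift (b : R) f : intg f -> intg (fun x => f (x + b)).
Proof.
move=> fi; apply: intg_eq (intg_affine b ltr01 fi) => x; by rewrite mul1r.
Qed.

Lemma Rint_shift (b : R) f : intg f -> \int[mu]_x f (x + b) = \int[mu]_x f x.
Proof.
move=> fi; rewrite [RHS](Rint_affine b ltr01 fi) mul1r.
by apply: eq_Rintegral => x _; rewrite mul1r.
Qed.

Lemma intg_rev (b : R) f : intg f -> intg (fun x => f (b - x)).
Proof.
by move=> fi; have := intg_refl (intg_shift b fi); apply: intg_eq => x; rewrite addrC.
Qed.

Lemma Rint_rev (b : R) f : intg f -> \int[mu]_x f (b - x) = \int[mu]_x f x.
Proof.
move=> fi; rewrite -[RHS](Rint_shift b fi) [RHS]Rint_refl; last exact: intg_shift.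
by apply: eq_Rintegral => x _; rewrite addrC.
Qed.

Lemma sqint_shift (b : R) f : sqint f -> sqint (fun x => f (x + b)).
Proof.
move=> [mf fi]; split; last exact: (intg_shift b fi).
by have := measurable_comp_affine 1 b mf; under eq_fun do rewrite mul1r.
Qed.

Lemma sqint_refl f : sqint f -> sqint (fun x => f (- x)).
Proof.
move=> [mf fi]; split; last exact: (intg_refl fi).
exact: measurable_comp_refl.
Qed.

Lemma sqint_rev (b : R) f : sqint f -> sqint (fun x => f (b - x)).
Proof.
by move=> fi; have := sqint_refl (sqint_shift b fi); under eq_fun do rewrite addrC.
Qed.

Lemma nsq_shift (b : R) f : sqint f -> nsq (fun x => f (x + b)) = nsq f.
Proof. by move=> [_ fi]; rewrite !nsqE; exact: (Rint_shift b fi). Qed.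

Lemma nsq_refl f : sqint f -> nsq (fun x => f (- x)) = nsq f.
Proof. by move=> [_ fi]; rewrite !nsqE [RHS](Rint_refl fi). Qed.

Lemma nsq_rev (b : R) f : sqint f -> nsq (fun x => f (b - x)) = nsq f.
Proof. by move=> [_ fi]; rewrite !nsqE; exact: (Rint_rev b fi). Qed.

End affine_change.

(** * Integrals depending on a parameter, and Fubini's theorem *)

Section product.
Context {R : realType}.
Notation mu := (@lebesgue_measure R).
Implicit Types (f g h : R -> R).

Lemma measurable_Rint (f : R * R -> R) : measurable_fun setT f ->
  measurable_fun setT (fun x => \int[mu]_y f (x, y)).
Proof.
move=> mf; apply: measurableT_comp => //.
under eq_fun do rewrite integralE.
apply: emeasurable_funB.
- have mp : measurable_fun setT ((EFin \o f)^\+)%E.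
    by apply: measurable_funepos; exact/measurable_EFinP.
  have := @measurable_fun_fubini_tonelli_F _ _ _ _ R mu _ mp (fun x => funepos_ge0 _ x).
  congr (measurable_fun _ _); apply/funext => x; rewrite /fubini_F.
  by apply: eq_integral => y _; rewrite !funeposE.
- have mp : measurable_fun setT ((EFin \o f)^\-)%E.
    by apply: measurable_funeneg; exact/measurable_EFinP.
  have := @measurable_fun_fubini_tonelli_F _ _ _ _ R mu _ mp (fun x => funeneg_ge0 _ x).
  congr (measurable_fun _ _); apply/funext => x; rewrite /fubini_F.
  by apply: eq_integral => y _; rewrite !funenegE.
Qed.

Lemma measurable_section1 (P : R * R -> R) x : measurable_fun setT P ->
  measurable_fun setT (fun y => P (x, y)).
Proof. by move=> mP; apply: (measurableT_comp mP); exact: measurable_pair1. Qed.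

Lemma measurable_section2 (P : R * R -> R) y : measurable_fun setT P ->
  measurable_fun setT (fun x => P (x, y)).
Proof. by move=> mP; apply: (measurableT_comp mP); exact: measurable_pair2. Qed.

Lemma intgMb f (m : R -> R) B : measurable_fun setT m -> (forall x, `|m x| <= B) ->
  intg f -> intg (fun x => f x * m x).
Proof.
move=> mm mB fi; have mf := intg_meas fi.
apply: intg_le (intgZ B fi); first exact: measurable_funM.
move=> x; rewrite !normrM mulrC ler_wpM2r//.
by apply: (le_trans (mB x)); exact: ler_norm.
Qed.

(** The integrand on the plane is dominated by B |G(x)| |v(y)|, so Fubini's theorem applies. In the
    applications the bounded kernel is either [cas] of a product or a box. *)
Lemma Rint_swap (G v : R -> R) (P : R * R -> R) B :
  intg G -> intg v -> measurable_fun setT P -> (forall z, `|P z| <= B) ->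
  \int[mu]_x (G x * \int[mu]_y (v y * P (x, y))) =
  \int[mu]_y (v y * \int[mu]_x (G x * P (x, y))).
Proof.
move=> Gi vi mP PB; have mG := intg_meas Gi; have mv := intg_meas vi.
have B0 : 0 <= B by apply: le_trans (PB (0, 0)).
pose h (z : R * R) := G z.1 * v z.2 * P z.
have mh : measurable_fun setT h.
  apply: measurable_funM => //; apply: measurable_funM.
    exact: (measurableT_comp mG).
  exact: (measurableT_comp mv).
have vP x : intg (fun y => v y * P (x, y)).
  by apply: (intgMb _ (fun y => PB (x, y))) => //; exact: measurable_section1.
have GP y : intg (fun x => G x * P (x, y)).
  by apply: (intgMb _ (fun x => PB (x, y))) => //; exact: measurable_section2.
have hi : (mu \x mu)%E.-integrable setT (EFin \o h).
  apply/integrable12ltyP; first exact/measurable_EFinP.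
  pose K := B * \int[mu]_y `|v y|.
  apply: (@le_lt_trans _ _ (\int[mu]_x (K * `|G x|)%:E)%E).
    apply: ge0_le_integral => //.
    - by move=> x _; apply: integral_ge0 => y _.
    - have mah : measurable_fun setT (abse \o (EFin \o h))%E.
        by apply: measurableT_comp => //; exact/measurable_EFinP.
      exact: (@measurable_fun_fubini_tonelli_F _ _ _ _ R mu _ mah (fun x => abse_ge0 _)).
    - apply/measurable_EFinP; apply: measurable_funM => //.
      exact: measurableT_comp.
    - move=> x _.
      have hx : intg (fun y => `|h (x, y)|).
        apply: intg_abs; apply: intg_eq (intgZ (G x) (vP x)) => y.
        by rewrite /h /= mulrA.
      rewrite [leLHS](_ : _ = (\int[mu]_y `|h (x, y)|)%:E); last first.
        by rewrite -intE.
      rewrite lee_fin /K mulrC mulrA -RintZ; last exact: intg_abs.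
      apply: Rint_le => //; first by apply: intgZ; exact: intg_abs.
      by move=> y; rewrite /h /= !normrM -!mulrA ler_wpM2l// mulrC ler_wpM2r// .
  by rewrite intE ?ltry//; apply: intgZ; exact: intg_abs.
have := Fubini hi; rewrite /h /=.
under eq_integral do under eq_integral do rewrite -mulrA.
under eq_integral => x _.
  rewrite intE; last exact: intgZ.
  rewrite RintZ//; over.
under [in X in _ = X -> _]eq_integral => y _.
  under eq_integral do rewrite (mulrC _ (v y)) -mulrA.
  rewrite intE; last by apply: intgZ.
  rewrite RintZ//; over.
by rewrite /Rintegral => ->.
Qed.

End product.

(** * Calculus on the whole line *)

Section line.
Context {R : realType}.
Notation mu := (@lebesgue_measure R).
Implicit Types (f g h : R -> R).

Definition der f f' := forall x : R, is_derive x (1 : R) f (f' x).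

Lemma der_cont f f' : der f f' -> continuous f.
Proof.
move=> fd x; apply: differentiable_continuous; apply/derivable1_diffP.
by case: (fd x).
Qed.

Lemma dct_real (F : nat -> R -> R) f g :
  (forall n, measurable_fun setT (F n)) -> measurable_fun setT f -> intg g ->
  (forall n x, `|F n x| <= g x) ->
  {ae mu, forall x, F ^~ x @ \oo --> f x} ->
  [/\ (forall n, intg (F n)), intg f &
      \int[mu]_x F n x @[n --> \oo] --> \int[mu]_x f x].
Proof.
move=> mF mf gi Fg Ff.
have Fi n : intg (F n).
  by apply: intg_le gi => // x; apply: le_trans (Fg n x) (ler_norm _).
have [] := @dominated_convergence _ _ _ mu setT measurableT
  (fun n x => (F n x)%:E) (EFin \o f) (EFin \o g) _ _ _ gi _.
- by move=> n; apply/measurable_EFinP; exact: mF.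
- by apply/measurable_EFinP; exact: mf.
- by apply: ae_imp Ff => x Fx _; apply: cvg_EFin => //; exact: nearW.
- by apply: aeW => x n _; rewrite /= lee_fin.
move=> fi _ c; split => //.
move: c; rewrite -[X in _ --> X]/(\int[mu]_x (f x)%:E)%E intE//.
have -> : (fun n => \int[mu]_x (F n x)%:E)%E = EFin \o (fun n => \int[mu]_x F n x).
  by apply/funext => n /=; rewrite intE.
by move=> /fine_cvgP[].
Qed.

(** A real valued indicator of the closed interval: multiplication by it turns integrals over
    intervals into integrals over the line, where the rules above apply. *)
Definition ind (a b x : R) : R := \1_(`[a, b]%classic : set R) x.

Lemma indE (a b x : R) : ind a b x = (a <= x <= b)%R%:R.
Proof. by rewrite /ind indicE mem_setE in_itv. Qed.

Lemma measurable_ind a b : measurable_fun setT (ind a b).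
Proof. exact: measurable_indic. Qed.

Lemma ind_norm a b x : `|ind a b x| <= 1.
Proof. by rewrite indE; case: andP; rewrite ?normr1 ?normr0. Qed.

Lemma Rint_itv a b f : \int[mu]_(x in `[a, b]) f x = \int[mu]_x (f x * ind a b x).
Proof.
rewrite Rintegral_mkcond; apply: eq_Rintegral => x _.
rewrite patchE indE mem_setE in_itv /=.
by case: (a <= x <= b); rewrite ?mulr1 ?mulr0.
Qed.

Lemma intg_ind a b : intg (ind a b).
Proof.
exact: integrable_indic_itv.
Qed.

Lemma Rint_ind a b : a <= b -> \int[mu]_x ind a b x = b - a.
Proof.
move=> ab; have := Rint_itv a b (cst 1); rewrite Rintegral_cst//= mul1r.
rewrite lebesgue_measure_itv /= lte_fin => h.
transitivity (\int[mu]_x (1 * ind a b x)).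
  by apply: eq_Rintegral => x _; rewrite mul1r.
rewrite -h; case: ltP => // ba /=.
by have -> : a = b; [apply/eqP; rewrite eq_le ab ba|rewrite subrr].
Qed.

Lemma intgM_ind a b f : intg f -> intg (fun x => f x * ind a b x).
Proof. apply: intgMb (ind_norm a b); exact: measurable_ind. Qed.

Lemma cont_meas f : continuous f -> measurable_fun setT f.
Proof. exact: continuous_measurable_fun. Qed.

Lemma cont_intg_ind a b f : continuous f -> intg (fun x => f x * ind a b x).
Proof.
move=> cf.
have : mu.-integrable `[a, b] (EFin \o f).
  apply: continuous_compact_integrable; first exact: segment_compact.
  exact: continuous_subspaceT.
rewrite integrable_mkcond//.
apply: eq_integrable => // x _; rewrite /= restrict_EFin /= patchE indE mem_setE in_itv /=.
by case: (a <= x <= b); rewrite ?mulr1 ?mulr0.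
Qed.

Lemma ftc f f' a b : a <= b -> der f f' ->
  continuous f' -> \int[mu]_x (f' x * ind a b x) = f b - f a.
Proof.
rewrite le_eqVlt => /predU1P[<- _ _|ab fd cf'].
  rewrite subrr -Rint_itv set_itv1 Rintegral_set1//.
have fc := der_cont fd.
rewrite -Rint_itv; apply: EFin_inj; rewrite /Rintegral.
rewrite (continuous_FTC2 ab (F := f)) ?EFinB//.
- exact: continuous_subspaceT.
- split.
  + by move=> x _; case: (fd x).
  + by apply: cvg_at_right_filter; exact: fc.
  + by apply: cvg_at_left_filter; exact: fc.
- by move=> x _; rewrite derive1E; case: (fd x).
Qed.

Lemma Rint_tail f : intg f -> \int[mu]_x (f x * ind n%:R (n%:R + 1) x) @[n --> \oo] --> 0.
Proof.
move=> fi; have mf := intg_meas fi.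
have -> : 0 = \int[mu]_x (0 : R) by rewrite Rintegral_cst// mul0r.
have [] := @dct_real (fun n x => f x * ind n%:R (n%:R + 1) x) (cst 0) (fun x => `|f x|) _ _ (intg_abs fi) _ _.
- by move=> n; apply: measurable_funM => //; exact: measurable_ind.
- exact: measurable_cst.
- by move=> n x; rewrite normrM ler_piMr// ind_norm.
- apply: aeW => x; apply: cvg_near_cst.
  exists (Num.truncn `|x|).+1 => // n /= xn; rewrite indE.
  have : x < n%:R.
    apply: le_lt_trans (ler_norm x) _; apply: lt_le_trans (_ : _ <= n%:R).
      exact: truncnS_gt.
    by rewrite ler_nat.
  by case: leP => //; rewrite mulr0.
- by [].
Qed.

(** For y in [N, N + 1], f(N) differs from f(y) by at most the integral of |f'| over that interval.
    Averaging over y bounds |f(N)| by the integral of |f| + |f'| over [N, N + 1], which tends to 0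
    for an integrable function. *)
Lemma vanish_infty f f' : der f f' -> continuous f' ->
  intg f -> intg f' -> f n%:R @[n --> \oo] --> 0.
Proof.
move=> fd cf' fi f'i.
have fc := der_cont fd.
pose h x := `|f x| + `|f' x|.
have hi : intg h by apply: intgD; exact: intg_abs.
apply/cvgr0Pnorm_le => e e0.
have /cvgr0Pnorm_le/(_ e e0) := Rint_tail hi; apply: filterS => n.
rewrite ger0_norm; last first.
  by apply: Rint_ge0 => x; rewrite mulr_ge0 ?addr_ge0// indE.
apply: le_trans; set N := n%:R.
pose K := \int[mu]_x (`|f' x| * ind N (N + 1) x).
have fK y : N <= y <= N + 1 -> `|f N| <= `|f y| + K.
  move=> /andP[Ny yN]; have E := ftc Ny fd cf'.
  rewrite (_ : f N = f y - (f y - f N)); last by ring.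
  apply: (le_trans (ler_normB _ _)); rewrite lerD2l -E.
  apply: (le_trans (Rint_abs _)); first exact: intgM_ind.
  apply: Rint_le; [by apply: intg_abs; exact: intgM_ind|by apply: intgM_ind; exact: intg_abs|].
  move=> x; rewrite normrM ler_wpM2l// !indE.
  case: andP => [[h1 h2]|]; rewrite ?normr0//.
  by rewrite h1 (le_trans h2 yN) normr1.
have N1 : N <= N + 1 by lra.
have E1 : \int[mu]_x ind N (N + 1) x = 1 by rewrite Rint_ind//; ring.
apply: (@le_trans _ _ (\int[mu]_x (`|f N| * ind N (N + 1) x))).
  by rewrite RintZ ?E1 ?mulr1//; exact: intg_ind.
apply: (@le_trans _ _ (\int[mu]_x (`|f x| * ind N (N + 1) x + K * ind N (N + 1) x))).
  apply: Rint_le; first by apply: intgZ; exact: intg_ind.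
    apply: intgD; first by apply: intgM_ind; exact: intg_abs.
    by apply: intgZ; exact: intg_ind.
  move=> x; rewrite -mulrDl indE; case: (boolP (_ <= _ <= _)); last by rewrite !mulr0.
  by move=> /fK; rewrite !mulr1.
rewrite RintD; [|by apply: intgM_ind; exact: intg_abs|by apply: intgZ; exact: intg_ind].
rewrite RintZ ?E1 ?mulr1; last exact: intg_ind.
rewrite /K -RintD; [|by apply: intgM_ind; exact: intg_abs..].
by apply: Rint_le; [apply: intgD; apply: intgM_ind; exact: intg_abs|exact: intgM_ind|move=> x; rewrite /h mulrDl].
Qed.

Lemma is_derive_refl f f' : der f f' ->
  der (fun y => f (- y)) (fun x => - f' (- x)).
Proof.
move=> fd x; have fdx := fd (- x).
have H := is_derive1_comp fdx (is_deriveN (is_derive_id x (1 : R))).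
have <- : f' (- x) * (- 1) = - f' (- x) by rewrite mulrN1.
exact: H.
Qed.

Lemma vanish_inftyN f f' : der f f' -> continuous f' ->
  intg f -> intg f' -> f (- n%:R) @[n --> \oo] --> 0.
Proof.
move=> fd cf' fi f'i.
apply: (@vanish_infty (fun x => f (- x)) (fun x => - f' (- x))).
- exact: is_derive_refl.
- move=> x; apply: cvgN; apply: (cvg_comp -%R f') (cf' _).
  exact: opp_continuous.
- exact: intg_refl.
- apply: intgN; exact: (intg_refl f'i).
Qed.

(** The source of integration by parts on the line: the increments of f over [-n, n] tend to 0
    because f and f' are both integrable. *)
Lemma Rint_deriv0 f f' : der f f' -> continuous f' ->
  intg f -> intg f' -> \int[mu]_x f' x = 0.
Proof.
move=> fd cf' fi f'i; have mf' := intg_meas f'i.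
have [] := @dct_real (fun n x => f' x * ind (- n%:R) n%:R x) f' (fun x => `|f' x|) _ _ (intg_abs f'i) _ _.
- by move=> n; apply: measurable_funM => //; exact: measurable_ind.
- exact: mf'.
- by move=> n x; rewrite normrM ler_piMr// ind_norm.
- apply: aeW => x; apply: cvg_near_cst.
  exists (Num.truncn `|x|).+1 => // n /= xn; rewrite indE.
  have : `|x| <= n%:R.
    by apply: ltW; apply: lt_le_trans (truncnS_gt _) _; rewrite ler_nat.
  by rewrite ler_norml => ->; rewrite mulr1.
move=> _ _ c; have c0 : (fun n => f n%:R - f (- n%:R)) @ \oo --> 0 - 0.
  apply: cvgB; first exact: (vanish_infty fd cf').
  exact: (vanish_inftyN fd cf').
move: c; rewrite (_ : (fun n => _) = fun n => f n%:R - f (- n%:R)); last first.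
  by apply/funext => n; apply: ftc fd cf'; apply: (@le_trans _ _ 0); rewrite ?oppr_le0.
by rewrite subrr in c0 => c; apply: cvg_unique c c0.
Qed.

End line.

(** * Plancherel theorem for the Hartley transform *)

Section kernel.
Context {R : realType}.
Notation mu := (@lebesgue_measure R).
Implicit Types (f g v : R -> R).

(** The integral over [-n, n] is an increment of [F], hence at most 2 B. The bound is passed to the
    limit by the L2 form of Fatou's lemma, applied to the square root of [f]. *)
Lemma intg_deriv_ge0 f F B : der F f -> continuous f -> (forall x, 0 <= f x) ->
  (forall x, `|F x| <= B) -> intg f.
Proof.
move=> Fd cf f0 FB; have mf := cont_meas cf.
have ms : measurable_fun setT (fun x => Num.sqrt (f x)).
  apply: measurableT_comp => //; apply: continuous_measurable_fun.
  exact: sqrt_continuous.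
pose G n x := Num.sqrt (f x) * ind (- n%:R) n%:R x.
have G2 n x : G n x ^+ 2 = f x * ind (- n%:R) n%:R x.
  by rewrite /G exprMn sqr_sqrtr// !indE; case: (_ <= _ <= _); rewrite ?expr1n ?expr0n.
have Gi n : sqint (G n).
  split; first by apply: measurable_funM => //; exact: measurable_ind.
  by apply: intg_eq (cont_intg_ind (- n%:R) n%:R cf) => x; rewrite G2.
have [[_ si] _] : sqint (fun x => Num.sqrt (f x)) /\ nsq (fun x => Num.sqrt (f x)) <= 2 * B.
  apply: (@fatou_nsq _ G) => // [|n].
    apply: aeW => x; apply: cvg_near_cst.
    exists (Num.truncn `|x|).+1 => // n /= xn; rewrite /G indE.
    have : `|x| <= n%:R by apply: ltW; apply: lt_le_trans (truncnS_gt _) _; rewrite ler_nat.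
    by rewrite ler_norml => ->; rewrite mulr1.
  have -> : nsq (G n) = \int[mu]_x (f x * ind (- n%:R) n%:R x).
    by rewrite nsqE; apply: eq_Rintegral => x _; exact: G2.
  have nn : - n%:R <= n%:R :> R by apply: (@le_trans _ _ 0); rewrite ?oppr_le0.
  rewrite (ftc nn Fd cf).
  have := FB n%:R; have := FB (- n%:R); rewrite !ler_norml; lra.
by apply: intg_eq si => x; rewrite sqr_sqrtr.
Qed.

Definition cas (x : R) := cos x + sin x.

Lemma cas_cont : continuous cas.
Proof. by move=> x; apply: cvgD; [exact: continuous_cos|exact: continuous_sin]. Qed.

Lemma cas_le2 x : `|cas x| <= 2.
Proof.
apply: (le_trans (ler_normD _ _)).
by have := cos_max x; have := sin_max x; lra.
Qed.

(** Against an even weight in x, with a and b proportional to x, the sine term integrates to 0 and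
    only the cosine of the difference remains. *)
Lemma casM a b : cas a * cas b = cos (a - b) + sin (a + b).
Proof. rewrite /cas cosB sinD; ring. Qed.

(** The derivative of the arctangent: an integrable majorant for [sinc_sq], and later a multiplier
    that tames a factor [xi]. *)
Definition lorentz (x : R) := (1 + x ^+ 2)^-1.

Lemma lorentz_gt0 x : 0 < lorentz x.
Proof. by rewrite invr_gt0 ltr_pwDl// sqr_ge0. Qed.

Lemma abs_sin_le (x : R) : `|sin x| <= `|x|.
Proof.
wlog x0 : x / 0 <= x.
  move=> H; case: (leP 0 x) => [/H//|/ltW]; rewrite -oppr_ge0 => /H.
  by rewrite sinN !normrN.
move: x0; rewrite le_eqVlt => /predU1P[<-|x0]; first by rewrite sin0.
have [|y _] := @MVT R sin cos 0 x x0 (fun y _ => is_derive_sin y).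
  by apply: continuous_subspaceT; exact: continuous_sin.
rewrite sin0 !subr0 => ->; rewrite normrM ler_piMl//; exact: cos_max.
Qed.

Lemma measurable_inv : measurable_fun setT (@GRing.inv R).
Proof.
have -> : setT = [set~ (0 : R)] `|` [set 0].
  by rewrite setUC setUv.
apply/measurable_funU => //; first exact: measurableC.
split; last exact: measurable_fun_set1.
apply: open_continuous_measurable_fun; first by apply: closed_openC; exact: closed_eq.
by move=> x; rewrite inE => /eqP x0; exact: inv_continuous.
Qed.

(* [sinc_sq z x] vanishes at [x = 0], where division gives 0. *)
Definition sinc_sq (z x : R) := (sin (z * x) / x) ^+ 2.

Lemma sinc_sq_ge0 z x : 0 <= sinc_sq z x. Proof. exact: sqr_ge0. Qed.

Lemma sinc_sq_le z x : sinc_sq z x <= z ^+ 2.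
Proof.
have [->|x0] := eqVneq x 0; first by rewrite /sinc_sq invr0 mulr0 expr0n sqr_ge0.
rewrite /sinc_sq -(real_normK (num_real (_ / _))) -[leRHS]real_normK ?num_real//.
rewrite lerXn2r ?nnegrE// normrM normfV ler_pdivrMr ?normr_gt0//.
by rewrite -normrM abs_sin_le.
Qed.

Lemma sinc_sq_lorentz z x : sinc_sq z x <= (z ^+ 2 + 1) * lorentz x.
Proof.
rewrite /lorentz ler_pdivlMr ?ltr_pwDl ?sqr_ge0// mulrDr mulr1 lerD ?sinc_sq_le//.
have [->|x0] := eqVneq x 0; first by rewrite expr0n mulr0.
rewrite /sinc_sq -exprMn divfK// -(real_normK (num_real _)) -(expr1n _ 2).
Qed.

Lemma sinc_sq_meas z : measurable_fun setT (sinc_sq z).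
Proof.
apply: measurable_funX; apply: measurable_funM.
  apply: measurableT_comp; last exact: measurable_funM.
  apply: continuous_measurable_fun; exact: continuous_sin.
exact: measurable_inv.
Qed.

Lemma intg_lorentz : intg lorentz.
Proof.
apply: (@intg_deriv_ge0 _ atan pi).
- by move=> x; exact: is_derive1_atan.
- move=> x; apply: cvgV; first by rewrite gt_eqF// ltr_pwDl ?sqr_ge0.
  by apply: cvgD; [exact: cvg_cst|exact: exprn_continuous].
- by move=> x; exact/ltW/lorentz_gt0.
- move=> x; have := atan_gtNpi2 x; have := atan_ltpi2 x; have := pi_gt0 R.
  rewrite ler_norml; lra.
Qed.

Lemma intg_sinc_sq z : intg (sinc_sq z).
Proof.
apply: (intg_le _ _ (intgZ (z ^+ 2 + 1) intg_lorentz)); first exact: sinc_sq_meas.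
by move=> x; rewrite ger0_norm ?sinc_sq_ge0// (le_trans (sinc_sq_lorentz _ _))// ler_norm.
Qed.

(** This number is pi. It is carried along as an integral; its positivity is what makes the Hartley
    transform invertible below. *)
Definition c0 := \int[mu]_x sinc_sq 1 x.

Lemma Rint_sinc_sq z : \int[mu]_x sinc_sq z x = `|z| * c0.
Proof.
wlog z0 : z / 0 < z.
  move=> H; case: (ltgtP 0 z) => [/H//|z0|<-].
    rewrite -normrN -H ?oppr_gt0//; apply: eq_Rintegral => x _.
    by rewrite /sinc_sq mulNr sinN mulNr sqrrN.
  rewrite normr0 mul0r -[RHS]Rint0; apply: Rint_eq => x.
  by rewrite /sinc_sq mul0r sin0 mul0r expr0n.
rewrite gtr0_norm// /c0 (Rint_affine 0 z0 (intg_sinc_sq 1)) mulrA -expr2.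
rewrite -RintZ; last exact: (intg_affine 0 z0 (intg_sinc_sq 1)).
apply: eq_Rintegral => x _; rewrite /sinc_sq addr0 mul1r -exprMn; congr (_ ^+ 2).
have [->|x0] := eqVneq x 0; first by rewrite !(mulr0, invr0).
by field; rewrite x0 gt_eqF.
Qed.

Lemma c0_gt0 : 0 < c0.
Proof.
rewrite lt_def Rint_ge0 ?andbT => [|x]; last exact: sinc_sq_ge0.
apply/eqP => c00.
have p0 := pi_gt0 R.
have le_pi : pi / 2 <= pi :> R by lra.
(* On [pi / 2, 3 pi / 4] the squared sine is at least 1/2 and x is at most pi, which bounds the
   integrand below by a positive constant. *)
have : \int[mu]_x (pi^-1 ^+ 2 * 2^-1 * ind (pi / 2) (pi / 2 + pi / 4) x) <= c0.
  apply: Rint_le; [by apply: intgZ; exact: intg_ind|exact: intg_sinc_sq|].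
  move=> x; rewrite indE; case: (boolP (_ <= _ <= _)) => [/andP[x1 x2]|_]; last first.
    by rewrite mulr0 sinc_sq_ge0.
  have x0 : 0 < x by lra.
  have x2p : x <= pi by lra.
  rewrite mulr1 /sinc_sq mul1r expr_div_n mulrC; apply: ler_pM.
  - by rewrite invr_ge0.
  - by rewrite exprn_ge0// invr_ge0 ltW.
  - rewrite -[sin x]opprK; suff : 2^-1 <= sin x ^+ 2 by rewrite opprK.
    have -> : sin x = cos (x - pi / 2).
      by rewrite cosB cos_pihalf sin_pihalf; ring.
    have : 1 / 2 <= cos (x - pi / 2) ^+ 2.
      rewrite -[X in _ <= X]/(_).
      have -> : cos (x - pi / 2) ^+ 2 = (1 + cos ((x - pi / 2) *+ 2)) / 2.
        by rewrite cos_mulr2n; field.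
      have : 0 <= cos ((x - pi / 2) *+ 2).
        by apply: cos_ge0_pihalf; apply/andP; split; lra.
      lra.
    by rewrite div1r.
  - by rewrite -exprVn lerXn2r ?nnegrE ?invr_ge0 ?lef_pV2 ?posrE// ltW.
rewrite c00 RintZ; last exact: intg_ind.
rewrite Rint_ind; last lra.
have : 0 < pi^-1 ^+ 2 * 2^-1 :> R by rewrite mulr_gt0 ?exprn_gt0 ?invr_gt0.
nra.
Qed.

Lemma Rint_odd f : intg f -> (forall x, f (- x) = - f x) -> \int[mu]_x f x = 0.
Proof.
move=> fi fo; have : \int[mu]_x f x = - \int[mu]_x f x.
  rewrite {1}Rint_refl// -mulN1r -RintZ//.
  by apply: eq_Rintegral => x _; rewrite fo mulN1r.
lra.
Qed.

(** Length of the intersection of two intervals of half-length [h] whose centres differ by [z]. *)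
Definition tent (h z : R) := Num.max (2 * h - `|z|) 0.

Lemma sin_meas z : measurable_fun setT (fun x : R => sin (z * x)).
Proof.
apply: measurableT_comp; last exact: measurable_funM.
by apply: continuous_measurable_fun; exact: continuous_sin.
Qed.

Lemma cos_meas z : measurable_fun setT (fun x : R => cos (z * x)).
Proof.
apply: measurableT_comp; last exact: measurable_funM.
by apply: continuous_measurable_fun; exact: continuous_cos.
Qed.

Lemma sin_sq (x : R) : sin x ^+ 2 = (1 - cos (x + x)) / 2.
Proof. by rewrite cosD -!expr2 cos2sin2; field. Qed.

(** Addition formulas write the integrand as a combination of [sinc_sq] at z/2 + h, z/2 - h and z/2.
    The integrals are [c0] times absolute values, and |z/2 + h| + |z/2 - h| - |z| is the tent. *)
Lemma Rint_sinc_sq_cos h z : 0 < h ->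
  \int[mu]_x (sinc_sq h x * cos (z * x)) = c0 / 2 * tent h z.
Proof.
move=> h0.
have E x : sinc_sq h x * cos (z * x) =
    2^-1 * sinc_sq (z / 2 + h) x + 2^-1 * sinc_sq (z / 2 - h) x - sinc_sq (z / 2) x.
  rewrite /sinc_sq !expr_div_n !sin_sq -!mulrDl.
  have -> : (z / 2 + h + (z / 2 + h)) * x = z * x + (h + h) * x by field.
  have -> : (z / 2 - h + (z / 2 - h)) * x = z * x - (h + h) * x by field.
  have -> : (z + z) / 2 * x = z * x by field.
  rewrite cosD cosB.
  have [->|x0] := eqVneq x 0; first by rewrite expr0n invr0 !mulr0 mul0r; lra.
  by field.
under eq_Rintegral do rewrite E.
have k1 := intgZ 2^-1 (intg_sinc_sq (z / 2 + h)).
have k2 := intgZ 2^-1 (intg_sinc_sq (z / 2 - h)).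
rewrite RintB ?RintD ?RintZ ?Rint_sinc_sq; [|exact: intg_sinc_sq..|by []|by []|exact: intgD|exact: intg_sinc_sq].
rewrite /tent /Num.max; have c := c0_gt0.
case: ifPn; case: (ler0P (z / 2 + h)) => ?; case: (ler0P (z / 2 - h)) => ?;
  case: (ler0P (z / 2)) => ?; case: (ler0P z) => ? ?; try lra; nra.
Qed.

Lemma Rint_sinc_sq_cas h a b : 0 < h ->
  \int[mu]_x (sinc_sq h x * cas (x * a) * cas (x * b)) = c0 / 2 * tent h (a - b).
Proof.
move=> h0; rewrite -Rint_sinc_sq_cos//.
have ci : intg (fun x => sinc_sq h x * cos ((a - b) * x)).
  by apply: (intgMb (cos_meas _) (fun x => cos_max _)); exact: intg_sinc_sq.
have si : intg (fun x => sinc_sq h x * sin ((a + b) * x)).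
  by apply: (intgMb (sin_meas _) (fun x => sin_max _)); exact: intg_sinc_sq.
rewrite (@Rint_eq _ _ (fun x => sinc_sq h x * cos ((a - b) * x) + sinc_sq h x * sin ((a + b) * x))).
  rewrite RintD// [X in _ + X]Rint_odd ?addr0// => x.
  by rewrite /sinc_sq !mulrN !sinN invrN mulrNN mulrN.
by move=> x; rewrite -mulrA casM mulrDr; congr (_ * cos _ + _ * sin _); ring.
Qed.

(** The cutoff to [-L, L] equals 1 wherever both boxes are nonzero. It supplies the integrable
    weight in [s] that the exchange of integrals asks for. *)
Lemma Rint_box h a b L : 0 < h -> `|a| + h <= L -> `|b| + h <= L ->
  \int[mu]_s (ind (- L) L s * ind (s - h) (s + h) a * ind (s - h) (s + h) b) =
  tent h (a - b).
Proof.
move=> h0 aL bL.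
rewrite (@Rint_eq _ _ (fun s => ind (Num.max a b - h) (Num.min a b + h) s)).
  have [ab|ab] := lerP (Num.max a b - h) (Num.min a b + h).
    rewrite Rint_ind// /tent; move: ab.
    rewrite /Num.max /Num.min; case: (ltP a b) => ? ?; case: (ler0P (a - b)) => ?; case: ltP => ?; lra.
  rewrite (@Rint_eq _ _ (fun=> 0)) ?Rint0; last first.
    by move=> s; rewrite indE; case: (boolP (_ <= _ <= _)) => // /andP[]; lra.
  rewrite /tent; move: ab.
  by rewrite /Num.max /Num.min; case: (ltP a b) => ? ?; case: (ler0P (a - b)) => ?; case: ltP => ?; lra.
move=> s; rewrite !indE.
move: aL bL; rewrite -!lerBrDr !ler_norml => /andP[a1 a2] /andP[b1 b2].
rewrite -!natrM !mulnb; congr (nat_of_bool _)%:R.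
apply/idP/idP.
  move=> /andP[/andP[_ /andP[h1 h2]] /andP[h3 h4]].
  by rewrite /Num.max /Num.min; case: ltP => _; apply/andP; split; lra.
by rewrite /Num.max /Num.min; case: ltP => ab /andP[h1 h2]; repeat (apply/andP; split); lra.
Qed.

End kernel.

(** * Plancherel's identity for compactly supported functions *)

Section plancherel_compact_support.
Context {R : realType}.
Notation mu := (@lebesgue_measure R).
Implicit Types (f g v : R -> R).

Definition hartley v (xi : R) := \int[mu]_x (v x * cas (x * xi)).

(** Since [c0] is pi, this is 2 pi, the factor in Plancherel's identity for the unnormalized
    transform. *)
Definition kappa : R := 2 * c0.

Lemma kappa_gt0 : 0 < kappa.
Proof. by rewrite mulr_gt0// c0_gt0. Qed.

Lemma cas_meas2 : measurable_fun setT (fun z : R * R => cas (z.2 * z.1)).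
Proof.
apply: (@measurableT_comp _ _ _ _ _ _ cas).
  by apply: continuous_measurable_fun; exact: cas_cont.
exact: measurable_funM.
Qed.

Lemma hartley_meas v : measurable_fun setT v -> measurable_fun setT (hartley v).
Proof.
move=> mv; apply: (measurable_Rint (f := fun z => v z.2 * cas (z.2 * z.1))).
by apply: measurable_funM; [exact: measurableT_comp|exact: cas_meas2].
Qed.

Lemma cas_meas1 xi : measurable_fun setT (fun x : R => cas (x * xi)).
Proof.
apply: (@measurableT_comp _ _ _ _ _ _ cas); last exact: measurable_funM.
by apply: continuous_measurable_fun; exact: cas_cont.
Qed.

Lemma intg_cas v xi : intg v -> intg (fun x => v x * cas (x * xi)).
Proof. by apply: intgMb (fun x => cas_le2 _); exact: cas_meas1. Qed.

Lemma hartley_le v xi : intg v -> `|hartley v xi| <= 2 * \int[mu]_x `|v x|.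
Proof.
move=> vi; apply: (le_trans (Rint_abs (intg_cas xi vi))).
rewrite -RintZ; last exact: intg_abs.
apply: Rint_le; [exact/intg_abs/intg_cas|by apply/intgZ; exact: intg_abs|].
by move=> x; rewrite normrM mulrC ler_wpM2r// cas_le2.
Qed.

(** Expanding the square and exchanging integrals twice gives a bilinear form in [v] whose kernel is
    the weighted integral of P(s, y) P(s, x). With P = [cas] and with P a box these kernels are the
    same tent up to a constant, which is how the two sides of [Rint_sinc] meet. *)
Lemma Rint_sq_swap (W v : R -> R) (P : R * R -> R) B :
  intg W -> intg v -> measurable_fun setT P -> (forall z, `|P z| <= B) ->
  \int[mu]_s (W s * (\int[mu]_x (v x * P (s, x))) ^+ 2) =
  \int[mu]_y (v y * \int[mu]_x (v x * \int[mu]_s (W s * P (s, y) * P (s, x)))).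
Proof.
move=> Wi vi mP PB; have B0 : 0 <= B by apply: le_trans (PB (0, 0)).
have mP1 s := measurable_section1 s mP.
have mP2 x := measurable_section2 x mP.
pose H s := \int[mu]_x (v x * P (s, x)).
have HB s : `|H s| <= B * \int[mu]_x `|v x|.
  have i := intgMb (mP1 s) (fun y => PB (s, y)) vi.
  apply: (le_trans (Rint_abs i)).
  rewrite -RintZ; last exact: intg_abs.
  apply: Rint_le; [exact/intg_abs|by apply/intgZ; exact: intg_abs|].
  by move=> x; rewrite normrM mulrC ler_wpM2r.
have mH : measurable_fun setT H.
  apply: (measurable_Rint (f := fun z => v z.2 * P z)).
  apply: measurable_funM => //; apply: (measurableT_comp (intg_meas vi)) => //.
have WHi : intg (fun s => W s * H s) by exact: intgMb HB Wi.
transitivity (\int[mu]_s ((W s * H s) * \int[mu]_x (v x * P (s, x)))).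
  by apply: Rint_eq => s; rewrite -/(H s); ring.
rewrite (Rint_swap WHi vi mP PB); apply: Rint_eq => y; congr (_ * _).
rewrite -(Rint_swap (intgMb (mP2 y) (fun s => PB (s, y)) Wi) vi mP PB).
by apply: Rint_eq => s; rewrite -/(H s); ring.
Qed.

Definition box (h s x : R) := ind (s - h) (s + h) x.

Lemma boxE h s x : box h s x = (`|x - s| <= h)%R%:R.
Proof.
rewrite /box indE ler_norml; congr (nat_of_bool _)%:R.
by apply/idP/idP => /andP[? ?]; apply/andP; split; lra.
Qed.

Lemma box_sym h s x : box h s x = box h x s.
Proof. by rewrite !boxE distrC. Qed.

Lemma box_norm h s x : `|box h s x| <= 1.
Proof. exact: ind_norm. Qed.

Lemma box_meas2 h : measurable_fun setT (fun z : R * R => box h z.1 z.2).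
Proof.
have -> : (fun z : R * R => box h z.1 z.2) =
    (fun z => \1_(`[-h, h]%classic : set R) (z.2 - z.1)).
  apply/funext => z; rewrite boxE indicE mem_setE in_itv /= ler_norml //.
apply: (@measurableT_comp _ _ _ _ _ _ (\1_(`[-h, h]%classic : set R) : R -> R)).
  exact: measurable_indic.
exact: measurable_funB.
Qed.

Definition avg h v s := (2 * h)^-1 * \int[mu]_x (v x * box h s x).

Lemma avg_meas h v : measurable_fun setT v -> measurable_fun setT (avg h v).
Proof.
move=> mv; apply: measurable_funM => //.
apply: (measurable_Rint (f := fun z => v z.2 * box h z.1 z.2)).
by apply: measurable_funM; [exact: measurableT_comp|exact: box_meas2].
Qed.

Lemma avg_supp h v N s : 0 < h -> (forall x, N < `|x| -> v x = 0) ->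
  N + h < `|s| -> avg h v s = 0.
Proof.
move=> h0 vN sN; rewrite /avg (@Rint_eq _ _ (fun=> 0)) ?Rint0 ?mulr0// => x.
rewrite boxE; case: (ltP N `|x|) => [/vN ->|xN]; first by rewrite mul0r.
case: (leP `|x - s| h) => [xs|]; last by rewrite mulr0.
have := ler_distD x s 0; rewrite !subr0 (distrC s x); lra.
Qed.

(** Cauchy-Schwarz against the box, of integral 2 h, bounds the square of the average by the average
    of the square; exchanging integrals then gives the norm. The cutoff at [L], outside which the
    average vanishes, provides an integrable weight in [s]. *)
Lemma nsq_avg_le h v N : 0 < h -> sqint v -> intg v ->
  (forall x, N < `|x| -> v x = 0) ->
  sqint (avg h v) /\ nsq (avg h v) <= nsq v.
Proof.
move=> h0 vi v1 vN.
pose L := `|N| + h + 1.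
have L0 : - L <= L by have := normr_ge0 N; rewrite /L; lra.
have NL : N + h < L by have := ler_norm N; rewrite /L; lra.
have bi s : intg (box h s) by exact: intg_ind.
have bI s : \int[mu]_x box h s x = 2 * h by rewrite /box Rint_ind; lra.
have bS s x : box h s x ^+ 2 = box h s x.
  by rewrite boxE; case: (_ <= _); rewrite ?expr1n ?expr0n.
have sb s : sqint (box h s).
  split; first exact: measurable_ind.
  by apply: intg_eq (bi s) => x; rewrite bS.
have vb s : sqint (fun x => v x * box h s x).
  under eq_fun do rewrite mulrC.
  by apply: (sqintMb _ (box_norm h s)) => //; exact: measurable_ind.
have pt s : avg h v s ^+ 2 <= (2 * h)^-1 * (ind (- L) L s * \int[mu]_x (v x ^+ 2 * box h s x)).
  have [sL|sL] := leP `|s| L; last first.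
    rewrite (avg_supp h0 vN) ?expr0n; last by apply: lt_trans sL.
    rewrite !mulr_ge0 ?invr_ge0 ?mulr_ge0 ?indE//; first exact: ltW.
    by apply: Rint_ge0 => x; rewrite mulr_ge0 ?sqr_ge0// boxE.
  rewrite indE -ler_norml sL mul1r /avg exprMn expr2 -mulrA ler_wpM2l ?invr_ge0 ?mulr_ge0//; first lra.
  rewrite ler_pdivrMl; last lra.
  have := cauchy_schwarz (vb s) (sb s); rewrite !nsqE.
  under [X in _ <= _ * X -> _]eq_Rintegral do rewrite bS.
  rewrite bI (_ : ip _ _ = \int[mu]_x (v x * box h s x)); last first.
    by apply: Rint_eq => x; rewrite -mulrA -expr2 bS.
  rewrite [X in _ <= X * _ -> _](@Rint_eq _ _ (fun x => v x ^+ 2 * box h s x)).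
    by rewrite mulrC.
  by move=> x; rewrite exprMn bS.
have [mv v2] := vi.
have Gi : intg (fun s => ind (- L) L s * \int[mu]_x (v x ^+ 2 * box h s x)).
  apply: (@intgMb _ _ _ (\int[mu]_x (v x ^+ 2))); last exact: intg_ind.
    apply: (measurable_Rint (f := fun z => v z.2 ^+ 2 * box h z.1 z.2)).
    apply: measurable_funM; last exact: box_meas2.
    by apply: measurable_funX; exact: measurableT_comp.
  move=> s; have i := intgMb (measurable_ind _ _) (box_norm h s) v2.
  apply: (le_trans (Rint_abs i)); apply: Rint_le => //; first exact: intg_abs.
  by move=> x; rewrite normrM ger0_norm ?sqr_ge0// ler_piMr ?sqr_ge0// box_norm.
have Ai : sqint (avg h v).
  split; first exact: avg_meas.
  apply: (intg_le _ _ (intgZ (2 * h)^-1 Gi)).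
    by apply: measurable_funX; exact: avg_meas.
  by move=> s; rewrite ger0_norm ?sqr_ge0// (le_trans (pt s))// ler_norm.
split => //; rewrite nsqE.
apply: (le_trans (Rint_le Ai.2 (intgZ (2 * h)^-1 Gi) pt)).
rewrite RintZ// (@Rint_swap _ _ _ (fun z => box h z.1 z.2) 1 (intg_ind _ _) v2 (box_meas2 h)); last first.
  by move=> z; exact: box_norm.
rewrite ler_pdivrMl; last lra.
rewrite nsqE -RintZ//; apply: Rint_le => [||x].
- apply: (@intgMb _ _ _ (2 * h)) => //.
    apply: (measurable_Rint (f := fun z => ind (- L) L z.2 * box h z.2 z.1)).
    apply: measurable_funM; first by apply: (measurableT_comp (measurable_ind _ _)).
    under eq_fun do rewrite box_sym; exact: box_meas2.
  move=> x; rewrite ger0_norm; last first.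
    by apply: Rint_ge0 => s; rewrite mulr_ge0 ?indE ?boxE.
  rewrite -(bI x); apply: Rint_le => //; last first.
    by move=> s; rewrite box_sym ler_piMl ?boxE// indE; case: (_ <= _ <= _).
  apply: (intgMb _ (fun s => box_norm h s x)); last exact: intg_ind.
  by under eq_fun do rewrite box_sym; exact: measurable_ind.
- exact: intgZ.
- rewrite mulrC ler_wpM2r ?sqr_ge0//.
  rewrite -(bI x); apply: Rint_le => //; last first.
    by move=> s; rewrite box_sym ler_piMl ?boxE// indE; case: (_ <= _ <= _).
  apply: (intgMb _ (fun s => box_norm h s x)); last exact: intg_ind.
  by under eq_fun do rewrite box_sym; exact: measurable_ind.
Qed.

(* sinc_sq h has a tent as cosine transform, and the tent is also the
   autocorrelation of a box; letting h tend to 0 gives Plancherel's identity. *)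
Lemma Rint_sinc h v N : 0 < h -> sqint v -> intg v ->
  (forall x, N < `|x| -> v x = 0) ->
  \int[mu]_xi (sinc_sq h xi * hartley v xi ^+ 2) = c0 / 2 * (2 * h) ^+ 2 * nsq (avg h v).
Proof.
move=> h0 v2 vi vN.
have := @Rint_sq_swap (sinc_sq h) v (fun z => cas (z.2 * z.1)) 2 (intg_sinc_sq h) vi cas_meas2 (fun z => cas_le2 _).
rewrite -/(hartley v _) => ->.
pose L := `|N| + h + 1.
have NL : N + h < L by have := ler_norm N; rewrite /L; lra.
have Wi : intg (fun s => c0 / 2 * ind (- L) L s) by apply: intgZ; exact: intg_ind.
have [Ai _] := nsq_avg_le h0 v2 vi vN.
rewrite (@Rint_eq _ _ (fun y => v y * \int[mu]_x (v x * \int[mu]_s (c0 / 2 * ind (- L) L s * box h s y * box h s x)))).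
  rewrite -(@Rint_sq_swap _ v (fun z => box h z.1 z.2) 1 Wi vi (box_meas2 h)); last first.
    by move=> z; exact: box_norm.
  rewrite nsqE -RintZ; last exact: Ai.2.
  apply: Rint_eq => s.
  have [sL|sL] := leP `|s| L.
    by rewrite indE -ler_norml sL /= /avg; field; rewrite gt_eqF.
  have A0 := avg_supp h0 vN (lt_trans NL sL).
  by rewrite indE -ler_norml leNgt sL A0 /=; ring.
move=> y; have [/vN ->|yN] := ltP N `|y|; first by rewrite !mul0r.
congr (_ * _); apply: Rint_eq => x.
have [/vN ->|xN] := ltP N `|x|; first by rewrite !mul0r.
congr (_ * _); rewrite [LHS](@Rint_eq _ _ (fun s => sinc_sq h s * cas (s * y) * cas (s * x))).
  rewrite Rint_sinc_sq_cas// -(@Rint_box _ h y x L)//; try lra.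
  rewrite -RintZ; first by apply: Rint_eq => s; rewrite /box !mulrA.
  apply: (intgMb _ (fun s => box_norm h s x)).
    by under eq_fun do rewrite box_sym; exact: measurable_ind.
  apply: (intgMb _ (fun s => box_norm h s y)); last exact: intg_ind.
  by under eq_fun do rewrite box_sym; exact: measurable_ind.
by move=> s; rewrite !(mulrC s).
Qed.

Lemma der_seq f (l x : R) (u : nat -> R) : is_derive x (1 : R) f l ->
  (forall n, u n != 0) -> u n @[n --> \oo] --> 0 ->
  (u n)^-1 * (f (u n + x) - f x) @[n --> \oo] --> l.
Proof.
case => d <- u0 ul.
have ul' : u n @[n --> \oo] --> (0 : R)^'.
  move=> A /ul [N _ NA]; exists N => // n Nn; exact: NA.
have -> : (fun n => (u n)^-1 * (f (u n + x) - f x)) =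
    (fun h : R => h^-1 *: ((f \o shift x) h%:A - f x)) \o u.
  by apply/funext => n /=; rewrite -[_%:A]/(u n * 1) mulr1.
exact: (cvg_comp _ _ ul' d).
Qed.

Lemma sinc_cvg (x : R) : x != 0 ->
  sin (n.+1%:R^-1 * x) / (n.+1%:R^-1 * x) @[n --> \oo] --> (1 : R).
Proof.
move=> x0.
have -> : (fun n => sin (n.+1%:R^-1 * x) / (n.+1%:R^-1 * x)) =
    fun n => (n.+1%:R^-1 * x)^-1 * (sin (n.+1%:R^-1 * x + 0) - sin 0).
  by apply/funext => n; rewrite addr0 sin0 subr0 mulrC.
rewrite -[X in _ --> X]cos0.
apply: (@der_seq sin (cos 0) 0 (fun n => n.+1%:R^-1 * x) (is_derive_sin 0)).
  by move=> n; rewrite mulf_neq0// invr_eq0 pnatr_eq0.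
by rewrite -(mul0r x); apply: cvgM; [exact: cvg_harmonic|exact: cvg_cst].
Qed.

(** Lebesgue's differentiation theorem along centred intervals. *)
Lemma avg_cvg v : intg v ->
  {ae mu, forall x, avg n.+1%:R^-1 v x @[n --> \oo] --> v x}.
Proof.
move=> vi.
have key (x e : R) : 0 < e -> x - e < x + e by lra.
have loc : locally_integrable setT v by apply: open_integrable_locally => //; exact: openT.
have sh (x : R) : nicely_shrinking x (fun n => `[x - n.+1%:R^-1, x + n.+1%:R^-1]%classic).
  split; first by move=> n; exact: measurable_itv.
  (* Each interval lies in the ball whose radius is twice its half-length, and that ball has twice
     its measure. *)
  exists (2, fun n => (2 * n.+1%:R^-1)%:pos); split => //=.
  - by rewrite -(mulr0 2); apply: cvgM; [exact: cvg_cst|exact: cvg_harmonic].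
  - move=> n y /=; rewrite in_itv /= => /andP[y1 y2]; rewrite /ball /=.
    have n0 : 0 < n.+1%:R^-1 :> R by rewrite invr_gt0.
    have key1 (e : R) : 0 < e -> x - e <= y -> y <= x + e -> `|x - y| < 2 * e.
      by move=> ? ? ?; rewrite ltr_distl; apply/andP; split; lra.
    exact: key1.
  - move=> n; rewrite lebesgue_measure_ball// lebesgue_measure_itv /= lte_fin.
    have n0 : 0 < n.+1%:R^-1 :> R by rewrite invr_gt0.
    rewrite (key _ _ n0) -EFinD -EFinM lee_fin.
    by rewrite le_eqVlt; apply/orP; left; apply/eqP; ring.
apply: ae_imp (lebesgue_differentiation loc) => x /(nice_lebesgue_differentiation sh loc).
have -> : (fun n => (mu `[(x - n.+1%:R^-1)%R, (x + n.+1%:R^-1)%R])^-1 *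
      \int[mu]_(y in `[(x - n.+1%:R^-1)%R, (x + n.+1%:R^-1)%R]) (v y)%:E)%E =
    EFin \o (fun n => avg n.+1%:R^-1 v x).
  apply/funext => n /=.
  have n0 : 0 < n.+1%:R^-1 :> R by rewrite invr_gt0.
  rewrite lebesgue_measure_itv /= lte_fin.
  rewrite (key _ _ n0) -EFinD /avg EFinM; congr (_ * _)%E.
    rewrite inver gt_eqF; last by rewrite subr_gt0 key.
    by congr (_^-1%:E); ring.
  rewrite -[in RHS]Rint_itv /Rintegral fineK//.
  apply: integrable_fin_num => //.
  exact: integrableS vi.
by move=> /fine_cvgP[].
Qed.

Lemma ae_neq0 : {ae mu, forall x : R, x != 0}.
Proof.
exists [set 0]; split => //; first exact: lebesgue_measure_set1.
by move=> x /= /negP; rewrite negbK => /eqP.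
Qed.

(** The transform multiplied by sin(h xi) / (h xi) has squared norm [kappa] times that of the
    average of [v] over boxes. As h tends to 0 the multiplied transform tends to the transform and
    the averages to [v], both almost everywhere; Fatou's lemma on either side gives the two
    inequalities. *)
Lemma plancherel_supp v N : sqint v -> intg v -> (forall x, N < `|x| -> v x = 0) ->
  sqint (hartley v) /\ nsq (hartley v) = kappa * nsq v.
Proof.
move=> v2 vi vN; have k0 := kappa_gt0.
pose h n : R := n.+1%:R^-1.
have h0 n : 0 < h n by rewrite invr_gt0.
have mH := hartley_meas (intg_meas vi).
pose F n xi := sin (h n * xi) / (h n * xi) * hartley v xi.
have F2 n xi : F n xi ^+ 2 = (h n ^+ 2)^-1 * (sinc_sq (h n) xi * hartley v xi ^+ 2).
  rewrite /F /sinc_sq; move: (hartley v xi) (sin (h n * xi)) (h n) => a b c.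
  by rewrite invfM -exprVn; ring.
have mF n : measurable_fun setT (F n).
  apply: measurable_funM => //; apply: measurable_funM; first exact: sin_meas.
  apply: (measurableT_comp measurable_inv); exact: measurable_funM.
have Ki n : intg (fun xi => sinc_sq (h n) xi * hartley v xi ^+ 2).
  apply: (@intgMb _ (sinc_sq (h n)) _ ((2 * \int[mu]_x `|v x|) ^+ 2)) => //; last exact: intg_sinc_sq.
    exact: measurable_funX.
  move=> xi; rewrite normrX; apply: lerXn2r; rewrite ?nnegrE//; last exact: hartley_le.
  by rewrite mulr_ge0//; apply: Rint_ge0.
have Fi n : sqint (F n).
  by split => //; apply: intg_eq (intgZ (h n ^+ 2)^-1 (Ki n)) => xi; rewrite F2.
have FA n : nsq (F n) = kappa * nsq (avg (h n) v).
  rewrite nsqE (@Rint_eq _ _ (fun xi => (h n ^+ 2)^-1 * (sinc_sq (h n) xi * hartley v xi ^+ 2))).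
    rewrite RintZ; last exact: Ki.
    rewrite (Rint_sinc (h0 n) v2 vi vN) /kappa.
    move: (nsq (avg (h n) v)) (h n) (h0 n) => A b b0; field.
    by rewrite gt_eqF.
  exact: F2.
have FH : {ae mu, forall xi, F ^~ xi @ \oo --> hartley v xi}.
  (* At xi = 0 the quotient is 0 by the convention for division, so the limit 1 fails there and that
     point is excluded. *)
  apply: ae_imp ae_neq0 => xi xi0; rewrite -[X in _ --> X]mul1r.
  by apply: cvgM; [exact: sinc_cvg|exact: cvg_cst].
have [Hi2 Hle] : sqint (hartley v) /\ nsq (hartley v) <= kappa * nsq v.
  apply: (fatou_nsq Fi mH FH) => n; rewrite FA ler_wpM2l ?(ltW k0)//.
  by have [] := nsq_avg_le (h0 n) v2 vi vN.
split => //; apply/eqP; rewrite eq_le Hle/=.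
rewrite mulrC -ler_pdivlMr//.
have [|_ //] := fatou_nsq (F := fun n => avg (h n) v) (f := v) (M := nsq (hartley v) / kappa)
  (fun n => (nsq_avg_le (h0 n) v2 vi vN).1) v2.1 (avg_cvg vi).
move=> n; rewrite ler_pdivlMr// mulrC -FA.
apply: ler_nsq => // xi; rewrite /F normrM ler_piMl// normrM normfV.
have [->|z0] := eqVneq (h n * xi) 0; first by rewrite normr0 invr0 mulr0.
by rewrite ler_pdivrMr ?normr_gt0// mul1r abs_sin_le.
Qed.

End plancherel_compact_support.

(** * The Hartley transform on L2: existence, uniqueness, inversion *)

Section hartley_transform.
Context {R : realType}.
Notation mu := (@lebesgue_measure R).
Implicit Types (f g v h : R -> R).

Definition trunc (N : nat) v x := v x * ind (- N%:R) N%:R x.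

Lemma trunc_supp N v x : N%:R < `|x| -> trunc N v x = 0.
Proof. by move=> xN; rewrite /trunc indE -ler_norml leNgt xN mulr0. Qed.

Lemma trunc_sq N v : sqint v -> sqint (trunc N v).
Proof.
move=> vi; rewrite /trunc; under eq_fun do rewrite mulrC.
by apply: (sqintMb _ (ind_norm _ _)) => //; exact: measurable_ind.
Qed.

Lemma sqint_ind (a b : R) : sqint (ind a b).
Proof.
split; first exact: measurable_ind.
apply: intg_eq (intg_ind a b) => x.
by rewrite indE; case: (_ <= _ <= _); rewrite ?expr1n ?expr0n.
Qed.

Lemma trunc_intg N v : sqint v -> intg (trunc N v).
Proof. by move=> vi; apply: sqint_mul => //; exact: sqint_ind. Qed.

Lemma near_ind (x : R) : \forall N \near \oo, ind (- N%:R) N%:R x = 1.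
Proof.
exists (Num.truncn `|x|).+1 => // n /= xn; rewrite indE.
have : `|x| <= n%:R by apply: ltW; apply: lt_le_trans (truncnS_gt _) _; rewrite ler_nat.
by rewrite ler_norml => ->.
Qed.

Lemma trunc_cvg v : sqint v -> nsq (fun x => v x - trunc N v x) @[N --> \oo] --> 0.
Proof.
move=> [mv vi].
have [] := @dct_real _ (fun N x => (v x - trunc N v x) ^+ 2) (cst 0) (fun x => v x ^+ 2) _ _ vi _ _.
- move=> N; apply: measurable_funX; apply: measurable_funB => //.
  by apply: measurable_funM => //; exact: measurable_ind.
- exact: measurable_cst.
- move=> N x; rewrite ger0_norm ?sqr_ge0// /trunc indE.
  by case: (_ <= _ <= _); rewrite ?mulr1 ?mulr0 ?subrr ?subr0 ?expr0n ?sqr_ge0.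
- apply: aeW => x; apply: cvg_near_cst; apply: filterS (near_ind x) => N H.
  by rewrite /trunc H mulr1 subrr expr0n.
move=> _ _; rewrite Rint0.
by under eq_fun do rewrite -nsqE.
Qed.

Lemma hartleyB f g xi : intg f -> intg g ->
  hartley (fun x => f x - g x) xi = hartley f xi - hartley g xi.
Proof.
move=> fi gi; rewrite /hartley -RintB; [|exact: intg_cas..].
by apply: Rint_eq => x; rewrite mulrBl.
Qed.

Lemma hartleyD f g xi : intg f -> intg g ->
  hartley (fun x => f x + g x) xi = hartley f xi + hartley g xi.
Proof.
move=> fi gi; rewrite /hartley -RintD; [|exact: intg_cas..].
by apply: Rint_eq => x; rewrite mulrDl.
Qed.

Lemma hartleyZ (k : R) f xi : intg f -> hartley (fun x => k * f x) xi = k * hartley f xi.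
Proof.
move=> fi; rewrite /hartley -RintZ; last exact: intg_cas.
by apply: Rint_eq => x; rewrite mulrA.
Qed.

Definition hartley_trunc N v := hartley (trunc N v).

Lemma nrm_nsq_cvg0 (F : nat -> R -> R) : nsq (F n) @[n --> \oo] --> 0 ->
  nrm (F n) @[n --> \oo] --> 0.
Proof.
move=> H; rewrite -[X in _ --> X](@sqrtr0 R).
apply: (cvg_comp (fun n => nsq (F n)) Num.sqrt H).
have := @sqrt_continuous R 0; exact.
Qed.

Lemma nsq_nrm_cvg0 (F : nat -> R -> R) : nrm (F n) @[n --> \oo] --> 0 ->
  nsq (F n) @[n --> \oo] --> 0.
Proof.
move=> H; rewrite -[X in _ --> X](mulr0 0); under eq_fun do rewrite -nrm_sq expr2.
exact: cvgM.
Qed.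

Lemma cvg0_le (a b c : nat -> R) : (forall n, 0 <= a n <= b n + c n) ->
  b n @[n --> \oo] --> 0 -> c n @[n --> \oo] --> 0 -> a n @[n --> \oo] --> 0.
Proof.
move=> ab b0 c0.
have bc : (fun n => b n + c n) @ \oo --> 0 + 0 by exact: cvgD.
rewrite addr0 in bc.
apply/cvgrPdist_le => e e0; move/cvgrPdist_le : bc => /(_ e e0).
apply: filterS => n; have /andP[a0 ale] := ab n.
rewrite !sub0r !normrN (ger0_norm a0) => H.
by apply: (le_trans ale); apply: le_trans H; exact: ler_norm.
Qed.

Lemma trunc_nrm v : sqint v -> nrm (fun x => v x - trunc N v x) @[N --> \oo] --> 0.
Proof. by move=> vi; apply: nrm_nsq_cvg0; exact: trunc_cvg. Qed.

(** A relation rather than a function, since the transform is determined up to a null set. The limit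
    over truncations has the form of [is_fourier], so the two can be compared truncation by
    truncation. *)
Definition is_hartley v h := sqint h /\ nrm (fun xi => h xi - hartley_trunc N v xi) @[N --> \oo] --> 0.

Lemma hartley_trunc_sq N v : sqint v -> sqint (hartley_trunc N v).
Proof.
move=> vi; have [//] := plancherel_supp (trunc_sq N vi) (trunc_intg N vi) (@trunc_supp N v).
Qed.

Lemma hartley_trunc_nsq N v : sqint v -> nsq (hartley_trunc N v) = kappa * nsq (trunc N v).
Proof.
move=> vi; have [//] := plancherel_supp (trunc_sq N vi) (trunc_intg N vi) (@trunc_supp N v).
Qed.

Lemma hartley_trunc_sub N M v : sqint v -> nsq (fun xi => hartley_trunc N v xi - hartley_trunc M v xi) =
  kappa * nsq (fun x => trunc N v x - trunc M v x).
Proof.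
move=> vi.
have S x : Num.max N%:R M%:R < `|x| -> trunc N v x - trunc M v x = 0.
  by rewrite gt_max => /andP[? ?]; rewrite !trunc_supp// subrr.
have [_ <-] := plancherel_supp
  (sqintB (trunc_sq N vi) (trunc_sq M vi)) (intgB (trunc_intg N vi) (trunc_intg M vi)) S.
by congr nsq; apply/funext => xi; rewrite /hartley_trunc hartleyB//; exact: trunc_intg.
Qed.

Lemma nrm_diff f g : sqint f -> sqint g -> `|nrm f - nrm g| <= nrm (fun x => f x - g x).
Proof.
move=> fi gi.
have h1 := nrmD (sqintB fi gi) gi; have h2 := nrmD (sqintB gi fi) fi.
have E (u w : R -> R) : nrm (fun x => u x - w x + w x) = nrm u.
  by congr nrm; apply/funext => x; rewrite subrK.
rewrite !E in h1 h2; rewrite (nrmBC g) in h2.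
rewrite ler_norml; lra.
Qed.

Lemma nrm_cvg_val (F : nat -> R -> R) f : (forall n, sqint (F n)) -> sqint f ->
  nrm (fun x => f x - F n x) @[n --> \oo] --> 0 ->
  nrm (F n) @[n --> \oo] --> nrm f.
Proof.
move=> Fi fi H.
apply/cvgrPdist_le => e e0; move/cvgr0Pnorm_le : H => /(_ e e0).
apply: filterS => n; rewrite ger0_norm ?nrm_ge0//; apply: le_trans.
exact: nrm_diff.
Qed.

Lemma is_hartley_ex v : sqint v -> exists h, is_hartley v h.
Proof.
move=> vi; have k0 := @kappa_gt0 R.
have [|h hi hc] := @complete_nsq _ (fun N => hartley_trunc N v) (fun N => hartley_trunc_sq N vi).
  move=> e e0; have /cvgr0Pnorm_le := trunc_nrm vi.
  (* Each of two truncations may be this far from [v], so their squared distance is at most e /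
     kappa; Plancherel's factor brings it back to [e]. *)
  pose e' := Num.sqrt (e / kappa) / 2.
  have e'0 : 0 < e' by rewrite divr_gt0// sqrtr_gt0 divr_gt0.
  move=> /(_ e' e'0) [N _ NP]; exists N => m n Nm Nn; rewrite hartley_trunc_sub//.
  rewrite mulrC -ler_pdivlMr// -nrm_sq -(sqr_sqrtr (ltW (divr_gt0 e0 k0))).
  rewrite lerXn2r ?nnegrE ?nrm_ge0 ?sqrtr_ge0//.
  have := nrm_tri (trunc_sq m vi) vi (trunc_sq n vi).
  have := NP m Nm; have := NP n Nn; rewrite /= !ger0_norm ?nrm_ge0//.
  by rewrite (nrmBC (trunc m v) v) /e' => *; lra.
exists h; split => //.
by under eq_fun do rewrite nrmBC; exact: nrm_nsq_cvg0.
Qed.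

Lemma is_hartley_sq v h : is_hartley v h -> sqint h. Proof. by case. Qed.

Lemma nrmE f : nrm f = Num.sqrt (nsq f). Proof. by []. Qed.

Lemma is_hartley_nrm v h : sqint v -> is_hartley v h -> nrm h = Num.sqrt kappa * nrm v.
Proof.
move=> vi [hi hc].
have c1 := nrm_cvg_val (fun N => hartley_trunc_sq N vi) hi hc.
have c2 : nrm (hartley_trunc N v) @[N --> \oo] --> Num.sqrt kappa * nrm v.
  have -> : (fun N => nrm (hartley_trunc N v)) = fun N => Num.sqrt kappa * nrm (trunc N v).
    apply/funext => N; rewrite nrmE hartley_trunc_nsq// sqrtrM//; exact/ltW/kappa_gt0.
  apply: cvgM; first exact: cvg_cst.
  exact: (nrm_cvg_val (fun N => trunc_sq N vi) vi (trunc_nrm vi)).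
exact: cvg_unique c1 c2.
Qed.

Lemma is_hartley_nsq v h : sqint v -> is_hartley v h -> nsq h = kappa * nsq v.
Proof.
move=> vi vh; rewrite -!nrm_sq (is_hartley_nrm vi vh) exprMn sqr_sqrtr//.
exact/ltW/kappa_gt0.
Qed.

Lemma hartley_truncD N v v' xi : sqint v -> sqint v' ->
  hartley_trunc N (fun x => v x + v' x) xi = hartley_trunc N v xi + hartley_trunc N v' xi.
Proof.
move=> vi vi'; rewrite /hartley_trunc -hartleyD; [|exact: trunc_intg..].
by congr hartley; apply/funext => x; rewrite /trunc mulrDl.
Qed.

Lemma hartley_truncZ N v (k : R) xi : sqint v -> hartley_trunc N (fun x => k * v x) xi = k * hartley_trunc N v xi.
Proof.
move=> vi; rewrite /hartley_trunc -hartleyZ; last exact: trunc_intg.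
by congr hartley; apply/funext => x; rewrite /trunc mulrA.
Qed.

Lemma is_hartleyD v v' h h' : sqint v -> sqint v' -> is_hartley v h -> is_hartley v' h' ->
  is_hartley (fun x => v x + v' x) (fun x => h x + h' x).
Proof.
move=> vi vi' [hi hc] [hi' hc']; split; first exact: sqintD.
apply: (cvg0_le _ hc hc') => N; rewrite nrm_ge0 /=.
apply: le_trans (nrmD (sqintB hi (hartley_trunc_sq N vi)) (sqintB hi' (hartley_trunc_sq N vi'))).
rewrite le_eqVlt; apply/orP; left; apply/eqP; congr nrm; apply/funext => xi.
by rewrite hartley_truncD//; ring.
Qed.

Lemma is_hartleyZ v h (k : R) : sqint v -> is_hartley v h ->
  is_hartley (fun x => k * v x) (fun x => k * h x).
Proof.
move=> vi [hi hc]; split; first exact: sqintZ.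
rewrite -[X in _ --> X](mulr0 `|k|).
have -> : (fun N => nrm (fun xi => k * h xi - hartley_trunc N (fun x => k * v x) xi)) =
    (fun N => `|k| * nrm (fun xi => h xi - hartley_trunc N v xi)).
  apply/funext => N; rewrite -nrmZ; last by apply: sqintB => //; exact: hartley_trunc_sq.
  by congr nrm; apply/funext => xi; rewrite hartley_truncZ// mulrBr.
by apply: cvgM => //; exact: cvg_cst.
Qed.

Lemma is_hartleyB v v' h h' : sqint v -> sqint v' -> is_hartley v h -> is_hartley v' h' ->
  is_hartley (fun x => v x - v' x) (fun x => h x - h' x).
Proof.
move=> vi vi' vh vh'; have := is_hartleyD vi (sqintZ (-1) vi') vh (is_hartleyZ (-1) vi' vh').
have -> : (fun x => v x + -1 * v' x) = fun x => v x - v' x.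
  by apply/funext => x; rewrite mulN1r.
by have -> : (fun x => h x + -1 * h' x) = fun x => h x - h' x
  by apply/funext => x; rewrite mulN1r.
Qed.

Lemma is_hartley_ip v v' h h' : sqint v -> sqint v' -> is_hartley v h -> is_hartley v' h' ->
  ip h h' = kappa * ip v v'.
Proof.
move=> vi vi' vh vh'; have := is_hartley_nsq (sqintD vi vi') (is_hartleyD vi vi' vh vh').
rewrite !nsqD//; [|exact: is_hartley_sq vh|exact: is_hartley_sq vh'].
by rewrite (is_hartley_nsq vi vh) (is_hartley_nsq vi' vh'); lra.
Qed.

Lemma is_hartley_ae v h h' : sqint v -> is_hartley v h -> measurable_fun setT h' ->
  {ae mu, forall x, h' x = h x} -> is_hartley v h'.
Proof.
move=> vi [hi hc] mh' hh'; have hi' := sqint_ae mh' hh' hi; split => //.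
have -> // : (fun N => nrm (fun xi => h' xi - hartley_trunc N v xi)) =
    (fun N => nrm (fun xi => h xi - hartley_trunc N v xi)).
apply/funext => N; rewrite !nrmE; congr Num.sqrt; apply: nsq_ae.
- by apply: measurable_funB => //; exact: sqint_meas (hartley_trunc_sq N vi).
- by apply: measurable_funB; [exact: sqint_meas hi|exact: sqint_meas (hartley_trunc_sq N vi)].
- by apply: ae_imp hh' => x ->.
Qed.

Lemma nrm_le0 f : sqint f -> nrm f = 0 -> {ae mu, forall x, f x = 0}.
Proof. by move=> fi f0; apply: nrm_eq0; rewrite // f0. Qed.

Lemma nrm_sub0 f g : sqint f -> sqint g -> nrm (fun x => f x - g x) = 0 ->
  {ae mu, forall x, f x = g x}.
Proof.
move=> fi gi /(nrm_le0 (sqintB fi gi)); apply: ae_imp => x /eqP.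
by rewrite subr_eq0 => /eqP.
Qed.

Lemma cst_cvg0 (a : R) (b c : nat -> R) : 0 <= a -> (forall n, a <= b n + c n) ->
  b n @[n --> \oo] --> 0 -> c n @[n --> \oo] --> 0 -> a = 0.
Proof.
move=> a0 ab b0 c0.
have ca : (fun _ : nat => a) @ \oo --> a by exact: cvg_cst.
apply: cvg_unique ca _ => //; apply: cvg0_le b0 c0 => n; by rewrite a0 ab.
Qed.

Lemma nrm_ae0 f : measurable_fun setT f -> {ae mu, forall x, f x = 0} -> nrm f = 0.
Proof.
move=> mf f0; have m0 : measurable_fun setT (fun _ : R => 0 : R) by exact: measurable_cst.
rewrite nrmE (nsq_ae mf m0 f0) nsqE.
rewrite (@Rint_eq _ _ (fun=> 0)) ?Rint0 ?sqrtr0// => x.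
by rewrite expr0n.
Qed.

Lemma is_hartley_uniq v h h' : sqint v -> is_hartley v h -> is_hartley v h' ->
  {ae mu, forall x, h x = h' x}.
Proof.
move=> vi [hi hc] [hi' hc']; apply: nrm_sub0 => //.
apply: cst_cvg0 hc hc'; first exact: nrm_ge0.
move=> N; rewrite (nrmBC h'); exact: nrm_tri (hartley_trunc_sq N vi) hi'.
Qed.

(** The graph of the transform is closed, because Plancherel's identity makes the transform of the
    limit a limit of the transforms. Formulas for translations and modulations reach L2 from
    integrable truncations in this way. *)
Lemma is_hartley_lim (vs hs : nat -> R -> R) v h : sqint v -> sqint h ->
  (forall k, sqint (vs k)) -> (forall k, is_hartley (vs k) (hs k)) ->
  nrm (fun x => v x - vs k x) @[k --> \oo] --> 0 ->
  nrm (fun x => h x - hs k x) @[k --> \oo] --> 0 -> is_hartley v h.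
Proof.
move=> vi hi vsi H vc hc; have [h0 vh0] := is_hartley_ex vi; have h0i := is_hartley_sq vh0.
apply: (is_hartley_ae vi vh0); first exact: sqint_meas.
apply: nrm_sub0 => //.
have kc : Num.sqrt kappa * nrm (fun x => v x - vs k x) @[k --> \oo] --> 0.
  by rewrite -[X in _ --> X](mulr0 (Num.sqrt kappa)); apply: cvgM => //; exact: cvg_cst.
apply: cst_cvg0 hc kc; first exact: nrm_ge0.
move=> k; apply: (le_trans (nrm_tri hi (is_hartley_sq (H k)) h0i)); rewrite lerD2l nrmBC.
by rewrite (is_hartley_nrm (sqintB vi (vsi k)) (is_hartleyB vi (vsi k) vh0 (H k))).
Qed.

(** The truncated transforms converge pointwise to the integral, by dominated convergence, and in L2
    to [h]; Fatou's lemma shows that the two limits agree almost everywhere. *)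
Lemma is_hartley_int v : sqint v -> intg v -> is_hartley v (hartley v).
Proof.
move=> vi v1; have [h vh] := is_hartley_ex vi; have hi := is_hartley_sq vh.
have mH := hartley_meas (intg_meas v1).
apply: (is_hartley_ae vi vh) => //.
have HNc xi : hartley_trunc N v xi @[N --> \oo] --> hartley v xi.
  have [] := @dct_real _ (fun N x => trunc N v x * cas (x * xi)) (fun x => v x * cas (x * xi))
    (fun x => `|v x * cas (x * xi)|) _ _ (intg_abs (intg_cas xi v1)) _ _.
  - by move=> N; apply: intg_meas; apply: intg_cas; exact: trunc_intg.
  - by apply: intg_meas; exact: intg_cas.
  - by move=> N x; rewrite /trunc mulrAC normrM ler_piMr// ind_norm.
  - apply: aeW => x; apply: cvg_near_cst; apply: filterS (near_ind x) => N H.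
    by rewrite /trunc H mulr1.
  by [].
have [] := @nsq_cvg_lim _ (fun N xi => h xi - hartley_trunc N v xi) (fun xi => h xi - hartley v xi) 0
  (fun N => sqintB hi (hartley_trunc_sq N vi)) (measurable_funB (sqint_meas hi) mH) _ (nsq_nrm_cvg0 vh.2).
  by apply: aeW => xi; apply: cvgB => //; exact: cvg_cst.
move=> hHi H; have H0 : nsq (fun xi => h xi - hartley v xi) = 0.
  by apply/eqP; rewrite eq_le H nsq_ge0.
by apply: ae_imp (nsq_eq0 hHi H0) => x /eqP; rewrite subr_eq0 => /eqP.
Qed.

(** The kernel is symmetric in its two variables, so an exchange of integrals gives the identity for
    truncations, and pairings are continuous in L2. *)
Lemma is_hartley_sym v v' h h' : sqint v -> sqint v' -> is_hartley v h -> is_hartley v' h' ->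
  ip h v' = ip v h'.
Proof.
move=> vi vi' [hi hc] [hi' hc'].
have T N : ip (hartley_trunc N v) (trunc N v') = ip (trunc N v) (hartley_trunc N v').
  have := Rint_swap (trunc_intg N vi') (trunc_intg N vi) (@cas_meas2 R) (fun z => cas_le2 _).
  rewrite /ip /hartley_trunc /hartley => E.
  transitivity (\int[mu]_x (trunc N v' x * \int[mu]_y (trunc N v y * cas ((x, y).2 * (x, y).1)))).
    by apply: Rint_eq => x; rewrite mulrC.
  by rewrite E; apply: Rint_eq => y; congr (_ * _); apply: Rint_eq => x; rewrite /= (mulrC y).
have L (a b : R -> R) (A B : nat -> R -> R) : sqint a -> sqint b ->
    (forall N, sqint (A N)) -> (forall N, sqint (B N)) ->
    nrm (fun x => a x - A N x) @[N --> \oo] --> 0 ->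
    nrm (fun x => b x - B N x) @[N --> \oo] --> 0 -> ip (A N) (B N) @[N --> \oo] --> ip a b.
  move=> ai bi Ai Bi Ac Bc.
  have c1 : nrm (fun x => a x - A N x) * nrm (B N) @[N --> \oo] --> 0.
    rewrite -[X in _ --> X](mul0r (nrm b)); apply: cvgM => //; exact: nrm_cvg_val.
  have c2 : nrm a * nrm (fun x => b x - B N x) @[N --> \oo] --> 0.
    rewrite -[X in _ --> X](mulr0 (nrm a)); apply: cvgM => //; exact: cvg_cst.
  have c3 : `|ip a b - ip (A N) (B N)| @[N --> \oo] --> 0.
    apply: cvg0_le c1 c2 => N; rewrite normr_ge0 /=.
    have -> : ip a b - ip (A N) (B N) = ip (fun x => a x - A N x) (B N) + ip a (fun x => b x - B N x).
      by rewrite ipBl// ipBr//; ring.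
    apply: (le_trans (ler_normD _ _)); apply: lerD; apply: cauchy_schwarz_nrm => //; exact: sqintB.
  apply/cvgrPdist_le => e e0; move/cvgr0Pnorm_le : c3 => /(_ e e0).
  by apply: filterS => N; rewrite normr_id.
have c1 := L _ _ _ _ hi vi' (fun N => hartley_trunc_sq N vi) (fun N => trunc_sq N vi') hc (trunc_nrm vi').
have c2 := L _ _ _ _ vi hi' (fun N => trunc_sq N vi) (fun N => hartley_trunc_sq N vi') (trunc_nrm vi) hc'.
move: c1; under eq_fun do rewrite T.
by move=> c1; exact: cvg_unique c1 c2.
Qed.

(** With [k] the transform of [h], the squared distance between [k] and [kappa] times [v] expands,
    by Plancherel and symmetry, into kappa^2 |v|^2 - 2 kappa^2 |v|^2 + kappa^2 |v|^2 = 0. *)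
Lemma is_hartley_inv v h : sqint v -> is_hartley v h -> is_hartley h (fun x => kappa * v x).
Proof.
move=> vi vh; have hi := is_hartley_sq vh; have [k hk] := is_hartley_ex hi; have ki := is_hartley_sq hk.
have kvi := sqintZ kappa vi.
apply: (is_hartley_ae hi hk); first exact: sqint_meas.
apply: nrm_sub0 => //; rewrite nrmE nsqB// nsqZ// ipZl//.
rewrite (is_hartley_nsq hi hk) (is_hartley_nsq vi vh) -(is_hartley_sym vi hi vh hk) -[ip h h]/(nsq h).
rewrite (is_hartley_nsq vi vh) (_ : _ + _ = 0) ?sqrtr0//; ring.
Qed.

End hartley_transform.

(** * The Hartley transform of a derivative *)

Section hartley_and_derivative.
Context {R : realType}.
Notation mu := (@lebesgue_measure R).
Implicit Types (f g v h r w : R -> R).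

Lemma is_hartley_aev v v' h : sqint v -> measurable_fun setT v' ->
  {ae mu, forall x, v' x = v x} -> is_hartley v h -> is_hartley v' h.
Proof.
move=> vi mv' vv' [hi hc]; split; first exact: hi.
have -> : (fun N => nrm (fun xi => h xi - hartley_trunc N v' xi)) =
    (fun N => nrm (fun xi => h xi - hartley_trunc N v xi)); last exact: hc.
apply/funext => N; congr nrm; apply/funext => xi; congr (_ - _).
have H w : measurable_fun setT w -> measurable_fun setT (fun x => trunc N w x * cas (x * xi)).
  move=> mw; apply: measurable_funM; last exact: cas_meas1.
  by apply: measurable_funM => //; exact: measurable_ind.
apply: Rint_ae; [exact: H|by apply: H; exact: sqint_meas|].
by apply: ae_imp vv' => x E; rewrite /trunc E.
Qed.

Lemma is_hartley_surj h : sqint h -> exists2 v, sqint v & is_hartley v h.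
Proof.
move=> hi; have [g hg] := is_hartley_ex hi; have gi := is_hartley_sq hg.
exists (fun x => kappa^-1 * g x); first exact: sqintZ.
have := is_hartleyZ kappa^-1 gi (is_hartley_inv hi hg).
have -> // : (fun x => kappa^-1 * (kappa * h x)) = h.
by apply/funext => x; rewrite mulKf// gt_eqF// kappa_gt0.
Qed.

Lemma nrm_refl f : sqint f -> nrm (fun x => f (- x)) = nrm f.
Proof. by move=> fi; rewrite !nrmE nsq_refl. Qed.

Lemma nrm_shift (b : R) f : sqint f -> nrm (fun x => f (x + b)) = nrm f.
Proof. by move=> fi; rewrite !nrmE nsq_shift. Qed.

Lemma nrm_rev (b : R) f : sqint f -> nrm (fun x => f (b - x)) = nrm f.
Proof. by move=> fi; rewrite !nrmE nsq_rev. Qed.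

Lemma ler_nrm f g : measurable_fun setT f -> (forall x, `|f x| <= `|g x|) ->
  sqint g -> nrm f <= nrm g.
Proof. by move=> mf fg gi; rewrite ler_wsqrtr// ler_nsq. Qed.

Lemma nrmMb (m : R -> R) B f : measurable_fun setT m -> (forall x, `|m x| <= B) ->
  sqint f -> nrm (fun x => m x * f x) <= B * nrm f.
Proof.
move=> mm mB fi; have B0 : 0 <= B by apply: le_trans (mB 0).
rewrite -[B in leRHS](ger0_norm B0) -nrmZ//; apply: ler_nrm.
- by apply: measurable_funM => //; exact: sqint_meas.
- by move=> x; rewrite !normrM ler_wpM2r// (ger0_norm B0).
- exact: sqintZ.
Qed.

(** Translation by [a], seen on the transform side. As [cas] is not multiplicative, the values at xi
    and -xi get mixed. *)
Definition Sa (a : R) h (xi : R) := cos (a * xi) * h xi - sin (a * xi) * h (- xi).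

Lemma Sa_sq a h : sqint h -> sqint (Sa a h).
Proof.
move=> hi; apply: sqintB.
  by apply: (sqintMb _ (fun x => cos_max _)) => //; exact: cos_meas.
apply: (sqintMb _ (fun x => sin_max _)); first exact: sin_meas.
exact: sqint_refl.
Qed.

Lemma Sa_nrm a h : sqint h -> nrm (Sa a h) <= nrm h + nrm h.
Proof.
move=> hi; have hr := sqint_refl hi.
have c := @sqintMb _ _ 1 h (@cos_meas R a) (fun x => cos_max _) hi.
have s := @sqintMb _ _ 1 _ (@sin_meas R a) (fun x => sin_max _) hr.
apply: (le_trans (nrmB c s)); apply: lerD.
  by rewrite -[leRHS]mul1r; apply: nrmMb => //; [exact: cos_meas|move=> x; exact: cos_max].
rewrite -[leRHS]mul1r -(nrm_refl hi).
by apply: nrmMb => //; [exact: sin_meas|move=> x; exact: sin_max].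
Qed.

Lemma hartley_shift (a : R) v xi : intg v -> hartley (fun x => v (x + a)) xi = Sa a (hartley v) xi.
Proof.
move=> vi.
have i1 := intgZ (cos (a * xi)) (intg_cas xi vi).
have i2 := intgZ (sin (a * xi)) (intg_cas (- xi) vi).
rewrite /hartley /Sa -!RintZ; [|exact: intg_cas..].
rewrite -(RintB i1 i2) -[RHS](@Rint_shift R a _ (intgB i1 i2)).
apply: Rint_eq => x /=.
have -> : x * xi = (x + a) * xi - a * xi by ring.
rewrite /cas cosB sinB mulrN cosN sinN; ring.
Qed.

Lemma is_hartley_shift (a : R) v h : sqint v -> is_hartley v h -> is_hartley (fun x => v (x + a)) (Sa a h).
Proof.
move=> vi vh; have hi := is_hartley_sq vh.
have dv N := sqintB vi (trunc_sq N vi).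
have dh N := sqintB hi (hartley_trunc_sq N vi).
apply: (@is_hartley_lim _ (fun N x => trunc N v (x + a)) (fun N => Sa a (hartley_trunc N v))).
- exact: sqint_shift.
- exact: Sa_sq.
- by move=> N; apply: (sqint_shift a); exact: trunc_sq.
- move=> N; have -> : Sa a (hartley_trunc N v) = hartley (fun x => trunc N v (x + a)).
    by apply/funext => xi; rewrite hartley_shift//; exact: trunc_intg.
  by apply: is_hartley_int; [apply: (sqint_shift a); exact: trunc_sq|apply: (intg_shift a); exact: trunc_intg].
- have := trunc_nrm vi; have -> // : (fun N => nrm (fun x => v x - trunc N v x)) =
      fun N => nrm (fun x => v (x + a) - trunc N v (x + a)).
  by apply/funext => N; rewrite -(nrm_shift a (dv N)).
- apply: (cvg0_le _ vh.2 vh.2) => N; rewrite nrm_ge0 /=.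
  apply: le_trans (Sa_nrm a (dh N)).
  rewrite le_eqVlt; apply/orP; left; apply/eqP; congr nrm; apply/funext => xi.
  rewrite /Sa; ring.
Qed.

Lemma abs_cos_sub1_le (x : R) : `|cos x - 1| <= `|x|.
Proof.
wlog x0 : x / 0 <= x.
  move=> H; case: (leP 0 x) => [/H//|/ltW]; rewrite -oppr_ge0 => /H.
  by rewrite cosN normrN.
move: x0; rewrite le_eqVlt => /predU1P[<-|x0]; first by rewrite cos0 subrr.
have [|y _] := @MVT R cos (fun y => - sin y) 0 x x0 (fun y _ => is_derive_cos y).
  by apply: continuous_subspaceT; exact: continuous_cos.
rewrite cos0 subr0 => ->; rewrite normrM normrN ler_piMl//; exact: sin_max.
Qed.

Lemma harm0 : n.+1%:R^-1 @[n --> \oo] --> (0 : R).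
Proof. exact: cvg_harmonic. Qed.

(** The difference quotients at 0 of cosine and sine tend to 0 and 1, and |xi h(xi)| + 2 |xi h(-xi)|
    dominates the error, so dominated convergence applies. The limit -xi h(-xi) is how a derivative
    acts on a Hartley transform. *)
Lemma Sa_quot_cvg h : sqint h -> sqint (fun xi => xi * h xi) ->
  nrm (fun xi => n.+1%:R^-1^-1 * (Sa n.+1%:R^-1 h xi - h xi) - - xi * h (- xi))
    @[n --> \oo] --> 0.
Proof.
move=> hi xhi; have mh := sqint_meas hi.
pose a n : R := n.+1%:R^-1; have a0 n : 0 < a n by rewrite invr_gt0.
pose D xi := `|xi * h xi| + 2 * `|- xi * h (- xi)|.
have Di : sqint D.
  apply: sqintD; first exact: sqint_abs.
  by apply/sqintZ/sqint_abs; exact: (sqint_refl xhi).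
pose E n xi := (a n)^-1 * (Sa (a n) h xi - h xi) - - xi * h (- xi).
have Ei n : sqint (E n).
  apply: sqintB; first by apply/sqintZ/sqintB => //; exact: Sa_sq.
  exact: (sqint_refl xhi).
have EE n xi : E n xi = (cos (a n * xi) - 1) / a n * h xi - (sin (a n * xi) / a n - xi) * h (- xi).
  by rewrite /E /Sa; ring.
apply: nrm_nsq_cvg0.
have [] := @dct_real _ (fun n xi => E n xi ^+ 2) (fun=> 0) (fun xi => D xi ^+ 2) _ _ Di.2 _ _.
- by move=> n; apply: measurable_funX; exact: sqint_meas.
- exact: measurable_cst.
- move=> n xi; rewrite normrX; apply: lerXn2r; rewrite ?nnegrE//.
    by rewrite /D addr_ge0// mulr_ge0.
  rewrite EE; apply: (le_trans (ler_normB _ _)); rewrite /D !normrM normrN.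
  have an : 0 < `|a n| by rewrite normr_gt0 gt_eqF.
  have h1 : `|cos (a n * xi) - 1| * `|(a n)^-1| <= `|xi|.
    rewrite normfV ler_pdivrMr// mulrC -normrM; exact: abs_cos_sub1_le.
  have h2 : `|sin (a n * xi) / a n| <= `|xi|.
    rewrite normrM normfV ler_pdivrMr// mulrC -normrM; exact: abs_sin_le.
  have h3 := le_trans (ler_normB (sin (a n * xi) / a n) xi) (lerD h2 (lexx _)).
  have := ler_wpM2r (normr_ge0 (h xi)) h1; have := ler_wpM2r (normr_ge0 (h (- xi))) h3.
  lra.
- apply: ae_imp ae_neq0 => xi xi0.
  rewrite -[X in _ --> X](mulr0 0); under eq_fun do rewrite expr2.
  suff c : E n xi @[n --> \oo] --> 0 by exact: cvgM.
  under eq_fun do rewrite EE.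
  have u0 n : a n * xi != 0 by rewrite mulf_neq0// gt_eqF.
  have u1 : a n * xi @[n --> \oo] --> 0.
    by rewrite -(mul0r xi); apply: cvgM; [exact: harm0|exact: cvg_cst].
  have c1 := der_seq (is_derive_cos (0 : R)) u0 u1.
  have c2 := der_seq (is_derive_sin (0 : R)) u0 u1.
  have E1 : (fun n => (cos (a n * xi) - 1) / a n) = fun n => xi * ((a n * xi)^-1 * (cos (a n * xi + 0) - cos 0)).
    apply/funext => n; rewrite addr0 cos0; move: (a0 n) => an; field.
    by rewrite xi0 gt_eqF.
  have E2 : (fun n => sin (a n * xi) / a n) = fun n => xi * ((a n * xi)^-1 * (sin (a n * xi + 0) - sin 0)).
    apply/funext => n; rewrite addr0 sin0 subr0; move: (a0 n) => an; field.
    by rewrite xi0 gt_eqF.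
  rewrite cos0 in c2; rewrite sin0 oppr0 in c1.
  have H1 : (fun n => (cos (a n * xi) - 1) / a n) @ \oo --> xi * 0.
    by rewrite E1; apply: cvgM c1; exact: cvg_cst.
  have H2 : (fun n => sin (a n * xi) / a n) @ \oo --> xi * 1.
    by rewrite E2; apply: cvgM c2; exact: cvg_cst.
  have -> : 0 = xi * 0 * h xi - (xi * 1 - xi) * h (- xi) by ring.
  apply: cvgB.
    apply: cvgM; last exact: cvg_cst.
    exact: H1.
  apply: cvgM; last exact: cvg_cst.
  apply: cvgB; last exact: cvg_cst.
  exact: H2.
move=> _ _; rewrite Rint0; under eq_fun do rewrite -nsqE; exact.
Qed.

(** The difference quotients converge in L2, by Plancherel, to the function whose transform is -xi
    h(-xi), and pointwise to v'; so the two agree almost everywhere. Square integrability of v' is a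
    conclusion here. *)
Lemma is_hartley_der v v' h : sqint v -> is_hartley v h -> der v v' -> measurable_fun setT v' ->
  sqint (fun xi => xi * h xi) -> sqint v' /\ is_hartley v' (fun xi => - xi * h (- xi)).
Proof.
move=> vi vh vd mv' xhi; have hi := is_hartley_sq vh.
have Gi := sqint_refl xhi; have [g gi gG] := is_hartley_surj Gi.
pose a n : R := n.+1%:R^-1; have a0 n : 0 < a n by rewrite invr_gt0.
pose q n x := (a n)^-1 * (v (x + a n) - v x).
have svi n := sqint_shift (a n) vi.
have qi n : sqint (q n) by apply/sqintZ/sqintB.
have qH n : is_hartley (q n) (fun xi => (a n)^-1 * (Sa (a n) h xi - h xi)).
  by apply: is_hartleyZ; [exact: sqintB|exact: (is_hartleyB (svi n) vi (is_hartley_shift (a n) vi vh) vh)].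
have qg : nrm (fun x => q n x - g x) @[n --> \oo] --> 0.
  have sk0 : 0 < Num.sqrt kappa :> R by rewrite sqrtr_gt0 kappa_gt0.
  have H := Sa_quot_cvg hi xhi.
  have -> : (fun n => nrm (fun x => q n x - g x)) = (fun n => (Num.sqrt kappa)^-1 *
    nrm (fun xi => (a n)^-1 * (Sa (a n) h xi - h xi) - - xi * h (- xi))).
    apply/funext => n; rewrite (is_hartley_nrm (sqintB (qi n) gi) (is_hartleyB (qi n) gi (qH n) gG)).
    by rewrite mulKf// gt_eqF.
  by rewrite -[X in _ --> X](mulr0 (Num.sqrt kappa)^-1); apply: cvgM => //; exact: cvg_cst.
have [] := @nsq_cvg_lim _ (fun n x => q n x - g x) (fun x => v' x - g x) 0
  (fun n => sqintB (qi n) gi) (measurable_funB mv' (sqint_meas gi)) _ (nsq_nrm_cvg0 qg).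
  apply: aeW => x; apply: cvgB; last exact: cvg_cst.
  have := der_seq (vd x) (fun n => _ : a n != 0) harm0.
  move=> /(_ (fun n => negbT (gt_eqF (a0 n)))).
  by under eq_fun do rewrite (addrC _ x).
move=> di d0.
have v'g : {ae mu, forall x, v' x = g x}.
  have d00 : nsq (fun x => v' x - g x) = 0 by apply/eqP; rewrite eq_le d0 nsq_ge0.
  by apply: ae_imp (nsq_eq0 di d00) => x /eqP; rewrite subr_eq0 => /eqP.
split; first exact: sqint_ae v'g gi.
exact: is_hartley_aev gi mv' v'g gG.
Qed.

Lemma lorentz_le1 (x : R) : `|lorentz x| <= 1.
Proof.
rewrite ger0_norm ?(ltW (lorentz_gt0 _))// /lorentz invf_le1 ?ltr_pwDl ?sqr_ge0//.
by rewrite lerDl sqr_ge0.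
Qed.

Lemma mul_lorentz_le1 (x : R) : `|x * lorentz x| <= 1.
Proof.
rewrite normrM (ger0_norm (ltW (lorentz_gt0 _))) /lorentz ler_pdivrMr ?ltr_pwDl ?sqr_ge0//.
rewrite mul1r -(real_normK (num_real x)); have := sqr_ge0 (`|x| - 1); nra.
Qed.

Lemma lorentz_meas : measurable_fun setT (@lorentz R).
Proof. exact: intg_meas intg_lorentz. Qed.

Lemma lorentz_sq : sqint (@lorentz R).
Proof.
split; first exact: lorentz_meas.
apply: intg_le intg_lorentz; first by apply: measurable_funX; exact: lorentz_meas.
by move=> x; rewrite normrX expr2 ler_piMl// lorentz_le1.
Qed.

Lemma derM f f' g g' : der f f' -> der g g' ->
  der (fun x => f x * g x) (fun x => f' x * g x + f x * g' x).
Proof.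
move=> fd gd x; have := is_deriveM (fd x) (gd x).
have -> : f x *: g' x + g x *: f' x = f' x * g x + f x * g' x.
  by rewrite -[_ *: _]/(_ * _) -[X in _ + X]/(_ * _); ring.
exact.
Qed.

Lemma derD f f' g g' : der f f' -> der g g' ->
  der (fun x => f x + g x) (fun x => f' x + g' x).
Proof. by move=> fd gd x; exact: (is_deriveD (fd x) (gd x)). Qed.

Lemma der_cst (k : R) : der (fun=> k) (fun=> 0).
Proof. by move=> x; exact: is_derive_cst. Qed.

Lemma der_id : der (fun x : R => x) (fun=> 1).
Proof. by move=> x; exact: is_derive_id. Qed.

Lemma der_eq f f' g' : (forall x, f' x = g' x) -> der f f' -> der f g'.
Proof. by move=> /funext ->. Qed.

Lemma derZ (k : R) f f' : der f f' -> der (fun x => k * f x) (fun x => k * f' x).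
Proof.
by move=> fd; apply: der_eq (derM (der_cst k) fd) => x; rewrite mul0r add0r.
Qed.

Lemma derN f f' : der f f' -> der (fun x => - f x) (fun x => - f' x).
Proof. by move=> fd x; exact: (is_deriveN (fd x)). Qed.

Lemma derB f f' g g' : der f f' -> der g g' ->
  der (fun x => f x - g x) (fun x => f' x - g' x).
Proof. by move=> fd gd; apply: derD => //; exact: derN. Qed.

Lemma der_comp f f' g g' : der f f' -> der g g' ->
  der (fun x => f (g x)) (fun x => f' (g x) * g' x).
Proof. by move=> fd gd x; exact: (is_derive1_comp (fd (g x)) (gd x)). Qed.

Lemma der_cas (xi : R) : der (fun x => cas (x * xi)) (fun x => xi * cas (- (x * xi))).
Proof.
have d1 : der (fun x : R => x * xi) (fun=> xi).
  by apply: der_eq (derM der_id (der_cst xi)) => x; ring.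
have c := der_comp (fun x => is_derive_cos x) d1.
have s := der_comp (fun x => is_derive_sin x) d1.
apply: der_eq (derD c s) => x.
by rewrite /cas cosN sinN; ring.
Qed.

Lemma cas_cont1 (xi : R) : continuous (fun x : R => cas (x * xi)).
Proof. exact: der_cont (@der_cas xi). Qed.

(** The square of [v] is integrable with integrable derivative 2 v v', so it vanishes at
    infinity. *)
Lemma sqint_vanish v v' : der v v' -> continuous v' -> sqint v -> sqint v' ->
  v n%:R @[n --> \oo] --> 0 /\ v (- n%:R) @[n --> \oo] --> 0.
Proof.
move=> vd cv' vi v'i; have cv := der_cont vd.
have d2 := derM vd vd.
have c2 : continuous (fun x => v' x * v x + v x * v' x).
  by move=> x; apply: cvgD; apply: cvgM; [exact: cv'|exact: cv|exact: cv|exact: cv'].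
have i1 : intg (fun x => v x * v x) by exact: sqint_mul.
have i2 : intg (fun x => v' x * v x + v x * v' x).
  by apply: intgD; exact: sqint_mul.
have P (u : nat -> R) : v (u n) * v (u n) @[n --> \oo] --> 0 -> v (u n) @[n --> \oo] --> 0.
  move=> H; apply/cvgr0Pnorm_le => e e0; move/cvgr0Pnorm_le : H => /(_ (e ^+ 2) (exprn_gt0 _ e0)).
  apply: filterS => n; rewrite normrM -expr2 ler_pXn2r ?nnegrE//; exact: ltW.
split; apply: P; [exact: (vanish_infty d2 c2 i1 i2)|exact: (vanish_inftyN d2 c2 i1 i2)].
Qed.

Lemma hartley_trunc_der N v v' xi : der v v' -> continuous v' ->
  hartley_trunc N v' xi = v N%:R * cas (N%:R * xi) - v (- N%:R) * cas (- N%:R * xi)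
    - xi * hartley_trunc N v (- xi).
Proof.
move=> vd cv'; have cv := der_cont vd.
have nn : - N%:R <= N%:R :> R by apply: (@le_trans _ _ 0); rewrite ?oppr_le0.
have cc : continuous (fun x : R => cas (- (x * xi))).
  by under eq_fun do rewrite -mulrN; exact: cas_cont1.
have c1 : continuous (fun x => v' x * cas (x * xi)).
  by move=> x; apply: cvgM; [exact: cv'|exact: cas_cont1].
have c2 : continuous (fun x => v x * (xi * cas (- (x * xi)))).
  move=> x; apply: cvgM; [exact: cv|apply: cvgM; [exact: cvg_cst|exact: cc]].
have := ftc nn (derM vd (@der_cas xi)) (fun x => cvgD (c1 x) (c2 x)).
move=> <-; rewrite (@Rint_eq _ _ (fun x => v' x * cas (x * xi) * ind (- N%:R) N%:R x
    + v x * (xi * cas (- (x * xi))) * ind (- N%:R) N%:R x)); last first.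
  by move=> x; rewrite mulrDl.
rewrite RintD; [|exact: cont_intg_ind..].
rewrite /hartley_trunc /hartley -RintZ; last first.
  have c3 : continuous (fun x => v x * cas (- (x * xi))).
    by move=> x; apply: cvgM; [exact: cv|exact: cc].
  by apply: intg_eq (cont_intg_ind (- N%:R) N%:R c3) => x; rewrite /trunc mulrN mulrAC.
rewrite [X in _ + X - _](@Rint_eq _ _ (fun x => xi * (trunc N v x * cas (x * - xi)))).
  by rewrite addrK; apply: Rint_eq => x; rewrite /trunc mulrAC.
by move=> x; rewrite /trunc mulrN; ring.
Qed.

(** The converse direction: v' is known to be in L2, and the decay of the transform is deduced.
    Integration by parts on [-N, N] relates the truncated transforms of v and v', with boundary
    terms that are bounded in xi and tend to 0 with v(N) and v(-N). *)
Lemma is_hartley_der2 v v' h : der v v' -> continuous v' -> sqint v -> sqint v' ->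
  is_hartley v h -> sqint (fun xi => xi * h xi) /\ is_hartley v' (fun xi => - xi * h (- xi)).
Proof.
move=> vd cv' vi v'i vh; have hi := is_hartley_sq vh.
have [h' vh'] := is_hartley_ex v'i; have h'i := is_hartley_sq vh'.
have mh := sqint_meas hi; have mhr := sqint_meas (sqint_refl hi).
have [v1 v2] := sqint_vanish vd cv' vi v'i.
have mG : measurable_fun setT (fun xi : R => - xi * h (- xi)).
  by apply: measurable_funM => //; apply: measurableT_comp.
pose e xi := h' xi - (- xi * h (- xi)).
have dh' N := sqintB h'i (hartley_trunc_sq N v'i).
have dh N := sqintB hi (hartley_trunc_sq N vi).
have le_i : sqint (fun xi => lorentz xi * e xi).
  have -> : (fun xi => lorentz xi * e xi) = fun xi => lorentz xi * h' xi + (xi * lorentz xi) * h (- xi).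
    by apply/funext => xi; rewrite /e; ring.
  apply: sqintD; first exact: (sqintMb lorentz_meas lorentz_le1).
  apply: (sqintMb _ mul_lorentz_le1); last exact: sqint_refl.
  by apply: measurable_funM => //; exact: lorentz_meas.
have mb (a : R) : measurable_fun setT (fun xi : R => cas (a * xi)).
  by under eq_fun do rewrite mulrC; exact: cas_meas1.
pose b N xi := v N%:R * cas (N%:R * xi) - v (- N%:R) * cas (- N%:R * xi).
have mbN N : measurable_fun setT (b N).
  by apply: measurable_funB; apply: measurable_funM => //; exact: mb.
have bN N xi : `|b N xi| <= 2 * (`|v N%:R| + `|v (- N%:R)|).
  apply: (le_trans (ler_normB _ _)); rewrite !normrM.
  have := ler_wpM2l (normr_ge0 (v N%:R)) (cas_le2 (N%:R * xi)).
  have := ler_wpM2l (normr_ge0 (v (- N%:R))) (cas_le2 (- N%:R * xi)); lra.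
(* Multiplying by [lorentz] makes the factor xi bounded and the boundary terms square integrable in
   xi; then every error in the truncated identity tends to 0 in L2. *)
have z0 : nrm (fun xi => lorentz xi * e xi) = 0.
  have cb : 2 * (`|v N%:R| + `|v (- N%:R)|) * nrm (@lorentz R) @[N --> \oo] --> 0.
    have E00 : 2 * (`|0 : R| + `|0 : R|) * nrm (@lorentz R) = 0.
      by rewrite normr0 addr0 mulr0 mul0r.
    rewrite -[X in _ --> X]E00.
    apply: cvgM; last exact: cvg_cst.
    apply: cvgM; first exact: cvg_cst.
    by apply: cvgD; apply: cvg_norm.
  have cc : nrm (fun xi => h' xi - hartley_trunc N v' xi) + nrm (fun xi => h xi - hartley_trunc N v xi) @[N --> \oo] --> 0.
    by rewrite -(addr0 0); apply: cvgD; [exact: vh'.2|exact: vh.2].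
  apply: cst_cvg0 cc cb; first exact: nrm_ge0.
  move=> N.
  have i1 := sqintMb lorentz_meas lorentz_le1 (dh' N).
  have m2 : measurable_fun setT (fun xi : R => xi * lorentz xi).
    by apply: measurable_funM => //; exact: lorentz_meas.
  have i2 := sqintMb m2 mul_lorentz_le1 (sqint_refl (dh N)).
  have i3 := sqintMb (mbN N) (bN N) lorentz_sq.
  have -> : (fun xi => lorentz xi * e xi) = fun xi => lorentz xi * (h' xi - hartley_trunc N v' xi)
      + xi * lorentz xi * (h (- xi) - hartley_trunc N v (- xi)) + b N xi * lorentz xi.
    by apply/funext => xi; rewrite /e (hartley_trunc_der N xi vd cv') /b; ring.
  apply: (le_trans (nrmD (sqintD i1 i2) i3)); apply: lerD; last first.
    by apply: (nrmMb (mbN N) (bN N)); exact: lorentz_sq.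
  apply: (le_trans (nrmD i1 i2)); apply: lerD.
    by rewrite -[leRHS]mul1r; apply: (nrmMb lorentz_meas lorentz_le1).
  rewrite -[leRHS]mul1r -(nrm_refl (dh N)); exact: (nrmMb m2 mul_lorentz_le1 (sqint_refl (dh N))).
have e0 : {ae mu, forall xi, - xi * h (- xi) = h' xi}.
  apply: ae_imp (nrm_le0 le_i z0) => xi /eqP.
  by rewrite mulf_eq0 gt_eqF ?lorentz_gt0//= /e subr_eq0 => /eqP ->.
have Gi : sqint (fun xi => - xi * h (- xi)) by exact: sqint_ae e0 h'i.
split; last exact: is_hartley_ae vh' mG e0.
by have := sqint_refl Gi; under eq_fun do rewrite opprK.
Qed.

End hartley_and_derivative.

(** * Commutator of a decaying weight with the multiplier <xi> *)

Section commutator.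
Context {R : realType}.
Notation mu := (@lebesgue_measure R).
Implicit Types (f g v h r w rho : R -> R).

(** For even [rho] the sine term of [casM] integrates to 0, and the sine integral at xi - eta, which
    vanishes too, is added to rebuild [cas]. *)
Lemma hartley_mod (rho : R -> R) (xi eta : R) : intg rho -> (forall x, rho (- x) = rho x) ->
  hartley (fun x => rho x * cas (x * xi)) eta = hartley rho (xi - eta).
Proof.
move=> ri re.
have mc (a : R) : measurable_fun setT (fun x : R => cos (x * a)).
  by under eq_fun do rewrite mulrC; exact: cos_meas.
have ms (a : R) : measurable_fun setT (fun x : R => sin (x * a)).
  by under eq_fun do rewrite mulrC; exact: sin_meas.
have ci (a : R) : intg (fun x => rho x * cos (x * a)).
  exact: (intgMb (mc a) (fun x => cos_max _) ri).
have si (a : R) : intg (fun x => rho x * sin (x * a)).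
  exact: (intgMb (ms a) (fun x => sin_max _) ri).
have s0 (a : R) : \int[mu]_x (rho x * sin (x * a)) = 0.
  by apply: Rint_odd => // x; rewrite re mulNr sinN mulrN.
transitivity (\int[mu]_x (rho x * cos (x * (xi - eta)) + rho x * sin (x * (xi + eta)))).
  by apply: Rint_eq => x; rewrite -mulrA casM mulrBr !mulrDr.
rewrite RintD// s0 addr0 -[LHS]addr0 -(s0 (xi - eta)) -RintD// /hartley.
by apply: Rint_eq => x; rewrite /cas -mulrDr.
Qed.

Lemma trunc_even N rho x : (forall x, rho (- x) = rho x) -> trunc N rho (- x) = trunc N rho x.
Proof.
move=> re; rewrite /trunc re !indE; congr (_ * (nat_of_bool _)%:R).
by apply/idP/idP => /andP[? ?]; apply/andP; split; lra.
Qed.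

Lemma is_hartley_mod rho r (xi : R) : sqint rho -> (forall x, rho (- x) = rho x) -> is_hartley rho r ->
  is_hartley (fun x => rho x * cas (x * xi)) (fun eta => r (xi - eta)).
Proof.
move=> ri re rr; have r2 := is_hartley_sq rr.
have S f : sqint f -> sqint (fun x => f x * cas (x * xi)).
  move=> fi; under eq_fun do rewrite mulrC.
  by apply: (sqintMb _ (fun x => cas_le2 _)) => //; exact: cas_meas1.
apply: (@is_hartley_lim _ (fun N x => trunc N rho x * cas (x * xi)) (fun N eta => hartley_trunc N rho (xi - eta))).
- exact: S.
- exact: sqint_rev.
- by move=> N; apply: S; exact: trunc_sq.
- move=> N.
  have -> : (fun eta => hartley_trunc N rho (xi - eta)) = hartley (fun x => trunc N rho x * cas (x * xi)).
    apply/funext => eta; rewrite hartley_mod//; first exact: trunc_intg.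
    by move=> x; exact: trunc_even.
  by apply: is_hartley_int; [apply: S; exact: trunc_sq|apply: intg_cas; exact: trunc_intg].
- have H : 2 * nrm (fun x => rho x - trunc N rho x) @[N --> \oo] --> 0.
    by rewrite -(mulr0 2); apply: cvgM; [exact: cvg_cst|exact: trunc_nrm].
  have H0 : (fun _ : nat => (0 : R)) @ \oo --> 0 by exact: cvg_cst.
  apply: (cvg0_le _ H H0) => N; rewrite nrm_ge0 addr0 /=.
  have d := sqintB ri (trunc_sq N ri).
  have -> : (fun x => rho x * cas (x * xi) - trunc N rho x * cas (x * xi)) =
    fun x => cas (x * xi) * (rho x - trunc N rho x) by apply/funext => x; ring.
  exact: (nrmMb (cas_meas1 xi) (fun x => cas_le2 _) d).
- have -> : (fun N => nrm (fun eta => r (xi - eta) - hartley_trunc N rho (xi - eta))) =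
      fun N => nrm (fun eta => r eta - hartley_trunc N rho eta).
    by apply/funext => N; rewrite -(nrm_rev xi (sqintB r2 (hartley_trunc_sq N ri))).
  exact: rr.2.
Qed.

(** The transform of the product at xi is the pairing of [w] with rho(x) cas(x xi), to which the
    polarized Plancherel identity applies. Evenness of the weight is what produces a plain
    convolution. *)
Lemma is_hartley_mul rho r w k : sqint rho -> (forall x, rho (- x) = rho x) -> is_hartley rho r ->
  sqint w -> is_hartley w k -> sqint (fun x => rho x * w x) ->
  is_hartley (fun x => rho x * w x) (fun xi => kappa^-1 * \int[mu]_eta (k eta * r (xi - eta))).
Proof.
move=> ri re rr wi wk rwi.
have -> : (fun xi => kappa^-1 * \int[mu]_eta (k eta * r (xi - eta))) =
    hartley (fun x => rho x * w x).
  apply/funext => xi; rewrite -[X in _ * X]/(ip k (fun eta => r (xi - eta))).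
  have ci : sqint (fun x => rho x * cas (x * xi)).
    under eq_fun do rewrite mulrC.
    by apply: (sqintMb _ (fun x => cas_le2 _)) => //; exact: cas_meas1.
  rewrite (is_hartley_ip wi ci wk (is_hartley_mod xi ri re rr)) mulKf ?gt_eqF ?kappa_gt0//.
  by apply: Rint_eq => x; ring.
by apply: is_hartley_int => //; exact: sqint_mul.
Qed.

Lemma rev_meas2 (m : R -> R) : measurable_fun setT m ->
  measurable_fun setT (fun z : R * R => m (z.1 - z.2)).
Proof.
move=> mm; apply: (@measurableT_comp _ _ _ _ _ _ m) => //.
exact: measurable_funB.
Qed.

(** Writing the kernel as a product of two square roots, Cauchy-Schwarz bounds the squared
    convolution by M times [Q], the convolution of h^2 with [m]. Tonelli's theorem evaluates the
    integral of [Q] as M |h|^2. *)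
Lemma young_convolution (m h : R -> R) B : (forall x, 0 <= m x <= B) -> intg m -> sqint h ->
  sqint (fun xi => \int[mu]_eta (`|h eta| * m (xi - eta))) /\
  nsq (fun xi => \int[mu]_eta (`|h eta| * m (xi - eta))) <=
    (\int[mu]_x m x) ^+ 2 * nsq h.
Proof.
move=> mB mi hi; have mm := intg_meas mi; have [mh h2] := hi.
have m0 x : 0 <= m x by have /andP[] := mB x.
have mle x : `|m x| <= B by have /andP[a b] := mB x; rewrite ger0_norm.
have B0 : 0 <= B by apply: le_trans (mle 0).
pose M := \int[mu]_x m x; have M0 : 0 <= M by apply: Rint_ge0 => z; have /andP[] := mB z.
have mr xi : measurable_fun setT (fun eta : R => m (xi - eta)) by exact: intg_meas (intg_rev xi mi).
pose Y xi := \int[mu]_eta (`|h eta| * m (xi - eta)).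
pose Q xi := \int[mu]_eta (h eta ^+ 2 * m (xi - eta)).
have mY : measurable_fun setT Y.
  apply: (measurable_Rint (f := fun z => `|h z.2| * m (z.1 - z.2))).
  apply: measurable_funM; last exact: rev_meas2.
  by apply: measurableT_comp => //; exact: measurableT_comp.
have mQ : measurable_fun setT Q.
  apply: (measurable_Rint (f := fun z => h z.2 ^+ 2 * m (z.1 - z.2))).
  apply: measurable_funM; last exact: rev_meas2.
  by apply: measurable_funX; exact: measurableT_comp.
have qi xi : intg (fun eta => h eta ^+ 2 * m (xi - eta)).
  exact: (intgMb (mr xi) (fun eta => mle _) h2).
have YQ xi : Y xi ^+ 2 <= Q xi * M.
  pose s eta := Num.sqrt (m (xi - eta)).
  have s2 eta : s eta ^+ 2 = m (xi - eta) by rewrite sqr_sqrtr.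
  have ms : measurable_fun setT s.
    apply: measurableT_comp => //; apply: continuous_measurable_fun.
    exact: sqrt_continuous.
  have si : sqint s by split => //; apply: intg_eq (intg_rev xi mi) => eta; rewrite s2.
  have hsi : sqint (fun eta => `|h eta| * s eta).
    split; first by apply: measurable_funM => //; exact: measurableT_comp.
    by apply: intg_eq (qi xi) => eta; rewrite exprMn s2 real_normK// num_real.
  have := cauchy_schwarz hsi si; rewrite !nsqE.
  have -> : ip (fun eta => `|h eta| * s eta) s = Y xi.
    by apply: Rint_eq => eta; rewrite -mulrA -expr2 s2.
  have -> : \int[mu]_x ((`|h x| * s x) ^+ 2) = Q xi.
    by apply: Rint_eq => eta; rewrite exprMn s2 real_normK// num_real.
  have -> // : \int[mu]_x (s x ^+ 2) = M.
  rewrite -[M](Rint_rev xi mi); exact: Rint_eq.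
have eQ : (\int[mu]_xi (Q xi)%:E = (M * nsq h)%:E)%E.
  have mf2 : measurable_fun setT (fun z : R * R => (h z.2 ^+ 2 * m (z.1 - z.2))%:E).
    apply/measurable_EFinP; apply: measurable_funM; last exact: rev_meas2.
    by apply: measurable_funX; exact: measurableT_comp.
  have := @fubini_tonelli _ _ _ _ R mu mu _ mf2 _.
  move=> /(_ (fun z => _)) FT.
  transitivity (\int[mu]_xi \int[mu]_eta (h eta ^+ 2 * m (xi - eta))%:E)%E.
    by apply: eq_integral => xi _; rewrite intE.
  rewrite FT; last by move=> z; rewrite lee_fin mulr_ge0 ?sqr_ge0.
  transitivity (\int[mu]_eta (M * h eta ^+ 2)%:E)%E.
    apply: eq_integral => eta _.
    have i := intgZ (h eta ^+ 2) (intg_shift (- eta) mi).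
    rewrite (intE i) RintZ; last exact: (intg_shift (- eta) mi).
    by rewrite Rint_shift// mulrC.
  by rewrite intE ?RintZ ?nsqE//; exact: intgZ.
have Qi : intg Q.
  apply: intg_ge0P => // [xi|]; last by rewrite eQ ltry.
  by apply: Rint_ge0 => eta; rewrite mulr_ge0 ?sqr_ge0.
have QI : \int[mu]_xi Q xi = M * nsq h.
  by apply: EFin_inj; rewrite -intE.
have QMi := intgZ M Qi.
have Yi : sqint Y.
  split => //; apply: intg_le QMi; first exact: measurable_funX.
  move=> xi; rewrite ger0_norm ?sqr_ge0// (le_trans (YQ xi))// mulrC; exact: ler_norm.
split => //; rewrite nsqE -/M expr2 -mulrA -QI -RintZ//.
by apply: Rint_le => [||xi]; [exact: Yi.2|exact: QMi|rewrite mulrC; exact: YQ].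
Qed.

Lemma jap_ge1 (x : R) : 1 <= jap x.
Proof. by rewrite /jap -[leLHS]sqrtr1 ler_wsqrtr// lerDl sqr_ge0. Qed.

Lemma jap_gt0 (x : R) : 0 < jap x. Proof. exact: lt_le_trans ltr01 (jap_ge1 x). Qed.

Lemma jap_sq (x : R) : jap x ^+ 2 = 1 + x ^+ 2.
Proof. by rewrite /jap sqr_sqrtr// addr_ge0// sqr_ge0. Qed.

Lemma jap_meas : measurable_fun setT (@jap R).
Proof.
apply: measurableT_comp; last by apply: measurable_funD => //; exact: measurable_funX.
by apply: continuous_measurable_fun; exact: sqrt_continuous.
Qed.

(** The difference of the squares is (x - y)(x + y), and |x + y| <= <x> + <y>. This Lipschitz bound
    turns the kernel of the commutator into |zeta r(zeta)|. *)
Lemma jap_lip (x y : R) : `|jap x - jap y| <= `|x - y|.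
Proof.
have j0 : 0 < jap x + jap y by rewrite addr_gt0 ?jap_gt0.
have E : (jap x - jap y) * (jap x + jap y) = (x - y) * (x + y).
  by rewrite -subr_sqr !jap_sq; ring.
have H : `|x + y| <= jap x + jap y.
  have L (z : R) : `|z| <= jap z.
    rewrite -(@ler_pXn2r _ 2)// ?nnegrE ?(ltW (jap_gt0 _))// jap_sq real_normK ?num_real//.
    by rewrite lerDr.
  exact: le_trans (ler_normD _ _) (lerD (L x) (L y)).
rewrite -(ler_pM2r j0) -[X in _ * X <= _](ger0_norm (ltW j0)) -normrM E normrM.
by rewrite ler_wpM2l.
Qed.

Lemma nsq_jap h : sqint h -> sqint (fun xi => xi * h xi) ->
  sqint (fun xi => jap xi * h xi) /\
  nsq (fun xi => jap xi * h xi) = nsq h + nsq (fun xi => xi * h xi).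
Proof.
move=> hi xhi; have E xi : (jap xi * h xi) ^+ 2 = h xi ^+ 2 + (xi * h xi) ^+ 2.
  by rewrite exprMn jap_sq; ring.
have i := intgD hi.2 xhi.2.
split.
  split; first by apply: measurable_funM; [exact: jap_meas|exact: sqint_meas].
  by apply: intg_eq i => xi; rewrite E.
rewrite !nsqE -RintD; [|exact: hi.2|exact: xhi.2].
by apply: Rint_eq.
Qed.

Lemma jap_inv_sq : sqint (fun x : R => (jap x)^-1).
Proof.
split; first by apply: (measurableT_comp measurable_inv); exact: jap_meas.
by apply: intg_eq intg_lorentz => x; rewrite exprVn jap_sq.
Qed.

(** Cauchy-Schwarz against 1 / <xi>, which is square integrable. *)
Lemma intg_H1 h : sqint h -> sqint (fun xi => xi * h xi) -> intg h.
Proof.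
move=> hi xhi; have [ji _] := nsq_jap hi xhi.
apply: intg_eq (sqint_mul ji jap_inv_sq) => xi.
by rewrite mulrAC mulfV ?mul1r// gt_eqF// jap_gt0.
Qed.

Lemma nrm_jap h : sqint h -> sqint (fun xi => xi * h xi) ->
  nrm (fun xi => jap xi * h xi) <= nrm h + nrm (fun xi => xi * h xi).
Proof.
move=> hi xhi; have [_ E] := nsq_jap hi xhi.
rewrite -(@ler_pXn2r _ 2)// ?nnegrE ?addr_ge0 ?nrm_ge0// nrm_sq E -!nrm_sq.
have := mulr_ge0 (nrm_ge0 h) (nrm_ge0 (fun xi => xi * h xi)).
rewrite sqrrD; lra.
Qed.

(* The commutator of rho with the multiplier <xi> is bounded on L2: its kernel
   is (<eta> - <xi>) r(xi - eta), dominated by |zeta r(zeta)| which is integrable. *)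
Lemma weighted_jap rho rho1 rho2 : sqint rho -> (forall x, rho (- x) = rho x) ->
  (forall x, `|rho x| <= 1) -> der rho rho1 -> der rho1 rho2 -> continuous rho2 ->
  sqint rho1 -> sqint rho2 -> intg rho1 ->
  exists2 C : R, 0 <= C & forall u u1 w h, sqint u -> der u u1 -> continuous u1 ->
    sqint u1 -> is_hartley u h -> sqint w -> is_hartley w (fun xi => jap xi * h xi) ->
    sqint (fun x => rho1 x * u x + rho x * u1 x) ->
    nrm (fun x => rho x * w x) <=
      nrm (fun x => rho x * u x) + nrm (fun x => rho1 x * u x + rho x * u1 x) + C * nrm u.
Proof.
move=> ri re rb d1 d2 c2 r1i r2i r1L; have k0 := @kappa_gt0 R.
have c1 := der_cont d2; have c0' := der_cont d1.
have [r rr] := is_hartley_ex ri; have r_i := is_hartley_sq rr.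
have [xri r1H] := is_hartley_der2 d1 c1 ri r1i rr.
have r1H' := is_hartley_int r1i r1L; have Hi1 := is_hartley_sq r1H'.
have [xHi _] := is_hartley_der2 d2 c2 r1i r2i r1H'.
have HL := intg_H1 Hi1 xHi.
(* Almost everywhere this is |z r(z)|, by uniqueness of the transform of [rho1]. Being an integral
   transform of an integrable function it is bounded at every point, and [HL] makes it integrable:
   the two hypotheses of [young_convolution]. *)
pose m z := `|hartley rho1 (- z)|.
have mL : intg m by apply: intg_abs; exact: (intg_refl HL).
pose B := 2 * \int[mu]_x `|rho1 x|.
have mB z : 0 <= m z <= B by rewrite normr_ge0 /= hartley_le.
pose g z := `|z * r z| - m z.
have mi : sqint m by apply: sqint_abs; exact: sqint_refl.
have gi : sqint g by apply: sqintB => //; exact: sqint_abs.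
have g0 : nrm g = 0.
  rewrite -(nrm_refl gi); apply: nrm_ae0; first exact: sqint_meas (sqint_refl gi).
  have E := is_hartley_uniq r1i r1H r1H'.
  by apply: ae_imp E => x E; rewrite /g /m E opprK subrr.
have gr xi : {ae mu, forall eta, `|(xi - eta) * r (xi - eta)| = m (xi - eta)}.
  have := nrm_le0 (sqint_rev xi gi); rewrite (nrm_rev xi gi) => /(_ g0).
  by apply: ae_imp => eta /eqP; rewrite subr_eq0 => /eqP.
pose M := \int[mu]_x m x; have M0 : 0 <= M by apply: Rint_ge0 => z; have /andP[] := mB z.
exists (kappa^-1 * M); first by rewrite mulr_ge0// invr_ge0 ltW.
move=> u u1 w h ui ud cu1 u1i uh wi wh rui; have hi := is_hartley_sq uh.
have jhi := is_hartley_sq wh.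
have mrho : measurable_fun setT rho := sqint_meas ri.
have rwi := sqintMb mrho rb wi; have rui0 := sqintMb mrho rb ui.
have wk := is_hartley_mul ri re rr wi wh rwi.
have ul := is_hartley_mul ri re rr ui uh rui0.
pose k xi := kappa^-1 * \int[mu]_eta (jap eta * h eta * r (xi - eta)).
pose l xi := kappa^-1 * \int[mu]_eta (h eta * r (xi - eta)).
change (is_hartley (fun xi => rho xi * w xi) k) in wk.
change (is_hartley (fun xi => rho xi * u xi) l) in ul.
have ki := is_hartley_sq wk; have li := is_hartley_sq ul.
have cu := der_cont ud.
have cd : continuous (fun x => rho1 x * u x + rho x * u1 x).
  by move=> x; apply: cvgD; apply: cvgM; [exact: c1|exact: cu|exact: c0'|exact: cu1].
have [xli dl] := is_hartley_der2 (derM d1 ud) cd rui0 rui ul.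
have [jli _] := nsq_jap li xli.
pose Y xi := \int[mu]_eta (`|h eta| * m (xi - eta)).
have [Yi Yle] := young_convolution mB mL hi.
have di := sqintB ki jli.
(* Up to normalization the difference k - <xi> l is the transform of the commutator applied to [u];
   the Lipschitz bound on <xi> dominates its kernel by [m]. *)
have dY xi : `|k xi - jap xi * l xi| <= `|kappa^-1 * Y xi|.
  have rri := sqint_rev xi r_i; have xrri := sqint_rev xi xri.
  have i1 := sqint_mul jhi rri; have i2 := intgZ (jap xi) (sqint_mul hi rri).
  have Y0 : 0 <= Y xi.
    by apply: Rint_ge0 => eta; rewrite mulr_ge0//; have /andP[] := mB (xi - eta).
  have -> : k xi - jap xi * l xi = kappa^-1 * \int[mu]_eta
      (jap eta * h eta * r (xi - eta) - jap xi * (h eta * r (xi - eta))).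
    rewrite (RintB i1 i2) (RintZ _ (sqint_mul hi rri)) /k /l mulrBr; congr (_ - _).
    by rewrite mulrCA.
  rewrite !normrM ler_wpM2l// (ger0_norm Y0).
  apply: (le_trans (Rint_abs (intgB i1 i2))).
  have -> : Y xi = \int[mu]_eta (`|h eta| * `|(xi - eta) * r (xi - eta)|).
    apply: Rint_ae.
    - apply: intg_meas; apply: sqint_mul; first exact: sqint_abs.
      exact: sqint_rev.
    - by apply: intg_meas; apply: sqint_mul; [exact: sqint_abs|exact: sqint_abs].
    - by apply: ae_imp (gr xi) => eta ->.
  apply: Rint_le; first by apply: intg_abs; exact: (intgB i1 i2).
    by apply: sqint_mul; exact: sqint_abs.
  move=> eta /=.
  have -> : jap eta * h eta * r (xi - eta) - jap xi * (h eta * r (xi - eta)) =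
    (jap eta - jap xi) * (h eta * r (xi - eta)) by ring.
  rewrite !normrM mulrCA ler_wpM2l// ler_wpM2r// distrC; exact: jap_lip.
have dn : nrm (fun xi => k xi - jap xi * l xi) <= kappa^-1 * M * nrm h.
  apply: (le_trans (ler_nrm (sqint_meas di) dY (sqintZ _ Yi))).
  rewrite nrmZ// gtr0_norm ?invr_gt0// -mulrA; apply: ler_wpM2l; first by rewrite invr_ge0 ltW.
  rewrite -(@ler_pXn2r _ 2)// ?nnegrE ?mulr_ge0 ?nrm_ge0// exprMn !nrm_sq; exact: Yle.
have sk0 : 0 < Num.sqrt kappa :> R by rewrite sqrtr_gt0.
rewrite -(ler_pM2l sk0) -(is_hartley_nrm rwi wk).
(* The part <xi> l is controlled by rho u and its derivative, the commutator by [u] alone. *)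
have -> : nrm k = nrm (fun xi => jap xi * l xi + (k xi - jap xi * l xi)).
  by congr nrm; apply/funext => xi; rewrite addrC subrK.
apply: (le_trans (nrmD jli di)); rewrite mulrDr; apply: lerD.
  apply: (le_trans (nrm_jap li xli)); rewrite mulrDr (is_hartley_nrm rui0 ul) lerD2l.
  rewrite -(is_hartley_nrm rui dl) -(nrm_refl xli) //.
by apply: (le_trans dn); rewrite (is_hartley_nrm ui uh) mulrCA.
Qed.

End commutator.

(** * The norms of the statement in terms of [sqint] and [nrm] *)

Section Lnorm2.
Context {R : realType}.
Notation mu := (@lebesgue_measure R).
Implicit Types (f g : R -> R).

(** Neither function is assumed measurable: the integral of a nonnegative function is the supremum
    over the simple functions below it. The time norms of the forcing term are handled through
    this. *)
Lemma le_int d (T : measurableType d) (m : {measure set T -> \bar R})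
    (f g : T -> \bar R) : (forall x, 0 <= f x)%E -> (forall x, f x <= g x)%E ->
  (\int[m]_x f x <= \int[m]_x g x)%E.
Proof.
move=> f0 fg; have g0 x : (0 <= g x)%E by exact: le_trans (fg x).
rewrite !ge0_integralTE//; apply: le_ereal_sup => _ [h hf <-].
by exists h => // x; exact: le_trans (hf x) (fg x).
Qed.

Lemma Lnorm2E f : Lnorm mu 2%:E (fun x => (f x)%:E) =
  ((\int[mu]_x (f x ^+ 2)%:E) `^ 2^-1)%E.
Proof.
rewrite unlock; congr (_ `^ _)%E; apply: eq_integral => x _.
by rewrite /= powR_mulrn// -normrX ger0_norm// sqr_ge0.
Qed.

Lemma Lnorm2_sqint f : sqint f -> Lnorm mu 2%:E (fun x => (f x)%:E) = (nrm f)%:E.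
Proof.
move=> [mf fi]; rewrite Lnorm2E (intE fi) poweR_EFin powR12_sqrt ?nrmE ?nsqE//.
by apply: Rint_ge0 => x; exact: sqr_ge0.
Qed.

Lemma Lnorm2_lty f : measurable_fun setT f ->
  (Lnorm mu 2%:E (fun x => (f x)%:E) < +oo)%E -> sqint f.
Proof.
move=> mf; rewrite Lnorm2E => /lty_poweRy-/(_ (lt0r_neq0 _)) H.
split=> //; apply/intg_ge0P => [|x|]; first exact: measurable_funX.
  exact: sqr_ge0.
by apply: H; rewrite invr_gt0.
Qed.

Lemma Lnorm2_le f e : measurable_fun setT f ->
  (Lnorm mu 2%:E (fun x => (f x)%:E) <= e%:E)%E -> sqint f /\ nrm f <= e.
Proof.
move=> mf h; have fi : sqint f by apply: Lnorm2_lty => //; exact: le_lt_trans h (ltry _).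
by split=> //; rewrite -lee_fin -Lnorm2_sqint.
Qed.

Variable n : nat.
Implicit Types F : 'I_n -> R -> R.

Definition vnorm F x := Num.sqrt (\sum_(i < n) F i x ^+ 2).

Lemma vnorm_sq F x : vnorm F x ^+ 2 = \sum_(i < n) F i x ^+ 2.
Proof. by rewrite sqr_sqrtr// sumr_ge0// => i _; exact: sqr_ge0. Qed.

Lemma vnorm_meas F : (forall i, measurable_fun setT (F i)) -> measurable_fun setT (vnorm F).
Proof.
move=> mF; apply: (measurableT_comp (continuous_measurable_fun (@sqrt_continuous R))).
by apply: measurable_sum => i; exact: measurable_funX.
Qed.

Lemma vnorm_ge F i x : `|F i x| <= `|vnorm F x|.
Proof.
rewrite -(@ler_pXn2r _ 2)// ?nnegrE// -!normrX !ger0_norm ?sqr_ge0// vnorm_sq.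
by rewrite (bigD1 i)//= lerDl sumr_ge0// => j _; exact: sqr_ge0.
Qed.

Lemma vnorm_sqint F : (forall i, sqint (F i)) -> sqint (vnorm F).
Proof.
move=> Fi; split; first by apply: vnorm_meas => i; exact: sqint_meas (Fi i).
have e : (fun x => \sum_(i < n) F i x ^+ 2) =1 (fun x => vnorm F x ^+ 2).
  by move=> x; rewrite vnorm_sq.
by apply: (intg_eq e); apply: intg_sum => i; have [] := Fi i.
Qed.

Lemma vnorm_nsq F : (forall i, sqint (F i)) -> nsq (vnorm F) = \sum_(i < n) nsq (F i).
Proof.
move=> Fi; rewrite nsqE (@Rint_eq _ _ (fun x => \sum_(i < n) F i x ^+ 2)).
  rewrite Rint_sum; first by apply: eq_bigr => i _; rewrite nsqE.
  by move=> i; have [] := Fi i.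
by move=> x; rewrite vnorm_sq.
Qed.

Lemma sqint_vnorm F i : (forall i, measurable_fun setT (F i)) -> sqint (vnorm F) -> sqint (F i).
Proof. by move=> mF; apply: sqint_le => // x; exact: vnorm_ge. Qed.

End Lnorm2.

(** * Fourier and Hartley transforms *)

Section fourier_link.
Context {R : realType}.
Notation mu := (@lebesgue_measure R).
Variable n : nat.
Implicit Types (v w : R -> 'cV[R]_n) (h : 'I_n -> R -> R).

Definition cmp v (i : 'I_n) (x : R) : R := v x i 0.

Lemma L2P v : L2 v <-> forall i, sqint (cmp v i).
Proof.
split=> [[mv vf] i|vi].
  have mc j : measurable_fun setT (cmp v j) by exact: mv.
  by apply: sqint_vnorm => //; apply: Lnorm2_lty => //; exact: vnorm_meas.
split=> [i j|]; first by rewrite (ord1 j); exact: sqint_meas (vi i).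
have E := Lnorm2_sqint (vnorm_sqint vi).
by rewrite /L2norm (_ : (fun x => _) = fun x => (vnorm (cmp v) x)%:E)// E ltry.
Qed.

Lemma L2normE v : L2 v -> L2norm v = (nrm (vnorm (cmp v)))%:E.
Proof. by move=> /L2P vi; rewrite -(Lnorm2_sqint (vnorm_sqint vi)). Qed.

Definition even_part (g : R -> R) (x : R) := (g x + g (- x)) / 2.
Definition odd_part (g : R -> R) (x : R) := (g x - g (- x)) / 2.

(* The value at xi of the Fourier transform of a vector whose components have
   Hartley transforms h_i. *)
Definition ft_of_hartley h (xi : R) : 'cV[R[i]]_n :=
  \col_i (even_part (h i) xi -i* odd_part (h i) xi)%C.

Lemma cenorm_sq (z : 'cV[R[i]]_n) : cenorm z ^+ 2 =
  \sum_i (complex.Re (z i 0) ^+ 2 + complex.Im (z i 0) ^+ 2).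
Proof.
rewrite sqr_sqrtr ?sumr_ge0// => [|i _]; last exact: sqr_ge0.
apply: eq_bigr => i _; rewrite /ComplexField.Normc.normc.
by case: (z i 0) => a b /=; rewrite sqr_sqrtr// addr_ge0 ?sqr_ge0.
Qed.

Lemma cenorm_ge0 (z : 'cV[R[i]]_n) : 0 <= cenorm z.
Proof. exact: sqrtr_ge0. Qed.

Lemma cenorm_Re (z : 'cV[R[i]]_n) i : `|complex.Re (z i 0)| <= cenorm z.
Proof.
rewrite -(@ler_pXn2r _ 2)// ?nnegrE ?cenorm_ge0// -normrX ger0_norm ?sqr_ge0//.
rewrite cenorm_sq (bigD1 i)//= -addrA lerDl addr_ge0 ?sqr_ge0//.
by rewrite sumr_ge0// => j _; rewrite addr_ge0 ?sqr_ge0.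
Qed.

Lemma cenorm_Im (z : 'cV[R[i]]_n) i : `|complex.Im (z i 0)| <= cenorm z.
Proof.
rewrite -(@ler_pXn2r _ 2)// ?nnegrE ?cenorm_ge0// -normrX ger0_norm ?sqr_ge0//.
rewrite cenorm_sq (bigD1 i)//= addrAC lerDr addr_ge0 ?sqr_ge0//.
by rewrite sumr_ge0// => j _; rewrite addr_ge0 ?sqr_ge0.
Qed.

Lemma cenorm_meas (z : R -> 'cV[R[i]]_n) :
  (forall i, measurable_fun setT (fun xi => complex.Re (z xi i 0))) ->
  (forall i, measurable_fun setT (fun xi => complex.Im (z xi i 0))) ->
  measurable_fun setT (fun xi => cenorm (z xi)).
Proof.
move=> mr mi.
have -> : (fun xi => cenorm (z xi)) = (fun xi => Num.sqrt (\sum_i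
    (complex.Re (z xi i 0) ^+ 2 + complex.Im (z xi i 0) ^+ 2))).
  by apply/funext => xi; rewrite -cenorm_sq sqrtr_sqr ger0_norm// cenorm_ge0.
apply: (measurableT_comp (continuous_measurable_fun (@sqrt_continuous R))).
by apply: measurable_sum => i; apply: measurable_funD; exact: measurable_funX.
Qed.

Lemma cenorm_of_hartley_sq h (xi : R) :
  cenorm (ft_of_hartley h xi) ^+ 2 = \sum_i (h i xi ^+ 2 + h i (- xi) ^+ 2) / 2.
Proof.
rewrite cenorm_sq; apply: eq_bigr => i _; rewrite mxE /= sqrrN /even_part /odd_part.
by field.
Qed.

Lemma hartley_trunc_even N (g : R -> R) xi : sqint g ->
  even_part (hartley_trunc N g) xi = \int[mu]_(x in `[- N%:R, N%:R]) (g x * cos (x * xi)).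
Proof.
move=> gi; have ti := trunc_intg N gi.
rewrite Rint_itv /even_part /hartley_trunc /hartley -RintD; try exact: intg_cas.
rewrite mulrC -RintZ; last by apply: intgD; exact: intg_cas.
apply: Rint_eq => x; rewrite /trunc /cas mulrN cosN sinN.
by field.
Qed.

Lemma hartley_trunc_odd N (g : R -> R) xi : sqint g ->
  odd_part (hartley_trunc N g) xi = \int[mu]_(x in `[- N%:R, N%:R]) (g x * sin (x * xi)).
Proof.
move=> gi; have ti := trunc_intg N gi.
rewrite Rint_itv /odd_part /hartley_trunc /hartley -RintB; try exact: intg_cas.
rewrite mulrC -RintZ; last by apply: intgB; exact: intg_cas.
apply: Rint_eq => x; rewrite /trunc /cas mulrN cosN sinN.
by field.
Qed.

Lemma fourier_truncE N v : L2 v -> fourier_trunc N v = ft_of_hartley (fun i => hartley_trunc N (cmp v i)).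
Proof.
move=> /L2P vi; apply/funext => xi; apply/colP => i; rewrite !mxE.
by rewrite (hartley_trunc_even _ _ (vi i)) (hartley_trunc_odd _ _ (vi i)).
Qed.

Lemma ft_of_hartley_Re_meas h i : (forall i, measurable_fun setT (h i)) ->
  measurable_fun setT (fun xi => complex.Re (ft_of_hartley h xi i 0)).
Proof.
move=> mh; rewrite (_ : (fun xi => _) = even_part (h i)); last by apply/funext => x; rewrite mxE.
by apply: measurable_funM => //; apply: measurable_funD => //; exact: measurable_comp_refl.
Qed.

Lemma ft_of_hartley_Im_meas h i : (forall i, measurable_fun setT (h i)) ->
  measurable_fun setT (fun xi => complex.Im (ft_of_hartley h xi i 0)).
Proof.
move=> mh; rewrite (_ : (fun xi => _) = fun xi => - odd_part (h i) xi); last first.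
  by apply/funext => x; rewrite mxE.
apply: measurableT_comp => //.
by apply: measurable_funM => //; apply: measurable_funB => //; exact: measurable_comp_refl.
Qed.

Lemma ft_of_hartleyB h h' xi : ft_of_hartley h xi - ft_of_hartley h' xi = ft_of_hartley (fun i x => h i x - h' i x) xi.
Proof.
apply/colP => i; rewrite !mxE /even_part /odd_part; apply/eqP; rewrite eq_complex /=.
by apply/andP; split; apply/eqP; field.
Qed.

Lemma sqint_cenorm h : (forall i, sqint (h i)) ->
  sqint (fun xi => cenorm (ft_of_hartley h xi)) /\
  nsq (fun xi => cenorm (ft_of_hartley h xi)) = \sum_i nsq (h i).
Proof.
move=> hi; have mh i := sqint_meas (hi i).
have i1 i : intg (fun xi => (h i xi ^+ 2 + h i (- xi) ^+ 2) / 2).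
  have e : (fun xi => 2^-1 * (h i xi ^+ 2 + h i (- xi) ^+ 2)) =1
    (fun xi => (h i xi ^+ 2 + h i (- xi) ^+ 2) / 2) by move=> x; rewrite mulrC.
  apply: (intg_eq e); apply: intgZ; apply: intgD; first by have [] := hi i.
  by have [] := sqint_refl (hi i).
have e : (fun xi => \sum_i (h i xi ^+ 2 + h i (- xi) ^+ 2) / 2) =1
  (fun xi => cenorm (ft_of_hartley h xi) ^+ 2) by move=> x; rewrite cenorm_of_hartley_sq.
split; first split.
- by apply: cenorm_meas => i; [exact: ft_of_hartley_Re_meas|exact: ft_of_hartley_Im_meas].
- by apply: (intg_eq e); exact: intg_sum.
- rewrite nsqE -(Rint_eq e) Rint_sum//; apply: eq_bigr => i _.
  rewrite (@Rint_eq _ _ (fun xi => 2^-1 * (h i xi ^+ 2 + h i (- xi) ^+ 2))).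
    rewrite RintZ; last by apply: intgD; [have [] := hi i|have [] := sqint_refl (hi i)].
    rewrite RintD; [|by have [] := hi i|by have [] := sqint_refl (hi i)].
    rewrite -(nsqE (fun x => h i (- x))) -nsqE nsq_refl; last exact: hi.
    by field.
  by move=> x; rewrite mulrC.
Qed.

Lemma is_fourier_of_hartley v h : L2 v -> (forall i, is_hartley (cmp v i) (h i)) -> is_fourier v (ft_of_hartley h).
Proof.
move=> v2 vh; have vi := (L2P v).1 v2; have hi i := is_hartley_sq (vh i).
have mh i := sqint_meas (hi i).
have di N i : sqint (fun x => h i x - hartley_trunc N (cmp v i) x).
  by apply: sqintB => //; apply: hartley_trunc_sq.
split=> [i|i|]; [exact: ft_of_hartley_Re_meas|exact: ft_of_hartley_Im_meas|].
have E N : Lnorm mu 2%:E (fun xi => (cenorm (ft_of_hartley h xi - fourier_trunc N v xi))%:E) =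
    (Num.sqrt (\sum_i nsq (fun x => h i x - hartley_trunc N (cmp v i) x)))%:E.
  rewrite fourier_truncE//; under eq_Lnorm => xi do rewrite ft_of_hartleyB.
  by have [s1 s2] := sqint_cenorm (di N); rewrite Lnorm2_sqint// nrmE s2.
rewrite (_ : (fun N => _) = (fun N =>
   (Num.sqrt (\sum_i nsq (fun x => h i x - hartley_trunc N (cmp v i) x)))%:E)); last first.
  by apply/funext => N; rewrite E.
apply: cvg_EFin; first by near=> N.
rewrite -[X in _ --> X]sqrtr0; apply: continuous_cvg; first exact: sqrt_continuous.
rewrite [X in _ --> X](_ : 0 = \sum_(i < n) (0 : R)); last by rewrite big1.
apply: cvg_big => [|i _]; first exact: add_continuous.
by apply: nsq_nrm_cvg0; exact: (vh i).2.
Unshelve. all: by end_near.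
Qed.

Lemma ae_all (P : 'I_n -> R -> Prop) : (forall i, {ae mu, forall x, P i x}) ->
  {ae mu, forall x, forall i, P i x}.
Proof.
move=> aeP; suff : {ae mu, forall x, forall i, i \in enum 'I_n -> P i x}.
  by apply: ae_imp => x Px i; apply: Px; rewrite mem_enum.
elim: (enum 'I_n) => [|j s ih].
  by exists set0; split=> // x; apply: contra_notP => _ i.
apply: ae_imp (ae_and (aeP j) ih) => x [Pj Ps] i.
by rewrite inE => /predU1P[->//|/Ps].
Qed.

Lemma is_fourier_near v (w : R -> 'cV[R[i]]_n) (e : R) : L2 v -> is_fourier v w -> 0 < e -> \forall N \near \oo,
  sqint (fun xi => cenorm (w xi - fourier_trunc N v xi)) /\
  nrm (fun xi => cenorm (w xi - fourier_trunc N v xi)) <= e.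
Proof.
move=> v2 [mr mi /fine_cvgP[fin cv]] e0; have vi := (L2P v).1 v2.
have /cvgrPdist_le /(_ e e0) le := cv.
near=> N; apply: Lnorm2_le.
  apply: cenorm_meas => i.
    have -> : (fun xi => complex.Re ((w xi - fourier_trunc N v xi) i 0)) =
      (fun xi => complex.Re (w xi i 0) - complex.Re (fourier_trunc N v xi i 0)).
      by apply/funext => xi; rewrite !mxE; case: (w xi i 0).
    apply: measurable_funB => //; rewrite (fourier_truncE N v2); apply: ft_of_hartley_Re_meas => j.
    exact: sqint_meas (hartley_trunc_sq N (vi j)).
  have -> : (fun xi => complex.Im ((w xi - fourier_trunc N v xi) i 0)) =
    (fun xi => complex.Im (w xi i 0) - complex.Im (fourier_trunc N v xi i 0)).
    by apply/funext => xi; rewrite !mxE; case: (w xi i 0).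
  apply: measurable_funB => //; rewrite (fourier_truncE N v2); apply: ft_of_hartley_Im_meas => j.
  exact: sqint_meas (hartley_trunc_sq N (vi j)).
have fN : Lnorm mu 2%:E (fun xi => (cenorm (w xi - fourier_trunc N v xi))%:E)
  \is a fin_num by near: N.
rewrite -(fineK fN) lee_fin; apply: le_trans (ler_norm _) _.
by rewrite -normrN -sub0r; near: N; exact: le.
Unshelve. all: by end_near.
Qed.

Lemma near_ex2 (P Q : nat -> Prop) : (\forall N \near \oo, P N) ->
  (\forall N \near \oo, Q N) -> exists2 N, P N & Q N.
Proof. by move=> [N _ PN] [M _ QM]; exists (maxn N M); [apply: PN|apply: QM]; rewrite /= ?leq_maxl ?leq_maxr. Qed.

Lemma small_nrm (p : R -> R) : (forall e, 0 < e -> sqint p /\ nrm p <= e) ->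
  {ae mu, forall x, p x = 0}.
Proof.
move=> pe; have [pi _] := pe _ ltr01; apply: nrm_eq0 => //.
by apply/ler_addgt0Pr => e /pe[_]; rewrite add0r.
Qed.

Lemma fourier_uniq v (w w' : R -> 'cV[R[i]]_n) : L2 v -> is_fourier v w -> is_fourier v w' ->
  {ae mu, forall xi, w xi = w' xi}.
Proof.
move=> v2 vw vw'; have [mr mi _] := vw; have [mr' mi' _] := vw'.
(* Real and imaginary parts are compared separately, both functions being within e / 2 of the same
   truncated transform [q]. *)
have key (p p' : R -> 'I_n -> R) (e : R) i : 0 < e ->
    (forall i, measurable_fun setT (p^~ i)) -> (forall i, measurable_fun setT (p'^~ i)) ->
    (forall N xi, exists q, `|p xi i - q| <= cenorm (w xi - fourier_trunc N v xi) /\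
       `|p' xi i - q| <= cenorm (w' xi - fourier_trunc N v xi)) ->
    sqint (fun xi => p xi i - p' xi i) /\ nrm (fun xi => p xi i - p' xi i) <= e.
  move=> e0 mp mp' pq; have e2 : 0 < e / 2 by rewrite divr_gt0.
  have H1 := is_fourier_near v2 vw e2; have H2 := is_fourier_near v2 vw' e2.
  have [N [s1 n1] [s2 n2]] : exists2 N, sqint (fun xi => cenorm (w xi - fourier_trunc N v xi)) /\
      nrm (fun xi => cenorm (w xi - fourier_trunc N v xi)) <= e / 2 &
      sqint (fun xi => cenorm (w' xi - fourier_trunc N v xi)) /\
      nrm (fun xi => cenorm (w' xi - fourier_trunc N v xi)) <= e / 2.
    exact: near_ex2 H1 H2.
  have mB : measurable_fun setT (fun xi => p xi i - p' xi i).
    by apply: measurable_funB; [exact: mp|exact: mp'].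
  have le xi : `|p xi i - p' xi i| <= `|cenorm (w xi - fourier_trunc N v xi) +
      cenorm (w' xi - fourier_trunc N v xi)|.
    have [q [q1 q2]] := pq N xi; rewrite (le_trans _ (ler_norm _))//.
    by rewrite (le_trans (ler_distD q _ _))// lerD// distrC.
  have sD := sqintD s1 s2; split; first exact: sqint_le le sD.
  rewrite (le_trans (ler_nrm mB le sD))// (le_trans (nrmD s1 s2))//.
  by rewrite [e in _ <= e]splitr lerD.
have R0 i : {ae mu, forall xi, complex.Re (w xi i 0) - complex.Re (w' xi i 0) = 0}.
  apply: small_nrm => e e0; apply: (key (fun xi i => complex.Re (w xi i 0))
    (fun xi i => complex.Re (w' xi i 0))) => // N xi.
  exists (complex.Re (fourier_trunc N v xi i 0)).
  have := cenorm_Re (w xi - fourier_trunc N v xi) i.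
  have := cenorm_Re (w' xi - fourier_trunc N v xi) i; rewrite !mxE.
  by move: (w xi i 0) (w' xi i 0) => [? ?] [? ?].
have I0 i : {ae mu, forall xi, complex.Im (w xi i 0) - complex.Im (w' xi i 0) = 0}.
  apply: small_nrm => e e0; apply: (key (fun xi i => complex.Im (w xi i 0))
    (fun xi i => complex.Im (w' xi i 0))) => // N xi.
  exists (complex.Im (fourier_trunc N v xi i 0)).
  have := cenorm_Im (w xi - fourier_trunc N v xi) i.
  have := cenorm_Im (w' xi - fourier_trunc N v xi) i; rewrite !mxE.
  by move: (w xi i 0) (w' xi i 0) => [? ?] [? ?].
apply: ae_imp (ae_and (ae_all R0) (ae_all I0)) => xi [r0 i0].
apply/colP => i; move: (r0 i) (i0 i); case: (w xi i 0) => a b; case: (w' xi i 0) => a' b' /=.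
by move=> /eqP; rewrite subr_eq0 => /eqP -> /eqP; rewrite subr_eq0 => /eqP ->.
Qed.

(** [fourier] is a choice among the functions satisfying [is_fourier]: existence shows that the
    chosen one satisfies it, uniqueness that it agrees almost everywhere with the Hartley
    expression. *)
Lemma fourier_of_hartley v h : L2 v -> (forall i, is_hartley (cmp v i) (h i)) ->
  is_fourier v (fourier v) /\ {ae mu, forall xi, fourier v xi = ft_of_hartley h xi}.
Proof.
move=> v2 vh; have F := is_fourier_of_hartley v2 vh.
have F' : is_fourier v (fourier v).
  by apply: (@xgetPex _ _ [set w | is_fourier v w]); exists (ft_of_hartley h).
by split=> //; exact: fourier_uniq F' F.
Qed.

Lemma japX_meas (s : R) : measurable_fun setT (fun xi : R => jap xi `^ s).
Proof. exact: measurableT_comp (measurable_powR s) jap_meas. Qed.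

Lemma abs_le_jap (x : R) : `|x| <= jap x.
Proof.
rewrite -(@ler_pXn2r _ 2)// ?nnegrE ?(ltW (jap_gt0 x))// jap_sq -normrX.
by rewrite ger0_norm ?sqr_ge0// lerDr.
Qed.

(** Each [h i] is the sum of its even and odd parts, and either part is at most the modulus of the
    Fourier transform: hence the factor 2. The power is absorbed by |xi|^k <= <xi>^s. *)
Lemma Hnorm_le v h (s e : R) k : L2 v -> (forall i, is_hartley (cmp v i) (h i)) ->
  k%:R <= s -> (Hnorm s v <= e%:E)%E ->
  forall i, sqint (fun xi => xi ^+ k * h i xi) /\ nrm (fun xi => xi ^+ k * h i xi) <= 2 * e.
Proof.
move=> v2 vh ks; have [[mr mi _] aeh] := fourier_of_hartley v2 vh.
have mh i := sqint_meas (is_hartley_sq (vh i)).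
rewrite /Hnorm => Hle; have mg : measurable_fun setT
    (fun xi => jap xi `^ s * cenorm (fourier v xi)).
  by apply: measurable_funM; [exact: japX_meas|exact: cenorm_meas].
have [gi gle] := Lnorm2_le mg Hle => i.
have mk : measurable_fun setT (fun xi : R => xi ^+ k) by exact: exprn_measurable.
pose g' xi := jap xi `^ s * cenorm (ft_of_hartley h xi).
have mg' : measurable_fun setT g'.
  apply: measurable_funM; first exact: japX_meas.
  by apply: cenorm_meas => j; [exact: ft_of_hartley_Re_meas|exact: ft_of_hartley_Im_meas].
have aeg : {ae mu, forall xi, g' xi = jap xi `^ s * cenorm (fourier v xi)}.
  by apply: ae_imp aeh => xi ->.
have g'i := sqint_ae mg' aeg gi.
have g'le : nrm g' <= e by rewrite nrmE (nsq_ae mg' mg aeg).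
have kle xi : `|xi ^+ k| <= jap xi `^ s.
  rewrite normrX (le_trans (y := jap xi ^+ k))//.
    by apply: lerXn2r; rewrite ?nnegrE ?(ltW (jap_gt0 xi))//; exact: abs_le_jap.
  rewrite -powR_mulrn ?(ltW (jap_gt0 xi))//; apply: ler_powR => //; exact: jap_ge1.
have [e1 e2] : (forall xi, `|xi ^+ k * even_part (h i) xi| <= `|g' xi|) /\
    (forall xi, `|xi ^+ k * odd_part (h i) xi| <= `|g' xi|).
  split=> xi; rewrite [in leRHS]ger0_norm ?mulr_ge0 ?powR_ge0 ?cenorm_ge0// normrM ler_pM//.
    by have := cenorm_Re (ft_of_hartley h xi) i; rewrite mxE.
  by have := cenorm_Im (ft_of_hartley h xi) i; rewrite mxE /= normrN.
have m1 : measurable_fun setT (fun xi : R => xi ^+ k * even_part (h i) xi).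
  apply: measurable_funM => //; apply: measurable_funM => //; apply: measurable_funD => //.
  exact: measurable_comp_refl.
have m2 : measurable_fun setT (fun xi : R => xi ^+ k * odd_part (h i) xi).
  apply: measurable_funM => //; apply: measurable_funM => //; apply: measurable_funB => //.
  exact: measurable_comp_refl.
have -> : (fun xi => xi ^+ k * h i xi) =
    (fun xi => xi ^+ k * even_part (h i) xi + xi ^+ k * odd_part (h i) xi).
  by apply/funext => xi; rewrite /even_part /odd_part; field.
have s1 := sqint_le m1 e1 g'i; have s2 := sqint_le m2 e2 g'i.
split; first exact: sqintD.
apply: (le_trans (nrmD s1 s2)); rewrite mulr_natl mulr2n lerD//.
  exact: le_trans (ler_nrm m1 e1 g'i) g'le.
exact: le_trans (ler_nrm m2 e2 g'i) g'le.
Qed.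

Lemma ft_of_hartley_japM (r : R) h xi :
  ft_of_hartley (fun i xi => jap xi `^ r * h i xi) xi = (jap xi `^ r)%:C%C *: ft_of_hartley h xi.
Proof.
have jE : jap (- xi) = jap xi by rewrite /jap sqrrN.
apply/colP => i; rewrite !mxE /even_part /odd_part jE; apply/eqP; rewrite eq_complex /=.
by apply/andP; split; apply/eqP; field.
Qed.

Lemma ft_of_hartley_inj h h' xi : ft_of_hartley h xi = ft_of_hartley h' xi -> forall i, h i xi = h' i xi.
Proof.
move=> /colP E i; have := E i; rewrite !mxE /even_part /odd_part => -[e1 e2]; lra.
Qed.

(** The symbol is real and even, so it multiplies the Hartley transforms as well. Their surjectivity
    provides one function with the required transform, hence the function chosen by [japD] has it
    too. *)
Lemma japD_spec (r : R) v h : L2 v -> (forall i, is_hartley (cmp v i) (h i)) ->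
  (forall i, sqint (fun xi => jap xi `^ r * h i xi)) ->
  L2 (japD r v) /\ forall i, is_hartley (cmp (japD r v) i) (fun xi => jap xi `^ r * h i xi).
Proof.
move=> v2 vh rh; have [_ ev] := fourier_of_hartley v2 vh.
have [w2 ew] : is_japD r v (japD r v).
  apply: (@xgetPex _ _ [set w | is_japD r v w]).
  have /choice[c cP] i : exists c, sqint c /\ is_hartley c (fun xi => jap xi `^ r * h i xi).
    by have [c ? ?] := is_hartley_surj (rh i); exists c.
  pose w (x : R) : 'cV[R]_n := \col_i c i x.
  have cw i : cmp w i = c i by apply/funext => x; rewrite /cmp mxE.
  have w2 : L2 w by apply/L2P => i; rewrite cw; exact: (cP i).1.
  exists w; split=> //=.
  have wh i : is_hartley (cmp w i) (fun xi => jap xi `^ r * h i xi) by rewrite cw; exact: (cP i).2.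
  have [_ ew] := fourier_of_hartley w2 wh.
  by apply: ae_imp (ae_and ev ew) => xi [-> ->]; rewrite ft_of_hartley_japM.
split; first exact: w2.
have wi := (L2P _).1 w2.
have /choice[g gP] i := is_hartley_ex (wi i).
have [_ eg] := fourier_of_hartley w2 gP => i.
apply: (is_hartley_ae (wi i) (gP i)); first exact: sqint_meas (rh i).
apply: ae_imp (ae_and (ae_and ev ew) eg) => xi [[E1 E2] E3].
apply/esym; apply: (@ft_of_hartley_inj g (fun i xi => jap xi `^ r * h i xi)).
by rewrite ft_of_hartley_japM -E1 -E2.
Qed.

End fourier_link.

(** * Matrix valued functions and their derivatives, entry by entry *)

Section matrix_functions.
Context {R : realType}.
Notation mu := (@lebesgue_measure R).
Variables p q : nat.
Implicit Types g : R -> 'M[R]_(p, q).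

Lemma mx_entry_le (m : 'M[R]_(p, q)) i j : `|m i j| <= `|m|.
Proof. by rewrite [leRHS]mx_normrE (le_trans _ (le_bigmax _ _ (i, j))). Qed.

Lemma mx_norm_le (m : 'M[R]_(p, q)) (e : R) : 0 <= e -> (forall i j, `|m i j| <= e) -> `|m| <= e.
Proof. by move=> e0 me; rewrite [leLHS]mx_normrE bigmax_le// => ij _; exact: me. Qed.

Lemma derivable_entry g x i j : derivable g x 1 ->
  is_derive x 1 (fun y => g y i j) (derive1 g x i j).
Proof.
move=> dg; apply: DeriveDef; first exact: (derivable_mxP _ _ _).1 dg i j.
by rewrite derive1E derive_mx// mxE.
Qed.

Lemma cont_entry g i j : continuous g -> continuous (fun x => g x i j).
Proof.
move=> cg x; apply: (@continuous_comp _ _ _ g (fun m : 'M[R]_(p, q) => m i j)).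
  exact: cg.
exact: coord_continuous.
Qed.

Lemma Ck_der k g j a b : Ck k g -> (j < k)%N ->
  der (fun x => derive1n j g x a b) (fun x => derive1n j.+1 g x a b).
Proof. by move=> [dg _] jk x; apply: derivable_entry; exact: dg. Qed.

Lemma Ck_cont k g j a b : Ck k g -> (j <= k)%N -> continuous (fun x => derive1n j g x a b).
Proof.
move=> gk; rewrite leq_eqVlt => /predU1P[->|jk]; first by apply: cont_entry; exact: gk.2.
exact: der_cont (Ck_der _ _ gk jk).
Qed.

Lemma derive1B (f g : R -> 'M[R]_(p, q)) x : derivable f x 1 -> derivable g x 1 ->
  derive1 (f - g) x = derive1 f x - derive1 g x.
Proof. by move=> df dg; rewrite !derive1E (deriveB df dg). Qed.

Lemma derive1_comb (f g h : R -> 'M[R]_(p, q)) (c : R) x : derivable f x 1 ->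
  derivable g x 1 -> derivable h x 1 ->
  derive1 (c *: (f - g) - h) x = c *: (derive1 f x - derive1 g x) - derive1 h x.
Proof.
move=> df dg dh; have dfg := derivableB df dg; have dc : derivable (c *: (f - g)) x 1.
  exact: derivableZ dfg.
by rewrite (derive1B dc dh) derive1E (deriveZ _ dfg) -derive1E (derive1B df dg).
Qed.

(** The combination is that of a difference quotient in time minus its limit, as in [C1I], with c =
    1 / (t - t0). *)
Lemma Ck_comb k (f g h : R -> 'M[R]_(p, q)) (c : R) j : Ck k f -> Ck k g -> Ck k h -> (j <= k)%N ->
  derive1n j (c *: (f - g) - h) = c *: (derive1n j f - derive1n j g) - derive1n j h.
Proof.
move=> fk gk hk; elim: j => [//|j ih jk]; rewrite !derive1nS ih ?(ltnW jk)//.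
apply/funext => x; have df := fk.1 j x jk; have dg := gk.1 j x jk; have dh := hk.1 j x jk.
by rewrite (derive1_comb c df dg dh).
Qed.

Lemma Ck_sub k (f g : R -> 'M[R]_(p, q)) j : Ck k f -> Ck k g -> (j <= k)%N ->
  derive1n j (f - g) = derive1n j f - derive1n j g.
Proof.
move=> fk gk; elim: j => [//|j ih jk]; rewrite !derive1nS ih ?(ltnW jk)//.
apply/funext => x; have df := fk.1 j x jk; have dg := gk.1 j x jk.
by rewrite (derive1B df dg).
Qed.

Lemma Bnorm_term k g j : (j <= k)%N ->
  (ereal_sup [set `|derive1n j g x|%:E | x in setT] <= Bnorm k g)%E.
Proof.
move=> jk; rewrite /Bnorm (bigD1 (Ordinal (jk : j < k.+1)%N))//= leeDl//.
apply: sume_ge0 => i _; apply: (@le_trans _ _ `|derive1n i g 0|%:E); first by rewrite lee_fin.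
by apply: ereal_sup_ubound; exists 0.
Qed.

Lemma Bnorm_ge k g j x : (j <= k)%N -> (`|derive1n j g x|%:E <= Bnorm k g)%E.
Proof.
move=> jk; apply: le_trans (Bnorm_term g jk).
by apply: ereal_sup_ubound; exists x.
Qed.

Lemma Bnorm_ge0 k g : (0 <= Bnorm k g)%E.
Proof. by apply: le_trans (Bnorm_ge g 0 (leq0n k)); rewrite lee_fin. Qed.

End matrix_functions.

(** * Coefficients *)

Section time.
Context {R : realType}.
Notation mu := (@lebesgue_measure R).
Implicit Types (y : R -> R) (T : R).

Lemma within_nbhs_ex (I : set R) (P : R -> Prop) (t0 : R) :
  (\forall t \near within I (nbhs t0), P t) ->
  exists2 d : R, 0 < d & forall t, I t -> `|t - t0| < d -> P t.
Proof.
move=> /nbhs_ballP[d /= d0 dP]; exists d => // t It td.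
by apply: dP => //; rewrite /ball /= distrC.
Qed.

Lemma within_dnbhs_ex (I : set R) (P : R -> Prop) (t0 : R) :
  (\forall t \near within I (dnbhs t0), P t) ->
  exists2 d : R, 0 < d & forall t, I t -> t != t0 -> `|t - t0| < d -> P t.
Proof.
move=> /nbhs_ballP[d /= d0 dP]; exists d => // t It tt0 td.
by apply: dP => //; rewrite /ball /= distrC.
Qed.

Lemma cvg0_lee (F : set_system R) {FF : Filter F} (f : R -> \bar R) (e : R) :
  f t @[t --> F] --> 0%E -> 0 < e -> \forall t \near F, (f t <= e%:E)%E.
Proof.
move=> /fine_cvgP[fin /cvgrPdist_le cv] e0; have le := cv _ e0.
near=> t; have ft : f t \is a fin_num by near: t.
rewrite -(fineK ft) lee_fin; apply: le_trans (ler_norm _) _.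
by rewrite -normrN -sub0r; near: t; exact: le.
Unshelve. all: by end_near.
Qed.

(** Projection onto [0, T]. Composition with it extends a function known on the interval to a
    continuous function on the line, where the fundamental theorem of calculus and the mean value
    theorem are available. *)
Definition clamp T t : R := Num.max 0 (Num.min t T).

Lemma clamp_itv T t : 0 <= T -> 0 <= clamp T t <= T.
Proof.
by move=> T0; rewrite /clamp; case: (leP t T) => ?; [case: (leP 0 t) => ?|case: (leP 0 T) => ?];
  apply/andP; split; lra.
Qed.

Lemma clamp_id T t : 0 <= t <= T -> clamp T t = t.
Proof. by case/andP=> t0 tT; rewrite /clamp (min_idPl tT) (max_idPr t0). Qed.

Lemma clamp_lip T t s : `|clamp T t - clamp T s| <= `|t - s|.
Proof.
have h1 := ler_norm (t - s); have h2 := ler_norm (- (t - s)); rewrite normrN in h2.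
rewrite ler_norml /clamp.
by case: (leP t T) => ?; case: (leP s T) => ?; case: (leP 0 t) => ?; case: (leP 0 s) => ?;
  case: (leP 0 T) => ?; apply/andP; split; lra.
Qed.

(** Continuity and, in [td], differentiability on [0, T], one-sided at the endpoints and with
    explicit tolerances; values outside the interval do not enter. *)
Definition tc T y := forall t0, 0 <= t0 <= T -> forall e : R, 0 < e ->
  exists2 d : R, 0 < d & forall t, 0 <= t <= T -> `|t - t0| < d -> `|y t - y t0| <= e.

Definition td T y y' := forall t0, 0 <= t0 <= T -> forall e : R, 0 < e ->
  exists2 d : R, 0 < d & forall t, 0 <= t <= T -> `|t - t0| < d ->
    `|y t - y t0 - (t - t0) * y' t0| <= e * `|t - t0|.

Lemma td_tc T y y' : td T y y' -> tc T y.
Proof.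
move=> yT t0 t0T e e0; have [d d0 dP] := yT t0 t0T 1 ltr01.
have k0 : 0 < 1 + `|y' t0| by rewrite ltr_pwDl.
exists (Num.min d (e / (1 + `|y' t0|))); first by rewrite lt_min d0 divr_gt0.
move=> t tT; rewrite lt_min => /andP[td te].
have := dP t tT td; rewrite mul1r => h.
have -> : y t - y t0 = (y t - y t0 - (t - t0) * y' t0) + (t - t0) * y' t0 by rewrite subrK.
apply: (le_trans (ler_normD _ _)); rewrite normrM.
move: te; rewrite ltr_pdivlMr// mulrDr mulr1 => /ltW; apply: le_trans.
by rewrite lerD2r.
Qed.

Lemma tc_cont T y : 0 <= T -> tc T y -> continuous (y \o clamp T).
Proof.
move=> T0 yT t; apply/cvgrPdist_le => e e0.
have [d d0 dP] := yT _ (clamp_itv t T0) e e0.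
near=> s; rewrite distrC; apply: dP; first exact: clamp_itv.
apply: le_lt_trans (clamp_lip _ _ _) _; rewrite distrC.
by near: s; exact: (nbhsx_ballx t d d0).
Unshelve. all: by end_near.
Qed.

Lemma td_derive T y y' t : 0 < t < T -> td T y y' -> is_derive t (1 : R) (y \o clamp T) (y' t).
Proof.
move=> /andP[t0 tT] yT; have tI : 0 <= t <= T by rewrite !ltW.
have cv : (fun h => h^-1 *: ((y \o clamp T) (h *: (1 : R) + t) - (y \o clamp T) t)) x
    @[x --> 0^'] --> y' t.
  apply/cvgrPdist_le => e e0; have [d d0 dP] := yT t tI e e0.
  have m0 : 0 < Num.min d (Num.min t (T - t)) by rewrite !lt_min d0 t0 subr_gt0.
  near=> h; have hd : `|h| < Num.min d (Num.min t (T - t)).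
    near: h; apply: dnbhs0_lt; exact: m0.
  have h0 : h != 0 by near: h; exact: nbhs_dnbhs_neq.
  move: hd; rewrite !lt_min => /and3P[hd ht hT].
  have htI : 0 <= h + t <= T.
    have := ler_norm h; have := ler_norm (- h); rewrite normrN; lra.
  have -> : h *: (1 : R) = h by rewrite /GRing.scale /= mulr1.
  rewrite distrC /= (clamp_id htI) (clamp_id tI).
  have := dP (h + t) htI; rewrite addrK => /(_ hd) le.
  have -> : h^-1 *: (y (h + t) - y t) - y' t = h^-1 * (y (h + t) - y t - h * y' t).
    by rewrite mulrBr mulKf.
  by rewrite normrM normfV mulrC ler_pdivrMr ?normr_gt0//; move: le; rewrite mulrC.
by apply: DeriveDef; [apply/cvg_ex; exists (y' t)|exact: cvg_lim cv].
Unshelve. all: by end_near.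
Qed.

Lemma td_mvt T y y' C : td T y y' -> (forall t, 0 <= t <= T -> `|y' t| <= C) ->
  forall t, 0 <= t <= T -> `|y t - y 0| <= C * t.
Proof.
move=> yT yC t tI; have /andP[t0 tT] := tI; have T0 := le_trans t0 tT.
move: t0; rewrite le_eqVlt => /predU1P[<-|t0]; first by rewrite subrr normr0 mulr0.
have cy := tc_cont T0 (td_tc yT).
have [x x0t|c|c] := @MVT R (y \o clamp T) y' 0 t t0.
- by apply: td_derive => //; move: x0t; rewrite in_itv/= => /andP[-> /lt_le_trans->].
- exact: continuous_subspaceT.
- rewrite in_itv/= => /andP[c0 ct]; rewrite /= !clamp_id ?lexx ?(ltW t0)// subr0 => ->.
  rewrite normrM (gtr0_norm t0) ler_wpM2r ?(ltW t0)//; apply: yC.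
  by rewrite (ltW c0) (le_trans (ltW ct)).
Qed.

End time.

(** * From norms of the coefficients to pointwise statements *)

Section coefficients.
Context {R : realType}.
Notation mu := (@lebesgue_measure R).

Lemma C1I_td (T : R) p q k (v v' : R -> R -> 'M[R]_(p, q)) j a b x :
  C1I `[0, T] (@Bk R k p q) (@Bnorm R k p q) v v' -> (j <= k)%N ->
  td T (fun t => derive1n j (v t) x a b) (fun t => derive1n j (v' t) x a b).
Proof.
move=> [[vB _] [v'B _] cv] jk t0 t0T e e0.
have It t : 0 <= t <= T -> (`[0, T]%classic : set R) t by rewrite /= in_itv.
have [d d0 dP] := within_dnbhs_ex (cvg0_lee (cv t0 (It _ t0T)) e0).
exists d => // t tT td.
have [->|tt0] := eqVneq t t0; first by rewrite !subrr mul0r subrr normr0 mulr0.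
have := dP t (It _ tT) tt0 td; move=> /(le_trans (Bnorm_ge _ x jk)).
rewrite (Ck_comb _ (vB _ (It _ tT)).1 (vB _ (It _ t0T)).1 (v'B _ (It _ t0T)).1 jk) lee_fin.
move=> /(le_trans (mx_entry_le _ a b)); rewrite !mxE => le.
have tn : t - t0 != 0 by rewrite subr_eq0.
have -> : derive1n j (v t) x a b - derive1n j (v t0) x a b - (t - t0) * derive1n j (v' t0) x a b =
  ((t - t0)^-1 * (derive1n j (v t) x a b - derive1n j (v t0) x a b) - derive1n j (v' t0) x a b)
    * (t - t0).
  by rewrite [RHS]mulrBl mulrAC mulVf// mul1r [X in _ = _ - X]mulrC.
by rewrite normrM ler_wpM2r.
Qed.

Lemma C0I_unif (T : R) p q k (v : R -> R -> 'M[R]_(p, q)) j :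
  C0I `[0, T] (@Bk R k p q) (@Bnorm R k p q) v -> (j <= k)%N ->
  forall t0, 0 <= t0 <= T -> forall e : R, 0 < e -> exists2 d : R, 0 < d &
    forall t, 0 <= t <= T -> `|t - t0| < d ->
      forall x, `|derive1n j (v t) x - derive1n j (v t0) x| <= e.
Proof.
move=> [vB cv] jk t0 t0T e e0.
have It t : 0 <= t <= T -> (`[0, T]%classic : set R) t by rewrite /= in_itv.
have [d d0 dP] := within_nbhs_ex (cvg0_lee (cv t0 (It _ t0T)) e0).
exists d => // t tT td x; have := dP t (It _ tT) td.
move=> /(le_trans (Bnorm_ge _ x jk)).
by rewrite (Ck_sub (vB _ (It _ tT)).1 (vB _ (It _ t0T)).1 jk) lee_fin.
Qed.

Lemma ae_le_not_ball (P : R -> Prop) (x r : R) : {ae mu, forall y, P y} -> 0 < r ->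
  (forall y, ball x r y -> ~ P y) -> False.
Proof.
move=> [A [mA A0 AP]] r0 nP.
have : (mu (ball x r) <= mu A)%E.
  by apply: le_measure; rewrite ?inE//; [exact: measurable_ball|move=> y /nP; exact: AP].
rewrite A0 (lebesgue_measure_ball x (ltW r0)) lee_fin mulr2n; lra.
Qed.

Lemma lebesgueT_gt0 : (0 < mu setT)%E.
Proof.
apply: (@lt_le_trans _ _ (mu (ball (0 : R) 1))).
  by rewrite lebesgue_measure_ball// lte_fin mulr2n; lra.
by apply: le_measure; rewrite ?inE//; exact: measurable_ball.
Qed.

(** By continuity a violation at one point spreads to a ball, which has positive measure. *)
Lemma Linf_pt (F : R -> R) (C : R) : continuous F ->
  (Lnorm mu +oo (fun x => (F x)%:E) <= C%:E)%E -> forall x, F x <= C.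
Proof.
move=> cF; rewrite unlock lebesgueT_gt0 => /ess_supP aeF x.
rewrite leNgt; apply/negP => Cx.
have [r /= r0 rP] : \forall y \near nbhs x, C < F y.
  exact: (cvgr_gt (F x) (cF x)).
apply: (ae_le_not_ball aeF r0) => y /rP; rewrite /= lee_fin => Cy /(le_trans (ler_norm _)).
by rewrite leNgt Cy.
Qed.

Lemma Linf_ae (F : R -> R) (C : R) : (Lnorm mu +oo (fun x => (F x)%:E) <= C%:E)%E ->
  {ae mu, forall x, `|F x| <= C}.
Proof. by rewrite unlock lebesgueT_gt0 => /ess_supP; apply: ae_imp => x; rewrite /= lee_fin. Qed.

Lemma jap_cont : continuous (@jap R).
Proof.
move=> x; apply: continuous_comp; last exact: sqrt_continuous.
apply: cvgD; first exact: cvg_cst.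
exact: exprn_continuous.
Qed.

Lemma japX_cont (w : R) : continuous (fun x : R => jap x `^ w).
Proof.
move=> x; apply: (@continuous_comp _ _ _ (@jap R) (fun y => y `^ w)); first exact: jap_cont.
apply/differentiable_continuous/derivable1_diffP.
by have [] := is_derive1_powR w (jap_gt0 x).
Qed.

Lemma wLinf_pt p q (g : R -> 'M[R]_(p, q)) (w C : R) : continuous g ->
  (wLinfnorm w g <= C%:E)%E -> forall x, jap x `^ w * `|g x| <= C.
Proof.
move=> cg gC x.
have -> : jap x `^ w * `|g x| = `|jap x `^ w *: g x|.
  by rewrite normrZ ger0_norm// powR_ge0.
move: x; apply: Linf_pt gC => x; apply: cvg_norm; apply: cvgZ; last exact: cg.
exact: japX_cont.
Qed.

Lemma ae2_not_rect (P : R * R -> Prop) (x r s t : R) :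
  {ae (mu \x mu)%E, forall z, P z} -> 0 < r -> s < t ->
  (forall y u, ball x r y -> s <= u <= t -> ~ P (y, u)) -> False.
Proof.
move=> [A [mA A0 AP]] r0 st nP.
have mb : measurable (ball x r `*` `[s, t]).
  by apply: measurableX => //; exact: measurable_ball.
have : ((mu \x mu)%E (ball x r `*` `[s, t]) <= (mu \x mu)%E A)%E.
  apply: le_measure; rewrite ?inE// => -[y u] [/= yx]; rewrite in_itv /= => ust.
  by apply: AP; apply: nP.
have m1 : mu (ball x r) = (r *+ 2)%:E := lebesgue_measure_ball x (ltW r0).
have m2 : mu `[s, t]%classic = (t - s)%:E.
  by rewrite lebesgue_measure_itv /= lte_fin st -EFinD.
rewrite A0 product_measure1E//; last exact: measurable_ball.
have -> : (mu (ball x r) * mu `[s, t]%classic = ((r *+ 2) * (t - s))%:E)%E by rewrite m1 m2.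
by rewrite lee_fin leNgt mulr_gt0// ?subr_gt0// mulr2n addr_gt0.
Qed.

(** The space-time version: a violation at one point spreads to a ball in x times an interval in t,
    a set of positive product measure. This uses that continuity in t is uniform in x. *)
Lemma wLinfI_pt (T w C : R) p q (M : R -> R -> 'M[R]_(p, q)) : 0 < T -> 0 <= C ->
  (forall t0, 0 <= t0 <= T -> forall e : R, 0 < e -> exists2 d : R, 0 < d &
    forall t, 0 <= t <= T -> `|t - t0| < d -> forall x, `|M t x - M t0 x| <= e) ->
  (forall t, 0 <= t <= T -> continuous (M t)) ->
  (wLinfnormI `[0%R, T]%classic w M <= C%:E)%E ->
  forall t x, 0 <= t <= T -> jap x `^ w * `|M t x| <= C.
Proof.
move=> T0 C0 uM cM; rewrite /wLinfnormI unlock.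
have -> : (0 < (mu \x mu)%E setT)%E.
  apply: (@lt_le_trans _ _ ((mu \x mu)%E (ball (0 : R) 1 `*` ball (0 : R) 1))).
    rewrite product_measure1E; [|exact: measurable_ball..].
    by rewrite /= lebesgue_measure_ball// -EFinM lte_fin mulr2n; lra.
  apply: le_measure; rewrite ?inE//.
  by apply: measurableX; exact: measurable_ball.
move=> /ess_supP ae t0 x0 t0T; rewrite leNgt; apply/negP => lt.
have jx := powR_gt0 w (jap_gt0 x0).
(* Half of the excess over the bound, which is what moving away from t0 is allowed to cost. *)
pose e := (`|M t0 x0| - C / jap x0 `^ w) / 2.
have e0 : 0 < e by rewrite divr_gt0// subr_gt0 ltr_pdivrMr// mulrC.
have [d d0 dP] := uM t0 t0T e e0.
have [r /= r0 rP] : \forall y \near nbhs x0, C < jap y `^ w * (`|M t0 y| - e).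
  have cF : continuous (fun y => jap y `^ w * (`|M t0 y| - e)).
    move=> y; apply: cvgM; first exact: japX_cont.
    apply: cvgB; last exact: cvg_cst.
    by apply: cvg_norm; exact: cM.
  apply: (cvgr_gt _ (cF x0)).
  rewrite mulrC -ltr_pdivrMr// /e; move: e0; rewrite /e; lra.
(* A neighbourhood of t0 cut to [0, T]; its length is positive even when t0 is an endpoint. *)
pose s := Num.max 0 (t0 - d / 2); pose u := Num.min T (t0 + d / 2).
move/andP: (t0T) => [t00 t0T'].
have su : s < u.
  by rewrite /s /u gt_max !lt_min T0 /=; apply/andP; split; [|apply/andP; split]; lra.
apply: (ae2_not_rect ae r0 su) => y v /rP Cy.
rewrite /s /u ge_max le_min => /andP[/andP[v0 v1] /andP[v2 v3]] /=.
have vT : 0 <= v <= T by rewrite v0.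
have -> : v \in (`[0, T]%classic : set R) by rewrite inE /= in_itv.
rewrite lee_fin; apply/negP; rewrite -ltNge; apply: lt_le_trans Cy _.
rewrite ger0_norm ?mulr_ge0 ?powR_ge0// ler_wpM2l ?powR_ge0//.
have vd : `|v - t0| < d by rewrite ltr_norml; apply/andP; split; lra.
have h1 := dP v vT vd y; have := ler_normB (M v y) (M v y - M t0 y).
by rewrite subKr lerBlDr => /le_trans; apply; rewrite lerD2l.
Qed.

Lemma C1Inorm_le (I : set R) p q k (v v' : R -> R -> 'M[R]_(p, q)) (C : R) :
  (C1Inorm I (@Bnorm R k p q) v v' <= C%:E)%E -> forall t j x a b, I t -> (j <= k)%N ->
  `|derive1n j (v t) x a b| <= C /\ `|derive1n j (v' t) x a b| <= C.
Proof.
move=> vC t j x a b It jk.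
have key (z : R -> R -> 'M[R]_(p, q)) : (`|derive1n j (z t) x a b|%:E <=
    ereal_sup [set Bnorm k (z t) | t in I])%E.
  apply: (@le_trans _ _ (Bnorm k (z t))); last by apply: ereal_sup_ubound; exists t.
  apply: le_trans (Bnorm_ge _ x jk); rewrite lee_fin; exact: mx_entry_le.
have ge0 (z : R -> R -> 'M[R]_(p, q)) : (0 <= ereal_sup [set Bnorm k (z t) | t in I])%E.
  by apply: le_trans (key z); rewrite lee_fin.
split; rewrite -lee_fin; apply: le_trans vC; rewrite /C1Inorm.
  by apply: le_trans (key v) _; rewrite leeDl.
by apply: le_trans (key v') _; rewrite leeDr.
Qed.

End coefficients.

(** * The weight *)

Section weight.
Context {R : realType}.
Notation mu := (@lebesgue_measure R).

Definition jp (w x : R) : R := jap x `^ w.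

Lemma jp_gt0 w x : 0 < jp w x. Proof. exact: powR_gt0 (jap_gt0 x). Qed.

Lemma jp_ge0 w x : 0 <= jp w x. Proof. exact: powR_ge0. Qed.

Lemma jpD w v x : jp (w + v) x = jp w x * jp v x.
Proof. by rewrite /jp powRD// (gt_eqF (jap_gt0 x)) implybT. Qed.

Lemma jp0 x : jp 0 x = 1. Proof. by rewrite /jp powRr0. Qed.

Lemma jp1 x : jp 1 x = jap x. Proof. by rewrite /jp powRr1// ltW// jap_gt0. Qed.

Lemma jp2 x : jp 2 x = 1 + x ^+ 2.
Proof. by rewrite /jp powR_mulrn ?ltW ?jap_gt0// jap_sq. Qed.

Lemma jpN w x : jp (- w) x = (jp w x)^-1. Proof. by rewrite /jp powRN. Qed.

Lemma jp_le w v x : w <= v -> jp w x <= jp v x.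
Proof. by move=> wv; apply: ler_powR => //; exact: jap_ge1. Qed.

Lemma jp_le1 w x : w <= 0 -> jp w x <= 1.
Proof. by move=> w0; rewrite -(jp0 x); exact: jp_le. Qed.

Lemma jp_even w x : jp w (- x) = jp w x.
Proof. by rewrite /jp /jap sqrrN. Qed.

Lemma jp_cont w : continuous (jp w). Proof. exact: japX_cont. Qed.

Lemma jp_norm w x : `|jp w x| = jp w x. Proof. by rewrite ger0_norm ?jp_ge0. Qed.

Lemma xjp_le w x : `|x * jp w x| <= jp (w + 1) x.
Proof.
rewrite normrM jp_norm jpD jp1 mulrC ler_wpM2l ?jp_ge0//; exact: abs_le_jap.
Qed.

Lemma der_jp w : der (jp w) (fun x => w * (x * jp (w - 2) x)).
Proof.
move=> x; pose s (y : R) := 1 + y ^+ 2.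
have s0 y : 0 < s y by rewrite ltr_pwDl// sqr_ge0.
have E v y : jp v y = s y `^ (v / 2).
  by rewrite /jp /jap -powR12_sqrt ?(ltW (s0 y))// -powRrM mulrC.
have ds : der s (fun y => 2 * y).
  apply: der_eq (derD (der_cst 1) (derM der_id der_id)) => y; lra.
have dp := is_derive1_powR (w / 2) (s0 x).
have -> : jp w = fun y => s y `^ (w / 2) by apply/funext => y; exact: E.
have -> : w * (x * jp (w - 2) x) = w / 2 * s x `^ (w / 2 - 1) * (2 * x).
  by rewrite E mulrBl divff//; field.
exact: (is_derive1_comp dp (ds x)).
Qed.

Lemma der_xjp w : der (fun x => x * jp w x) (fun x => (1 + w) * jp w x - w * jp (w - 2) x).
Proof.
apply: der_eq (derM der_id (der_jp w)) => x.
have e : jp w x = jp (w - 2) x * (1 + x ^+ 2) by rewrite -jp2 -jpD subrK.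
by rewrite e; ring.
Qed.

Lemma norm_mul_le (a b B : R) : `|b| <= B -> `|a * b| <= `|a| * B.
Proof. by move=> bB; rewrite normrM ler_wpM2l. Qed.

Lemma jp_b w x : w <= 0 -> `|jp w x| <= 1.
Proof. by move=> w0; rewrite jp_norm jp_le1. Qed.

Lemma xjp_b w x : w <= -1 -> `|x * jp w x| <= 1.
Proof. by move=> w0; apply: le_trans (xjp_le w x) _; apply: jp_le1; lra. Qed.

Variable delta : R.
Hypothesis hdelta : 2^-1 < delta.

Let d1 : 1 < 2 * delta.
Proof. by rewrite -ltr_pdivrMl// mulr1. Qed.

(* Both terms are bounded, and the derivative of the first one compensates for
   the non-positive part of the derivative of the second one. *)
Definition Psi x := 2 * (x * jp (-1) x) - x * jp (- (2 * delta)) x.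

Definition Psi1 x := 2 * jp (-3) x + (2 * delta - 1) * jp (- (2 * delta)) x
  - 2 * delta * jp (- (2 * delta) - 2) x.

Definition Psi2 x := 2 * (-3 * (x * jp (-3 - 2) x))
  + (2 * delta - 1) * (- (2 * delta) * (x * jp (- (2 * delta) - 2) x))
  - 2 * delta * ((- (2 * delta) - 2) * (x * jp (- (2 * delta) - 2 - 2) x)).

Definition Psi3 x := 2 * (-3 * ((1 + (-3 - 2)) * jp (-3 - 2) x - (-3 - 2) * jp (-3 - 2 - 2) x))
  + (2 * delta - 1) * (- (2 * delta) * ((1 + (- (2 * delta) - 2)) * jp (- (2 * delta) - 2) x
      - (- (2 * delta) - 2) * jp (- (2 * delta) - 2 - 2) x))
  - 2 * delta * ((- (2 * delta) - 2) * ((1 + (- (2 * delta) - 2 - 2)) * jp (- (2 * delta) - 2 - 2) x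
      - (- (2 * delta) - 2 - 2) * jp (- (2 * delta) - 2 - 2 - 2) x)).

Lemma Psi_der : der Psi Psi1.
Proof.
have := derB (derZ 2 (der_xjp (-1))) (der_xjp (- (2 * delta))).
apply: der_eq => x; rewrite /Psi1 (_ : -1 - 2 = -3 :> R); last by lra.
rewrite (_ : 1 + -1 = 0 :> R); last by lra.
by ring.
Qed.

Lemma Psi1_der : der Psi1 Psi2.
Proof. exact: derB (derD (derZ _ (der_jp _)) (derZ _ (der_jp _))) (derZ _ (der_jp _)). Qed.

Lemma Psi2_der : der Psi2 Psi3.
Proof.
exact: derB (derD (derZ _ (derZ _ (der_xjp _))) (derZ _ (derZ _ (der_xjp _))))
  (derZ _ (derZ _ (der_xjp _))).
Qed.

Lemma Psi3_cont : continuous Psi3.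
Proof.
have c (k w : R) : continuous (fun x => k * jp w x).
  by move=> x; apply: cvgM; [exact: cvg_cst|exact: jp_cont].
have cB (f g : R -> R) : continuous f -> continuous g -> continuous (fun x => f x - g x).
  by move=> cf cg x; apply: cvgB; [exact: cf|exact: cg].
have cZ (k : R) (f : R -> R) : continuous f -> continuous (fun x => k * f x).
  by move=> cf x; apply: cvgM; [exact: cvg_cst|exact: cf].
apply: (cB _ _ _ (cZ _ _ (cZ _ _ (cB _ _ (c _ _) (c _ _))))) => x.
by apply: cvgD; [exact: (cZ _ _ (cZ _ _ (cB _ _ (c _ _) (c _ _))))|
  exact: (cZ _ _ (cZ _ _ (cB _ _ (c _ _) (c _ _))))].
Qed.

Lemma bdZ (k : R) (f : R -> R) : (exists B, forall x, `|f x| <= B) ->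
  exists B, forall x, `|k * f x| <= B.
Proof. by move=> [B fB]; exists (`|k| * B) => x; exact: norm_mul_le. Qed.

Lemma bdD (f g : R -> R) : (exists B, forall x, `|f x| <= B) ->
  (exists B, forall x, `|g x| <= B) -> exists B, forall x, `|f x + g x| <= B.
Proof.
move=> [B fB] [C gC]; exists (B + C) => x.
by rewrite (le_trans (ler_normD _ _))// lerD.
Qed.

Lemma bdB (f g : R -> R) : (exists B, forall x, `|f x| <= B) ->
  (exists B, forall x, `|g x| <= B) -> exists B, forall x, `|f x - g x| <= B.
Proof.
move=> [B fB] [C gC]; exists (B + C) => x.
by rewrite (le_trans (ler_normB _ _))// lerD.
Qed.

Lemma bd_jp w : w <= 0 -> exists B, forall x, `|jp w x| <= B.
Proof. by move=> w0; exists 1 => x; exact: jp_b. Qed.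

Lemma bd_xjp w : w <= -1 -> exists B, forall x, `|x * jp w x| <= B.
Proof. by move=> w0; exists 1 => x; exact: xjp_b. Qed.

Lemma Psi_b : exists B, forall x, `|Psi x| <= B.
Proof. have h := d1; by apply: bdB; [apply: bdZ|]; apply: bd_xjp; lra. Qed.

Lemma Psi1_b : exists B, forall x, `|Psi1 x| <= B.
Proof.
have h := d1; by apply: bdB; [apply: bdD; apply: bdZ; apply: bd_jp; lra|apply: bdZ; apply: bd_jp; lra].
Qed.

Lemma Psi2_b : exists B, forall x, `|Psi2 x| <= B.
Proof.
have h := d1; by apply: bdB; [apply: bdD; do 2 apply: bdZ; apply: bd_xjp; lra|
  do 2 apply: bdZ; apply: bd_xjp; lra].
Qed.

Lemma Psi3_b : exists B, forall x, `|Psi3 x| <= B.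
Proof.
have h := d1; by apply: bdB; [apply: bdD|]; do 2 apply: bdZ; apply: bdB; apply: bdZ; apply: bd_jp; lra.
Qed.

(** Put g = <x>^(-2 delta) and s = <x>^(-2) <= 1. Bounding <x>^(-3) below by s g leaves g times an
    affine function of s with value 2 delta - 1 at s = 0 and 1 at s = 1, and [c] is the smaller of
    the two. For 2 delta >= 3 the bound <x>^(-3) >= g is used instead. *)
Lemma Psi1_ge : exists2 c : R, 0 < c & forall x, c * jp (- (2 * delta)) x <= Psi1 x.
Proof.
have d1' := d1; exists (Num.min 1 (2 * delta - 1)); first by rewrite lt_min ltr01 /=; lra.
move=> x; rewrite /Psi1 jpD; set g := jp (- (2 * delta)) x; set s := jp (-2) x.
have g0 : 0 < g := jp_gt0 _ _.
have s0 : 0 < s := jp_gt0 _ _.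
have s1 : s <= 1 by apply: jp_le1; lra.
have [m1 m2] : Num.min 1 (2 * delta - 1) <= 1 /\ Num.min 1 (2 * delta - 1) <= 2 * delta - 1.
  by rewrite !ge_min !lexx orbT.
have g3 : Num.min 1 s * g <= jp (-3) x \/ (g <= jp (-3) x /\ 3 <= 2 * delta).
  have [d3|d3] := leP 3 (2 * delta); first by right; split=> //; apply: jp_le; lra.
  left; rewrite (min_idPr s1) /s /g -jpD; apply: jp_le; lra.
move: (Num.min 1 (2 * delta - 1)) m1 m2 g3 => m m1 m2; rewrite (min_idPr s1) => -[g3|[g3 d3]].
  have h : 0 <= g * (2 * s + (2 * delta - 1) - 2 * delta * s - m).
    apply: mulr_ge0; first exact: ltW.
    have [e1|e1] := leP delta 1; nra.
  nra.
have h : 0 <= g * (2 * delta * (1 - s) + (1 - m)).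
  by apply: mulr_ge0; [exact: ltW|nra].
nra.
Qed.

Lemma bdM (f g : R -> R) : (exists B, forall x, `|f x| <= B) ->
  (exists B, forall x, `|g x| <= B) -> exists B, forall x, `|f x * g x| <= B.
Proof. by move=> [B fB] [C gC]; exists (B * C) => x; rewrite normrM ler_pM. Qed.

Lemma der_expR : der (@expR R) (@expR R).
Proof. by move=> x; exact: is_derive_expR. Qed.

(** [PM] bounds the weight together with three derivatives, because integrating a third order term
    by parts moves up to three derivatives onto it. Both [Pm] and [PM] depend on M and delta alone,
    so they may enter the final constants. *)
Lemma weight_ex (M : R) : 0 <= M -> exists phi phi1 phi2 phi3 : R -> R,
  [/\ der phi phi1, der phi1 phi2, der phi2 phi3 & continuous phi3] /\
  exists Pm PM : R, [/\ 0 < Pm, forall x, Pm <= phi x <= PM,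
    forall x, `|phi1 x| <= PM /\ `|phi2 x| <= PM, forall x, `|phi3 x| <= PM &
    forall x, M * jp (- (2 * delta)) x * phi x <= phi1 x].
Proof.
move=> M0; have [c c0 cP] := Psi1_ge; have [B PB] := Psi_b.
pose m := M / c; have m0 : 0 <= m by rewrite divr_ge0// ltW.
pose f x := expR (m * Psi x).
pose f1 x := f x * (m * Psi1 x).
pose f2 x := f1 x * (m * Psi1 x) + f x * (m * Psi2 x).
pose f3 x := (f2 x * (m * Psi1 x) + f1 x * (m * Psi2 x)) + (f1 x * (m * Psi2 x) + f x * (m * Psi3 x)).
have d0 : der f f1 by exact: der_comp der_expR (derZ m Psi_der).
have dd1 : der f1 f2 by exact: derM d0 (derZ m Psi1_der).
have d2 : der f2 f3.
  exact: derD (derM dd1 (derZ m Psi1_der)) (derM d0 (derZ m Psi2_der)).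
have cc (k : R) (g : R -> R) : continuous g -> continuous (fun x => k * g x).
  by move=> cg x; apply: cvgM; [exact: cvg_cst|exact: cg].
have cM (g h : R -> R) : continuous g -> continuous h -> continuous (fun x => g x * h x).
  by move=> cg ch x; apply: cvgM; [exact: cg|exact: ch].
have cD (g h : R -> R) : continuous g -> continuous h -> continuous (fun x => g x + h x).
  by move=> cg ch x; apply: cvgD; [exact: cg|exact: ch].
have cp1 := der_cont Psi1_der; have cp2 := der_cont Psi2_der.
exists f, f1, f2, f3; split.
  split=> //; apply: (cD); apply: (cD); apply: (cM); try apply: (cc) => //.
  - exact: der_cont d2.
  - exact: der_cont dd1.
  - exact: der_cont dd1.
  - exact: der_cont d0.
  - exact: Psi3_cont.
have fB x : expR (- (m * B)) <= f x <= expR (m * B).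
  rewrite /f !ler_expR -ler_norml normrM ger0_norm// ler_wpM2l//; exact: PB.
have bf : exists B, forall x, `|f x| <= B.
  by exists (expR (m * B)) => x; rewrite ger0_norm ?expR_ge0//; have /andP[] := fB x.
have b1 : exists B, forall x, `|f1 x| <= B by apply: bdM => //; apply: bdZ; exact: Psi1_b.
have b2 : exists B, forall x, `|f2 x| <= B.
  by apply: bdD; apply: bdM => //; apply: bdZ; [exact: Psi1_b|exact: Psi2_b].
have [B3 b3] : exists B, forall x, `|f3 x| <= B.
  apply: bdD; apply: bdD; apply: bdM => //; apply: bdZ; [exact: Psi1_b|exact: Psi2_b|exact: Psi2_b|exact: Psi3_b].
move: b1 b2 => [B1 b1] [B2 b2].
exists (expR (- (m * B))), (Num.max (expR (m * B)) (Num.max B1 (Num.max B2 B3))).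
split=> [|x|x|x|x].
- exact: expR_gt0.
- by have /andP[-> h] := fB x; rewrite le_max h.
- by split; rewrite !le_max ?b1 ?b2 !orbT.
- by rewrite !le_max b3 !orbT.
- rewrite mulrC ler_wpM2l ?expR_ge0//.
  have -> : M * jp (- (2 * delta)) x = m * (c * jp (- (2 * delta)) x).
    by rewrite /m mulrA divfK// gt_eqF.
  by rewrite ler_wpM2l.
Qed.

Definition rho := jp (- delta).
Definition rho1 x := - delta * (x * jp (- delta - 2) x).
Definition rho2 x := - delta * ((1 + (- delta - 2)) * jp (- delta - 2) x
  - (- delta - 2) * jp (- delta - 2 - 2) x).

Lemma rho_sq x : rho x ^+ 2 = jp (- (2 * delta)) x.
Proof. by rewrite expr2 /rho -jpD; congr jp; lra. Qed.

Lemma rho_der : der rho rho1. Proof. exact: der_jp. Qed.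

Lemma rho1_der : der rho1 rho2. Proof. exact: derZ (der_xjp _). Qed.

Lemma rho2_cont : continuous rho2.
Proof.
move=> x; apply: cvgM; first exact: cvg_cst.
by apply: cvgB; apply: cvgM; [exact: cvg_cst|exact: jp_cont|exact: cvg_cst|exact: jp_cont].
Qed.

Lemma rho_le1 x : `|rho x| <= 1.
Proof. by have h := d1; apply: jp_b; lra. Qed.

Lemma rho_gt0 x : 0 < rho x. Proof. exact: jp_gt0. Qed.

Lemma rho_meas : measurable_fun setT rho. Proof. exact: cont_meas (der_cont rho_der). Qed.

(** The square of [rho] is at most [Psi1] / c, and [Psi1] is a nonnegative derivative of a bounded
    function; this is where 2 delta > 1 gives integrability. *)
Lemma rho_sqint : sqint rho.
Proof.
split; first exact: rho_meas.
have [c c0 cP] := Psi1_ge; have [B PB] := Psi_b.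
have P0 x : 0 <= Psi1 x.
  by apply: le_trans (cP x); rewrite mulr_ge0 ?jp_ge0// ltW.
have i1 := intg_deriv_ge0 Psi_der (der_cont Psi1_der) P0 PB.
apply: (intg_le _ _ (intgZ c^-1 i1)).
  by apply: measurable_funX; exact: rho_meas.
move=> x; rewrite rho_sq !ger0_norm ?jp_ge0 ?mulr_ge0 ?invr_ge0 ?(ltW c0)//.
by rewrite ler_pdivlMl.
Qed.

Lemma rho1_le x : `|rho1 x| <= delta * jp (- delta - 1) x.
Proof.
have h := d1; rewrite normrM normrN (ger0_norm (_ : 0 <= delta)); last by lra.
apply: ler_wpM2l; first by lra.
by apply: le_trans (xjp_le _ _) _; apply: jp_le; lra.
Qed.

Lemma rho1_le_rho x : `|rho1 x| <= delta * rho x.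
Proof.
apply: le_trans (rho1_le x) _; have h := d1; apply: ler_wpM2l; first by lra.
by apply: jp_le; lra.
Qed.

Lemma rho1_sqint : sqint rho1.
Proof.
apply: (sqint_le _ _ (sqintZ delta rho_sqint)); first exact: cont_meas (der_cont rho1_der).
by move=> x; apply: le_trans (rho1_le_rho x) (ler_norm _).
Qed.

(** The derivative is at most delta rho / <x>, a product of two square integrable functions. *)
Lemma rho1_intg : intg rho1.
Proof.
have i := intgZ delta (sqint_mul rho_sqint jap_inv_sq).
apply: (intg_le _ _ i); first exact: cont_meas (der_cont rho1_der).
move=> x; apply: le_trans (rho1_le x) _; rewrite -jp1 -jpN -jpD; exact: ler_norm.
Qed.

Lemma rho2_sqint : sqint rho2.
Proof.
have h := d1.
have jpi w : w <= - delta -> sqint (jp w).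
  move=> wd; apply: (sqint_le _ _ rho_sqint); first exact: japX_meas.
  by move=> x; rewrite !jp_norm; exact: jp_le.
by apply: sqintZ; apply: sqintB; apply: sqintZ; apply: jpi; lra.
Qed.

End weight.

(** * The energy inequality at a fixed time *)

Section energy.
Context {R : realType}.
Notation mu := (@lebesgue_measure R).
Implicit Types (m p q s : R -> R).

Definition I3 m p q := \int[mu]_x (m x * (p x * q x)).

Definition bm m := measurable_fun setT m /\ exists B, forall x, `|m x| <= B.

Lemma bmM m m' : bm m -> bm m' -> bm (fun x => m x * m' x).
Proof. by move=> [mm mb] [mm' mb']; split; [exact: measurable_funM|exact: bdM]. Qed.

Lemma bmD m m' : bm m -> bm m' -> bm (fun x => m x + m' x).
Proof. by move=> [mm mb] [mm' mb']; split; [exact: measurable_funD|exact: bdD]. Qed.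

Lemma bmB m m' : bm m -> bm m' -> bm (fun x => m x - m' x).
Proof. by move=> [mm mb] [mm' mb']; split; [exact: measurable_funB|exact: bdB]. Qed.

Lemma bmZ (k : R) m : bm m -> bm (fun x => k * m x).
Proof. by move=> [mm mb]; split; [exact: measurable_funM|exact: bdZ]. Qed.

Lemma I3_intg m p q : bm m -> sqint p -> sqint q -> intg (fun x => m x * (p x * q x)).
Proof.
move=> [mm [B mB]] pi qi; have := sqint_mul (sqintMb mm mB pi) qi.
by apply: intg_eq => x; rewrite mulrA.
Qed.

Lemma I3C m p q : I3 m p q = I3 m q p.
Proof. by apply: Rint_eq => x; rewrite [p x * _]mulrC. Qed.

Lemma I3D m m' p q : bm m -> bm m' -> sqint p -> sqint q ->
  I3 (fun x => m x + m' x) p q = I3 m p q + I3 m' p q.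
Proof.
move=> bm1 bm2 pi qi; rewrite /I3 -RintD; try exact: I3_intg.
by apply: Rint_eq => x; rewrite mulrDl.
Qed.

Lemma I3B m m' p q : bm m -> bm m' -> sqint p -> sqint q ->
  I3 (fun x => m x - m' x) p q = I3 m p q - I3 m' p q.
Proof.
move=> bm1 bm2 pi qi; rewrite /I3 -RintB; try exact: I3_intg.
by apply: Rint_eq => x; rewrite mulrBl.
Qed.

Lemma I3Z (k : R) m p q : bm m -> sqint p -> sqint q ->
  I3 (fun x => k * m x) p q = k * I3 m p q.
Proof.
move=> bm1 pi qi; rewrite /I3 -RintZ; last exact: I3_intg.
by apply: Rint_eq => x; rewrite -mulrA.
Qed.

Lemma ibp m m1 p p1 q q1 : der m m1 -> continuous m1 -> bm m -> bm m1 ->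
  der p p1 -> continuous p1 -> der q q1 -> continuous q1 ->
  sqint p -> sqint p1 -> sqint q -> sqint q1 ->
  I3 m p q1 + I3 m q p1 = - I3 m1 p q.
Proof.
move=> dm cm1 bm0 bm1 dp cp1 dq cq1 pi p1i qi q1i.
have cm := der_cont dm; have cp := der_cont dp; have cq := der_cont dq.
have dF := derM dm (derM dp dq).
have i1 := I3_intg bm1 pi qi.
have i2 := I3_intg bm0 p1i qi; have i3 := I3_intg bm0 pi q1i.
have iF' : intg (fun x => m1 x * (p x * q x) + m x * (p1 x * q x + p x * q1 x)).
  have := intgD i1 (intgD i2 i3); apply: intg_eq => x /=; by rewrite mulrDr.
have cF : continuous (fun x => m1 x * (p x * q x) + m x * (p1 x * q x + p x * q1 x)).
  move=> x; apply: cvgD; apply: cvgM; [exact: cm1| |exact: cm| ].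
    by apply: cvgM; [exact: cp|exact: cq].
  by apply: cvgD; apply: cvgM; [exact: cp1|exact: cq|exact: cp|exact: cq1].
have := Rint_deriv0 dF cF (I3_intg bm0 pi qi) iF'.
have -> : \int[mu]_x (m1 x * (p x * q x) + m x * (p1 x * q x + p x * q1 x)) =
    I3 m1 p q + (I3 m p1 q + I3 m p q1).
  rewrite /I3 -RintD// -RintD//; last exact: intgD.
  by apply: Rint_eq => x; rewrite mulrDr.
by rewrite (I3C m p1 q) => h; lra.
Qed.

Lemma I3_le m p q K : bm m -> (forall x, `|m x| <= K) -> sqint p -> sqint q ->
  `|I3 m p q| <= K * ((nsq p + nsq q) / 2).
Proof.
move=> bm0 mK pi qi; have i := I3_intg bm0 pi qi.
have K0 : 0 <= K by apply: le_trans (mK 0).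
apply: (le_trans (Rint_abs i)); rewrite !nsqE -RintD; [|by have [] := pi|by have [] := qi].
rewrite [X in K * X]mulrC -RintZ; last by apply: intgD; [have [] := pi|have [] := qi].
rewrite -RintZ; last by apply: intgZ; apply: intgD; [have [] := pi|have [] := qi].
apply: Rint_le; first exact: intg_abs.
  by apply: intgZ; apply: intgZ; apply: intgD; [have [] := pi|have [] := qi].
move=> x; rewrite normrM ler_pM// normrM.
have := sqr_ge0 (`|p x| - `|q x|); rewrite sqrrB !real_normK ?num_real//; lra.
Qed.

(** Young's inequality with the decay [r] of the coefficient attached to [q]. With q a derivative of
    the solution, the last term is absorbed by the smoothing and the first is bounded by the
    energy. *)
Lemma I3_cross k r p q (Q eta : R) : bm k -> bm r -> 0 < eta ->
  (forall x, `|k x| <= Q * r x) -> sqint p -> sqint q ->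
  I3 k p q <= Q ^+ 2 / eta / 2 * nsq p + eta / 2 * nsq (fun x => r x * q x).
Proof.
move=> bk [mr [Br rB]] e0 kQ pi qi; have i := I3_intg bk pi qi.
have rqi := sqintMb mr rB qi.
rewrite !nsqE -RintZ; last by have [] := pi.
rewrite -RintZ; last by have [] := rqi.
rewrite -RintD; [|by apply: intgZ; have [] := pi|by apply: intgZ; have [] := rqi].
apply: Rint_le => //.
  by apply: intgD; apply: intgZ; [have [] := pi|have [] := rqi].
move=> x; apply: (le_trans (ler_norm _)); rewrite !normrM.
have h : `|k x| * (`|p x| * `|q x|) <= Q * r x * (`|p x| * `|q x|).
  by apply: ler_wpM2r => //; rewrite mulr_ge0.
apply: (le_trans h).
have s0 : 0 < Num.sqrt eta by rewrite sqrtr_gt0.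
have -> : eta = Num.sqrt eta ^+ 2 by rewrite sqr_sqrtr// ltW.
move: (Num.sqrt eta) s0 => s s0.
have -> : Q ^+ 2 / s ^+ 2 / 2 * p x ^+ 2 + s ^+ 2 / 2 * (r x * q x) ^+ 2 =
  ((Q / s * `|p x|) ^+ 2 + (s * (r x * `|q x|)) ^+ 2) / 2.
  by rewrite -(real_normK (num_real (p x))) !exprMn -(real_normK (num_real (q x))) exprVn; ring.
have -> : Q * r x * (`|p x| * `|q x|) = (Q / s * `|p x|) * (s * (r x * `|q x|)).
  by field; exact: lt0r_neq0.
have := sqr_ge0 (Q / s * `|p x| - s * (r x * `|q x|)); rewrite sqrrB; lra.
Qed.

Lemma dsum_le n (X : 'I_n -> 'I_n -> R) (y : 'I_n -> R) (K : R) :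
  (forall i j, X i j <= K * ((y i + y j) / 2)) ->
  \sum_i \sum_j X i j <= K * n%:R * \sum_i y i.
Proof.
move=> Xy; apply: (@le_trans _ _ (\sum_i \sum_j K * ((y i + y j) / 2))).
  by apply: ler_sum => i _; apply: ler_sum => j _.
have -> : \sum_i \sum_j K * ((y i + y j) / 2) = K / 2 * (\sum_i \sum_(j < n) y i + \sum_(i < n) \sum_j y j).
  rewrite -big_split mulr_sumr; apply: eq_bigr => i _; rewrite -big_split mulr_sumr.
  by apply: eq_bigr => j _ /=; field.
have -> : \sum_i \sum_(j < n) y i = n%:R * \sum_i y i.
  rewrite mulr_sumr; apply: eq_bigr => i _.
  by rewrite sumr_const card_ord mulr_natl.
rewrite sumr_const card_ord -[X in _ + X]mulr_natl; set S := n%:R * _.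
have -> : K / 2 * (S + S) = K * S by field.
by rewrite /S mulrA.
Qed.

Definition cm m := continuous m /\ bm m.

Lemma cm_bm m : cm m -> bm m. Proof. by case. Qed.

Lemma cmM m m' : cm m -> cm m' -> cm (fun x => m x * m' x).
Proof.
move=> [c b] [c' b']; split; last exact: bmM.
by move=> x; apply: cvgM; [exact: c|exact: c'].
Qed.

Lemma cmD m m' : cm m -> cm m' -> cm (fun x => m x + m' x).
Proof.
move=> [c b] [c' b']; split; last exact: bmD.
by move=> x; apply: cvgD; [exact: c|exact: c'].
Qed.

Lemma cmB m m' : cm m -> cm m' -> cm (fun x => m x - m' x).
Proof.
move=> [c b] [c' b']; split; last exact: bmB.
by move=> x; apply: cvgB; [exact: c|exact: c'].
Qed.

Lemma cmZ (k : R) m : cm m -> cm (fun x => k * m x).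
Proof.
move=> [c b]; split; last exact: bmZ.
by move=> x; apply: cvgM; [exact: cvg_cst|exact: c].
Qed.

Lemma cm_intro m (B : R) : continuous m -> (forall x, `|m x| <= B) -> cm m.
Proof. by move=> c b; split=> //; split; [exact: cont_meas|exists B]. Qed.

(* A function with continuous derivatives in L^2, listed one by one. *)
Definition jet (k : nat) (U : nat -> R -> R) := [/\ forall j, (j < k)%N -> der (U j) (U j.+1),
  forall j, (j <= k)%N -> continuous (U j) & forall j, (j <= k)%N -> sqint (U j)].

Lemma ibpj k m m1 U V i j : jet k U -> jet k V -> (i < k)%N -> (j < k)%N ->
  der m m1 -> cm m -> cm m1 ->
  I3 m (U i) (V j.+1) + I3 m (V j) (U i.+1) = - I3 m1 (U i) (V j).
Proof.
move=> [dU cU sU] [dV cV sV] ik jk dm [_ bm0] [cm1 bm1].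
by apply: ibp dm cm1 bm0 bm1 (dU _ ik) (cU _ ik) (dV _ jk) (cV _ jk) (sU _ _) (sU _ ik)
  (sV _ _) (sV _ jk); exact: ltnW.
Qed.

(** In the sum over both orders the terms with second derivatives combine into total derivatives;
    six single integrations by parts leave first derivatives and the third derivative of the
    coefficient. *)
Lemma ibp3 k m m1 m2 m3 U V : (3 <= k)%N -> jet k U -> jet k V ->
  der m m1 -> der m1 m2 -> der m2 m3 -> cm m -> cm m1 -> cm m2 -> cm m3 ->
  I3 m (U 0%N) (V 3%N) + I3 m (V 0%N) (U 3%N) = 3 * I3 m1 (U 1%N) (V 1%N) - I3 m3 (U 0%N) (V 0%N).
Proof.
move=> k3 Uj Vj d1 d2 d3 c0 c1 c2 c3.
have k2 := ltnW k3; have k1 := ltnW k2.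
have e1 := ibpj Uj Vj k1 k3 d1 c0 c1.
have e2 := ibpj Vj Uj k1 k3 d1 c0 c1.
have e3 := ibpj Uj Vj k2 k2 d1 c0 c1.
have e4 := ibpj Uj Vj k1 k2 d2 c1 c2.
have e5 := ibpj Vj Uj k1 k2 d2 c1 c2.
have e6 := ibpj Uj Vj k1 k1 d3 c2 c3.
have s1 := I3C m (V 2%N) (U 1%N); have s2 := I3C m (V 1%N) (U 2%N).
have s3 := I3C m1 (V 1%N) (U 1%N).
lra.
Qed.

Lemma ibp4 k m m1 m2 U : (4 <= k)%N -> jet k U -> der m m1 -> der m1 m2 ->
  cm m -> cm m1 -> cm m2 ->
  I3 m (U 0%N) (U 4%N) = I3 m (U 2%N) (U 2%N) - I3 m2 (U 1%N) (U 1%N) + I3 m2 (U 0%N) (U 2%N).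
Proof.
move=> k4 Uj d1 d2 c0 c1 c2.
have k3 := ltnW k4; have k2 := ltnW k3; have k1 := ltnW k2.
have e1 := ibpj Uj Uj k1 k4 d1 c0 c1.
have e2 := ibpj Uj Uj k1 k3 d2 c1 c2.
have e3 := ibpj Uj Uj k2 k3 d1 c0 c1.
have e4 := ibpj Uj Uj k2 k2 d2 c1 c2.
have s1 := I3C m (U 3%N) (U 1%N); have s2 := I3C m1 (U 2%N) (U 1%N).
lra.
Qed.

(* The same for a bounded coefficient. *)
Definition cjet (k : nat) (C : R) (F : nat -> R -> R) := [/\ forall j, (j < k)%N -> der (F j) (F j.+1),
  forall j, (j <= k)%N -> continuous (F j) & forall j x, (j <= k)%N -> `|F j x| <= C].

Lemma cjet_cm k C F j : cjet k C F -> (j <= k)%N -> cm (F j).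
Proof. by move=> [_ cF bF] jk; apply: cm_intro (cF j jk) (fun x => bF j x jk). Qed.

Lemma cjetW k l C F : (l <= k)%N -> cjet k C F -> cjet l C F.
Proof.
move=> lk [dF cF bF]; split=> [j jl|j jl|j x jl].
- by apply: dF; exact: leq_trans lk.
- by apply: cF; exact: leq_trans lk.
- by apply: bF; exact: leq_trans lk.
Qed.

Lemma norm2_le (a b A B : R) : `|a| <= A -> `|b| <= B -> `|a + b| <= A + B.
Proof. by move=> aA bB; rewrite (le_trans (ler_normD _ _))// lerD. Qed.

(** The factors 2, 4 and 8 of this lemma and the next two are the sums of binomial coefficients in
    Leibniz's rule. *)
Lemma prod_jet1 P F PM C : cjet 1 PM P -> cjet 1 C F ->
  [/\ der (fun x => P 0%N x * F 0%N x) (fun x => P 1%N x * F 0%N x + P 0%N x * F 1%N x),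
     cm (fun x => P 0%N x * F 0%N x), cm (fun x => P 1%N x * F 0%N x + P 0%N x * F 1%N x) &
     forall x, `|P 1%N x * F 0%N x + P 0%N x * F 1%N x| <= 2 * (PM * C)].
Proof.
move=> Pj Fj; have c k : (k <= 1)%N -> cm (P k) by exact: cjet_cm Pj.
have c' k : (k <= 1)%N -> cm (F k) by exact: cjet_cm Fj.
have [dP _ bP] := Pj; have [dF _ bF] := Fj.
split; first exact: derM (dP 0 isT) (dF 0 isT).
- by apply: cmM; [exact: c|exact: c'].
- by apply: cmD; apply: cmM; [exact: c|exact: c'|exact: c|exact: c'].
- move=> x; rewrite mulrDl mul1r; apply: norm2_le; rewrite normrM ler_pM//;
  by [exact: bP|exact: bF].
Qed.

Lemma prod_jet2 P F PM C : cjet 2 PM P -> cjet 2 C F -> exists m2,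
  [/\ der (fun x => P 1%N x * F 0%N x + P 0%N x * F 1%N x) m2, cm m2 &
     forall x, `|m2 x| <= 4 * (PM * C)].
Proof.
move=> Pj Fj; have c k : (k <= 2)%N -> cm (P k) by exact: cjet_cm Pj.
have c' k : (k <= 2)%N -> cm (F k) by exact: cjet_cm Fj.
have [dP _ bP] := Pj; have [dF _ bF] := Fj.
exists (fun x => (P 2%N x * F 0%N x + P 1%N x * F 1%N x) + (P 1%N x * F 1%N x + P 0%N x * F 2%N x)).
split; first exact: derD (derM (dP 1 isT) (dF 0 isT)) (derM (dP 0 isT) (dF 1 isT)).
- by apply: cmD; apply: cmD; apply: cmM;
    [exact: c|exact: c'|exact: c|exact: c'|exact: c|exact: c'|exact: c|exact: c'].
- move=> x; have -> : 4 * (PM * C) = (PM * C + PM * C) + (PM * C + PM * C) by lra.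
  by apply: norm2_le; apply: norm2_le; rewrite normrM ler_pM//;
  by [exact: bP|exact: bF].
Qed.

Lemma prod_jet3 P F PM C : cjet 3 PM P -> cjet 3 C F -> exists m2 m3,
  [/\ der (fun x => P 1%N x * F 0%N x + P 0%N x * F 1%N x) m2, der m2 m3, cm m2, cm m3 &
     forall x, `|m3 x| <= 8 * (PM * C)].
Proof.
move=> Pj Fj; have c k : (k <= 3)%N -> cm (P k) by exact: cjet_cm Pj.
have c' k : (k <= 3)%N -> cm (F k) by exact: cjet_cm Fj.
have [dP _ bP] := Pj; have [dF _ bF] := Fj.
exists (fun x => (P 2%N x * F 0%N x + P 1%N x * F 1%N x) + (P 1%N x * F 1%N x + P 0%N x * F 2%N x)).
exists (fun x => ((P 3%N x * F 0%N x + P 2%N x * F 1%N x) + (P 2%N x * F 1%N x + P 1%N x * F 2%N x))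
  + ((P 2%N x * F 1%N x + P 1%N x * F 2%N x) + (P 1%N x * F 2%N x + P 0%N x * F 3%N x))).
split; first exact: derD (derM (dP 1 isT) (dF 0 isT)) (derM (dP 0 isT) (dF 1 isT)).
- exact: derD (derD (derM (dP 2 isT) (dF 0 isT)) (derM (dP 1 isT) (dF 1 isT)))
    (derD (derM (dP 1 isT) (dF 1 isT)) (derM (dP 0 isT) (dF 2 isT))).
- by apply: cmD; apply: cmD; apply: cmM;
    [exact: c|exact: c'|exact: c|exact: c'|exact: c|exact: c'|exact: c|exact: c'].
- by do 3 apply: cmD; do ?apply: cmM; do ?[exact: c|exact: c'].
- move=> x; have -> : 8 * (PM * C) = ((PM * C + PM * C) + (PM * C + PM * C)) +
     ((PM * C + PM * C) + (PM * C + PM * C)) by lra.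
  by do 3 apply: norm2_le; rewrite normrM ler_pM//;
  by [exact: bP|exact: bF].
Qed.

Lemma ip_expand n P (A B Cc D : 'I_n -> R -> R) (U0 U1 U2 U3 : 'I_n -> R -> R) V V4 v (eps : R) :
  bm P -> (forall j, bm (A j)) -> (forall j, bm (B j)) -> (forall j, bm (Cc j)) ->
  (forall j, bm (D j)) ->
  (forall j, [/\ sqint (U0 j), sqint (U1 j), sqint (U2 j) & sqint (U3 j)]) ->
  sqint V -> sqint V4 -> sqint v ->
  {ae mu, forall x, v x = - (\sum_j (A j x * U3 j x + B j x * U2 j x
    + Cc j x * U1 j x + D j x * U0 j x)) - eps * V4 x} ->
  ip (fun x => P x * V x) v = - (\sum_j (I3 (fun x => P x * A j x) V (U3 j)
    + I3 (fun x => P x * B j x) V (U2 j) + I3 (fun x => P x * Cc j x) V (U1 j)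
    + I3 (fun x => P x * D j x) V (U0 j))) - eps * I3 P V V4.
Proof.
move=> bP bA bB bC bD Ui Vi V4i vi ae.
pose F j x := P x * A j x * (V x * U3 j x) + P x * B j x * (V x * U2 j x)
  + P x * Cc j x * (V x * U1 j x) + P x * D j x * (V x * U0 j x).
have iA j : intg (fun x => P x * A j x * (V x * U3 j x)).
  by have [_ _ _ ?] := Ui j; apply: I3_intg => //; exact: bmM.
have iB j : intg (fun x => P x * B j x * (V x * U2 j x)).
  by have [_ _ ? _] := Ui j; apply: I3_intg => //; exact: bmM.
have iC j : intg (fun x => P x * Cc j x * (V x * U1 j x)).
  by have [_ ? _ _] := Ui j; apply: I3_intg => //; exact: bmM.
have iD j : intg (fun x => P x * D j x * (V x * U0 j x)).
  by have [? _ _ _] := Ui j; apply: I3_intg => //; exact: bmM.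
have iF j : intg (F j) by apply: intgD => //; apply: intgD => //; exact: intgD.
have iV := I3_intg bP Vi V4i.
have [mP [BP PB]] := bP.
have iS : intg (fun x => - \sum_j F j x) by apply: intgN; apply: intg_sum.
have -> : ip (fun x => P x * V x) v =
    \int[mu]_x ((- \sum_j F j x) - eps * (P x * (V x * V4 x))).
  apply: Rint_ae.
  - by apply: intg_meas; apply: sqint_mul => //; exact: sqintMb mP PB Vi.
  - by apply: intg_meas; apply: intgB => //; exact: intgZ.
  - apply: ae_imp ae => x ->; rewrite /F mulrBr mulrN mulr_sumr.
    congr (- _ - _); last by ring.
    by apply: eq_bigr => j _; ring.
rewrite RintB//; last exact: intgZ.
rewrite RintZ//; congr (_ - _).
have -> : \int[mu]_x (- \sum_j F j x) = - \int[mu]_x (\sum_j F j x).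
  rewrite -[RHS]mulN1r -RintZ; last exact: intg_sum.
  by apply: Rint_eq => x; rewrite mulN1r.
rewrite Rint_sum//; congr (- _); apply: eq_bigr => j _.
rewrite /F RintD//; last by apply: intgD => //; exact: intgD.
by rewrite RintD// ?RintD//; exact: intgD.
Qed.

Lemma sum_const n (x : R) : \sum_(j < n) x = n%:R * x.
Proof. by rewrite sumr_const card_ord mulr_natl. Qed.

(** * The weighted energy inequality for abstract coefficients *)

Section energy_inequality.
Variables (n : nat) (lambda C0 C Q Pm PM M eps : R) (P : nat -> R -> R) (r : R -> R).
Variables (A B Cc : 'I_n -> 'I_n -> nat -> R -> R) (D : 'I_n -> 'I_n -> R -> R).
Variables (U : 'I_n -> nat -> R -> R) (v : 'I_n -> R -> R).
Hypotheses (hn : (0 < n)%N) (hPm : 0 < Pm) (hP : cjet 3 PM P) (hPm' : forall x, Pm <= P 0%N x).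
Hypotheses (hA : forall i j, cjet 3 C (A i j)) (hB : forall i j, cjet 2 C (B i j)).
Hypotheses (hC : forall i j, cjet 1 C (Cc i j)) (hD : forall i j, bm (D i j)).
Hypothesis hDC : forall i j x, `|D i j x| <= C.
Hypothesis hsym : forall i j x, A i j 0%N x = A j i 0 x.
Hypothesis hell : forall x (y : 'I_n -> R),
  lambda / 2 * \sum_i y i ^+ 2 <= \sum_i \sum_j A i j 0%N x * (y i * y j).
Hypothesis hr : bm r.
Hypothesis hA1 : forall i j x, `|A i j 1%N x| <= 2 * C0 * r x ^+ 2.
Hypothesis hB0 : forall i j x, `|B i j 0%N x| <= 2 * C0 * r x ^+ 2.
(** [Q] may depend on C1, since it feeds the growth rate of the energy, whereas the two bounds above
    determine M and must be in terms of [C0]. *)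
Hypothesis hBQ : forall i j x, `|B i j 0%N x| <= Q * r x.
Hypothesis hB1 : forall i j x, `|B i j 1%N x - B j i 1 x| <= Q * r x.
Hypothesis hC0 : forall i j x, `|Cc i j 0%N x - Cc j i 0 x| <= Q * r x.
Hypothesis hP1 : forall x, M * r x ^+ 2 * P 0%N x <= P 1%N x.
Hypotheses (hM0 : 0 <= M) (hlam : 0 < lambda).
(** 10 = 2 * 2 + 3 * 2, from 2 B - 3 A' where the entries of B and of the derivative of A are at
    most 2 C0 r^2. The 1 is the dissipation that remains. *)
Hypothesis hM : 10 * C0 * n%:R + 1 <= 3 * (lambda / 2) * M.
Hypothesis hU : forall i, jet 4 (U i).

Let N := \sum_i nsq (U i 0%N).
Let DD := \sum_i nsq (fun x => r x * U i 1%N x).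

Let sU i k : (k <= 4)%N -> sqint (U i k).
Proof. by move=> k4; have [_ _ h] := hU i; exact: h. Qed.

Let cP k : (k <= 3)%N -> cm (P k).
Proof. by move=> k3; exact: cjet_cm hP k3. Qed.

Let cA i j k : (k <= 3)%N -> cm (A i j k).
Proof. by move=> k3; exact: cjet_cm (hA i j) k3. Qed.

Let cB i j k : (k <= 2)%N -> cm (B i j k).
Proof. by move=> k3; exact: cjet_cm (hB i j) k3. Qed.

Let cC i j k : (k <= 1)%N -> cm (Cc i j k).
Proof. by move=> k3; exact: cjet_cm (hC i j) k3. Qed.

Let PM0 : 0 <= PM.
Proof. by have [_ _ h] := hP; apply: le_trans (h 0%N 0 isT). Qed.

Let P0_ge0 x : 0 <= P 0%N x. Proof. exact: le_trans (ltW hPm) (hPm' x). Qed.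

Let rU_sq i : sqint (fun x => r x * U i 1%N x).
Proof. by have [mr [Br hb]] := hr; exact: sqintMb mr hb (sU i (isT : 1 <= 4)%N). Qed.

Let m1 i j x := P 1%N x * A i j 0%N x + P 0%N x * A i j 1%N x.
Let n1 i j x := P 1%N x * B i j 0%N x + P 0%N x * B i j 1%N x.

Let cm1 i j : cm (m1 i j).
Proof. by apply: cmD; apply: cmM; [exact: cP|exact: cA|exact: cP|exact: cA]. Qed.

Let cn1 i j : cm (n1 i j).
Proof. by apply: cmD; apply: cmM; [exact: cP|exact: cB|exact: cP|exact: cB]. Qed.

(** By symmetry of [A], twice the double sum is the sum over both orders of the indices, to which
    [ibp3] applies. The remainder carries the third derivative of weight times coefficient, at most
    8 PM C. *)
Lemma third_order : - (2 * \sum_i \sum_j I3 (fun x => P 0%N x * A i j 0%N x) (U i 0%N) (U j 3%N)) <=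
  - (3 * \sum_i \sum_j I3 (m1 i j) (U i 1%N) (U j 1%N)) + 8 * (PM * C) * n%:R * N.
Proof.
set S := \sum_i _.
have eS : 2 * S = \sum_i \sum_j (I3 (fun x => P 0%N x * A i j 0%N x) (U i 0%N) (U j 3%N) +
    I3 (fun x => P 0%N x * A i j 0%N x) (U j 0%N) (U i 3%N)).
  rewrite mulr_natl mulr2n [in LHS]/S {2}exchange_big /= -big_split.
  apply: eq_bigr => i _; rewrite -big_split; apply: eq_bigr => j _; congr (_ + _).
  by apply: Rint_eq => x; rewrite hsym.
have : \sum_i \sum_j (3 * I3 (m1 i j) (U i 1%N) (U j 1%N) -
    (I3 (fun x => P 0%N x * A i j 0%N x) (U i 0%N) (U j 3%N) +
     I3 (fun x => P 0%N x * A i j 0%N x) (U j 0%N) (U i 3%N))) <= 8 * (PM * C) * n%:R * N.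
  apply: dsum_le => i j.
  have [m2 [m3 [d1 d2 c2 c3 b3]]] := prod_jet3 hP (hA i j).
  have [d0 c0 _ _] := prod_jet1 (cjetW (isT : 1 <= 3)%N hP) (cjetW (isT : 1 <= 3)%N (hA i j)).
  have := ibp3 (isT : 3 <= 4)%N (hU i) (hU j) d0 d1 d2 c0 (cm1 i j) c2 c3.
  have := I3_le (cm_bm c3) b3 (sU i (isT : 0 <= 4)%N) (sU j (isT : 0 <= 4)%N).
  move=> /(le_trans (ler_norm _)) h ->.
  by rewrite opprB addrC subrK.
under eq_bigr do rewrite sumrB.
rewrite sumrB -eS; under eq_bigr do rewrite -mulr_sumr.
rewrite -mulr_sumr; lra.
Qed.

Lemma second_order : - (2 * \sum_i \sum_j I3 (fun x => P 0%N x * B i j 0%N x) (U i 0%N) (U j 2%N)) =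
  2 * (\sum_i \sum_j I3 (n1 i j) (U i 0%N) (U j 1%N)) +
  2 * \sum_i \sum_j I3 (fun x => P 0%N x * B i j 0%N x) (U i 1%N) (U j 1%N).
Proof.
rewrite -mulrDr -mulrN; congr (2 * _); rewrite -sumrN -big_split; apply: eq_bigr => i _.
rewrite -sumrN -big_split; apply: eq_bigr => j _ /=.
have [d0 c0 c1 _] := prod_jet1 (cjetW (isT : 1 <= 3)%N hP) (cjetW (isT : 1 <= 2)%N (hB i j)).
have := ibpj (hU i) (hU j) (isT : 0 < 4)%N (isT : 1 < 4)%N d0 c0 c1.
rewrite (I3C _ (U j 1%N) (U i 1%N)) -/(n1 i j) => h; lra.
Qed.

(** The coefficient is split into its symmetric and antisymmetric parts in (i, j). The symmetric
    part sees the derivative of u_i u_j, so one more integration by parts leaves no derivative of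
    [U]; the antisymmetric part decays like [r] and is treated by [I3_cross]. *)
Lemma first_order : 2 * (\sum_i \sum_j I3 (n1 i j) (U i 0%N) (U j 1%N))
    - 2 * \sum_i \sum_j I3 (fun x => P 0%N x * Cc i j 0%N x) (U i 0%N) (U j 1%N) <=
  6 * (PM * C) * n%:R * N + ((4 * PM * Q) ^+ 2 / (Pm / n%:R) / 2 * n%:R * N + Pm / 2 * DD).
Proof.
have n0 : 0 < n%:R :> R by rewrite ltr0n.
pose q i j x := 2 * n1 i j x - 2 * (P 0%N x * Cc i j 0%N x).
have cPC i j : cm (fun x => P 0%N x * Cc i j 0%N x) by apply: cmM; [exact: cP|exact: cC].
have cq i j : cm (q i j) by apply: cmB; exact: cmZ.
pose s i j x := 2^-1 * (q i j x + q j i x).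
pose k i j x := 2^-1 * (q i j x - q j i x).
have cs i j : cm (s i j) by apply: cmZ; exact: cmD.
have ck i j : cm (k i j) by apply: cmZ; exact: cmB.
have -> : 2 * (\sum_i \sum_j I3 (n1 i j) (U i 0%N) (U j 1%N))
    - 2 * (\sum_i \sum_j I3 (fun x => P 0%N x * Cc i j 0%N x) (U i 0%N) (U j 1%N)) =
  \sum_i \sum_j I3 (s i j) (U i 0%N) (U j 1%N) + \sum_i \sum_j I3 (k i j) (U i 0%N) (U j 1%N).
  rewrite !mulr_sumr -sumrB -big_split; apply: eq_bigr => i _ /=.
  rewrite !mulr_sumr -sumrB -big_split; apply: eq_bigr => j _ /=.
  have s0 := sU i (isT : 0 <= 4)%N; have s1 := sU j (isT : 1 <= 4)%N.
  rewrite -(I3Z _ (cm_bm (cn1 i j)) s0 s1) -(I3Z _ (cm_bm (cPC i j)) s0 s1).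
  rewrite -I3B//; [|exact: bmZ (cm_bm (cn1 i j))|exact: bmZ (cm_bm (cPC i j))].
  rewrite -I3D//; [|exact: cm_bm|exact: cm_bm].
  by apply: Rint_eq => x; rewrite /s /k /q; congr (_ * _); field.
apply: lerD.
  have eS : 2 * (\sum_i \sum_j I3 (s i j) (U i 0%N) (U j 1%N)) = \sum_i \sum_j
      (I3 (s i j) (U i 0%N) (U j 1%N) + I3 (s i j) (U j 0%N) (U i 1%N)).
    rewrite mulr_natl mulr2n {2}exchange_big /= -big_split.
    apply: eq_bigr => i _; rewrite -big_split; apply: eq_bigr => j _; congr (_ + _).
    by apply: Rint_eq => x; rewrite /s [q i j x + _]addrC.
  (* 12 = 4 + 2 + 4 + 2: the Leibniz bounds for the derivatives of [n1] and of the product with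
     [Cc], and their transposes. *)
  have : 2 * (\sum_i \sum_j I3 (s i j) (U i 0%N) (U j 1%N)) <= 12 * (PM * C) * n%:R * N.
    rewrite eS; apply: dsum_le => i j.
    have [nij [dn cn bn]] := prod_jet2 (cjetW (isT : 2 <= 3)%N hP) (hB i j).
    have [nji [dn' cn' bn']] := prod_jet2 (cjetW (isT : 2 <= 3)%N hP) (hB j i).
    have [dc _ cc bc] := prod_jet1 (cjetW (isT : 1 <= 3)%N hP) (hC i j).
    have [dc' _ cc' bc'] := prod_jet1 (cjetW (isT : 1 <= 3)%N hP) (hC j i).
    have ds := derZ 2^-1 (derD (derB (derZ 2 dn) (derZ 2 dc)) (derB (derZ 2 dn') (derZ 2 dc'))).
    have cs1 := cmZ 2^-1 (cmD (cmB (cmZ 2 cn) (cmZ 2 cc)) (cmB (cmZ 2 cn') (cmZ 2 cc'))).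
    have := ibpj (hU i) (hU j) (isT : 0 < 4)%N (isT : 0 < 4)%N ds (cs i j) cs1 => e.
    rewrite [leLHS]e.
    apply: (le_trans (ler_norm _)); rewrite normrN.
    apply: (le_trans (I3_le (K := 12 * (PM * C)) (cm_bm cs1) _ (sU i (isT : 0 <= 4)%N)
      (sU j (isT : 0 <= 4)%N))) => // x.
    move: (bn x) (bn' x) (bc x) (bc' x); rewrite !ler_norml.
    move=> /andP[h1 h2] /andP[h3 h4] /andP[h5 h6] /andP[h7 h8].
    by apply/andP; split; lra.
  by lra.
(* Young's parameter is Pm / n because the sum over the other index multiplies it by n; in total
   half of the dissipation Pm DD is spent. *)
have : \sum_i \sum_j I3 (k i j) (U i 0%N) (U j 1%N) <= \sum_i \sum_j
    ((4 * PM * Q) ^+ 2 / (Pm / n%:R) / 2 * nsq (U i 0%N)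
     + Pm / n%:R / 2 * nsq (fun x => r x * U j 1%N x)).
  apply: ler_sum => i _; apply: ler_sum => j _.
  apply: I3_cross (cm_bm (ck i j)) hr _ _ (sU i (isT : 0 <= 4)%N) (sU j (isT : 1 <= 4)%N).
    by rewrite divr_gt0.
  move=> x; have [_ _ bP] := hP.
  have p0 := bP 0%N x isT; have p1 := bP 1%N x isT.
  have -> : k i j x = P 1%N x * (B i j 0%N x - B j i 0 x) + P 0%N x * (B i j 1%N x - B j i 1 x)
     - P 0%N x * (Cc i j 0%N x - Cc j i 0 x) by rewrite /k /q /n1; field.
  have e1 : `|P 1%N x * (B i j 0%N x - B j i 0 x)| <= PM * (Q * r x + Q * r x).
    by rewrite normrM ler_pM// (le_trans (ler_normB _ _))// lerD.
  have e2 : `|P 0%N x * (B i j 1%N x - B j i 1 x)| <= PM * (Q * r x) by rewrite normrM ler_pM.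
  have e3 : `|P 0%N x * (Cc i j 0%N x - Cc j i 0 x)| <= PM * (Q * r x) by rewrite normrM ler_pM.
  move: e1 e2 e3; rewrite !ler_norml.
  move=> /andP[h1 h2] /andP[h3 h4] /andP[h5 h6].
  have -> : 4 * PM * Q * r x = PM * (Q * r x + Q * r x) + PM * (Q * r x) + PM * (Q * r x) by ring.
  by apply/andP; split; lra.
move=> /le_trans; apply.
under eq_bigr do rewrite big_split /= sum_const -mulr_sumr.
rewrite big_split /= sum_const -mulr_sumr -mulr_sumr -/N -/DD.
have e1 : n%:R * (Pm / n%:R / 2 * DD) = Pm / 2 * DD by field; rewrite gt_eqF.
by rewrite e1 lerD2r mulrA [n%:R * _]mulrC.
Qed.

(** A pointwise inequality. Ellipticity and [hP1] make the derivative of the weight dominate the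
    terms with B and with the derivative of A, and the 1 in [hM] leaves P r^2 |u_x|^2, which is at
    least Pm r^2 |u_x|^2. *)
Lemma principal : - (3 * \sum_i \sum_j I3 (m1 i j) (U i 1%N) (U j 1%N)) +
  2 * (\sum_i \sum_j I3 (fun x => P 0%N x * B i j 0%N x) (U i 1%N) (U j 1%N)) <= - (Pm * DD).
Proof.
have s1 i := sU i (isT : 1 <= 4)%N.
have cPB i j : cm (fun x => P 0%N x * B i j 0%N x) by apply: cmM; [exact: cP|exact: cB].
pose w i j x := 2 * (P 0%N x * B i j 0%N x) - 3 * m1 i j x.
have bw i j : bm (w i j) by apply: cm_bm; apply: cmB; exact: cmZ.
have -> : - (3 * \sum_i \sum_j I3 (m1 i j) (U i 1%N) (U j 1%N)) +
  2 * (\sum_i \sum_j I3 (fun x => P 0%N x * B i j 0%N x) (U i 1%N) (U j 1%N)) =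
  \sum_i \sum_j I3 (w i j) (U i 1%N) (U j 1%N).
  rewrite addrC !mulr_sumr -sumrB; apply: eq_bigr => i _; rewrite !mulr_sumr -sumrB.
  apply: eq_bigr => j _; rewrite -(I3Z _ (cm_bm (cPB i j)))// -(I3Z _ (cm_bm (cm1 i j)))//.
  by rewrite -I3B//; apply: cm_bm; exact: cmZ.
have iw i j := I3_intg (bw i j) (s1 i) (s1 j).
have ir i : intg (fun x => - Pm * (r x * U i 1%N x) ^+ 2).
  by apply: intgZ; have [] := rU_sq i.
have -> : \sum_i \sum_j I3 (w i j) (U i 1%N) (U j 1%N) =
    \int[mu]_x (\sum_i \sum_j w i j x * (U i 1%N x * U j 1%N x)).
  rewrite Rint_sum => [|i]; last by apply: intg_sum.
  by apply: eq_bigr => i _; rewrite Rint_sum.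
have -> : - (Pm * DD) = \int[mu]_x (\sum_i - Pm * (r x * U i 1%N x) ^+ 2).
  rewrite Rint_sum// -mulNr mulr_sumr; apply: eq_bigr => i _.
  by rewrite nsqE -RintZ//; have [] := rU_sq i.
apply: Rint_le; [by apply: intg_sum => i; exact: intg_sum|exact: intg_sum|] => x.
set y := fun i => U i 1%N x.
have a1 := hell x y; have p0 := P0_ge0 x; have pm := hPm' x; have p1 := hP1 x.
have S0 : 0 <= \sum_i y i ^+ 2 by apply: sumr_ge0 => i _; exact: sqr_ge0.
have r0 := sqr_ge0 (r x).
have -> : \sum_i - Pm * (r x * U i 1%N x) ^+ 2 = - (Pm * r x ^+ 2 * \sum_i y i ^+ 2).
  rewrite -mulNr mulr_sumr; apply: eq_bigr => i _; rewrite /y exprMn; ring.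
have -> : \sum_i \sum_j w i j x * (U i 1%N x * U j 1%N x) =
  - (3 * P 1%N x * \sum_i \sum_j A i j 0%N x * (y i * y j)) +
  \sum_i \sum_j P 0%N x * (2 * B i j 0%N x - 3 * A i j 1%N x) * (y i * y j).
  rewrite mulr_sumr -sumrN -big_split; apply: eq_bigr => i _ /=.
  rewrite mulr_sumr -sumrN -big_split; apply: eq_bigr => j _ /=.
  by rewrite /w /m1 /y; ring.
have : \sum_i \sum_j P 0%N x * (2 * B i j 0%N x - 3 * A i j 1%N x) * (y i * y j) <=
    P 0%N x * (10 * C0 * r x ^+ 2) * n%:R * \sum_i y i ^+ 2.
  apply: dsum_le => i j; rewrite -!mulrA; apply: ler_wpM2l => //.
  apply: (le_trans (ler_norm _)); rewrite normrM.
  have h1 : `|2 * B i j 0%N x - 3 * A i j 1%N x| <= 10 * (C0 * r x ^+ 2).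
    move: (hB0 i j x) (hA1 i j x); rewrite !ler_norml => /andP[h1 h2] /andP[h3 h4].
    by apply/andP; split; lra.
  have h2 : `|y i * y j| <= (y i ^+ 2 + y j ^+ 2) / 2.
    rewrite normrM; have := sqr_ge0 (`|y i| - `|y j|).
    by rewrite sqrrB !real_normK ?num_real//; lra.
  have := ler_pM (normr_ge0 _) (normr_ge0 _) h1 h2.
  by rewrite -!mulrA.
move: (\sum_i \sum_j A i j 0%N x * (y i * y j)) a1 => a a1.
move: (\sum_i \sum_j _) => b hb.
have p1ge : 0 <= P 1%N x.
  by apply: le_trans p1; apply: mulr_ge0 => //; apply: mulr_ge0.
have e1 : 3 * P 1%N x * (lambda / 2 * (\sum_i y i ^+ 2)) <= 3 * P 1%N x * a.
  by apply: ler_wpM2l => //; apply: mulr_ge0.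
have l2 : 0 <= 3 * (lambda / 2) by apply: mulr_ge0 => //; apply: divr_ge0 => //; exact: ltW.
have e2 : 3 * (lambda / 2) * (M * r x ^+ 2 * P 0%N x) <= 3 * (lambda / 2) * P 1%N x.
  exact: ler_wpM2l.
have e3 : (10 * C0 * n%:R + 1) * (r x ^+ 2 * P 0%N x) <= 3 * (lambda / 2) * M * (r x ^+ 2 * P 0%N x).
  by apply: ler_wpM2r => //; apply: mulr_ge0.
have e4 : Pm * r x ^+ 2 <= P 0%N x * r x ^+ 2 by apply: ler_wpM2r.
move: (\sum_i y i ^+ 2) S0 e1 hb => S S0 e1 hb.
have e5 : ((10 * C0 * n%:R + 1) * (r x ^+ 2 * P 0%N x)) * S <= 3 * (lambda / 2) * P 1%N x * S.
  apply: ler_wpM2r => //; apply: le_trans e3 _; apply: le_trans e2.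
  by rewrite le_eqVlt; apply/orP; left; apply/eqP; ring.
have e6 : Pm * r x ^+ 2 * S <= P 0%N x * r x ^+ 2 * S by apply: ler_wpM2r.
lra.
Qed.

(** Integration by parts produces the weighted square of u_xx with the good sign. The errors, which
    carry the second derivative of the weight, are interpolated between u and u_xx; with eps <= 1
    the resulting bound no longer contains eps. *)
Lemma eps_term : 0 <= eps <= 1 ->
  - (2 * eps * \sum_i I3 (P 0%N) (U i 0%N) (U i 4%N)) <= 4 * (PM ^+ 2 / Pm) * N.
Proof.
move=> /andP[e0 e1]; rewrite mulr_sumr -sumrN /N mulr_sumr; apply: ler_sum => i _.
have [dP _ bP] := hP.
have s0 := sU i (isT : 0 <= 4)%N; have s1 := sU i (isT : 1 <= 4)%N.
have s2 := sU i (isT : 2 <= 4)%N.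
rewrite (ibp4 (isT : 4 <= 4)%N (hU i) (dP 0%N isT) (dP 1%N isT)
  (cP (isT : 0 <= 3)%N) (cP (isT : 1 <= 3)%N) (cP (isT : 2 <= 3)%N)).
have c1 : cm (fun=> 1 : R).
  by apply: (@cm_intro _ 1) => x; [exact: cvg_cst|rewrite normr1].
have c0 : cm (fun=> 0 : R).
  by apply: (@cm_intro _ 0) => x; [exact: cvg_cst|rewrite normr0].
have := ibpj (hU i) (hU i) (isT : 0 < 4)%N (isT : 1 < 4)%N (der_cst 1) c1 c0.
have -> : I3 (fun=> 0) (U i 0%N) (U i 1%N) = 0.
  by rewrite /I3 (@Rint_eq _ _ (fun=> 0)) ?Rint0// => x; rewrite mul0r.
have -> : I3 (fun=> 1) (U i 1%N) (U i 1%N) = nsq (U i 1%N).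
  by rewrite nsqE; apply: Rint_eq => x; rewrite mul1r.
rewrite oppr0 => e.
(* This makes PM th = Pm / 2, so the two error terms together take Pm / 2 out of the coefficient Pm
   of u_xx^2. *)
pose th := Pm / (2 * PM).
have hPm0 := hPm; have PMge : Pm <= PM.
  by apply: le_trans (hPm' 0) _; apply: le_trans (ler_norm _) (bP _ _ _).
have PMgt : 0 < PM by lra.
have th0 : 0 < th by rewrite divr_gt0// mulr_gt0.
have br : bm (fun=> 1 : R) by exact: cm_bm.
have nU : nsq (fun x => 1 * U i 2%N x) = nsq (U i 2%N).
  by rewrite !nsqE; apply: Rint_eq => x; rewrite mul1r.
(* Interpolation: the squared norm of u_x is minus the pairing of u with u_xx. *)
have le1 : nsq (U i 1%N) <= 1 / th / 2 * nsq (U i 0%N) + th / 2 * nsq (U i 2%N).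
  have := @I3_cross (fun=> - 1) (fun=> 1) (U i 0%N) (U i 2%N) 1 th.
  rewrite nU expr1n => h.
  have : I3 (fun=> - 1) (U i 0%N) (U i 2%N) = nsq (U i 1%N).
    have -> : I3 (fun=> - 1) (U i 0%N) (U i 2%N) = - I3 (fun=> 1) (U i 0%N) (U i 2%N).
      rewrite /I3 -[RHS]mulN1r -RintZ; last exact: I3_intg.
      by apply: Rint_eq => x; rewrite mul1r.
    by move/eqP: e; rewrite addrC addr_eq0 => /eqP ->.
  move=> <-; apply: h => //; last by move=> x; rewrite normrN normr1 mulr1.
  by apply: cm_bm; apply: (@cm_intro _ 1) => x; [exact: cvg_cst|rewrite normrN normr1].
have b2 x : `|P 2%N x| <= PM by exact: bP.
have le2 : I3 (P 2%N) (U i 1%N) (U i 1%N) <= PM * nsq (U i 1%N).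
  have := I3_le (cm_bm (cP (isT : 2 <= 3)%N)) b2 s1 s1.
  have -> : (nsq (U i 1%N) + nsq (U i 1%N)) / 2 = nsq (U i 1%N) by field.
  exact: le_trans (ler_norm _).
have le3 : - I3 (P 2%N) (U i 0%N) (U i 2%N) <= PM / th / 2 * nsq (U i 0%N) + PM * th / 2 * nsq (U i 2%N).
  have pth : 0 < th / PM by rewrite divr_gt0.
  have := @I3_cross (fun x => - 1 * P 2%N x) (fun=> 1) (U i 0%N) (U i 2%N) PM (PM * th).
  rewrite nU I3Z//; last by exact: cm_bm (cP _).
  rewrite mulN1r => h; have := h (bmZ _ (cm_bm (cP (isT : 2 <= 3)%N))) br.
  move=> /(_ (mulr_gt0 PMgt th0)) h'.
  have -> : PM / th / 2 = PM ^+ 2 / (PM * th) / 2 by field; rewrite !gt_eqF.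
  by apply: h' => // x; rewrite mulN1r normrN mulr1.
have ge : Pm * nsq (U i 2%N) <= I3 (P 0%N) (U i 2%N) (U i 2%N).
  rewrite nsqE -RintZ; last by have [] := s2.
  apply: Rint_le; first by apply: intgZ; have [] := s2.
    by apply: I3_intg => //; exact: cm_bm (cP _).
  by move=> x; rewrite -expr2 ler_wpM2r ?sqr_ge0.
have X0 := nsq_ge0 (U i 2%N); have N0 := nsq_ge0 (U i 0%N).
move: (I3 (P 0%N) (U i 2%N) (U i 2%N)) (I3 (P 2%N) (U i 1%N) (U i 1%N)) (I3 (P 2%N) (U i 0%N) (U i 2%N)) le2 le3 ge => a b c le2 le3 ge.
have le4 : PM * nsq (U i 1%N) <= PM * (1 / th / 2 * nsq (U i 0%N) + th / 2 * nsq (U i 2%N)).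
  by apply: ler_wpM2l => //; exact: ltW.
have e2 : PM * th = Pm / 2 by rewrite /th; field; rewrite gt_eqF.
have e3 : PM / th = 2 * (PM ^+ 2 / Pm) by rewrite /th; field; rewrite !gt_eqF.
have F : - (a - b + c) <= 2 * (PM ^+ 2 / Pm) * nsq (U i 0%N) - Pm / 2 * nsq (U i 2%N).
  have e4 : PM * (1 / th / 2 * nsq (U i 0%N) + th / 2 * nsq (U i 2%N)) =
    PM / th / 2 * nsq (U i 0%N) + PM * th / 2 * nsq (U i 2%N) by ring.
  rewrite e4 e2 e3 in le4; rewrite e2 e3 in le3; lra.
have G : - (a - b + c) <= 2 * (PM ^+ 2 / Pm) * nsq (U i 0%N).
  apply: (le_trans F); rewrite lerBlDr lerDl; apply: mulr_ge0 => //.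
  by apply: divr_ge0 => //; exact: ltW.
have k0 : 0 <= 2 * (PM ^+ 2 / Pm) * nsq (U i 0%N).
  by apply: mulr_ge0 => //; apply: mulr_ge0 => //; apply: divr_ge0; [exact: sqr_ge0|exact: ltW].
have G' := ler_wpM2l e0 G.
have K' : eps * (2 * (PM ^+ 2 / Pm) * nsq (U i 0%N)) <= 1 * (2 * (PM ^+ 2 / Pm) * nsq (U i 0%N)).
  exact: ler_wpM2r.
lra.
Qed.

(** 16 = 8 + 6 + 2 collects the third order, the symmetric first order and the zeroth order terms.
    Then come the Cauchy-Schwarz constant of the antisymmetric part and the contribution of the
    fourth order term. *)
Definition energy_const := 16 * (PM * C) * n%:R
  + (4 * PM * Q) ^+ 2 / (Pm / n%:R) / 2 * n%:R + 4 * (PM ^+ 2 / Pm).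

Hypothesis hv : forall i, sqint (v i).
Hypothesis heq : forall i, {ae mu, forall x, v i x = - (\sum_j (A i j 0%N x * U j 3%N x
  + B i j 0%N x * U j 2%N x + Cc i j 0%N x * U j 1%N x + D i j x * U j 0%N x)) - eps * U i 4%N x}.

Lemma energy_ineq : 0 <= eps <= 1 ->
  2 * (\sum_i ip (fun x => P 0%N x * U i 0%N x) (v i)) <= - (Pm / 2 * DD) + energy_const * N.
Proof.
move=> e01.
have bA i j := cm_bm (cA i j (isT : 0 <= 3)%N).
have bB i j := cm_bm (cB i j (isT : 0 <= 2)%N).
have bC i j := cm_bm (cC i j (isT : 0 <= 1)%N).
have sj j : [/\ sqint (U j 0%N), sqint (U j 1%N), sqint (U j 2%N) & sqint (U j 3%N)].
  by split; exact: sU.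
have eq i := ip_expand (cm_bm (cP (isT : 0 <= 3)%N)) (bA i) (bB i) (bC i) (hD i) sj
  (sU i (isT : 0 <= 4)%N) (sU i (isT : 4 <= 4)%N) (hv i) (heq i).
under eq_bigr do rewrite eq.
rewrite sumrB sumrN -mulr_sumr.
under eq_bigr do rewrite !big_split /=.
rewrite !big_split /=.
have D0 : - (2 * \sum_i \sum_j I3 (fun x => P 0%N x * D i j x) (U i 0%N) (U j 0%N)) <=
    2 * (PM * C) * n%:R * N.
  rewrite mulr_sumr -sumrN; under eq_bigr do rewrite mulr_sumr -sumrN.
  apply: dsum_le => i j.
  have [_ _ bP] := hP.
  have b x : `|P 0%N x * D i j x| <= PM * C by rewrite normrM ler_pM// bP.
  have := I3_le (bmM (cm_bm (cP (isT : 0 <= 3)%N)) (hD i j)) b (sU i (isT : 0 <= 4)%N)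
    (sU j (isT : 0 <= 4)%N).
  rewrite ler_norml => /andP[h _]; lra.
have h1 := third_order; have h2 := second_order; have h3 := first_order.
have h4 := principal; have h5 := eps_term e01.
rewrite /energy_const; move: h1 h2 h3 h4 h5 D0.
move: (\sum_i \sum_j I3 (fun x => P 0%N x * A i j 0%N x) (U i 0%N) (U j 3%N)) => x1.
move: (\sum_i \sum_j I3 (m1 i j) (U i 1%N) (U j 1%N)) => x2.
move: (\sum_i \sum_j I3 (fun x => P 0%N x * B i j 0%N x) (U i 0%N) (U j 2%N)) => x3.
move: (\sum_i \sum_j I3 (n1 i j) (U i 0%N) (U j 1%N)) => x4.
move: (\sum_i \sum_j I3 (fun x => P 0%N x * B i j 0%N x) (U i 1%N) (U j 1%N)) => x5.
move: (\sum_i \sum_j I3 (fun x => P 0%N x * Cc i j 0%N x) (U i 0%N) (U j 1%N)) => x6.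
move: (\sum_i \sum_j I3 (fun x => P 0%N x * D i j x) (U i 0%N) (U j 0%N)) => x7.
move: (\sum_i I3 (P 0%N) (U i 0%N) (U i 4%N)) => x8.
move: (PM * C) ((4 * PM * Q) ^+ 2 / (Pm / n%:R) / 2) (PM ^+ 2 / Pm) N DD (n%:R : R).
move=> k1 k2 k3 NN D1 nn h1 h2 h3 h4 h5 h6.
lra.
Qed.

End energy_inequality.

End energy.

(** * Propagation of decay in time, antisymmetric parts, truncation *)

Section coefficient_bounds.
Context {R : realType}.
Notation mu := (@lebesgue_measure R).

(** The mean value theorem in t at a fixed x keeps the rate of decay in x and lets the constant grow
    linearly in t. *)
Lemma weighted_time (T w K0 K1 : R) p q (M M' : R -> R -> 'M[R]_(p, q)) :
  (forall x i j, td T (fun t => M t x i j) (fun t => M' t x i j)) ->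
  (forall x, jap x `^ w * `|M 0 x| <= K0) ->
  (forall t x, 0 <= t <= T -> jap x `^ w * `|M' t x| <= K1) ->
  forall t x i j, 0 <= t <= T -> `|M t x i j| <= (K0 + K1 * t) * jp (- w) x.
Proof.
move=> Mtd M0 M1 t x i j tT.
have jw := jp_gt0 w x; rewrite jpN.
have e0 : `|M 0 x i j| <= K0 / jp w x.
  rewrite ler_pdivlMr// mulrC; apply: le_trans (M0 x).
  by apply: ler_wpM2l; [exact: jp_ge0|exact: mx_entry_le].
have e1 s : 0 <= s <= T -> `|M' s x i j| <= K1 / jp w x.
  move=> sT; rewrite ler_pdivlMr// mulrC; apply: le_trans (M1 s x sT).
  by apply: ler_wpM2l; [exact: jp_ge0|exact: mx_entry_le].
have h := td_mvt (Mtd x i j) e1 tT.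
have -> : M t x i j = (M t x i j - M 0 x i j) + M 0 x i j by rewrite subrK.
apply: (le_trans (ler_normD _ _)); apply: (le_trans (lerD h e0)).
by rewrite mulrDl addrC lerD2l mulrAC.
Qed.

Lemma td_lin (T k : R) (y1 y1' y2 y2' : R -> R) : td T y1 y1' -> td T y2 y2' ->
  td T (fun t => k * (y1 t - y2 t)) (fun t => k * (y1' t - y2' t)).
Proof.
move=> h1 h2 t0 t0T e e0; have k0 : 0 < 1 + `|k| by rewrite ltr_pwDl.
have e'0 : 0 < e / (1 + `|k|) / 2 by rewrite !divr_gt0.
have [d1 d10 D1] := h1 t0 t0T _ e'0; have [d2 d20 D2] := h2 t0 t0T _ e'0.
exists (Num.min d1 d2); first by rewrite lt_min d10.
move=> t tT; rewrite lt_min => /andP[td1 td2].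
have := D1 t tT td1; have := D2 t tT td2; set f := e / _ / 2 => a b.
have -> : k * (y1 t - y2 t) - k * (y1 t0 - y2 t0) - (t - t0) * (k * (y1' t0 - y2' t0)) =
  k * ((y1 t - y1 t0 - (t - t0) * y1' t0) - (y2 t - y2 t0 - (t - t0) * y2' t0)) by ring.
rewrite normrM; apply: (@le_trans _ _ ((1 + `|k|) * (f * `|t - t0| + f * `|t - t0|))).
  apply: ler_pM => //; first by rewrite lerDr.
  by rewrite (le_trans (ler_normB _ _))// lerD.
by rewrite /f le_eqVlt; apply/orP; left; apply/eqP; field; rewrite gt_eqF.
Qed.

Lemma tdZ (T k : R) (y y' : R -> R) : td T y y' -> td T (fun t => k * y t) (fun t => k * y' t).
Proof.
move=> h; have z : td T (fun=> 0) (fun=> 0).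
  by move=> t0 _ e e0; exists 1 => // t _ _; rewrite mulr0 !subrr normr0 mulr_ge0// ltW.
have := td_lin k h z.
have -> : (fun t => k * (y t - 0)) = (fun t => k * y t) by apply/funext => t; rewrite subr0.
have -> // : (fun t => k * (y' t - 0)) = (fun t => k * y' t).
by apply/funext => t; rewrite subr0.
Qed.

Lemma td_sum (T : R) (I : Type) (s : seq I) (y y' : I -> R -> R) : (forall i, td T (y i) (y' i)) ->
  td T (fun t => \sum_(i <- s) y i t) (fun t => \sum_(i <- s) y' i t).
Proof.
move=> h; elim: s => [|i s ih].
  by move=> t0 _ e e0; exists 1 => // t _ _; rewrite !big_nil mulr0 !subrr normr0 mulr_ge0// ltW.
have := td_lin 1 (h i) (tdZ (-1) ih).
have -> : (fun t => 1 * (y i t - -1 * \sum_(i <- s) y i t)) = (fun t => \sum_(i <- i :: s) y i t).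
  by apply/funext => t; rewrite big_cons mul1r mulN1r opprK.
have -> // : (fun t => 1 * (y' i t - -1 * \sum_(i <- s) y' i t)) = (fun t => \sum_(i <- i :: s) y' i t).
by apply/funext => t; rewrite big_cons mul1r mulN1r opprK.
Qed.

Lemma tc_sum (T : R) (I : Type) (s : seq I) (y : I -> R -> R) : (forall i, tc T (y i)) ->
  tc T (fun t => \sum_(i <- s) y i t).
Proof.
move=> h; elim: s => [|i s ih] t0 t0T e e0.
  by exists 1 => // t _ _; rewrite !big_nil subrr normr0 ltW.
have e2 : 0 < e / 2 by rewrite divr_gt0.
have [d1 d10 D1] := h i t0 t0T _ e2; have [d2 d20 D2] := ih t0 t0T _ e2.
exists (Num.min d1 d2); first by rewrite lt_min d10.
move=> t tT; rewrite lt_min => /andP[t1 t2]; rewrite !big_cons opprD addrACA [leRHS]splitr.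
by rewrite (le_trans (ler_normD _ _))// lerD// ?D1 ?D2.
Qed.

Lemma tcZ (T k : R) (y : R -> R) : tc T y -> tc T (fun t => k * y t).
Proof.
move=> h t0 t0T e e0; have k0 : 0 < 1 + `|k| by rewrite ltr_pwDl.
have [d1 d10 D1] := h t0 t0T _ (divr_gt0 e0 k0); exists d1 => // t tT td.
rewrite -mulrBr normrM; apply: (@le_trans _ _ ((1 + `|k|) * (e / (1 + `|k|)))).
  by apply: ler_pM => //; [rewrite lerDr|exact: D1].
by rewrite mulrC divfK// gt_eqF.
Qed.

Lemma antisym_norm n (m : 'M[R]_n) : `|antisym m| <= `|m|.
Proof.
apply: mx_norm_le => // i j; rewrite !mxE normrM ger0_norm ?invr_ge0//.
rewrite ler_pdivrMl// (le_trans (ler_normB _ _))// mulr_natl mulr2n.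
by apply: lerD; exact: mx_entry_le.
Qed.

Lemma antisymB n (m m' : 'M[R]_n) : antisym m - antisym m' = antisym (m - m').
Proof. by apply/matrixP => i j; rewrite !mxE; ring. Qed.

Lemma derive1_antisym n (g : R -> 'M[R]_n) x : derivable g x 1 ->
  derive1 (fun y => antisym (g y)) x = antisym (derive1 g x).
Proof.
move=> dg.
have de i j : is_derive x (1 : R) (fun y => antisym (g y) i j) (antisym (derive1 g x) i j).
  have -> : (fun y => antisym (g y) i j) = (fun y => 2^-1 *: (g y i j - g y j i)).
    by apply/funext => y; rewrite !mxE.
  rewrite !mxE; exact: is_deriveZ (is_deriveB (derivable_entry i j dg) (derivable_entry j i dg)).
apply/matrixP => i j; rewrite derive1E derive_mx; last first.
  by apply/derivable_mxP => i' j'; have [] := de i' j'.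
by rewrite mxE; apply: derive_val.
Qed.

Lemma cont_antisym n (g : R -> 'M[R]_n) : continuous g -> continuous (fun x => antisym (g x)).
Proof.
move=> cg x; apply/cvgrPdist_le => e e0.
have /cvgrPdist_le /(_ e e0) h := cg x.
near=> y; rewrite antisymB (le_trans (antisym_norm _))//.
by near: y.
Unshelve. all: by end_near.
Qed.

Lemma adde_le2 (x y : \bar R) (C : R) : (0 <= x)%E -> (0 <= y)%E -> (x + y <= C%:E)%E ->
  (x <= C%:E)%E /\ (y <= C%:E)%E.
Proof.
by move=> x0 y0 xyC; split; apply: le_trans xyC; [rewrite leeDl|rewrite leeDr].
Qed.

Lemma C1Inorm_ge0 (I : set R) p q (nr : (R -> 'M[R]_(p, q)) -> \bar R) v v' t : I t ->
  (forall g, 0 <= nr g)%E -> (0 <= C1Inorm I nr v v')%E.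
Proof.
move=> It nr0; apply: adde_ge0.
  by apply: (@le_trans _ _ (nr (v t))) => //; apply: ereal_sup_ubound; exists t.
by apply: (@le_trans _ _ (nr (v' t))) => //; apply: ereal_sup_ubound; exists t.
Qed.

Lemma Linf_entry p q (g : R -> 'M[R]_(p, q)) C : (Linfnorm g <= C%:E)%E ->
  {ae mu, forall x, forall i j, `|g x i j| <= C}.
Proof.
move=> /Linf_ae; apply: ae_imp => x; rewrite normr_id => h i j.
exact: le_trans (mx_entry_le _ i j) h.
Qed.

(** The matrix [d] is bounded by C1 almost everywhere only. Its entries cut at C1 are bounded at
    every point and satisfy the same equation almost everywhere. *)
Definition cut (C x : R) : R := Num.max (- C) (Num.min C x).

Lemma cut_id C x : `|x| <= C -> cut C x = x.
Proof. by rewrite ler_norml => /andP[h1 h2]; rewrite /cut (min_idPr h2) (max_idPr h1). Qed.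

Lemma cut_le C x : 0 <= C -> `|cut C x| <= C.
Proof.
move=> C0; rewrite ler_norml /cut; case: (leP C x) => ?.
  by case: (leP (- C) C) => ?; apply/andP; split; lra.
by case: (leP (- C) x) => ?; apply/andP; split; lra.
Qed.

Lemma cut_meas C (g : R -> R) : measurable_fun setT g -> measurable_fun setT (fun x => cut C (g x)).
Proof.
move=> mg; apply: measurable_maxr; first exact: measurable_cst.
by apply: measurable_minr => //; exact: measurable_cst.
Qed.

End coefficient_bounds.

(** * The coefficients at a time of the short interval *)

Section coefficients_at_time.
Context {R : realType}.
Notation mu := (@lebesgue_measure R).
Variables (n : nat) (lambda C0 C1 delta T : R).
Variables (a a' b b' c c' d d' : R -> R -> 'M[R]_n).
Hypothesis H : coeff_hyp lambda C0 C1 delta `[0, T] a a' b b' c c' d d'.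
Hypotheses (hC0 : 0 < C0) (hC1 : C0 <= C1) (hdelta : 2^-1 < delta) (hT : 0 < T).
Hypotheses (hT1 : T * C1 <= C0) (hT2 : n%:R * C1 * T <= lambda / 2).

Let It t : 0 <= t <= T -> (`[0, T]%classic : set R) t.
Proof. by rewrite /= in_itv. Qed.

Let I0 : (0 : R) <= 0 <= T. Proof. by rewrite lexx ltW. Qed.

Let C1ge0 : 0 <= C1. Proof. exact: le_trans (ltW hC0) hC1. Qed.

Lemma coeff_sup : [/\ (C1Inorm `[0%R, T] (@Bnorm R 3 n n) a a' <= C1%:E)%E,
  (C1Inorm `[0%R, T] (@Bnorm R 2 n n) b b' <= C1%:E)%E,
  (C1Inorm `[0%R, T] (@Bnorm R 1 n n) c c' <= C1%:E)%E &
  (C1Inorm `[0%R, T] (@Linfnorm R n n) d d' <= C1%:E)%E].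
Proof.
have h := coeff_C1 H; have i0 := It I0.
have g1 := C1Inorm_ge0 a a' i0 (@Bnorm_ge0 R n n 3).
have g2 := C1Inorm_ge0 b b' i0 (@Bnorm_ge0 R n n 2).
have g3 := C1Inorm_ge0 c c' i0 (@Bnorm_ge0 R n n 1).
have g4 : (0 <= C1Inorm `[0%R, T] (@Linfnorm R n n) d d')%E.
  by apply: (C1Inorm_ge0 _ _ i0) => g; exact: Lnorm_ge0.
have [h' h4] := adde_le2 (adde_ge0 (adde_ge0 g1 g2) g3) g4 h.
have [h'' h3] := adde_le2 (adde_ge0 g1 g2) g3 h'.
by have [h1 h2] := adde_le2 g1 g2 h''.
Qed.

Lemma Bk_cjet k (g g' : R -> R -> 'M[R]_n) : C0I `[0, T] (@Bk R k n n) (@Bnorm R k n n) g ->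
  (C1Inorm `[0%R, T] (@Bnorm R k n n) g g' <= C1%:E)%E ->
  forall t i j, 0 <= t <= T -> cjet k C1 (fun l x => derive1n l (g t) x i j).
Proof.
move=> [gB _] gC t i j tT; have [gk _] := gB t (It tT); split=> [l|l|l x] lk.
- exact: Ck_der gk lk.
- exact: Ck_cont gk lk.
- by have [] := C1Inorm_le gC x i j (It tT) lk.
Qed.

Lemma coeff_cjet t i j : 0 <= t <= T ->
  [/\ cjet 3 C1 (fun l x => derive1n l (a t) x i j),
      cjet 2 C1 (fun l x => derive1n l (b t) x i j) &
      cjet 1 C1 (fun l x => derive1n l (c t) x i j)].
Proof.
have [h1 h2 h3 _] := coeff_sup.
have [ca _ _] := coeff_a H; have [cb _ _] := coeff_b H; have [cc _ _] := coeff_c H.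
by move=> tT; split; [exact: Bk_cjet ca h1 _ _ _ tT|exact: Bk_cjet cb h2 _ _ _ tT|
  exact: Bk_cjet cc h3 _ _ _ tT].
Qed.

Lemma coeff_d_bound t : 0 <= t <= T -> {ae mu, forall x, forall i j, `|d t x i j| <= C1}.
Proof.
move=> tT; apply: Linf_entry; have [_ _ _] := coeff_sup; apply: le_trans.
have s0 : (0 <= ereal_sup [set Linfnorm (d' t) | t in `[0%R, T]])%E.
  apply: (@le_trans _ _ (Linfnorm (d' t))); first exact: Lnorm_ge0.
  by apply: ereal_sup_ubound; exists t => //; exact: It.
apply: (@le_trans _ _ (ereal_sup [set Linfnorm (d t) | t in `[0%R, T]])%E); last by rewrite leeDl.
by apply: ereal_sup_ubound; exists t => //; exact: It.
Qed.

Lemma coeff_d_meas t i j : 0 <= t <= T -> measurable_fun setT (fun x => d t x i j).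
Proof. by move=> tT; have [[dL _] _ _] := coeff_d H; have [md _] := dL t (It tT); exact: md. Qed.

(** Every entry of [a] moves by at most C1 T, hence the quadratic form by at most n C1 T |y|^2;
    [hT2] says that this costs no more than half of the ellipticity. *)
Lemma coeff_elliptic t x (y : 'I_n -> R) : 0 <= t <= T ->
  lambda / 2 * \sum_i y i ^+ 2 <= \sum_i \sum_j a t x i j * (y i * y j).
Proof.
move=> tT; have [h1 _ _ _] := coeff_sup.
have aC i j : `|a t x i j - a 0 x i j| <= C1 * T.
  have ha := C1I_td i j x (coeff_a H) (leq0n 3).
  have /andP[_ tT'] := tT; apply: (@le_trans _ _ (C1 * t)); last exact: ler_wpM2l.
  apply: (td_mvt ha _ tT) => s sT.
  by have [] := C1Inorm_le h1 x i j (It sT) (leq0n 3).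
have e0 := coeff_ell H x (\col_i y i).
have -> : \sum_i \sum_j a t x i j * (y i * y j) =
  \sum_i \sum_j a 0 x i j * (y i * y j) - \sum_i \sum_j (a 0 x i j - a t x i j) * (y i * y j).
  rewrite -sumrB; apply: eq_bigr => i _; rewrite -sumrB; apply: eq_bigr => j _.
  by ring.
have e1 : \sum_i \sum_j (a 0 x i j - a t x i j) * (y i * y j) <=
    C1 * T * n%:R * \sum_i y i ^+ 2.
  apply: dsum_le => i j; apply: (le_trans (ler_norm _)); rewrite normrM.
  apply: ler_pM => //; first by rewrite distrC.
  rewrite normrM; have := sqr_ge0 (`|y i| - `|y j|).
  by rewrite sqrrB !real_normK ?num_real//; lra.
have e2 : lambda * \sum_i y i ^+ 2 <= \sum_i \sum_j a 0 x i j * (y i * y j).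
  have s0 : 0 <= \sum_i y i ^+ 2 by apply: sumr_ge0 => i _; exact: sqr_ge0.
  move: e0; rewrite /enorm sqr_sqrtr; last by apply: sumr_ge0 => i _; exact: sqr_ge0.
  under eq_bigr do rewrite mxE.
  move=> /le_trans; apply; rewrite le_eqVlt; apply/orP; left; apply/eqP.
  by apply: eq_bigr => i _; apply: eq_bigr => j _; rewrite !mxE mulrA.
have s0 : 0 <= \sum_i y i ^+ 2 by apply: sumr_ge0 => i _; exact: sqr_ge0.
have e3 : C1 * T * n%:R * (\sum_i y i ^+ 2) <= lambda / 2 * \sum_i y i ^+ 2.
  apply: ler_wpM2r => //; apply: le_trans hT2.
  by rewrite le_eqVlt; apply/orP; left; apply/eqP; ring.
by move: (\sum_i y i ^+ 2) (\sum_i \sum_j _) (\sum_i \sum_j _) e1 e2 e3 => *; lra.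
Qed.

Lemma decay_split0 p q (X Y : R -> 'M[R]_(p, q)) w C :
  (wLinfnorm w X + wLinfnorm w Y <= C%:E)%E ->
  (wLinfnorm w X <= C%:E)%E /\ (wLinfnorm w Y <= C%:E)%E.
Proof. by apply: adde_le2; exact: Lnorm_ge0. Qed.

Lemma decay_split (I : set R) p q (X Y : R -> R -> 'M[R]_(p, q)) w C :
  (wLinfnormI I w X + wLinfnormI I w Y <= C%:E)%E ->
  (wLinfnormI I w X <= C%:E)%E /\ (wLinfnormI I w Y <= C%:E)%E.
Proof. by apply: adde_le2; exact: Lnorm_ge0. Qed.

Lemma Ck_mcont k p q (g : R -> 'M[R]_(p, q)) j : Ck k g -> (j <= k)%N -> continuous (derive1n j g).
Proof.
move=> gk jk x; apply/cvgrPdist_le => e e0.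
have h : \forall y \near nbhs x, forall ab : 'I_p * 'I_q,
    `|derive1n j g x ab.1 ab.2 - derive1n j g y ab.1 ab.2| <= e.
  apply: filter_forall => ab.
  have := @Ck_cont _ _ _ k g j ab.1 ab.2 gk jk x.
  by move=> /cvgrPdist_le /(_ e e0).
near=> y; apply: mx_norm_le => [|i' j']; first exact: ltW.
have hy : forall ab : 'I_p * 'I_q,
    `|derive1n j g x ab.1 ab.2 - derive1n j g y ab.1 ab.2| <= e by near: y.
by rewrite !mxE; exact: (hy (i', j')).
Unshelve. all: by end_near.
Qed.

Lemma Ck_derivable k p q (g : R -> 'M[R]_(p, q)) x : Ck k g -> (0 < k)%N -> derivable g x 1.
Proof. by move=> [gk _] k0; exact: (gk 0%N x k0). Qed.

Let T_small t : 0 <= t <= T -> C0 + C1 * t <= 2 * C0.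
Proof.
move=> /andP[_ tT]; have := ler_wpM2l C1ge0 tT; rewrite [C1 * T]mulrC => h.
have := hT1; lra.
Qed.

(** The constant at time t is C0 + C1 t, and [hT1] keeps it below 2 C0. This is what frees M, and
    with it the weight, from C1. *)
Lemma decay_bound k (g g' : R -> R -> 'M[R]_n) j w : C1I `[0, T] (@Bk R k n n) (@Bnorm R k n n) g g' ->
  (j <= k)%N -> (wLinfnorm w (derive1n j (g 0%R)) <= C0%:E)%E ->
  (wLinfnormI `[0%R, T] w (fun t => derive1n j (g' t)) <= C1%:E)%E ->
  forall t x i l, 0 <= t <= T -> `|derive1n j (g t) x i l| <= 2 * C0 * jp (- w) x.
Proof.
move=> gC jk g0 g1 t x i l tT; have [[gB _] [gB' g'c] _] := gC.
have M0 := wLinf_pt (Ck_mcont (gB 0 (It I0)).1 jk) g0.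
have M1 := wLinfI_pt hT C1ge0 (C0I_unif (conj gB' g'c) jk)
  (fun t tT => Ck_mcont (gB' t (It tT)).1 jk) g1.
apply: (le_trans (weighted_time (fun x i l => C1I_td i l x gC jk) M0 M1 x i l tT)).
by apply: ler_wpM2r; [exact: jp_ge0|exact: T_small].
Qed.

Lemma coeff_ab_decay t x i j : 0 <= t <= T ->
  `|derive1n 1 (a t) x i j| <= 2 * C0 * rho delta x ^+ 2 /\
  `|derive1n 0 (b t) x i j| <= 2 * C0 * rho delta x ^+ 2.
Proof.
move=> tT; have [a0 b0] := decay_split0 (coeff_decay_ab0 H).
have [a1 b1] := decay_split (coeff_decay_ab H).
rewrite rho_sq; split; first exact: (decay_bound (j := 1) (coeff_a H) isT a0 a1).
exact: (decay_bound (j := 0) (coeff_b H) isT b0 b1).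
Qed.

Lemma td_antisym (g g' : R -> R -> 'M[R]_n) :
  (forall x i j, td T (fun t => g t x i j) (fun t => g' t x i j)) ->
  forall x i j, td T (fun t => antisym (g t x) i j) (fun t => antisym (g' t x) i j).
Proof.
move=> h x i j; have := td_lin 2^-1 (h x i j) (h x j i).
have -> : (fun t => antisym (g t x) i j) = (fun t => 2^-1 * (g t x i j - g t x j i)).
  by apply/funext => t; rewrite !mxE.
have -> // : (fun t => antisym (g' t x) i j) = (fun t => 2^-1 * (g' t x i j - g' t x j i)).
by apply/funext => t; rewrite !mxE.
Qed.

(** The difference of opposite entries is twice an entry of the antisymmetric part, so the bound is
    2 (C0 + C1 t) <= 4 C0 <= 4 C1. A constant in C1 is affordable here: it enters the growth rate
    only. *)
Lemma antisym_decay_bound k (g g' : R -> R -> 'M[R]_n) j w :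
  C1I `[0, T] (@Bk R k n n) (@Bnorm R k n n) g g' ->
  (j <= k)%N -> (wLinfnorm w (fun x => antisym (derive1n j (g 0%R) x)) <= C0%:E)%E ->
  (wLinfnormI `[0%R, T] w (fun t x => antisym (derive1n j (g' t) x)) <= C1%:E)%E ->
  forall t x i l, 0 <= t <= T ->
  `|derive1n j (g t) x i l - derive1n j (g t) x l i| <= 4 * C1 * jp (- w) x.
Proof.
move=> gC jk g0 g1 t x i l tT; have [[gB _] [gB' g'c] _] := gC.
have M0 := wLinf_pt (cont_antisym (Ck_mcont (gB 0 (It I0)).1 jk)) g0.
have uni : forall t0, 0 <= t0 <= T -> forall e : R, 0 < e -> exists2 d : R, 0 < d &
    forall t, 0 <= t <= T -> `|t - t0| < d ->
    forall x, `|antisym (derive1n j (g' t) x) - antisym (derive1n j (g' t0) x)| <= e.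
  move=> t0 t0T e e0; have [d0 d00 D] := C0I_unif (conj gB' g'c) jk t0T e0.
  exists d0 => // s sT sd y; rewrite antisymB (le_trans (antisym_norm _))//; exact: D.
have M1 := wLinfI_pt hT C1ge0 uni
  (fun t tT => cont_antisym (Ck_mcont (gB' t (It tT)).1 jk)) g1.
have := weighted_time (td_antisym (fun x i l => C1I_td i l x gC jk)) M0 M1 x i l tT.
have -> : antisym (derive1n j (g t) x) i l =
    2^-1 * (derive1n j (g t) x i l - derive1n j (g t) x l i) by rewrite !mxE.
rewrite normrM ger0_norm ?invr_ge0// ler_pdivrMl// => /le_trans; apply.
rewrite mulrA; apply: ler_wpM2r; first exact: jp_ge0.
have := T_small tT; have := hC1; lra.
Qed.

Lemma coeff_bc_decay t x i j : 0 <= t <= T ->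
  [/\ `|derive1n 0 (b t) x i j| <= 4 * C1 * rho delta x,
  `|derive1n 1 (b t) x i j - derive1n 1 (b t) x j i| <= 4 * C1 * rho delta x &
  `|derive1n 0 (c t) x i j - derive1n 0 (c t) x j i| <= 4 * C1 * rho delta x].
Proof.
move=> tT; have [b0 c0] := decay_split0 (coeff_decay_bc0 H).
have [b1 c1] := decay_split (coeff_decay_bc H).
have [[bB _] [bB' _] _] := coeff_b H.
split.
- have [_ h] := coeff_ab_decay x i j tT; apply: (le_trans h).
  have r0 := rho_gt0 delta x; have r1 := rho_le1 hdelta x.
  rewrite ger0_norm ?(ltW r0)// in r1; rewrite expr2 mulrA; apply: ler_wpM2r; first exact: ltW.
  apply: (@le_trans _ _ (2 * C0)); last by have := hC1; have := C1ge0; lra.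
  by apply: ler_piMr => //; have := hC0; lra.
- apply: (antisym_decay_bound (j := 1) (coeff_b H)) => //.
    rewrite (_ : (fun x => _) = derive1 (fun x => antisym (b 0 x)))//.
    apply/funext => y; rewrite (derive1_antisym (Ck_derivable (x := y) (bB 0 (It I0)).1 isT)).
    by [].
  have -> // : wLinfnormI `[0%R, T] delta (fun t x => antisym (derive1n 1 (b' t) x)) =
    wLinfnormI `[0%R, T] delta (fun t => derive1 (fun x => antisym (b' t x))).
  apply: eq_Lnorm => z; case: ifPn => // zI; congr (_ * `|_|)%:E.
  move: zI; rewrite inE => zI.
  by rewrite (derive1_antisym (Ck_derivable (x := z.1) (bB' z.2 zI).1 isT)).
- exact: (antisym_decay_bound (j := 0) (coeff_c H)).
Qed.

End coefficients_at_time.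

(** * Time dependence of the solution *)

Section solution_regularity.
Context {R : realType}.
Notation mu := (@lebesgue_measure R).
Variable n : nat.
Implicit Types (v w : R -> 'cV[R]_n).

Lemma is_hartley_choice v : L2 v -> exists h : 'I_n -> R -> R, forall i, is_hartley (cmp v i) (h i).
Proof. by move=> /L2P vi; have /choice[h hP] i := is_hartley_ex (vi i); exists h. Qed.

Lemma Hs_jet v (s : R) (k : nat) : k%:R <= s -> Hs s v -> Ck k v ->
  forall i, jet k (fun l x => derive1n l v x i 0).
Proof.
move=> ks [v2 vs] vk i.
have [h vh] := is_hartley_choice v2; have vi := (L2P v).1 v2.
have Hfin : Hnorm s v = (fine (Hnorm s v))%:E.
  by rewrite fineK// ge0_fin_numE// Lnorm_ge0.
have hk l : (l <= k)%N -> sqint (fun xi => xi ^+ l * h i xi).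
  move=> lk; have lks : l%:R <= s by apply: le_trans ks; rewrite ler_nat.
  by have [] := Hnorm_le v2 vh lks (_ : (Hnorm s v <= (fine (Hnorm s v))%:E)%E) i;
    rewrite -?Hfin.
have D l : (l < k)%N -> der (fun x => derive1n l v x i 0) (fun x => derive1n l.+1 v x i 0).
  exact: Ck_der.
have cD l : (l <= k)%N -> continuous (fun x => derive1n l v x i 0) by exact: Ck_cont.
(* The transform of the l-th derivative is xi^l h(xi) up to sign and up to a reflection of the
   argument of h; each derivative reflects it once more, which [b] records. *)
suff S l : (l <= k)%N -> sqint (fun x => derive1n l v x i 0) /\
    exists g, is_hartley (fun x => derive1n l v x i 0) g /\
    exists b : bool, forall xi, `|g xi| = `|xi ^+ l * h i (if b then - xi else xi)|.
  by split=> // l lk; have [] := S l lk.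
elim: l => [_|l ih lk].
  split; first exact: vi.
  by exists (h i); split; [exact: vh|exists false => xi; rewrite mul1r].
have [si [g [gH [b bP]]]] := ih (ltnW lk).
have mg := sqint_meas (is_hartley_sq gH).
have xg : sqint (fun xi => xi * g xi).
  have hs : sqint (fun xi => xi ^+ l.+1 * h i (if b then - xi else xi)).
    case: (b); last exact: hk.
    have := sqintZ ((-1) ^+ l.+1) (sqint_refl (hk l.+1 lk)).
    have -> // : (fun x => (-1) ^+ l.+1 * ((- x) ^+ l.+1 * h i (- x))) =
      (fun xi => xi ^+ l.+1 * h i (- xi)).
    by apply/funext => x; rewrite mulrA -exprMn mulN1r opprK.
  apply: (sqint_le _ _ hs); first exact: measurable_funM.
  by move=> xi; rewrite exprS -mulrA !normrM bP normrM.
have [s1 H1] := is_hartley_der si gH (D l lk) (cont_meas (cD l.+1 lk)) xg.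
split=> //; exists (fun xi => - xi * g (- xi)); split=> //.
exists (~~ b) => xi; rewrite normrM normrN bP !normrM exprS normrM -mulrA; congr (_ * _).
rewrite !normrX normrN; congr (_ * `|h i _|).
by case: (b); rewrite //= opprK.
Qed.

(** The 2 comes from [Hnorm_le], the square root of [kappa] from Plancherel's identity. *)
Definition plancherel_const : R := 2 / Num.sqrt kappa.

Lemma plancherel_const_gt0 : 0 < plancherel_const.
Proof. by rewrite divr_gt0// sqrtr_gt0 kappa_gt0. Qed.

Lemma is_hartley_nrm_le (p h : R -> R) (e : R) : sqint p -> is_hartley p h -> nrm h <= 2 * e ->
  nrm p <= plancherel_const * e.
Proof.
move=> pi ph he; have s0 : 0 < Num.sqrt kappa :> R by rewrite sqrtr_gt0 kappa_gt0.
rewrite -(ler_pM2l s0) -(is_hartley_nrm pi ph) (le_trans he)// /plancherel_const.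
rewrite le_eqVlt; apply/orP; left; apply/eqP; field; exact: lt0r_neq0.
Qed.

Lemma Hnorm_nrm v (s e : R) : L2 v -> 0 <= s -> (Hnorm s v <= e%:E)%E ->
  forall i, nrm (cmp v i) <= plancherel_const * e.
Proof.
move=> v2 s0 ve i; have [h vh] := is_hartley_choice v2; have vi := (L2P v).1 v2.
have [_ le] := Hnorm_le v2 vh (k := 0) s0 ve i.
apply: (is_hartley_nrm_le (vi i) (vh i)); apply: le_trans le.
by rewrite (_ : (fun xi => _) = h i)//; apply/funext => xi; rewrite mul1r.
Qed.

Lemma Hnorm_nrm1 v (s e : R) i (v1 : R -> R) : L2 v -> 1 <= s -> (Hnorm s v <= e%:E)%E ->
  der (cmp v i) v1 -> measurable_fun setT v1 -> nrm v1 <= plancherel_const * e.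
Proof.
move=> v2 s1 ve dv m1; have [h vh] := is_hartley_choice v2; have vi := (L2P v).1 v2.
have [xi_h le] := Hnorm_le v2 vh (k := 1) s1 ve i.
have xh : sqint (fun xi => xi * h i xi).
  by move: xi_h; rewrite (_ : (fun xi => _) = (fun xi => xi * h i xi)).
have [s1' H1] := is_hartley_der (vi i) (vh i) dv m1 xh.
apply: (is_hartley_nrm_le s1' H1); apply: le_trans le.
have -> : (fun xi => xi ^+ 1 * h i xi) = (fun xi => xi * h i xi) by [].
by rewrite -(nrm_refl xh).
Qed.

Lemma L2B v w : L2 v -> L2 w -> L2 (v - w).
Proof.
move=> /L2P vi /L2P wi; apply/L2P => i.
by have := sqintB (vi i) (wi i); rewrite (_ : cmp (v - w) i = fun x => cmp v i x - cmp w i x)//;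
  apply/funext => x; rewrite /cmp !mxE.
Qed.

Lemma L2Z (k : R) v : L2 v -> L2 (k *: v).
Proof.
move=> /L2P vi; apply/L2P => i.
by have := sqintZ k (vi i); rewrite (_ : cmp (k *: v) i = fun x => k * cmp v i x)//;
  apply/funext => x; rewrite /cmp !mxE.
Qed.

(** Continuity and, in [nder], differentiability in time with values in L2, for one component; this
    is what the Sobolev regularity of the solution is used for in the energy. *)
Definition ncont T (p : R -> R -> R) := forall t0, 0 <= t0 <= T -> forall e : R, 0 < e ->
  exists2 d : R, 0 < d & forall t, 0 <= t <= T -> `|t - t0| < d ->
    nrm (fun x => p t x - p t0 x) <= e.

Definition nder T (p p' : R -> R -> R) := forall t0, 0 <= t0 <= T -> forall e : R, 0 < e ->
  exists2 d : R, 0 < d & forall t, 0 <= t <= T -> `|t - t0| < d ->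
    nrm (fun x => p t x - p t0 x - (t - t0) * p' t0 x) <= e * `|t - t0|.

Let It T t : 0 <= t <= T -> (`[0, T]%classic : set R) t.
Proof. by rewrite /= in_itv. Qed.

Lemma C0I_ncont T (s : R) (u : R -> R -> 'cV[R]_n) i : 0 <= s ->
  C0I `[0, T] (@Hs R s n) (@Hnorm R s n) u -> ncont T (fun t => cmp (u t) i).
Proof.
move=> s0 [uH cu] t0 t0T e e0; have e'0 : 0 < e / plancherel_const by rewrite divr_gt0// plancherel_const_gt0.
have [d d0 dP] := within_nbhs_ex (cvg0_lee (cu t0 (It t0T)) e'0).
exists d => // t tT td.
have := Hnorm_nrm (L2B (uH t (It tT)).1 (uH t0 (It t0T)).1) s0 (dP t (It tT) td) i.
rewrite mulrC divfK ?(gt_eqF plancherel_const_gt0)//.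
by rewrite (_ : cmp (u t - u t0) i = fun x => cmp (u t) i x - cmp (u t0) i x)//;
  apply/funext => x; rewrite /cmp !mxE.
Qed.

Lemma C0I_ncont1 T (s : R) (u : R -> R -> 'cV[R]_n) i (u1 : R -> R -> R) : 1 <= s ->
  C0I `[0, T] (@Hs R s n) (@Hnorm R s n) u ->
  (forall t, 0 <= t <= T -> der (cmp (u t) i) (u1 t)) ->
  (forall t, 0 <= t <= T -> measurable_fun setT (u1 t)) -> ncont T u1.
Proof.
move=> s0 [uH cu] du mu1 t0 t0T e e0; have e'0 : 0 < e / plancherel_const by rewrite divr_gt0// plancherel_const_gt0.
have [d d0 dP] := within_nbhs_ex (cvg0_lee (cu t0 (It t0T)) e'0).
exists d => // t tT td.
have dB : der (cmp (u t - u t0) i) (fun x => u1 t x - u1 t0 x).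
  rewrite (_ : cmp (u t - u t0) i = fun x => cmp (u t) i x - cmp (u t0) i x); last first.
    by apply/funext => x; rewrite /cmp !mxE.
  by apply: derB; exact: du.
have mB : measurable_fun setT (fun x => u1 t x - u1 t0 x).
  by apply: measurable_funB; exact: mu1.
have := Hnorm_nrm1 (L2B (uH t (It tT)).1 (uH t0 (It t0T)).1) s0 (dP t (It tT) td) dB mB.
by rewrite mulrC divfK ?(gt_eqF plancherel_const_gt0).
Qed.

Lemma C1I_nder T (s : R) (u u' : R -> R -> 'cV[R]_n) i : 0 <= s ->
  C1I `[0, T] (@Hs R s n) (@Hnorm R s n) u u' ->
  nder T (fun t => cmp (u t) i) (fun t => cmp (u' t) i).
Proof.
move=> s0 [[uH _] [u'H _] cu] t0 t0T e e0; have e'0 : 0 < e / plancherel_const by rewrite divr_gt0// plancherel_const_gt0.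
have [d d0 dP] := within_dnbhs_ex (cvg0_lee (cu t0 (It t0T)) e'0).
exists d => // t tT td.
have [->|tt0] := eqVneq t t0.
  rewrite (_ : (fun x => _) = fun=> 0); last first.
    by apply/funext => x; rewrite !subrr mul0r subrr.
  by rewrite /nrm /nsq /ip (@Rint_eq _ _ (fun=> 0)) ?Rint0 ?sqrtr0 ?subrr ?normr0 ?mulr0// => x; rewrite mulr0.
have tn : t - t0 != 0 by rewrite subr_eq0.
have l2 := L2B (L2Z (t - t0)^-1 (L2B (uH t (It tT)).1 (uH t0 (It t0T)).1)) (u'H t0 (It t0T)).1.
have := Hnorm_nrm l2 s0 (dP t (It tT) tt0 td) i.
rewrite mulrC divfK ?(gt_eqF plancherel_const_gt0)// => le.
set q := cmp _ i in le.
have -> : (fun x => cmp (u t) i x - cmp (u t0) i x - (t - t0) * cmp (u' t0) i x) =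
    (fun x => (t - t0) * q x).
  by apply/funext => x; rewrite /q /cmp !mxE; field.
by rewrite nrmZ; [rewrite mulrC ler_wpM2r|exact: (L2P _).1 l2 i].
Qed.

Lemma nder_ncont T p p' : (forall t, 0 <= t <= T -> sqint (p t)) ->
  (forall t, 0 <= t <= T -> sqint (p' t)) -> nder T p p' -> ncont T p.
Proof.
move=> pi p'i pd t0 t0T e e0; have [d d0 dP] := pd t0 t0T 1 ltr01.
have k0 : 0 < 1 + nrm (p' t0) by rewrite ltr_pwDl// nrm_ge0.
exists (Num.min d (e / (1 + nrm (p' t0)))); first by rewrite lt_min d0 divr_gt0.
move=> t tT; rewrite lt_min => /andP[td te].
have := dP t tT td; rewrite mul1r => h.
have si := sqintB (pi t tT) (pi t0 t0T); have s'i := sqintZ (t - t0) (p'i t0 t0T).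
have -> : (fun x => p t x - p t0 x) =
    (fun x => (p t x - p t0 x - (t - t0) * p' t0 x) + (t - t0) * p' t0 x).
  by apply/funext => x; rewrite subrK.
apply: (le_trans (nrmD (sqintB si s'i) s'i)); rewrite nrmZ; last exact: p'i.
move: te; rewrite ltr_pdivlMr// mulrDr mulr1 => /ltW; apply: le_trans.
by rewrite lerD2r.
Qed.

Lemma I3_nrm (m p q : R -> R) (B : R) : measurable_fun setT m -> (forall x, `|m x| <= B) ->
  sqint p -> sqint q -> `|I3 m p q| <= B * (nrm p * nrm q).
Proof.
move=> mm mB pi qi; have mpi := sqintMb mm mB pi.
have -> : I3 m p q = ip (fun x => m x * p x) q by apply: Rint_eq => x; rewrite mulrA.
apply: (le_trans (cauchy_schwarz_nrm mpi qi)); rewrite mulrA; apply: ler_wpM2r; first exact: nrm_ge0.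
exact: nrmMb.
Qed.

Lemma I3Br (m p q q' : R -> R) : bm m -> sqint p -> sqint q -> sqint q' ->
  I3 m p (fun x => q x - q' x) = I3 m p q - I3 m p q'.
Proof.
move=> b pi qi q'i; rewrite /I3 -RintB; try exact: I3_intg.
by apply: Rint_eq => x; rewrite !mulrBr.
Qed.

Lemma I3Bl (m p p' q : R -> R) : bm m -> sqint p -> sqint p' -> sqint q ->
  I3 m (fun x => p x - p' x) q = I3 m p q - I3 m p' q.
Proof. by move=> b pi p'i qi; rewrite I3C I3Br// !(I3C m q). Qed.

Lemma I3Zr (m : R -> R) (k : R) p q : bm m -> sqint p -> sqint q ->
  I3 m p (fun x => k * q x) = k * I3 m p q.
Proof.
move=> b pi qi; rewrite /I3 -RintZ; last exact: I3_intg.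
by apply: Rint_eq => x; rewrite ![k * _]mulrC !mulrA.
Qed.

Lemma ncont_tc T m p q : bm m -> (forall t, 0 <= t <= T -> sqint (p t)) ->
  (forall t, 0 <= t <= T -> sqint (q t)) -> ncont T p -> ncont T q ->
  tc T (fun t => I3 m (p t) (q t)).
Proof.
move=> bm0 pi qi cp cq t0 t0T e e0; have [mm [B mB]] := bm0.
have B0 : 0 <= B by apply: le_trans (mB 0).
pose A := B * (nrm (p t0) + nrm (q t0) + 1) + 1.
have A0 : 0 < A.
  by rewrite ltr_wpDl// mulr_ge0// !addr_ge0// nrm_ge0.
pose e1 := Num.min 1 (e / A).
have e10 : 0 < e1 by rewrite lt_min ltr01 divr_gt0.
have [d1 d10 D1] := cp t0 t0T _ e10; have [d2 d20 D2] := cq t0 t0T _ e10.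
exists (Num.min d1 d2); first by rewrite lt_min d10.
move=> t tT; rewrite lt_min => /andP[td1 td2].
have n1 := D1 t tT td1; have n2 := D2 t tT td2.
have [si1 si2] := (sqintB (pi t tT) (pi t0 t0T), sqintB (qi t tT) (qi t0 t0T)).
have -> : I3 m (p t) (q t) - I3 m (p t0) (q t0) =
    I3 m (fun x => p t x - p t0 x) (fun x => q t x - q t0 x) +
    I3 m (fun x => p t x - p t0 x) (q t0) + I3 m (p t0) (fun x => q t x - q t0 x).
  have a1 := pi t tT; have a2 := pi t0 t0T; have a3 := qi t tT; have a4 := qi t0 t0T.
  by rewrite I3Br// !I3Bl// I3Br//; ring.
apply: (@le_trans _ _ (B * (e1 * 1) + B * (e1 * nrm (q t0)) + B * (nrm (p t0) * e1))).
  apply: norm2_le; first apply: norm2_le.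
  - apply: (le_trans (I3_nrm mm mB si1 si2)); apply: ler_wpM2l => //.
    apply: ler_pM; rewrite ?nrm_ge0//; apply: (le_trans n2).
    by rewrite ge_min lexx.
  - apply: (le_trans (I3_nrm mm mB si1 (qi t0 t0T))); apply: ler_wpM2l => //.
    by apply: ler_wpM2r => //; exact: nrm_ge0.
  - apply: (le_trans (I3_nrm mm mB (pi t0 t0T) si2)); apply: ler_wpM2l => //.
    by apply: ler_wpM2l => //; exact: nrm_ge0.
have e1A : e1 * A <= e by rewrite -ler_pdivlMr// ge_min lexx orbT.
apply: le_trans e1A; rewrite /A; have := ltW e10.
move: (e1) (nrm (p t0)) (nrm (q t0)) => z x y z0.
have -> : z * (B * (x + y + 1) + 1) = B * (z * 1) + B * (z * y) + B * (x * z) + z by ring.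
by rewrite lerDl.
Qed.

Lemma nder_td T m p p' : bm m -> (forall t, 0 <= t <= T -> sqint (p t)) ->
  (forall t, 0 <= t <= T -> sqint (p' t)) -> nder T p p' ->
  td T (fun t => I3 m (p t) (p t)) (fun t => 2 * I3 m (p t) (p' t)).
Proof.
move=> bm0 pi p'i pd t0 t0T e e0; have [mm [B mB]] := bm0.
have B0 : 0 <= B by apply: le_trans (mB 0).
pose N := nrm (p t0); pose N' := nrm (p' t0).
have N0 : 0 <= N := nrm_ge0 _; have N'0 : 0 <= N' := nrm_ge0 _.
(* [A] collects the factors of [e1] in the final bound, so that e1 A <= e closes the estimate. *)
pose A := B * (1 + N') + 2 * B * N + 1.
have A0 : 0 < A by rewrite ltr_wpDl// addr_ge0// ?mulr_ge0// addr_ge0.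
pose e1 := Num.min 1 (e / A).
have e10 : 0 < e1 by rewrite lt_min ltr01 divr_gt0.
have [d1 d10 D1] := pd t0 t0T _ e10.
have [d2 d20 D2] := nder_ncont pi p'i pd t0T e10.
exists (Num.min d1 d2); first by rewrite lt_min d10.
move=> t tT; rewrite lt_min => /andP[td1 td2].
have n1 := D1 t tT td1; have n2 := D2 t tT td2.
have a1 := pi t tT; have a2 := pi t0 t0T; have a3 := p'i t0 t0T.
have s1 := sqintB a1 a2; have s3 := sqintZ (t - t0) a3; have s2 := sqintB s1 s3.
(* Increment of a quadratic form: the form at the increment of [p], which is of second order in t -
   t0, plus twice the pairing of [p t0] with the remainder of the differentiation. *)
have -> : I3 m (p t) (p t) - I3 m (p t0) (p t0) - (t - t0) * (2 * I3 m (p t0) (p' t0)) =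
    I3 m (fun x => p t x - p t0 x) (fun x => p t x - p t0 x) +
    2 * I3 m (p t0) (fun x => p t x - p t0 x - (t - t0) * p' t0 x).
  rewrite (@I3Br m (p t0) (fun x => p t x - p t0 x) (fun x => (t - t0) * p' t0 x))//.
  rewrite I3Zr// !I3Br// !I3Bl// (I3C m (p t) (p t0)); ring.
have nle : nrm (fun x => p t x - p t0 x) <= (1 + N') * `|t - t0|.
  have -> : (fun x => p t x - p t0 x) =
      (fun x => (p t x - p t0 x - (t - t0) * p' t0 x) + (t - t0) * p' t0 x).
    by apply/funext => x; rewrite subrK.
  apply: (le_trans (nrmD s2 s3)); rewrite (nrmZ _ a3) mulrDl mul1r [N' * _]mulrC.
  apply: lerD => //; apply: (le_trans n1).
  by apply: ler_piMl => //; rewrite ge_min lexx.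
apply: (@le_trans _ _ (B * (e1 * ((1 + N') * `|t - t0|)) + 2 * (B * (N * (e1 * `|t - t0|))))).
  apply: norm2_le.
    apply: (le_trans (I3_nrm mm mB s1 s1)); apply: ler_wpM2l => //.
    by apply: ler_pM; rewrite ?nrm_ge0.
  rewrite normrM ger0_norm//; apply: ler_wpM2l => //.
  apply: (le_trans (I3_nrm mm mB a2 s2)); apply: ler_wpM2l => //.
  exact: ler_wpM2l.
have e1A : e1 * A <= e by rewrite -ler_pdivlMr// ge_min lexx orbT.
have h := ler_wpM2r (normr_ge0 (t - t0)) e1A; apply: le_trans h; rewrite /A.
have := mulr_ge0 (ltW e10) (normr_ge0 (t - t0)).
move: (e1) (`|t - t0|) => x y *.
have -> : x * (B * (1 + N') + 2 * B * N + 1) * y =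
  B * (x * ((1 + N') * y)) + 2 * (B * (N * (x * y))) + x * y by ring.
by rewrite lerDl.
Qed.

End solution_regularity.

(** * Gronwall inequalities with an arbitrary nonnegative right hand side *)

Section gronwall.
Context {R : realType}.
Notation mu := (@lebesgue_measure R).

(** [G] is an arbitrary nonnegative function of time, possibly infinite and not measurable. The left
    side is the integral of the continuous function Y' + h over [0, s], and only monotonicity of the
    integral is applied to [G]. *)
Lemma le_int_primitive (T : R) (Y Y' h : R -> R) (G : R -> \bar R) s : 0 < s <= T ->
  continuous Y -> continuous Y' -> continuous h ->
  (forall t, 0 < t < T -> is_derive t (1 : R) Y (Y' t)) ->
  (forall t, 0 <= G t)%E -> (forall t, 0 <= t <= T -> ((Y' t + h t)%:E <= G t)%E) ->
  ((Y s - Y 0 + \int[mu]_(x in `[0%R, s]) h x)%:E <=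
    \int[mu]_x (if x \in `[0%R, T]%classic then G x else 0))%E.
Proof.
move=> /andP[s0 sT] cY cY' ch dY G0 hG.
have E1 : \int[mu]_(x in `[0%R, s]) Y' x = Y s - Y 0.
  rewrite /Rintegral (@continuous_FTC2 _ _ Y) //.
  - exact: continuous_subspaceT.
  - split.
    + move=> x; rewrite in_itv/= => /andP[x0 xs].
      by have [] := dY x (introT andP (conj x0 (lt_le_trans xs sT))).
    + by apply: cvg_at_right_filter; exact: cY.
    + by apply: cvg_at_left_filter; exact: cY.
  - move=> x; rewrite in_itv/= => /andP[x0 xs].
    have d := dY x (introT andP (conj x0 (lt_le_trans xs sT))).
    by rewrite derive1E; exact: derive_val.
have c1 : continuous (fun x => Y' x + h x) by move=> x; apply: cvgD; [exact: cY'|exact: ch].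
have i1 := cont_intg_ind 0 s c1.
rewrite -E1 !Rint_itv -RintD; [|exact: cont_intg_ind..].
have -> : \int[mu]_x (Y' x * ind 0 s x + h x * ind 0 s x) =
   \int[mu]_x ((Y' x + h x) * ind 0 s x).
  by apply: Rint_eq => x; rewrite mulrDl.
(* The positive part is integrable and still lies below [G], since [G] is nonnegative. *)
pose k x := Num.max ((Y' x + h x) * ind 0 s x) 0.
have ki : intg k.
  apply: (intg_le _ _ i1).
    by apply: measurable_maxr; [exact: intg_meas i1|exact: measurable_cst].
  by move=> x; rewrite /k; case: (leP _ 0) => // _; rewrite normr0.
apply: (@le_trans _ _ (\int[mu]_x k x)%:E).
  by rewrite lee_fin; apply: Rint_le => // x; rewrite le_max lexx.
rewrite -intE//; apply: le_int => x; first by rewrite lee_fin le_max lexx orbT.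
case: ifPn => [xI|xI].
  have xT : 0 <= x <= T by move: xI; rewrite inE /= in_itv.
  rewrite /k indE; case: (boolP (0 <= x <= s)) => xs /=; last first.
    by rewrite mulr0 maxxx; exact: G0.
  by rewrite mulr1; case: (leP _ 0) => _; [exact: G0|exact: hG].
rewrite /k indE; have /negbTE -> : ~~ (0 <= x <= s).
  apply: contra xI => /andP[x0 xs]; rewrite inE /= in_itv /= x0 /=; exact: le_trans sT.
by rewrite mulr0 maxxx.
Qed.

Lemma der_expl (k t : R) : is_derive t (1 : R) (fun t => expR (- (k * t))) (- k * expR (- (k * t))).
Proof.
have := der_comp der_expR (derN (derZ k der_id)).
by move=> h; have := h t; rewrite mulr1 mulrC.
Qed.

Lemma cont_expl (k : R) : continuous (fun t : R => expR (- (k * t))).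
Proof. by apply: der_cont => t; exact: der_expl. Qed.

(** The forcing enters through sqrt E times F, so it is sqrt E whose derivative is controlled, by (K
    / 2) sqrt E + c F. That is what produces the L1 norm of the forcing in time, to the first
    power. *)
Lemma gronwall_sqrt (T K c : R) (E E' : R -> R) (F : R -> R) : 0 < T -> 0 <= K -> K * T <= 1 ->
  0 < c -> td T E E' -> tc T E' -> (forall t, 0 <= t <= T -> 0 <= E t) ->
  (forall t, 0 <= F t) ->
  (forall t, 0 <= t <= T -> E' t <= K * E t + 2 * c * (Num.sqrt (E t) * F t)) ->
  forall t, 0 <= t <= T -> ((Num.sqrt (E t))%:E <=
    (expR 1)%:E * ((Num.sqrt (E 0%R))%:E + c%:E *
       \int[mu]_x (if x \in `[0%R, T]%classic then (F x)%:E else 0)))%E.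
Proof.
move=> T0 K0 KT c0 dE cE' Epos F0 ineq t tT.
set J := (\int[mu]_x _)%E.
have J0 : (0 <= J)%E by apply: integral_ge0 => x _; case: ifP => // _; rewrite lee_fin.
have e1 : 1 <= expR 1 :> R by rewrite -expR0 ler_expR.
have eg0 : 0 <= expR 1 :> R by exact: expR_ge0.
have I0 : (0 : R) <= 0 <= T by rewrite lexx ltW.
(* An infinite integral makes the right hand side infinite, because the factors in front of it are
   positive. *)
have [J1|J1] := eqVneq J +oo%E.
  rewrite J1 gt0_muley ?lte_fin// addey// gt0_muley ?lte_fin ?expR_gt0//.
  exact: leey.
have Jfin : J \is a fin_num by rewrite fin_real// (lt_le_trans _ J0)//= lt_neqAle J1 leey.
pose j := fine J; have Jj : J = j%:E by rewrite /j fineK.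
suff: Num.sqrt (E t) <= expR 1 * (Num.sqrt (E 0) + c * j) by rewrite Jj -lee_fin.
have j0 : 0 <= j by rewrite fine_ge0.
move: tT => /andP[t0 tT]; move: t0; rewrite le_eqVlt => /predU1P[<-|t0].
  rewrite -[leLHS]mul1r; apply: ler_pM => //.
  by rewrite lerDl mulr_ge0// ltW.
(* The square root is not differentiable at 0, so E is shifted by eta > 0, which is sent to 0 at the
   end. *)
have key eta : 0 < eta -> Num.sqrt (E t) <= expR 1 * (Num.sqrt (E 0 + eta) + c * j).
  move=> eta0.
  pose s t := E (clamp T t) + eta.
  have cT x := clamp_itv x (ltW T0).
  have s0 x : 0 < s x by rewrite ltr_wpDl// Epos.
  have ss0 x : 0 < Num.sqrt (s x) by rewrite sqrtr_gt0.
  have cs : continuous s.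
    by move=> x; apply: cvgD; [exact: (tc_cont (ltW T0) (td_tc dE))|exact: cvg_cst].
  have csq : continuous (fun x => Num.sqrt (s x)).
    by move=> x; apply: (@continuous_comp _ _ _ s Num.sqrt); [exact: cs|exact: sqrt_continuous].
  have cE'' := tc_cont (ltW T0) cE'.
  pose k := K / 2.
  pose Y x := c^-1 * (Num.sqrt (s x) * expR (- (k * x))).
  pose Y' x := c^-1 * ((E' (clamp T x) / (2 * Num.sqrt (s x)) - k * Num.sqrt (s x))
    * expR (- (k * x))).
  have cY : continuous Y.
    move=> x; apply: cvgM; first exact: cvg_cst.
    by apply: cvgM; [exact: csq|exact: cont_expl].
  have cY' : continuous Y'.
    move=> x; apply: cvgM; first exact: cvg_cst.
    apply: cvgM; last exact: cont_expl.
    apply: cvgB; last by apply: cvgM; [exact: cvg_cst|exact: csq].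
    apply: cvgM; first exact: cE''.
    apply: cvgV; first by rewrite gt_eqF// mulr_gt0.
    by apply: cvgM; [exact: cvg_cst|exact: csq].
  have dY x : 0 < x < T -> is_derive x (1 : R) Y (Y' x).
    move=> xT; have ds : is_derive x (1 : R) s (E' x).
      have := is_deriveD (td_derive xT dE) (is_derive_cst eta x 1).
      by rewrite addr0.
    have dq := is_derive1_comp (is_derive1_sqrt (s0 x)) ds.
    have dd : is_derive x (1 : R) Y _ := is_deriveZ c^-1 (is_deriveM dq (der_expl k x)).
    apply: (is_derive_eq dd).
    have xT' : 0 <= x <= T by move/andP: xT => [/ltW -> /ltW ->].
    rewrite /Y' (clamp_id xT'); rewrite /= /GRing.scale /=.
    by field; rewrite !gt_eqF.
  have hG x : 0 <= x <= T -> ((Y' x + 0)%:E <= (F x)%:E)%E.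
    move=> xT; rewrite addr0 lee_fin /Y' ler_pdivrMl//.
    have h := ineq x xT; rewrite (clamp_id xT).
    have sE : s x = E x + eta by rewrite /s clamp_id.
    have sq2 : Num.sqrt (s x) ^+ 2 = s x by rewrite sqr_sqrtr// ltW.
    have le1 : Num.sqrt (E x) <= Num.sqrt (s x) by apply: ler_wsqrtr; rewrite sE lerDl ltW.
    have le2 : Num.sqrt (E x) * F x <= Num.sqrt (s x) * F x by exact: ler_wpM2r.
    have le3 : K * E x <= K * Num.sqrt (s x) ^+ 2.
      by apply: ler_wpM2l => //; rewrite sq2 sE lerDl ltW.
    have le4 : c * (Num.sqrt (E x) * F x) <= c * (Num.sqrt (s x) * F x).
      by apply: ler_wpM2l le2; exact: ltW.
    have b : E' x / (2 * Num.sqrt (s x)) - k * Num.sqrt (s x) <= c * F x.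
      rewrite lerBlDr ler_pdivrMr ?mulr_gt0//; rewrite /k; nra.
    apply: (le_trans (ler_wpM2r (expR_ge0 _) b)); rewrite -[leRHS]mulr1.
    apply: ler_wpM2l; first by rewrite mulr_ge0// ltW.
    rewrite -expR0 ler_expR lerNl oppr0 mulr_ge0 ?divr_ge0//.
    by have /andP[] := xT.
  have c00 : continuous (fun _ : R => 0 : R) by exact: cst_continuous.
  have tT2 : 0 < t <= T by rewrite t0.
  have FG x : (0 <= (F x)%:E)%E by rewrite lee_fin.
  have := le_int_primitive tT2 cY cY' c00 dY FG hG.
  rewrite -/J Jj lee_fin Rintegral_cst// mul0r addr0 lerBlDr /Y !mulr0 oppr0 expR0 mulr1.
  rewrite ler_pdivrMl// mulrDr mulVKf ?gt_eqF//.
  rewrite /s (clamp_id I0) (clamp_id (introT andP (conj (ltW t0) tT))) => h.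
  have ek : 0 < expR (- (k * t)) by exact: expR_gt0.
  have se : Num.sqrt (E t) <= Num.sqrt (E t + eta) by apply: ler_wsqrtr; rewrite lerDl ltW.
  have kt : 1 <= expR 1 * expR (- (k * t)).
    rewrite -expRD -[leLHS]expR0 ler_expR /k subr_ge0.
    have := ler_wpM2l K0 tT; lra.
  apply: (le_trans se).
  have h1 : expR 1 * (Num.sqrt (E t + eta) * expR (- (k * t))) <=
    expR 1 * (c * j + Num.sqrt (E 0 + eta)) by exact: ler_wpM2l.
  rewrite [c * j + _]addrC in h1; apply: le_trans h1.
  by rewrite mulrCA ler_peMr// sqrtr_ge0.
apply/ler_addgt0Pr => e e0.
(* With this eta, sqrt (E 0 + eta) exceeds sqrt (E 0) by at most e / exp 1, so the loss after
   multiplication by exp 1 is at most e. *)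
have q0 : 0 < (e / expR 1) ^+ 2 by rewrite exprn_gt0// divr_gt0// expR_gt0.
apply: (le_trans (key _ q0)).
have h : Num.sqrt (E 0 + (e / expR 1) ^+ 2) <= Num.sqrt (E 0) + e / expR 1.
  have p0 : 0 <= e / expR 1 by rewrite divr_ge0// ltW.
  rewrite -(@ler_pXn2r _ 2)// ?nnegrE ?sqrtr_ge0 ?addr_ge0 ?sqrtr_ge0//.
  have A0 : 0 <= E 0 + (e / expR 1) ^+ 2 by rewrite addr_ge0 ?sqr_ge0// Epos.
  rewrite (sqr_sqrtr A0) sqrrD (sqr_sqrtr (Epos 0 I0)).
  by rewrite lerD2r lerDl mulrn_wge0// mulr_ge0// sqrtr_ge0.
have h' := ler_wpM2l eg0 h.
rewrite mulrDr in h'; rewrite !mulrDr; move: h'.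
have -> : expR 1 * (e / expR 1) = e by rewrite mulrCA divff ?mulr1// gt_eqF// expR_gt0.
move: (expR 1 * _) (expR 1 * _) (expR 1 * _) => *; lra.
Qed.

(** The integrating factor e^(-K t) removes K E, and one integration then bounds both the energy at
    each time and the dissipation over the whole interval. *)
Lemma gronwall_dissipative (T K k : R) (E E' D : R -> R) (G : R -> \bar R) : 0 < T -> 0 <= K -> K * T <= 1 ->
  0 <= k -> td T E E' -> tc T E' -> tc T D -> (forall t, 0 <= t <= T -> 0 <= E t) ->
  (forall t, 0 <= t <= T -> 0 <= D t) -> (forall t, 0 <= G t)%E ->
  (forall t, 0 <= t <= T -> ((E' t + k * D t - K * E t)%:E <= G t)%E) ->
  let J := (\int[mu]_x (if x \in `[0%R, T]%classic then G x else 0))%E in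
  (forall t, 0 <= t <= T -> ((E t)%:E <= (expR 1)%:E * ((E 0%R)%:E + J))%E) /\
  ((k * \int[mu]_(x in `[0%R, T]) D (clamp T x))%:E <= (expR 1)%:E * ((E 0%R)%:E + J))%E.
Proof.
move=> T0 K0 KT k0 dE cE' cD Epos Dpos G0 ineq J.
have J0 : (0 <= J)%E by apply: integral_ge0 => x _; case: ifP.
have e1 : 1 <= expR 1 :> R by rewrite -expR0 ler_expR.
have eg0 : 0 < expR 1 :> R by exact: expR_gt0.
have I0 : (0 : R) <= 0 <= T by rewrite lexx ltW.
have E0 := Epos 0 I0.
have [J1|J1] := eqVneq J +oo%E.
  rewrite J1 addey// gt0_muley ?lte_fin//.
  by split=> [t _|]; exact: leey.
pose j := fine J; have Jj : J = j%:E.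
  by rewrite /j fineK// fin_real// (lt_le_trans _ J0)//= lt_neqAle J1 leey.
have j0 : 0 <= j by rewrite fine_ge0.
rewrite Jj.
have cT x := clamp_itv x (ltW T0).
have cEc := tc_cont (ltW T0) (td_tc dE).
have cE'c := tc_cont (ltW T0) cE'.
have cDc := tc_cont (ltW T0) cD.
pose Y x := E (clamp T x) * expR (- (K * x)).
pose Y' x := (E' (clamp T x) - K * E (clamp T x)) * expR (- (K * x)).
(* As K T <= 1, the integrating factor is at least e^(-1) on [0, T]; this fraction of the
   dissipation is kept. *)
pose h x := expR (- 1) * (k * D (clamp T x)).
have cY : continuous Y by move=> x; apply: cvgM; [exact: cEc|exact: cont_expl].
have cY' : continuous Y'.
  move=> x; apply: cvgM; last exact: cont_expl.
  by apply: cvgB; [exact: cE'c|apply: cvgM; [exact: cvg_cst|exact: cEc]].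
have ch : continuous h.
  by move=> x; apply: cvgM; [exact: cvg_cst|apply: cvgM; [exact: cvg_cst|exact: cDc]].
have dY x : 0 < x < T -> is_derive x (1 : R) Y (Y' x).
  move=> xT; have dd : is_derive x (1 : R) Y _ := is_deriveM (td_derive xT dE) (der_expl K x).
  have xT' : 0 <= x <= T by move/andP: xT => [/ltW -> /ltW ->].
  apply: (is_derive_eq dd); rewrite /Y' /= (clamp_id xT') /GRing.scale /=; ring.
have h0 x : 0 <= h x by rewrite mulr_ge0 ?expR_ge0// mulr_ge0// Dpos.
have hG x : 0 <= x <= T -> ((Y' x + h x)%:E <= G x)%E.
  move=> xT; have := ineq x xT; rewrite /Y' /h (clamp_id xT); move: (G0 x); case: (G x) => //=.
    move=> r; rewrite !lee_fin => r0 le.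
    have /andP[x0 xT'] := xT.
    have Kx : 0 <= K * x <= 1.
      by rewrite mulr_ge0//= (le_trans _ KT)// ler_wpM2l.
    have ex1 : expR (- (K * x)) <= 1 by rewrite -expR0 ler_expR lerNl oppr0; have /andP[] := Kx.
    have ex2 : expR (- 1) <= expR (- (K * x)) by rewrite ler_expR lerN2; have /andP[] := Kx.
    have kd : 0 <= k * D x by rewrite mulr_ge0// Dpos.
    have s1 := ler_wpM2r kd ex2.
    have s2 : (E' x + k * D x - K * E x) * expR (- (K * x)) <= r * expR (- (K * x)).
      by apply: ler_wpM2r => //; exact: expR_ge0.
    have s3 : r * expR (- (K * x)) <= r * 1 by exact: ler_wpM2l.
    move: (k * D x) kd s1 s2 s3 => kD kd s1 s2 s3; lra.
  by move=> _ _; exact: leey.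
have base s : 0 < s <= T -> E s * expR (- (K * s)) +
    \int[mu]_(x in `[0%R, s]) h x <= E 0 + j.
  move=> sT; have := le_int_primitive sT cY cY' ch dY G0 hG.
  rewrite -/J Jj lee_fin /Y mulr0 oppr0 expR0 mulr1 (clamp_id I0) (clamp_id _); first by lra.
  by move/andP: sT => [/ltW -> ->].
have hI s : 0 <= \int[mu]_(x in `[0%R, s]) h x by apply: Rintegral_ge0.
split.
  move=> t /andP[t0 tT]; rewrite -EFinD -EFinM lee_fin.
  move: t0; rewrite le_eqVlt => /predU1P[<-|t0].
    rewrite -[leLHS]mul1r; apply: ler_pM => //; by rewrite lerDl.
  have b := base t (introT andP (conj t0 tT)).
  have tI : 0 <= t <= T by rewrite (ltW t0).
  have Et := Epos t tI; have hIt := hI t.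
  have kt : 1 <= expR 1 * expR (- (K * t)).
    rewrite -expRD -[leLHS]expR0 ler_expR subr_ge0.
    exact: le_trans (ler_wpM2l K0 tT) KT.
  have b' : E t * expR (- (K * t)) <= E 0 + j by apply: le_trans b; rewrite lerDl.
  have := ler_wpM2l (ltW eg0) b'; apply: le_trans.
  by rewrite mulrCA ler_peMr.
have TT : 0 < T <= T by rewrite T0 lexx.
have b := base T TT.
have ET : 0 <= E T * expR (- (K * T)).
  by rewrite mulr_ge0 ?expR_ge0// Epos// lexx ltW.
rewrite -EFinD -EFinM lee_fin.
have -> : k * \int[mu]_(x in `[0%R, T]) D (clamp T x) = expR 1 * \int[mu]_(x in `[0%R, T]) h x.
  rewrite !Rint_itv -!RintZ.
  - apply: Rint_eq => x; rewrite /h -!mulrA [in RHS]mulrA -expRD subrr expR0 mul1r.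
    by [].
  - exact: cont_intg_ind.
  - exact: cont_intg_ind.
by apply: ler_wpM2l; [exact: ltW|apply: le_trans b; rewrite lerDr].
Qed.

End gronwall.

(** * Weighted duality between <D> and its inverse *)

Section pairing.
Context {R : realType}.
Notation mu := (@lebesgue_measure R).
Variable delta : R.
Hypothesis hdelta : 2^-1 < delta.

Notation rho := (rho delta).

Lemma delta_gt0 : 0 < delta.
Proof. exact: lt_trans hdelta. Qed.

Lemma rho_b (p : R -> R) : sqint p -> sqint (fun x => rho x * p x) /\
  nrm (fun x => rho x * p x) <= nrm p.
Proof.
move=> pi; split; first exact: sqintMb (rho_meas delta) (rho_le1 hdelta) pi.
by have := nrmMb (rho_meas delta) (rho_le1 hdelta) pi; rewrite mul1r.
Qed.

Lemma rho1_b (p : R -> R) : sqint p -> sqint (fun x => rho1 delta x * p x) /\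
  nrm (fun x => rho1 delta x * p x) <= delta * nrm p.
Proof.
move=> pi; have m1 := sqint_meas (rho1_sqint hdelta).
have b x : `|rho1 delta x| <= delta.
  apply: (le_trans (rho1_le_rho hdelta x)); rewrite -[leRHS]mulr1.
  apply: ler_wpM2l; first exact: ltW delta_gt0.
  exact: le_trans (ler_norm _) (rho_le1 hdelta x).
by split; [exact: sqintMb m1 b pi|exact: nrmMb m1 b pi].
Qed.

(** The commutator bound for [rho] = <x>^(-delta), simplified by |rho| <= 1 and |rho1| <= delta,
    whence the constant 1 + delta + C. *)
Lemma rho_jap_bound : exists2 C : R, 1 <= C & forall u u1 w h, sqint u -> der u u1 ->
  continuous u1 -> sqint u1 -> is_hartley u h -> sqint w -> is_hartley w (fun xi => jap xi * h xi) ->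
  nrm (fun x => rho x * w x) <= C * (nrm u + nrm (fun x => rho x * u1 x)).
Proof.
have d0 := delta_gt0.
have [C C0 CP] := weighted_jap (rho_sqint hdelta) (jp_even (- delta)) (rho_le1 hdelta)
  (rho_der delta) (rho1_der delta) (@rho2_cont R delta)
  (rho1_sqint hdelta) (rho2_sqint hdelta) (rho1_intg hdelta).
exists (1 + delta + C); first by lra.
move=> u u1 w h ui du cu1 u1i uh wi wh.
have [s1 n1] := rho_b ui; have [s2 n2] := rho1_b ui; have [s3 _] := rho_b u1i.
have := CP u u1 w h ui du cu1 u1i uh wi wh (sqintD s2 s3) => /le_trans; apply.
have n3 := nrmD s2 s3; have a0 := nrm_ge0 u; have b0 := nrm_ge0 (fun x => rho x * u1 x).
move: (nrm (fun x => rho x * u x)) (nrm (fun x => rho1 delta x * u x))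
  (nrm (fun x => rho1 delta x * u x + rho x * u1 x)) (nrm u)
  (nrm (fun x => rho x * u1 x)) n1 n2 n3 a0 b0 => x1 x2 x3 a b n1 n2 n3 a0 b0.
have p1 := mulr_ge0 (ltW d0) b0; have p2 := mulr_ge0 C0 b0.
lra.
Qed.

(** The symbols of <D> and <D>^(-1) cancel under Plancherel's identity. In the resulting pairing the
    factor 1 = <x>^(-delta) <x>^delta is shared out before Cauchy-Schwarz, and the half carried by
    <D> u is what the hypothesis on [C] controls. *)
Lemma dual_bound (C : R) : (forall u u1 w h, sqint u -> der u u1 ->
    continuous u1 -> sqint u1 -> is_hartley u h -> sqint w -> is_hartley w (fun xi => jap xi * h xi) ->
    nrm (fun x => rho x * w x) <= C * (nrm u + nrm (fun x => rho x * u1 x))) ->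
  forall u u1 f w h, sqint u -> der u u1 -> continuous u1 -> sqint u1 ->
  sqint f -> is_hartley f h -> sqint w -> is_hartley w (fun xi => jp (-1) xi * h xi) ->
  sqint (fun x => jp delta x * w x) ->
  `|ip u f| <= C * (nrm u + nrm (fun x => rho x * u1 x)) * nrm (fun x => jp delta x * w x).
Proof.
move=> CP u u1 f w h ui du cu1 u1i fi fh wi wh jwi.
have [k uk] := is_hartley_ex ui; have ki := is_hartley_sq uk.
have [xki _] := is_hartley_der2 du cu1 ui u1i uk.
have [jki _] := nsq_jap ki xki.
have [g gi gk] := is_hartley_surj jki.
have E : ip u f = ip g w.
  have k0 := @kappa_gt0 R; apply: (mulfI (lt0r_neq0 k0)).
  rewrite -(is_hartley_ip ui fi uk fh) -(is_hartley_ip gi wi gk wh); apply: Rint_eq => xi.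
  have := jp_gt0 1 xi; rewrite jpN -jp1 => j0.
  by field; exact: lt0r_neq0.
have E2 : ip g w = ip (fun x => rho x * g x) (fun x => jp delta x * w x).
  apply: Rint_eq => x; rewrite mulrACA -jpD addNr jp0 mul1r.
  by [].
rewrite E E2; apply: (le_trans (cauchy_schwarz_nrm (rho_b gi).1 jwi)).
by apply: ler_wpM2r; [exact: nrm_ge0|exact: CP du cu1 u1i uk gi gk].
Qed.

End pairing.

Lemma system_component (R : realType) n (A B C D : 'M[R]_n) (w0 w1 w2 w3 w4 v g : 'cV[R]_n) (eps : R) i :
  v + A *m w3 + B *m w2 + C *m w1 + D *m w0 = - (eps *: w4) + g ->
  g i 0 = v i 0 + \sum_j (A i j * w3 j 0 + B i j * w2 j 0 + C i j * w1 j 0 + D i j * w0 j 0)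
    + eps * w4 i 0.
Proof.
move=> e; have -> : g = v + A *m w3 + B *m w2 + C *m w1 + D *m w0 + eps *: w4.
  by rewrite e addrAC addNr add0r.
by rewrite !mxE !big_split /= !addrA.
Qed.

(** * The two a priori estimates *)

Section estimates.
Context {R : realType}.
Notation mu := (@lebesgue_measure R).
Variables (n : nat) (lambda C0 C1 delta T eps Pm PM M : R) (P : nat -> R -> R).
Variables (a a' b b' c c' d d' : R -> R -> 'M[R]_n).
Variables (f : R -> R -> 'cV[R]_n) (u0 : R -> 'cV[R]_n) (u u' : R -> R -> 'cV[R]_n).
Hypotheses (hn : (0 < n)%N) (hlam : 0 < lambda).
Hypothesis H : coeff_hyp lambda C0 C1 delta `[0, T] a a' b b' c c' d d'.
Hypothesis Sol : classical_solution eps `[0, T] a b c d f u0 u u'.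
Hypotheses (hC0 : 0 < C0) (hC1 : C0 <= C1) (hdelta : 2^-1 < delta) (hT : 0 < T).
Hypotheses (hT1 : T * C1 <= C0) (hT2 : n%:R * C1 * T <= lambda / 2).
Hypotheses (heps : 0 <= eps <= 1).
Hypotheses (hPm : 0 < Pm) (hP : cjet 3 PM P) (hPm' : forall x, Pm <= P 0%N x).
Hypothesis hP1 : forall x, M * rho delta x ^+ 2 * P 0%N x <= P 1%N x.
Hypotheses (hM0 : 0 <= M) (hM : 10 * C0 * n%:R + 1 <= 3 * (lambda / 2) * M).

Let It t : 0 <= t <= T -> (`[0, T]%classic : set R) t.
Proof. by rewrite /= in_itv. Qed.

Definition Dk (v : R -> R -> 'cV[R]_n) t i k x := derive1n k (v t) x i 0.

Lemma sol_jet t : 0 <= t <= T -> forall i, jet 4 (Dk u t i).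
Proof.
move=> tT; have [uH _] := sol_H5 Sol.
have k45 : 4%:R <= 5 :> R by rewrite ler_nat.
exact: (Hs_jet k45 (uH t (It tT)) (sol_C4 Sol (It tT))).
Qed.

Lemma sol_dt t i : 0 <= t <= T -> sqint (cmp (u' t) i).
Proof. by move=> tT; have [_ [u'H _] _] := sol_H1 Sol; exact: (L2P _).1 (u'H t (It tT)).1 i. Qed.

Let Dc t i j x := cut C1 (d t x i j).

Let F t i x := \sum_j (derive1n 0 (a t) x i j * Dk u t j 3%N x
  + derive1n 0 (b t) x i j * Dk u t j 2%N x
  + derive1n 0 (c t) x i j * Dk u t j 1%N x + Dc t i j x * Dk u t j 0%N x).

Let C1ge0 : 0 <= C1. Proof. exact: le_trans (ltW hC0) hC1. Qed.

Let bD t i j : 0 <= t <= T -> bm (Dc t i j).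
Proof.
move=> tT; split; first by apply: cut_meas; exact: (coeff_d_meas H).
by exists C1 => x; exact: cut_le.
Qed.

Let sF t i : 0 <= t <= T -> sqint (F t i).
Proof.
move=> tT; have key (m p : R -> R) : bm m -> sqint p -> sqint (fun x => m x * p x).
  by move=> [mm [B mB]] pi; exact: sqintMb mm mB pi.
have s j k : (k <= 4)%N -> sqint (Dk u t j k).
  by move=> k4; have [_ _ h] := sol_jet tT j; exact: h.
apply: sqint_sum => j.
have [ca cb cc] := coeff_cjet H hT i j tT.
apply: sqintD; last by apply: (key); [exact: bD|exact: s].
apply: sqintD; last by apply: (key); [exact: cm_bm (cjet_cm cc _)|exact: s].
apply: sqintD.
  by apply: (key); [exact: cm_bm (cjet_cm ca _)|exact: s].
by apply: (key); [exact: cm_bm (cjet_cm cb _)|exact: s].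
Qed.

Lemma sol_comp t : 0 <= t <= T -> {ae mu, forall x, forall i,
  cmp (f t) i x = cmp (u' t) i x + F t i x + eps * Dk u t i 4%N x}.
Proof.
move=> tT; have e := sol_eq Sol (It tT).
apply: ae_imp (ae_and e (coeff_d_bound H hT tT)) => x [ex dx] i.
rewrite /cmp /F /Dk (system_component i ex); congr (_ + _ + _).
by apply: eq_bigr => j _; rewrite /Dc (cut_id (dx _ _)).
Qed.

(** At each time the forcing is assumed to be measurable; that it lies in L2 is read off the
    equation, all other terms being square integrable. *)
Lemma sol_f t i : 0 <= t <= T -> sqint (cmp (f t) i).
Proof.
move=> tT; have [_ _ sU] := sol_jet tT i.
have s := sqintD (sqintD (sol_dt i tT) (sF i tT)) (sqintZ eps (sU 4%N isT)).
apply: sqint_ae s; first exact: (sol_meas Sol (It tT)).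
by apply: ae_imp (sol_comp tT) => x h; exact: h.
Qed.

Lemma solution_energy_ineq t : 0 <= t <= T ->
  2 * (\sum_i ip (fun x => P 0%N x * cmp (u t) i x) (cmp (u' t) i)) <=
  - (Pm / 2 * \sum_i nsq (fun x => rho delta x * Dk u t i 1%N x))
  + energy_const n C1 (4 * C1) Pm PM * \sum_i nsq (cmp (u t) i)
  + 2 * (\sum_i ip (fun x => P 0%N x * cmp (u t) i x) (cmp (f t) i)).
Proof.
(* The abstract inequality is applied with the time derivative minus the forcing, which is what the
   spatial operator determines. *)
move=> tT; pose v i x := cmp (u' t) i x - cmp (f t) i x.
have vi i : sqint (v i) by apply: sqintB; [exact: sol_dt|exact: sol_f].
have ev i : {ae mu, forall x, v i x = - F t i x - eps * Dk u t i 4%N x}.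
  by apply: ae_imp (sol_comp tT) => x h; rewrite /v h; ring.
have e1 : \sum_i ip (fun x => P 0%N x * cmp (u t) i x) (v i) =
    \sum_i ip (fun x => P 0%N x * cmp (u t) i x) (cmp (u' t) i) -
    \sum_i ip (fun x => P 0%N x * cmp (u t) i x) (cmp (f t) i).
  rewrite -sumrB; apply: eq_bigr => i _.
  have [mP [B PB]] := cm_bm (cjet_cm hP (leq0n 3)).
  have [_ _ s] := sol_jet tT i; have Pu := sqintMb mP PB (s 0%N isT).
  exact: ipBr (sol_dt i tT) (sol_f i tT) Pu.
have := energy_ineq (A := fun i j k x => derive1n k (a t) x i j)
  (B := fun i j k x => derive1n k (b t) x i j) (Cc := fun i j k x => derive1n k (c t) x i j)
  (D := Dc t) (U := Dk u t) (r := rho delta) (C := C1) (Q := 4 * C1) hn hPm hP hPm'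
  (fun i j => let: And3 h _ _ := coeff_cjet H hT i j tT in h)
  (fun i j => let: And3 _ h _ := coeff_cjet H hT i j tT in h)
  (fun i j => let: And3 _ _ h := coeff_cjet H hT i j tT in h)
  (fun i j => bD i j tT) (fun i j x => cut_le _ C1ge0).
have sym i j x : derive1n 0 (a t) x i j = derive1n 0 (a t) x j i.
  have := congr1 (fun m : 'M[R]_n => m j i) (coeff_sym H x (It tT)).
  by rewrite mxE.
have ell x y := coeff_elliptic H hC0 hC1 hT hT2 x y tT.
have br : bm (rho delta).
  by split; [exact: rho_meas|exists 1; exact: rho_le1].
have ab x i j := coeff_ab_decay H hC0 hC1 hT hT1 x i j tT.
have bc x i j := coeff_bc_decay H hC0 hC1 hdelta hT hT1 x i j tT.
move=> /(_ lambda C0 M eps v sym ell br (fun i j x => (ab x i j).1) (fun i j x => (ab x i j).2)).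
move=> /(_ (fun i j x => let: And3 h _ _ := bc x i j in h)
  (fun i j x => let: And3 _ h _ := bc x i j in h)
  (fun i j x => let: And3 _ _ h := bc x i j in h)).
move=> /(_ hP1 hM0 hlam hM (sol_jet tT) vi ev heps).
rewrite e1; move: (\sum_i ip _ _) (\sum_i ip _ _) => x1 x2.
rewrite /Dk; move: (energy_const _ _ _ _ _) (\sum_i _) (\sum_i _) => x3 x4 x5; lra.
Qed.

Let E t := \sum_i I3 (P 0%N) (cmp (u t) i) (cmp (u t) i).
Let E' t := \sum_i 2 * I3 (P 0%N) (cmp (u t) i) (cmp (u' t) i).
Let N t := \sum_i nsq (cmp (u t) i).
Let D t := \sum_i nsq (fun x => rho delta x * Dk u t i 1%N x).

Let bP : bm (P 0%N). Proof. exact: cm_bm (cjet_cm hP (leq0n 3)). Qed.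

Let su t i : 0 <= t <= T -> sqint (cmp (u t) i).
Proof. by move=> tT; have [_ _ s] := sol_jet tT i; exact: s 0%N isT. Qed.

Let su1 t i : 0 <= t <= T -> sqint (Dk u t i 1%N).
Proof. by move=> tT; have [_ _ s] := sol_jet tT i; exact: s 1%N isT. Qed.

Let PMge : Pm <= PM.
Proof. by have [_ _ h] := hP; apply: le_trans (hPm' 0) (le_trans (ler_norm _) (h 0%N 0 isT)). Qed.

Let PM0 : 0 < PM. Proof. exact: lt_le_trans hPm PMge. Qed.

Let I0 : (0 : R) <= 0 <= T. Proof. by rewrite lexx ltW. Qed.

Lemma E_td : td T E E'.
Proof.
apply: td_sum => i; apply: nder_td => //.
- by move=> t tT; exact: su.
- by move=> t tT; exact: sol_dt.
- have s1 : 0 <= 1%:R :> R by [].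
  exact: (C1I_nder i s1 (sol_H1 Sol)).
Qed.

Lemma E'_tc : tc T E'.
Proof.
have s1 : 0 <= 1%:R :> R by [].
have [cu cu' _] := sol_H1 Sol.
apply: tc_sum => i; apply: tcZ; apply: ncont_tc => //.
- by move=> t tT; exact: su.
- by move=> t tT; exact: sol_dt.
- exact: (C0I_ncont i s1 cu).
- exact: (C0I_ncont i s1 cu').
Qed.

Lemma D_tc : tc T D.
Proof.
apply: tc_sum => i.
have -> : (fun t => nsq (fun x => rho delta x * Dk u t i 1%N x)) =
    (fun t => I3 (fun x => rho delta x ^+ 2) (Dk u t i 1%N) (Dk u t i 1%N)).
  by apply/funext => t; rewrite nsqE; apply: Rint_eq => x; rewrite exprMn [in RHS]expr2 -expr2.
have br : bm (fun x => rho delta x ^+ 2).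
  split; first by apply: measurable_funX; exact: rho_meas.
  exists 1 => x; rewrite normrX expr_le1//; exact: rho_le1.
have nc : ncont T (fun t => Dk u t i 1%N).
  have s5 : 1 <= 5%:R :> R by rewrite ler1n.
  apply: (C0I_ncont1 s5 (sol_H5 Sol) (i := i)) => t tT.
    by have [du _ _] := sol_jet tT i; exact: du 0%N isT.
  exact: sqint_meas (su1 i tT).
by apply: ncont_tc => // t tT; exact: su1.
Qed.

Lemma E_ge t : 0 <= t <= T -> Pm * N t <= E t.
Proof.
move=> tT; rewrite mulr_sumr; apply: ler_sum => i _; have s := su i tT.
rewrite nsqE -RintZ; last by have [] := s.
apply: Rint_le; [by apply: intgZ; have [] := s|exact: I3_intg|] => x.
by rewrite -expr2 ler_wpM2r// sqr_ge0.
Qed.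

Lemma E_le t : 0 <= t <= T -> E t <= PM * N t.
Proof.
move=> tT; rewrite mulr_sumr; apply: ler_sum => i _; have s := su i tT.
rewrite nsqE -RintZ; last by have [] := s.
apply: Rint_le; [exact: I3_intg|by apply: intgZ; have [] := s|] => x.
have [_ _ h] := hP.
by rewrite -expr2 ler_wpM2r ?sqr_ge0// (le_trans (ler_norm _))// h.
Qed.

Lemma N_ge0 t : 0 <= N t. Proof. by apply: sumr_ge0 => i _; exact: nsq_ge0. Qed.

Lemma D_ge0 t : 0 <= D t. Proof. by apply: sumr_ge0 => i _; exact: nsq_ge0. Qed.

Lemma E_ge0 t : 0 <= t <= T -> 0 <= E t.
Proof. by move=> tT; apply: le_trans (E_ge tT); rewrite mulr_ge0 ?N_ge0// ltW. Qed.

Lemma L2norm_u t : 0 <= t <= T -> L2norm (u t) = (Num.sqrt (N t))%:E.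
Proof.
move=> tT; have si i := su i tT.
by rewrite L2normE; [rewrite nrmE vnorm_nsq|exact/L2P].
Qed.

Lemma u0E : u0 = u 0.
Proof. by apply/funext => x; rewrite (sol_init Sol). Qed.

Let Kc := energy_const n C1 (4 * C1) Pm PM.
(** Division by Pm turns the norm of [u] into the energy. The extra 1 yields the spare term [N t] on
    the left of [energy_growth], which absorbs the norm of [u] produced by the dual pairing. *)
Let K1 := (`|Kc| + 1) / Pm.
Hypothesis hT3 : K1 * T <= 1.

Lemma K1_ge0 : 0 <= K1.
Proof. by rewrite divr_ge0 ?(ltW hPm)// addr_ge0. Qed.

Lemma energy_growth t : 0 <= t <= T ->
  E' t + Pm / 2 * D t + N t <= K1 * E t + 2 * (\sum_i ip (fun x => P 0%N x * cmp (u t) i x) (cmp (f t) i)).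
Proof.
move=> tT; have := solution_energy_ineq tT; rewrite -/(N t) -/(D t) -/Kc.
have -> : 2 * (\sum_i ip (fun x => P 0%N x * cmp (u t) i x) (cmp (u' t) i)) = E' t.
  rewrite mulr_sumr; apply: eq_bigr => i _; congr (_ * _).
  by apply: Rint_eq => x; rewrite mulrA.
have h1 : (`|Kc| + 1) * N t <= K1 * E t.
  rewrite /K1 mulrAC ler_pdivlMr// -mulrA; apply: ler_wpM2l; first by rewrite addr_ge0.
  by rewrite mulrC E_ge.
have h2 : Kc * N t <= `|Kc| * N t by apply: ler_wpM2r; [exact: N_ge0|exact: ler_norm].
move: (2 * _) (D t) => S Dt; move: (K1 * E t) h1 h2 => KE; rewrite mulrDl mul1r.
move: (Kc * N t) (`|Kc| * N t) => x y h1 h2 h3; lra.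
Qed.

Let c1 := n%:R * PM / Num.sqrt Pm.

Let sPm : 0 < Num.sqrt Pm. Proof. by rewrite sqrtr_gt0. Qed.

Lemma forcing_L2 t : 0 <= t <= T ->
  \sum_i ip (fun x => P 0%N x * cmp (u t) i x) (cmp (f t) i) <=
  c1 * (Num.sqrt (E t) * nrm (vnorm (cmp (f t)))).
Proof.
move=> tT; have sf i := sol_f i tT.
have [mP [_ _]] := bP; have [_ _ bP'] := hP.
have PB x : `|P 0%N x| <= PM by exact: bP'.
have hb i : ip (fun x => P 0%N x * cmp (u t) i x) (cmp (f t) i) <=
    PM * (Num.sqrt (E t) / Num.sqrt Pm * nrm (vnorm (cmp (f t)))).
  have -> : ip (fun x => P 0%N x * cmp (u t) i x) (cmp (f t) i) =
      I3 (P 0%N) (cmp (u t) i) (cmp (f t) i) by apply: Rint_eq => x; rewrite mulrA.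
  apply: (le_trans (ler_norm _)); apply: (le_trans (I3_nrm mP PB (su i tT) (sf i))).
  apply: ler_wpM2l; first exact: ltW.
  apply: ler_pM; rewrite ?nrm_ge0//.
    rewrite ler_pdivlMr// nrmE -sqrtrM ?nsq_ge0//; apply: ler_wsqrtr.
    rewrite mulrC; apply: le_trans (E_ge tT); apply: ler_wpM2l; first exact: ltW.
    rewrite /N (bigD1 i)//= lerDl; apply: sumr_ge0 => j _; exact: nsq_ge0.
  apply: ler_nrm; [exact: sqint_meas (sf i)|exact: vnorm_ge|exact: vnorm_sqint].
apply: (le_trans (ler_sum _ (fun i _ => hb i))); rewrite sum_const /c1.
rewrite le_eqVlt; apply/orP; left; apply/eqP; field; exact: lt0r_neq0.
Qed.

(** The exponential is Gronwall's, and the square roots of [PM] and [Pm] pass from the norm of [u]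
    to sqrt E and back; C1 does not occur. *)
Definition sup_const := expR 1 * (Num.sqrt PM + c1) / Num.sqrt Pm.

Lemma sup_estimate : (LpI +oo `[0%R, T] (fun t => L2norm (u t)) <=
  sup_const%:E * (L2norm u0 + LpI 1%:E `[0%R, T] (fun t => L2norm (f t))))%E.
Proof.
have n0 : 0 < n%:R :> R by rewrite ltr0n.
have c10 : 0 < c1 by rewrite divr_gt0// mulr_gt0.
pose F0 t := nrm (vnorm (cmp (f t))).
have gw : forall t, 0 <= t <= T -> E' t <= K1 * E t + 2 * c1 * (Num.sqrt (E t) * F0 t).
  move=> t tT; have h1 := energy_growth tT; have h2 := forcing_L2 tT.
  have h3 := D_ge0 t; have h4 := N_ge0 t.
  have h5 : 0 <= Pm / 2 * D t by rewrite mulr_ge0// divr_ge0// ltW.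
  rewrite /F0; move: (\sum_i _) (Num.sqrt _ * _) (K1 * E t) (Pm / 2 * D t) h1 h2 h5 => *.
  lra.
have G := gronwall_sqrt hT K1_ge0 hT3 c10 E_td E'_tc E_ge0 (fun t => nrm_ge0 _) gw.
have -> : LpI 1%:E `[0%R, T] (fun t => L2norm (f t)) =
    (\int[mu]_x (if x \in `[0%R, T]%classic then (F0 x)%:E else 0))%E.
  rewrite /LpI Lnorm1; apply: eq_integral => x _; case: ifPn => [xI|_]; last by rewrite abse0.
  have xT : 0 <= x <= T by move: xI; rewrite inE /= in_itv.
  rewrite L2normE; last by apply/L2P => i; exact: sol_f.
  by rewrite gee0_abs// lee_fin nrm_ge0.
set J := (\int[mu]_x _)%E in G *.
have J0 : (0 <= J)%E.
  by apply: integral_ge0 => x _; case: ifP => // _; rewrite lee_fin nrm_ge0.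
have sup_const0 : 0 < sup_const.
  by rewrite divr_gt0// mulr_gt0 ?expR_gt0// addr_gt0// sqrtr_gt0.
rewrite u0E (L2norm_u I0) /LpI unlock lebesgueT_gt0.
have key t : 0 <= t <= T -> ((Num.sqrt (N t))%:E <= sup_const%:E * ((Num.sqrt (N 0))%:E + J))%E.
  move=> tT; have := G t tT; move: J0; case: (J) => [j|_ _|//]; last first.
    by rewrite addey// gt0_muley ?lte_fin//; exact: leey.
  rewrite !lee_fin => j0 h.
  have hl : Num.sqrt (N t) * Num.sqrt Pm <= Num.sqrt (E t).
    by rewrite -sqrtrM ?N_ge0//; apply: ler_wsqrtr; rewrite mulrC; exact: E_ge.
  have hr : Num.sqrt (E 0) <= Num.sqrt PM * Num.sqrt (N 0).
    by rewrite -sqrtrM ?(ltW PM0)//; apply: ler_wsqrtr; exact: E_le.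
  rewrite /sup_const mulrAC ler_pdivlMr//; apply: (le_trans hl); apply: (le_trans h).
  rewrite -[leRHS]mulrA; apply: ler_wpM2l; first exact: expR_ge0.
  apply: (le_trans (lerD hr (lexx _))); rewrite mulrDl !mulrDr.
  have p1 : 0 <= Num.sqrt PM * j by rewrite mulr_ge0// sqrtr_ge0.
  have p2 : 0 <= c1 * Num.sqrt (N 0) by rewrite mulr_ge0 ?sqrtr_ge0// ltW.
  move: (Num.sqrt PM * j) (c1 * Num.sqrt (N 0)) (Num.sqrt PM * Num.sqrt (N 0)) (c1 * j) p1 p2 => *.
  lra.
(* The bound holds at every time, so the exceptional set of the essential supremum is empty. *)
apply/ess_supP; exists set0; split => // t; apply: contra_notP => _ /=.
case: ifPn => [tI|_].
  have tT : 0 <= t <= T by move: tI; rewrite inE /= in_itv.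
  rewrite (L2norm_u tT) gee0_abs ?lee_fin ?sqrtr_ge0//; exact: key.
rewrite abse0 mule_ge0 ?lee_fin ?(ltW sup_const0)// adde_ge0// lee_fin; exact: sqrtr_ge0.
Qed.

Variable Cj : R.
Hypothesis hCj : 1 <= Cj.
Hypothesis hCjP : forall v v1 w h, sqint v -> der v v1 ->
  continuous v1 -> sqint v1 -> is_hartley v h -> sqint w -> is_hartley w (fun xi => jap xi * h xi) ->
  nrm (fun x => rho delta x * w x) <= Cj * (nrm v + nrm (fun x => rho delta x * v1 x)).

(** The norm of P u and the weighted norm of its derivative add up to at most 2 PM times that of [u]
    plus that of rho u_x. From this, [c2] results by completing two squares so as to spend exactly
    [N] and (Pm / 4) [D]. *)
Let cF := 2 * Cj * PM.
Let c2 := cF ^+ 2 * (1 + 4 / Pm).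

Let Cj0 : 0 < Cj. Proof. exact: lt_le_trans ltr01 hCj. Qed.

Let cF0 : 0 < cF. Proof. by rewrite !mulr_gt0. Qed.

Let c20 : 0 < c2.
Proof. by rewrite mulr_gt0 ?exprn_gt0// addr_gt0// divr_gt0. Qed.

Lemma wL2norm_E (w : R) (v : R -> 'cV[R]_n) : measurable_mx v -> (wL2norm w v < +oo)%E ->
  (forall i, sqint (fun x => jp w x * cmp v i x)) /\
  wL2norm w v = (Num.sqrt (\sum_i nsq (fun x => jp w x * cmp v i x)))%:E.
Proof.
move=> mv vfin.
have e i : cmp (fun x => jap x `^ w *: v x) i = fun x => jp w x * cmp v i x.
  by apply/funext => x; rewrite /cmp mxE.
have l2 : L2 (fun x => jap x `^ w *: v x).
  split=> // i j; rewrite (ord1 j).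
  rewrite (_ : (fun x => _) = fun x => jp w x * cmp v i x); last exact: e.
  by apply: measurable_funM; [exact: japX_meas|exact: mv].
have si i : sqint (fun x => jp w x * cmp v i x) by rewrite -e; exact: (L2P _).1 l2 i.
split=> //; rewrite /wL2norm L2normE// nrmE vnorm_nsq => [|i]; last by rewrite e.
by congr (Num.sqrt _)%:E; apply: eq_bigr => i _; rewrite e.
Qed.

(** Duality, then Young's inequality. Out of the dissipation (Pm / 2) D in [energy_growth], half is
    spent here and (Pm / 4) D remains for the smoothing estimate. *)
Lemma forcing_dual t : 0 <= t <= T -> (wL2norm delta (japD (-1) (f t)) < +oo)%E ->
  2 * (\sum_i ip (fun x => P 0%N x * cmp (u t) i x) (cmp (f t) i)) <=
  N t + Pm / 4 * D t + c2 * fine (wL2norm delta (japD (-1) (f t))) ^+ 2.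
Proof.
move=> tT Wfin; have sf i := sol_f i tT; have f2 : L2 (f t) by exact/L2P.
have [h fh] := is_hartley_choice f2.
have jh i : sqint (fun xi => jap xi `^ (-1) * h i xi).
  have hb : forall x : R, `|jap x `^ (-1)| <= 1 by move=> x; apply: jp_b; lra.
  exact: sqintMb (japX_meas _) hb (is_hartley_sq (fh i)).
have [w2 wH] := japD_spec f2 fh jh; have wi := (L2P _).1 w2.
set w := japD (-1) (f t) in w2 wH wi Wfin *.
have [jwi We] := wL2norm_E w2.1 Wfin.
have W2 : fine (wL2norm delta w) ^+ 2 = \sum_i nsq (fun x => jp delta x * cmp w i x).
  by rewrite We /= sqr_sqrtr// sumr_ge0// => i _; exact: nsq_ge0.
rewrite W2 /N /D !mulr_sumr -!big_split /=; apply: ler_sum => i _.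
have [dP cP' bP'] := hP; have [dU cU sU] := sol_jet tT i.
have [mr0 mr1] : measurable_fun setT (P 0%N) /\ measurable_fun setT (P 1%N).
  by split; apply: cont_meas; exact: cP'.
have b0 x : `|P 0%N x| <= PM by exact: bP'.
have b1 x : `|P 1%N x| <= PM by exact: bP'.
have u0i := su i tT; have u1i := su1 i tT.
have s0 := sqintMb mr0 b0 u0i; have s1 := sqintMb mr1 b1 u0i; have s2 := sqintMb mr0 b0 u1i.
have dp : der (fun x => P 0%N x * cmp (u t) i x)
    (fun x => P 1%N x * cmp (u t) i x + P 0%N x * Dk u t i 1%N x).
  exact: derM (dP 0%N isT) (dU 0%N isT).
have cp : continuous (fun x => P 1%N x * cmp (u t) i x + P 0%N x * Dk u t i 1%N x).
  by move=> x; apply: cvgD; apply: cvgM;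
    [exact: cP' 1%N isT x|exact: cU 0%N isT x|exact: cP' 0%N isT x|exact: cU 1%N isT x].
have := dual_bound hdelta hCjP s0 dp cp (sqintD s1 s2) (sf i) (fh i) (wi i) (wH i) (jwi i).
move=> /(le_trans (ler_norm _)).
have n0 : nrm (fun x => P 0%N x * cmp (u t) i x) <= PM * nrm (cmp (u t) i) by exact: nrmMb.
have ru1 := rho_b hdelta u1i.
have n1 : nrm (fun x => rho delta x * (P 1%N x * cmp (u t) i x + P 0%N x * Dk u t i 1%N x)) <=
    PM * nrm (cmp (u t) i) + PM * nrm (fun x => rho delta x * Dk u t i 1%N x).
  have -> : (fun x => rho delta x * (P 1%N x * cmp (u t) i x + P 0%N x * Dk u t i 1%N x)) =
      (fun x => rho delta x * (P 1%N x * cmp (u t) i x) + P 0%N x * (rho delta x * Dk u t i 1%N x)).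
    by apply/funext => x; ring.
  have [r1 r1n] := rho_b hdelta s1.
  apply: (le_trans (nrmD r1 (sqintMb mr0 b0 ru1.1))); apply: lerD.
    by apply: (le_trans r1n); exact: nrmMb.
  exact: nrmMb b0 ru1.1.
have w0 := nrm_ge0 (fun x => jp delta x * cmp w i x).
have x0 := nrm_ge0 (cmp (u t) i); have y0 := nrm_ge0 (fun x => rho delta x * Dk u t i 1%N x).
rewrite -(nrm_sq (cmp (u t) i)) -(nrm_sq (fun x => rho delta x * _)) -(nrm_sq (fun x => jp delta x * _)).
move: (nrm (fun x => P 0%N x * cmp (u t) i x))
  (nrm (fun x => rho delta x * (P 1%N x * cmp (u t) i x + P 0%N x * Dk u t i 1%N x))) n0 n1
  => q1 q2 n0 n1.
move: (nrm (cmp (u t) i)) (nrm (fun x => rho delta x * Dk u t i 1%N x))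
  (nrm (fun x => jp delta x * cmp w i x)) x0 y0 w0 n0 n1
  => x y z x0 y0 z0 n0 n1 le1.
have le2 : Cj * (q1 + q2) * z <= cF * (x + y) * z.
  apply: ler_wpM2r => //; rewrite /cF [2 * Cj]mulrC -!mulrA; apply: ler_wpM2l; first exact: ltW.
  have p1 : 0 <= PM * y by rewrite mulr_ge0// ltW.
  rewrite !mulrDr; move: (PM * x) (PM * y) n0 n1 p1 => *; lra.
(* The two completed squares: 2 cF x z <= x^2 + cF^2 z^2, and 2 cF y z <= (Pm / 4) y^2 + (4 cF^2 /
   Pm) z^2. *)
have e1 := sqr_ge0 (x - cF * z).
have sp : 0 < Num.sqrt Pm by [].
have e2 := sqr_ge0 (Num.sqrt Pm / 2 * y - 2 * cF / Num.sqrt Pm * z).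
have sq : Num.sqrt Pm ^+ 2 = Pm by rewrite sqr_sqrtr// ltW.
have E1 : (Num.sqrt Pm / 2 * y - 2 * cF / Num.sqrt Pm * z) ^+ 2 =
    Num.sqrt Pm ^+ 2 / 4 * y ^+ 2 - 2 * (cF * y * z) + 4 * cF ^+ 2 / Num.sqrt Pm ^+ 2 * z ^+ 2.
  by field; exact: lt0r_neq0.
have E2 : (x - cF * z) ^+ 2 = x ^+ 2 - 2 * (cF * x * z) + cF ^+ 2 * z ^+ 2 by ring.
rewrite E1 sq in e2; rewrite E2 in e1.
have E3 : c2 * z ^+ 2 = cF ^+ 2 * z ^+ 2 + 4 * cF ^+ 2 / Pm * z ^+ 2 by rewrite /c2; ring.
have E4 : cF * (x + y) * z = cF * x * z + cF * y * z by ring.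
rewrite E3; rewrite E4 in le2.
have le3 := le_trans le1 le2.
move: (cF * x * z) (cF * y * z) (cF ^+ 2 * z ^+ 2) (4 * cF ^+ 2 / Pm * z ^+ 2) e1 e2 le3 => *.
lra.
Qed.

Lemma japD_u t : 0 <= t <= T -> L2 (japD 1 (u t)) /\
  \sum_i nsq (fun x => rho delta x * cmp (japD 1 (u t)) i x) <= 2 * Cj ^+ 2 * (N t + D t).
Proof.
move=> tT; have u2 : L2 (u t) by apply/L2P => i; exact: su.
have [h uh] := is_hartley_choice u2.
have jh i : sqint (fun xi => jap xi * h i xi).
  have [dU cU sU] := sol_jet tT i.
  have [xh _] := is_hartley_der2 (dU 0%N isT) (cU 1%N isT) (sU 0%N isT) (sU 1%N isT) (uh i).
  by have [] := nsq_jap (is_hartley_sq (uh i)) xh.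
have e i : (fun xi => jap xi * h i xi) = (fun xi => jap xi `^ 1 * h i xi).
  by apply/funext => xi; rewrite powRr1// ltW// jap_gt0.
have jh' i : sqint (fun xi => jap xi `^ 1 * h i xi) by rewrite -e; exact: jh.
have [w2 wH] := japD_spec u2 uh jh'; split=> //.
rewrite /N /D -big_split mulr_sumr; apply: ler_sum => i _ /=.
have [dU cU sU] := sol_jet tT i.
have wHi : is_hartley (cmp (japD 1 (u t)) i) (fun xi => jap xi * h i xi) by rewrite e; exact: wH.
have le := hCjP (sU 0%N isT) (dU 0%N isT) (cU 1%N isT) (sU 1%N isT) (uh i)
  ((L2P _).1 w2 i) wHi.
rewrite -(nrm_sq (fun x => rho delta x * cmp _ i x)) -(nrm_sq (cmp (u t) i)).
rewrite -(nrm_sq (fun x => rho delta x * Dk u t i 1%N x)).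
have x0 := nrm_ge0 (Dk u t i 0%N); have y0 := nrm_ge0 (fun x => rho delta x * Dk u t i 1%N x).
have z0 := nrm_ge0 (fun x => rho delta x * cmp (japD 1 (u t)) i x).
rewrite -[cmp (u t) i]/(Dk u t i 0%N).
move: (nrm (Dk u t i 0%N)) (nrm (fun x => rho delta x * Dk u t i 1%N x))
  (nrm (fun x => rho delta x * cmp (japD 1 (u t)) i x)) x0 y0 z0 le => x y z x0 y0 z0 le.
apply: (@le_trans _ _ ((Cj * (x + y)) ^+ 2)).
  by rewrite ler_pXn2r// nnegrE// mulr_ge0 ?addr_ge0// ltW.
rewrite exprMn [2 * Cj ^+ 2]mulrC -[leRHS]mulrA; apply: ler_wpM2l; first exact: sqr_ge0.
have := sqr_ge0 (x - y); rewrite sqrrB sqrrD; lra.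
Qed.

Lemma LpI2E (g : R -> \bar R) : (forall t, 0 <= g t)%E -> LpI 2%:E `[0%R, T] g =
  ((\int[mu]_x (if x \in `[0%R, T]%classic then g x `^ 2 else 0)) `^ 2^-1)%E.
Proof.
move=> g0; rewrite /LpI unlock; congr (_ `^ _)%E.
apply: eq_integral => x _; case: ifP => _; first by rewrite gee0_abs.
by rewrite poweR_EFin normr0 powR0// pnatr_eq0.
Qed.

Lemma poweR_sq (r : R) : 0 <= r -> (r%:E `^ 2 = (r ^+ 2)%:E)%E.
Proof. by move=> r0; rewrite poweR_EFin powR_mulrn. Qed.

(** 10 = 2 * (1 + 4): the 2 is that of [japD_u], the 1 comes from [N] and the 4 from the time
    integral of [D], both measured against the same multiple of the data. The square root is there
    because squared norms are compared. *)
Definition smoothing_const := Num.sqrt (10 * Cj ^+ 2 * expR 1 * (PM + c2) / Pm).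

Lemma smoothing_estimate : T <= 1 ->
  (LpI 2%:E `[0%R, T] (fun t => wL2norm (- delta) (japD 1 (u t))) <=
  smoothing_const%:E * (L2norm u0 + LpI 2%:E `[0%R, T] (fun t => wL2norm delta (japD (-1) (f t)))))%E.
Proof.
move=> T1.
have wge0 w (v : R -> 'cV[R]_n) : (0 <= wL2norm w v)%E by exact: Lnorm_ge0.
pose W t := wL2norm delta (japD (-1) (f t)).
pose V t := wL2norm (- delta) (japD 1 (u t)).
have W0 t : (0 <= W t)%E by exact: wge0.
have V0 t : (0 <= V t)%E by exact: wge0.
(* The energy inequality is divided by [c2] so that the squared forcing norm has coefficient 1; the
   dissipation (Pm / 4) D is divided along with it. *)
pose k := Pm / 4 / c2.
have ic0 : 0 < c2^-1 by rewrite invr_gt0.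
have k0 : 0 < k by rewrite !divr_gt0.
have c2n : c2 != 0 by exact: lt0r_neq0.
have gw t : 0 <= t <= T ->
    ((c2^-1 * E' t + k * D t - K1 * (c2^-1 * E t))%:E <= W t `^ 2)%E.
  move=> tT; have w0 := wge0 delta (japD (-1) (f t)).
  (* Where the weighted norm of the forcing is infinite the inequality is trivial, and elsewhere
     [forcing_dual] applies. *)
  have [Wy|Wy] := eqVneq (W t) +oo%E; first by rewrite Wy poweRyr ?pnatr_eq0// leey.
  have Wlt : (W t < +oo)%E by rewrite lt_neqAle Wy leey.
  have h1 := energy_growth tT; have h2 := forcing_dual tT Wlt.
  have -> : (W t = (fine (W t))%:E)%E by rewrite fineK// fin_real// Wlt (lt_le_trans _ w0).
  rewrite -/(W t) in h2 w0; rewrite poweR_sq ?fine_ge0// lee_fin.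
  have -> : c2^-1 * E' t + k * D t - K1 * (c2^-1 * E t) =
      c2^-1 * (E' t + Pm / 4 * D t - K1 * E t) by rewrite /k; field.
  rewrite ler_pdivrMl//; move: (\sum_i _) (fine (W t) ^+ 2) (D t) (N t) (K1 * E t) h1 h2 => *.
  lra.
have VND t : 0 <= t <= T -> (V t `^ 2 <= (2 * Cj ^+ 2 * (N t + D t))%:E)%E.
  move=> tT; have [w2 w2le] := japD_u tT.
  have wfin : (wL2norm (- delta) (japD 1 (u t)) < +oo)%E.
    have l : L2 (fun y => jap y `^ (- delta) *: japD 1 (u t) y).
      apply/L2P => i.
      rewrite (_ : cmp _ i = fun y => rho delta y * cmp (japD 1 (u t)) i y).
        exact: (rho_b hdelta ((L2P _).1 w2 i)).1.
      by apply/funext => y; rewrite /cmp mxE.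
    exact: l.2.
  have [_ E2] := wL2norm_E w2.1 wfin.
  rewrite /V E2 poweR_sq ?sqrtr_ge0// lee_fin sqr_sqrtr//.
  by apply: sumr_ge0 => i _; exact: nsq_ge0.
suff: (LpI 2%:E `[0%R, T] V <= smoothing_const%:E * (L2norm u0 + LpI 2%:E `[0%R, T] W))%E by [].
clearbody V W; rewrite (LpI2E V0) (LpI2E W0).
have [] := gronwall_dissipative hT K1_ge0 hT3 (ltW k0) (tdZ c2^-1 E_td) (tcZ c2^-1 E'_tc) D_tc _ _ _ gw.
- by move=> t tT; rewrite mulr_ge0 ?E_ge0// ltW.
- by move=> t _; exact: D_ge0.
- by move=> t; exact: poweR_ge0.
set J := (\int[mu]_x (if _ then W x `^ 2 else 0))%E => G1 G2.
have J0 : (0 <= J)%E by apply: integral_ge0 => x _; case: ifP => // _; exact: poweR_ge0.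
have PMc : 0 < PM + c2 by rewrite addr_gt0.
have B0 : 0 < 10 * Cj ^+ 2 * expR 1 * (PM + c2) / Pm.
  by rewrite divr_gt0// !mulr_gt0 ?expR_gt0// exprn_gt0.
have smoothing_const0 : 0 < smoothing_const by rewrite sqrtr_gt0.
rewrite u0E (L2norm_u I0).
move: J0 G1 G2; case: (J) => [j j0 G1 G2|_ _ _|//]; last first.
  by rewrite poweRyr// addey// gt0_muley ?lte_fin//; exact: leey.
rewrite lee_fin in j0; rewrite lee_fin in G2.
set X := expR 1 * (c2^-1 * E 0 + j) in G2.
have NX t : 0 <= t <= T -> N t <= c2 / Pm * X.
  move=> tT; have := G1 t tT; rewrite lee_fin -/X ler_pdivrMl// => h.
  by rewrite mulrAC ler_pdivlMr// mulrC; apply: le_trans (E_ge tT) h.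
have cD := tc_cont (ltW hT) D_tc.
pose h x := 2 * Cj ^+ 2 * (c2 / Pm * X + D (clamp T x)).
have ch : continuous h.
  move=> x; apply: cvgM; first exact: cvg_cst.
  by apply: cvgD; [exact: cvg_cst|exact: cD].
have X0 : 0 <= X.
  by rewrite mulr_ge0 ?expR_ge0// addr_ge0// mulr_ge0 ?E_ge0// ltW.
have hi := cont_intg_ind 0 T ch.
have le1 : (\int[mu]_x (if x \in `[0%R, T]%classic then
    V x `^ 2 else 0) <= (\int[mu]_x (h x * ind 0 T x))%:E)%E.
  rewrite -intE//; apply: le_int => x; first by case: ifP => // _; exact: poweR_ge0.
  rewrite indE; case: ifPn => [xI|xI]; last first.
    have /negbTE -> : ~~ (0 <= x <= T) by apply: contra xI => xT; rewrite inE /= in_itv.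
    by rewrite mulr0.
  have xT : 0 <= x <= T by move: xI; rewrite inE /= in_itv.
  rewrite xT mulr1 /h clamp_id//; apply: (le_trans (VND x xT)); rewrite lee_fin.
  apply: ler_wpM2l; first by rewrite mulr_ge0// sqr_ge0.
  by apply: lerD => //; exact: NX.
have le2 : \int[mu]_x (h x * ind 0 T x) <= smoothing_const ^+ 2 * (N 0 + j).
  rewrite sqr_sqrtr; last exact: ltW.
  have cX : continuous (fun _ : R => c2 / Pm * X) by exact: cst_continuous.
  have iX := cont_intg_ind 0 T cX; have iD := cont_intg_ind 0 T cD.
  have -> : \int[mu]_x (h x * ind 0 T x) = 2 * Cj ^+ 2 * (\int[mu]_(x in `[0%R, T]) (c2 / Pm * X)
      + \int[mu]_(x in `[0%R, T]) D (clamp T x)).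
    rewrite !Rint_itv -RintD// -RintZ; last exact: intgD.
    by apply: Rint_eq => x; rewrite /h; ring.
  have muT : mu `[0%R, T]%classic = T%:E.
    by rewrite lebesgue_measure_itv/= lte_fin hT -EFinB subr0.
  have -> : \int[mu]_(x in `[0%R, T]) (c2 / Pm * X) = c2 / Pm * X * T.
    by rewrite Rintegral_cst//; congr (_ * _); rewrite -[RHS]/(fine T%:E) -muT.
  (* T <= 1 turns the bound on [N], uniform in time, into one on its time integral without a new
     constant. *)
  have l1 : c2 / Pm * X * T <= c2 / Pm * X.
    by rewrite -[leRHS]mulr1; apply: ler_wpM2l => //; rewrite mulr_ge0// divr_ge0// ltW.
  have l2 : \int[mu]_(x in `[0%R, T]) D (clamp T x) <= 4 * (c2 / Pm * X).
    rewrite -(ler_pM2l k0); apply: (le_trans G2).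
    rewrite le_eqVlt; apply/orP; left; apply/eqP; rewrite /k; field.
    by rewrite c2n lt0r_neq0.
  have l3 : c2 / Pm * X <= expR 1 * (PM + c2) / Pm * (N 0 + j).
    have -> : c2 / Pm * X = expR 1 / Pm * (E 0 + c2 * j).
      by rewrite /X; field; rewrite c2n lt0r_neq0.
    rewrite [_ * (PM + c2) / Pm]mulrAC -[leRHS]mulrA; apply: ler_wpM2l.
      by rewrite divr_ge0 ?expR_ge0// ltW.
    have := E_le I0; have q1 : 0 <= PM * j by rewrite mulr_ge0// ltW.
    have q2 : 0 <= c2 * N 0 by rewrite mulr_ge0 ?N_ge0// ltW.
    rewrite mulrDl !mulrDr; move: (PM * j) (c2 * N 0) (PM * N 0) (c2 * j) q1 q2 => *.
    lra.
  have Cj2 : 0 < Cj ^+ 2 by rewrite exprn_gt0.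
  have -> : 10 * Cj ^+ 2 * expR 1 * (PM + c2) / Pm * (N 0 + j) =
     2 * Cj ^+ 2 * (5 * (expR 1 * (PM + c2) / Pm * (N 0 + j))) by ring.
  apply: ler_wpM2l; first by rewrite mulr_ge0// ltW.
  move: (c2 / Pm * X) (c2 / Pm * X * T) (expR 1 * (PM + c2) / Pm * (N 0 + j)) l1 l2 l3 => *.
  lra.
have h0 : 0 <= \int[mu]_x (h x * ind 0 T x).
  apply: Rint_ge0 => x; apply: mulr_ge0; last by rewrite indE.
  apply: mulr_ge0; first by rewrite mulr_ge0// sqr_ge0.
  by rewrite addr_ge0 ?D_ge0// mulr_ge0// divr_ge0// ltW.
apply: (le_trans (gt0_ler_poweR _ _ _ le1)) => //.
- rewrite in_itv /= leey andbT; apply: integral_ge0 => x _; case: ifP => // _; exact: poweR_ge0.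
- by rewrite in_itv /= leey andbT lee_fin.
have N0 := N_ge0 0.
rewrite !poweR_EFin -EFinD -EFinM lee_fin !powR12_sqrt//.
have s1 : 0 <= Num.sqrt (N 0) + Num.sqrt j by rewrite addr_ge0 ?sqrtr_ge0.
have smoothing_s : 0 <= smoothing_const * (Num.sqrt (N 0) + Num.sqrt j) by rewrite mulr_ge0// ltW.
rewrite -(ler_pXn2r (ltn0Sn 1)) ?nnegrE ?sqrtr_ge0//.
rewrite (sqr_sqrtr h0); apply: (le_trans le2); rewrite exprMn.
apply: ler_wpM2l; first exact: sqr_ge0.
rewrite sqrrD (sqr_sqrtr N0) (sqr_sqrtr j0) lerD2r lerDl.
by rewrite mulrn_wge0// mulr_ge0 ?sqrtr_ge0.
Qed.

End estimates.

Theorem theorem2p1 (R : realType) (n : nat) (hn : (1 <= n)%N)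
    (lambda C0 delta : R) (hlambda : 0 < lambda) (hC0 : 0 < C0)
    (hdelta : 2^-1 < delta) :
  exists2 A : R, 0 < A &
  forall C1 : R, C0 <= C1 ->
  exists2 T : R, 0 < T <= 1 &
  forall eps T' : R, 0 <= eps <= 1 -> 0 < T' <= T ->
  let I : set R := `[0, T'] in
  forall (a a' b b' c c' d d' : R -> R -> 'M[R]_n),
  coeff_hyp lambda C0 C1 delta I a a' b b' c c' d d' ->
  forall (f : R -> R -> 'cV[R]_n) (u0 : R -> 'cV[R]_n)
    (u u' : R -> R -> 'cV[R]_n),
  classical_solution eps I a b c d f u0 u u' ->
  (LpI +oo I (fun t => L2norm (u t))
    <= A%:E * (L2norm u0 + LpI 1%:E I (fun t => L2norm (f t))))%E /\
  (LpI 2%:E I (fun t => wL2norm (- delta)%R (japD 1%R (u t)))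
    <= A%:E * (L2norm u0 +
         LpI 2%:E I (fun t => wL2norm delta (japD (-1)%R (f t)))))%E.
Proof.
(* The value at which the condition [hM] of the energy inequality is an equality. It involves C0,
   lambda and n, so the weight and both constants are fixed before C1 appears. *)
pose M := (10 * C0 * n%:R + 1) / (3 * (lambda / 2)).
have l0 : 0 < 3 * (lambda / 2) by rewrite mulr_gt0// divr_gt0.
have n0 : 0 < n%:R :> R by rewrite ltr0n.
have M0 : 0 <= M by rewrite divr_ge0 ?(ltW l0)// addr_ge0// !mulr_ge0// ltW.
have hM : 10 * C0 * n%:R + 1 <= 3 * (lambda / 2) * M.
  by rewrite /M [leRHS]mulrC divfK// lt0r_neq0.
have [phi [phi1 [phi2 [phi3 [[d0 d1 d2 c3] [Pm [PM [Pm0 hphi h12 h3 hphi1]]]]]]]] :=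
  weight_ex hdelta M0.
have [Cj Cj1 hCj] := rho_jap_bound hdelta.
pose P k := match k with 0%N => phi | 1%N => phi1 | 2%N => phi2 | _ => phi3 end.
have hP : cjet 3 PM P.
  split.
  - by case=> [|[|[|//]]].
  - by case=> [|[|[|[|//]]]] _; [exact: der_cont d0|exact: der_cont d1|exact: der_cont d2|].
  - case=> [|[|[|[|//]]]] x _ //=; [|by have [] := h12 x|by have [] := h12 x].
    have /andP[p1 p2] := hphi x; rewrite ger0_norm//; exact: le_trans (ltW Pm0) p1.
have hPm' x : Pm <= P 0%N x by have /andP[] := hphi x.
have hP1 x : M * rho delta x ^+ 2 * P 0%N x <= P 1%N x by rewrite rho_sq.
have PM0 : 0 < PM by have /andP[p1 p2] := hphi 0; exact: lt_le_trans Pm0 (le_trans p1 p2).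
pose A := sup_const n Pm PM + smoothing_const Pm PM Cj.
have sup_const0 : 0 < sup_const n Pm PM.
  by rewrite /sup_const divr_gt0 ?sqrtr_gt0// mulr_gt0 ?expR_gt0// ltr_pwDl ?sqrtr_gt0//
    divr_ge0 ?sqrtr_ge0// mulr_ge0// ltW.
have smoothing_const0 : 0 <= smoothing_const Pm PM Cj by exact: sqrtr_ge0.
exists A => [|C1 hC1]; first by rewrite ltr_pwDl.
have C10 : 0 < C1 by exact: lt_le_trans hC1.
pose K1 := (`|energy_const n C1 (4 * C1) Pm PM| + 1) / Pm.
have K10 : 0 < K1 by rewrite divr_gt0// ltr_wpDl.
have nC0 : 0 < n%:R * C1 by rewrite mulr_gt0.
(* The four entries serve, in order: time integrals of uniform bounds, the decay constants staying
   below 2 C0, the ellipticity staying above lambda / 2, and the exponential factor staying below e.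
   C1 enters through the last three. *)
pose T := Num.min 1 (Num.min (C0 / C1) (Num.min (lambda / 2 / (n%:R * C1)) K1^-1)).
exists T.
  rewrite !lt_min ge_min lexx ltr01 invr_gt0 K10 !andbT /= !divr_gt0//.
move=> eps T' heps /andP[T'0]; rewrite !le_min => /and4P[T'1 hT1 hT2 hT3].
move=> I a a' b b' c c' d d' H f u0 u u' Sol.
rewrite ler_pdivlMr// in hT1; rewrite ler_pdivlMr// mulrC in hT2.
rewrite -[K1^-1]mul1r ler_pdivlMr// mulrC in hT3.
have e1 := sup_estimate hn hlambda H Sol hC0 hC1 hdelta T'0 hT1 hT2 heps Pm0 hP hPm' hP1 M0 hM hT3.
have e2 := smoothing_estimate hn hlambda H Sol hC0 hC1 hdelta T'0 hT1 hT2 heps Pm0 hP hPm' hP1 M0 hM hT3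
  Cj1 hCj T'1.
have Lp0 p (g : R -> \bar R) : (0 <= LpI p I g)%E by exact: Lnorm_ge0.
split.
- apply: (le_trans e1); apply: lee_wpmul2r; first by rewrite adde_ge0// Lnorm_ge0.
  by rewrite lee_fin lerDl.
- apply: (le_trans e2); apply: lee_wpmul2r; first by rewrite adde_ge0// Lnorm_ge0.
  by rewrite lee_fin lerDr ltW.
Qed.
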